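(* Let $\mathbf k=\mathbb R$ or $\mathbb C$. Let $\pi:E\to X$ be a smooth fiber bundle over a smooth manifold $X$ and let $\mathcal L$ be a local system of $\mathbf k$-modules of finite rank on $X$. Assume that there exist $e_i\in H_{dR}^\bullet(E,\mathbf k)$ of degree $u_i$ for $1\le i\le r$ such that their restrictions $e_1|_{E_x},\dots,e_r|_{E_x}$ freely linearly generate $H_{dR}^\bullet(E_x,\mathbf k)$ (that is, form a basis of it) for every $x\in X$, where $E_x=\pi^{-1}(x)$. Then $$\sum_{i=1}^r\pi^*(\bullet)\cup e_i:\ \bigoplus_{i=1}^rH_\Phi^{\bullet-u_i}(X,\mathcal L)\to H_{\pi^{-1}\Phi}^\bullet(E,\pi^{-1}\mathcal L)$$ is an isomorphism for any paracompactifying family $\Phi$ of supports on $X$.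
   Context: Manifolds are connected and paracompact. A local system of $\mathbf k$-modules is a locally constant sheaf of $\mathbf k$-modules. A family of supports on a topological space $X$ is a family $\Phi$ of closed subsets closed under finite unions and under passing to closed subsets of members; it is paracompactifying if moreover each member is paracompact and has a closed neighborhood in $\Phi$. For continuous $f:Z\to X$, $f^{-1}\Phi$ is the family of closed subsets of sets $f^{-1}(K)$, $K\in\Phi$. $H_\Phi^p(X,\mathcal L)$ is sheaf cohomology with supports in $\Phi$, computed as the $p$-th cohomology of $\Gamma_\Phi(X,\mathcal L\otimes\mathcal A_X^\bullet)$ ($\mathcal L$-valued smooth forms with support in $\Phi$). $\pi^*$ is the pullback of forms and $\cup$ is induced by the wedge product; $H_{dR}^\bullet(E,\mathbf k)$ is de Rham cohomology with coefficients in $\mathbf k$. *)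

(* Defs.v *)
From HB Require Import structures.
From mathcomp Require Import boot.all_boot order.order algebra.all_algebra.
From mathcomp Require Import fingroup.perm.
From mathcomp Require Import complex.
From mathcomp Require Import all_classical all_reals topology normedtype derive.
From mathcomp Require Import ring.

Set Implicit Arguments.
Unset Strict Implicit.
Unset Printing Implicit Defensive.

Import Order.TTheory GRing.Theory Num.Theory numFieldNormedType.Exports.

Local Open Scope classical_set_scope.
Local Open Scope ring_scope.

Definition dprod (K : pzRingType) (I : Type) (V : I -> lmodType K) : Type :=
  forall i, V i.

Local Notation dfunext := functional_extensionality_dep.

Section dprod_lmodType.
Variables (K : pzRingType) (I : Type) (V : I -> lmodType K).
Implicit Types f g h : dprod V.

HB.instance Definition _ := gen_eqMixin (dprod V).
HB.instance Definition _ := gen_choiceMixin (dprod V).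

Let dadd f g : dprod V := fun i => f i + g i.
Let dopp f : dprod V := fun i => - f i.
Let dzero : dprod V := fun i => 0.
Let dscale (a : K) f : dprod V := fun i => a *: f i.

Fact dprod_addA : associative dadd.
Proof. by move=> f g h; apply: dfunext => i; exact: addrA. Qed.
Fact dprod_addC : commutative dadd.
Proof. by move=> f g; apply: dfunext => i; exact: addrC. Qed.
Fact dprod_add0 : left_id dzero dadd.
Proof. by move=> f; apply: dfunext => i; exact: add0r. Qed.
Fact dprod_addN : left_inverse dzero dopp dadd.
Proof. by move=> f; apply: dfunext => i; exact: addNr. Qed.

HB.instance Definition _ := GRing.isZmodule.Build (dprod V)
  dprod_addA dprod_addC dprod_add0 dprod_addN.

Fact dprod_scaleA a b f : dscale a (dscale b f) = dscale (a * b) f.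
Proof. by apply: dfunext => i; exact: scalerA. Qed.
Fact dprod_scale1 : left_id 1 dscale.
Proof. by move=> f; apply: dfunext => i; exact: scale1r. Qed.
Fact dprod_scaleDr : right_distributive dscale +%R.
Proof. by move=> a f g; apply: dfunext => i; exact: scalerDr. Qed.
Fact dprod_scaleDl f : {morph dscale^~ f : a b / a + b}.
Proof. by move=> a b; apply: dfunext => i; exact: scalerDl. Qed.

HB.instance Definition _ := GRing.Zmodule_isLmodule.Build K (dprod V)
  dprod_scaleA dprod_scale1 dprod_scaleDr dprod_scaleDl.

End dprod_lmodType.

Definition is_submod (K : pzRingType) (V : lmodType K) (A : set V) :=
  A 0 /\ forall (k : K) v w, A v -> A w -> A (k *: v + w).

Section subquotient.
Variables (K : pzRingType) (V : lmodType K) (Z B : set V).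
Hypotheses (hZ : is_submod Z) (hB : is_submod B).

Definition subq_num_pred (_ : is_submod Z) : {pred V} := fun v => `[< Z v >].

Fact subq_num_closed : subsemimod_closed (subq_num_pred hZ).
Proof.
case: (hZ) => Z0 Zl; split; first split.
- exact/asboolP.
- move=> v w /asboolP Zv /asboolP Zw; apply/asboolP.
  by rewrite -[v]scale1r; exact: Zl.
- by move=> k v /asboolP Zv; apply/asboolP; rewrite -[_ *: _]addr0; exact: Zl.
Qed.
HB.instance Definition _ :=
  GRing.isSubmodClosed.Build K V (subq_num_pred hZ) subq_num_closed.

Definition subq_num : Type := {v : V | v \in subq_num_pred hZ}.
HB.instance Definition _ := SubChoice.on subq_num.
HB.instance Definition _ := [SubChoice_isSubLmodule of subq_num by <:].

Definition subq_den_pred (_ : is_submod B) : {pred subq_num} :=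
  fun z => `[< B (val z) >].
Fact subq_den_closed : subsemimod_closed (subq_den_pred hB).
Proof.
case: (hB) => B0 Bl; split; first split.
- exact/asboolP.
- move=> v w /asboolP Bv /asboolP Bw; apply/asboolP.
  have -> : val (v + w) = 1 *: val v + val w by rewrite scale1r.
  exact: Bl.
- move=> k v /asboolP Bv; apply/asboolP.
  have -> : val (k *: v) = k *: val v + 0 by rewrite addr0.
  exact: Bl.
Qed.
HB.instance Definition _ :=
  GRing.isSubmodClosed.Build K subq_num (subq_den_pred hB) subq_den_closed.

(* The quotient Z / (Z :&: B) *)
Definition subquotient : Type := Quotient.quot (subq_den_pred hB).
HB.instance Definition _ := GRing.Zmodule.on subquotient.
HB.instance Definition _ := EqQuotient.on subquotient.

Local Notation pi := (\pi_subquotient)%qT.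

Let qscale (k : K) (q : subquotient) : subquotient := pi (k *: repr q).

Let pi_eqP (y z : subq_num) : (pi y == pi z) = (y - z \in subq_den_pred hB).
Proof. by rewrite piE. Qed.

Let qscale_pi k z : qscale k (pi z) = pi (k *: z).
Proof.
apply/eqP; rewrite pi_eqP -scalerBr; apply: rpredZ.
by rewrite -pi_eqP reprK.
Qed.

Let piD y z : pi (y + z) = pi y + pi z.
Proof. by have := @Quotient.pi_add _ (subq_den_pred hB) y z. Qed.

Fact subq_scaleA a b q : qscale a (qscale b q) = qscale (a * b) q.
Proof. by elim/quotW: q => z; rewrite (qscale_pi b) !qscale_pi scalerA. Qed.
Fact subq_scale1 : left_id 1 qscale.
Proof. by elim/quotW=> z; rewrite qscale_pi scale1r. Qed.
Fact subq_scaleDr : right_distributive qscale +%R.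
Proof.
move=> a; elim/quotW=> y; elim/quotW=> z.
by rewrite -piD !qscale_pi scalerDr piD.
Qed.
Fact subq_scaleDl q : {morph qscale^~ q : a b / a + b}.
Proof. by elim/quotW: q => z a b; rewrite !qscale_pi scalerDl piD. Qed.

HB.instance Definition _ := GRing.Zmodule_isLmodule.Build K subquotient
  subq_scaleA subq_scale1 subq_scaleDr subq_scaleDl.

(* The class of v in Z / (Z :&: B), with value 0 when v is not in Z. *)
Definition subq_class (v : V) : subquotient :=
  if insub v is Some z then pi z else 0.

Definition subq_repr (q : subquotient) : V := val (repr q).

End subquotient.

Arguments subq_class {K V Z B} hZ hB v.
Arguments subq_repr {K V Z B hZ hB} q.

(* The element of the direct sum of the V p given by c in degree q *)
Definition homog (K : pzRingType) (V : nat -> lmodType K) (q : nat) (c : V q)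
    (p : nat) : V p :=
  match @eqP _ q p with
  | ReflectT qp => ecast p (V p) qp c
  | ReflectF _ => 0
  end.

(* The homogeneous elements w_i of degree u_i form a basis of the direct sum of
   the V p *)
Definition freely_generates (K : pzRingType) (V : nat -> lmodType K)
    (r : nat) (u : 'I_r -> nat) (w : forall i, V (u i)) : Prop :=
  forall c : (forall p, V p),
    (exists N, forall p, (N <= p)%N -> c p = 0) ->
    exists! a : 'I_r -> K, forall p, c p = \sum_(i < r) a i *: homog (w i) p.

Variant coef := RealCoef | ComplexCoef.

Definition coef_field (R : realType) (c : coef) : fieldType :=
  match c with RealCoef => R | ComplexCoef => R[i] end.

Definition repart (R : realType) (c : coef) : coef_field R c -> R :=
  match c with
  | RealCoef => fun a => a
  | ComplexCoef => fun z => complex.Re z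
  end.

Definition impart (R : realType) (c : coef) : coef_field R c -> R :=
  match c with
  | RealCoef => fun=> 0
  | ComplexCoef => fun z => complex.Im z
  end.

(* a + i b; the imaginary part is dropped when c is RealCoef *)
Definition mkcoef (R : realType) (c : coef) (a b : R) : coef_field R c :=
  match c with RealCoef => a | ComplexCoef => Complex a b end.

Fixpoint iderive (R : realType) (n : nat) (vs : seq 'rV[R]_n)
    (f : 'rV[R]_n -> R) : 'rV[R]_n -> R :=
  if vs is v :: vs' then fun x => 'D_v (iderive vs' f) x else f.

Definition rV_smooth_on (R : realType) (n : nat) (O : set 'rV[R]_n)
    (f : 'rV[R]_n -> R) : Prop :=
  forall vs x, O x -> {for x, continuous (iderive vs f)} /\
    forall v, derivable (iderive vs f) x v.

(* Topological spaces with a sheaf of algebras of continuous real functions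
   (a functional structure); smooth_on U f only depends on the restriction of
   f to U and is meaningful for open U. *)
Record fspace (R : realType) := FSpace {
  fspace_sort :> topologicalType;
  smooth_on : set fspace_sort -> (fspace_sort -> R) -> Prop;
  smooth_on_cst : forall U a, open U -> smooth_on U (fun=> a);
  smooth_onD : forall U f g, open U -> smooth_on U f -> smooth_on U g ->
    smooth_on U (fun x => f x + g x);
  smooth_onM : forall U f g, open U -> smooth_on U f -> smooth_on U g ->
    smooth_on U (fun x => f x * g x);
  smooth_on_local : forall U f, open U -> smooth_on U f <->
    forall x, U x -> exists V g, [/\ open V, V x, smooth_on V g &
      forall y, U y -> V y -> f y = g y];
  smooth_on_continuous : forall U f, open U -> smooth_on U f ->
    forall x, U x -> {for x, continuous f} }.

Definition smooth (R : realType) (M : fspace R) (f : M -> R) : Prop :=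
  smooth_on setT f.

(* phi is a homeomorphism from U onto an open subset of R^n, with inverse psi,
   that identifies smooth functions with smooth functions. *)
Definition is_chart (R : realType) (M : fspace R) (U : set M) (n : nat)
    (phi : M -> 'rV[R]_n) (psi : 'rV[R]_n -> M) : Prop :=
  [/\ open U /\ open (phi @` U),
      forall x, U x -> psi (phi x) = x,
      forall x, U x -> {for x, continuous phi},
      forall w, (phi @` U) w -> {for w, continuous psi} &
      forall V f, open V -> V `<=` U ->
        (smooth_on V f <-> rV_smooth_on (phi @` V) (f \o psi))].

Definition paracompact (T : topologicalType) : Prop :=
  hausdorff_space T /\
  forall C : set (set T), C `<=` open -> \bigcup_(U in C) U = setT ->
    exists D : set (set T),
      [/\ D `<=` open, \bigcup_(W in D) W = setT,
          forall W, D W -> exists2 U, C U & W `<=` U &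
          forall x : T, exists2 N, nbhs x N &
            finite_set [set W | D W /\ W `&` N !=set0]].

(* A manifold, without the connectedness requirement *)
Definition premanifold (R : realType) (M : fspace R) : Prop :=
  paracompact M /\
  forall x : M, exists U n (phi : M -> 'rV[R]_n) psi,
    is_chart U phi psi /\ U x.

Definition smooth_manifold (R : realType) (M : fspace R) : Prop :=
  premanifold M /\ connected [set: M].

Record smooth_map (R : realType) (M N : fspace R) := SmoothMap {
  smooth_fun :> M -> N;
  smooth_fun_continuous : continuous smooth_fun;
  smooth_fun_comp : forall V g, open V -> smooth_on V g ->
    smooth_on (smooth_fun @^-1` V) (g \o smooth_fun) }.

Section smooth_theory.
Variables (R : realType) (M : fspace R).
Implicit Types (U V : set M) (f g : M -> R).

Lemma smooth_onS U V f : open U -> open V -> V `<=` U ->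
  smooth_on U f -> smooth_on V f.
Proof.
move=> oU oV VU fU; apply/smooth_on_local => // x Vx.
by exists U, f; split=> //; exact: VU.
Qed.

Lemma smooth_cst (a : R) : smooth (fun _ : M => a).
Proof. by apply: smooth_on_cst; exact: openT. Qed.

Lemma smoothD f g : smooth f -> smooth g -> smooth (fun x => f x + g x).
Proof. by apply: smooth_onD; exact: openT. Qed.

Lemma smoothM f g : smooth f -> smooth g -> smooth (fun x => f x * g x).
Proof. by apply: smooth_onM; exact: openT. Qed.

Lemma smoothZ (a : R) f : smooth f -> smooth (fun x => a * f x).
Proof. by apply: smoothM; exact: smooth_cst. Qed.

End smooth_theory.

(* A subset with the induced structure: the smooth functions are the local
   restrictions of smooth functions on the ambient space.  For the fibers of a
   bundle this is the structure of embedded submanifold. *)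
Section sub_fspace.
Variables (R : realType) (M : fspace R) (A : set M).

Definition sub_smooth_on (W : set (set_type A)) (g : set_type A -> R) : Prop :=
  forall y, W y -> exists O G, [/\ open O, O (set_val y), smooth_on O G &
    forall z, W z -> O (set_val z) -> g z = G (set_val z)].

Fact sub_smooth_cst U a : open U -> sub_smooth_on U (fun=> a).
Proof.
move=> _ y _; exists setT, (fun=> a); split=> //; first exact: openT.
exact: smooth_cst.
Qed.

Fact sub_smooth_op (op : R -> R -> R)
    (opP : forall (V : set M) f g, open V -> smooth_on V f -> smooth_on V g ->
       smooth_on V (fun x => op (f x) (g x))) U f g :
  open U -> sub_smooth_on U f -> sub_smooth_on U g ->
  sub_smooth_on U (fun x => op (f x) (g x)).
Proof.
move=> oU fU gU y Uy.
have [O [F [oO Oy FO fF]]] := fU y Uy.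
have [P [G [oP Py GP gG]]] := gU y Uy.
have oOP : open (O `&` P) by exact: openI.
exists (O `&` P), (fun x => op (F x) (G x)); split=> //.
  by apply: opP => //; [apply: smooth_onS FO | apply: smooth_onS GP] => // x [].
by move=> z Uz [Oz Pz]; rewrite fF // gG.
Qed.

Fact sub_smooth_local U f : open U -> sub_smooth_on U f <->
  forall x, U x -> exists V g, [/\ open V, V x, sub_smooth_on V g &
    forall y, U y -> V y -> f y = g y].
Proof.
move=> oU; split=> [fU x Ux|fU x Ux]; first by exists U, f.
have [V [g [[V' oV' V'V] Vx gV fg]]] := fU x Ux.
have [O [G [oO Ox GO gG]]] := gV x Vx.
have oOV : open (O `&` V') by exact: openI.
exists (O `&` V'), G; split=> //.
- by split=> //; move: Vx; rewrite -V'V.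
- by apply: smooth_onS GO => // y [].
move=> z Uz [Oz Vz]; have {}Vz : V z by rewrite -V'V.
by rewrite fg // gG.
Qed.

Fact sub_smooth_continuous U f : open U -> sub_smooth_on U f ->
  forall x, U x -> {for x, continuous f}.
Proof.
move=> oU fU x Ux; have [O [G [oO Ox GO fG]]] := fU x Ux.
have vc : continuous (set_val : set_type A -> M) by exact: initial_continuous.
have nO : \forall y \near x, O (set_val y) by apply: vc; exact: open_nbhs_nbhs.
have nU : \forall y \near x, U y by exact: open_nbhs_nbhs.
have fGn : \forall y \near x, f y = (G \o set_val) y.
  by near=> y; apply: fG; near: y.
have cG : {for x, continuous (G \o set_val)}.
  apply: continuous_comp; first exact: vc.
  exact: smooth_on_continuous GO _ Ox.
move=> B; rewrite fG // => /cG; rewrite !nbhs_simpl /= => nB.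
near=> y; rewrite /= (near fGn y) //.
by near: y.
Unshelve. all: by end_near. Qed.

Definition sub_fspace : fspace R :=
  FSpace sub_smooth_cst (sub_smooth_op (@smooth_onD R M))
    (sub_smooth_op (@smooth_onM R M)) sub_smooth_local sub_smooth_continuous.

Fact sub_incl_comp V (g : M -> R) : open V -> smooth_on V g ->
  @smooth_on R sub_fspace (set_val @^-1` V) (g \o set_val).
Proof. by move=> oV gV y Vy; exists V, g. Qed.

Definition sub_incl : smooth_map sub_fspace M :=
  @SmoothMap R sub_fspace M set_val (@initial_continuous _ _ set_val)
    sub_incl_comp.

End sub_fspace.

(* h is smooth on the open subset W of the product manifold M x N: near each
   point of W it is smooth in a product chart. *)
Definition prod_smooth_on (R : realType) (M N : fspace R) (W : set (M * N))
    (h : M * N -> R) : Prop :=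
  forall z, W z -> exists (U : set M) (V : set N) m n
      (phi : M -> 'rV[R]_m) phi' (psi : N -> 'rV[R]_n) psi',
    [/\ is_chart U phi phi' /\ is_chart V psi psi', U z.1 /\ V z.2,
        U `*` V `<=` W &
        rV_smooth_on
          [set w : 'rV[R]_(m + n) | (phi @` U) (lsubmx w) /\
                                    (psi @` V) (rsubmx w)]
          (fun w => h (phi' (lsubmx w), psi' (rsubmx w)))].

(* (pi, q) is a diffeomorphism from pi^-1(U) onto U x F, with inverse g. *)
Definition is_trivialization (R : realType) (E X F : fspace R)
    (pi : smooth_map E X) (U : set X) (q : E -> F) (g : X * F -> E) : Prop :=
  [/\ (forall z, U (pi z) -> g (pi z, q z) = z) /\
      (forall y, U y.1 -> pi (g y) = y.1 /\ q (g y) = y.2),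
      forall z, U (pi z) -> {for z, continuous q},
      forall (V : set F) h, open V -> smooth_on V h ->
        smooth_on (pi @^-1` U `&` q @^-1` V) (h \o q),
      forall y, U y.1 -> {for y, continuous g} &
      forall (V : set E) h, open V -> smooth_on V h ->
        prod_smooth_on [set y | U y.1 /\ V (g y)] (h \o g)].

Definition fiber_bundle (R : realType) (E X : fspace R)
    (pi : smooth_map E X) : Prop :=
  exists2 F : fspace R, premanifold F &
    forall x : X, exists U (q : E -> F) g,
      [/\ open U, U x & is_trivialization pi U q g].

Definition fiber (R : realType) (E X : fspace R) (pi : smooth_map E X)
  (x : X) : fspace R := sub_fspace (pi @^-1` [set x]).

Definition fiber_incl (R : realType) (E X : fspace R) (pi : smooth_map E X)
  (x : X) : smooth_map (fiber pi x) E := sub_incl (pi @^-1` [set x]).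

Section tangent.
Variables (R : realType) (M : fspace R).
Implicit Types (x : M) (f g : M -> R).

(* Derivations at x of the algebra of global smooth functions, extended by 0 to
   the other functions so that equality of derivations is equality of maps *)
Definition is_derivation x (v : (M -> R) -> R^o) : Prop :=
  [/\ forall a f g, smooth f -> smooth g ->
        v (fun y => a * f y + g y) = a * v f + v g,
      forall f g, smooth f -> smooth g ->
        v (fun y => f y * g y) = v f * g x + f x * v g &
      forall f, ~ smooth f -> v f = 0].

Definition tangent_pred x : {pred ((M -> R) -> R^o)} :=
  fun v => `[< is_derivation x v >].

Fact tangent_pred_closed x : subsemimod_closed (tangent_pred x).
Proof.
split; first split.
- by apply/asboolP; split=> *; rewrite /= ?mulr0 ?mul0r ?addr0.
- move=> v w /asboolP[vl vL v0] /asboolP[wl wL w0]; apply/asboolP; split.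
  + by move=> a f g sf sg; rewrite !addrfctE vl // wl // mulrDr addrACA.
  + move=> f g sf sg; rewrite !addrfctE vL // wL // mulrDl mulrDr addrACA.
    by [].
  + by move=> f sf; rewrite addrfctE v0 // w0 // addr0.
- move=> k v /asboolP[vl vL v0]; apply/asboolP; split.
  + move=> a f g sf sg; rewrite !scalrfctE vl //.
    by rewrite /GRing.scale /= mulrDr mulrCA.
  + move=> f g sf sg; rewrite !scalrfctE vL //.
    by rewrite /GRing.scale /= mulrDr mulrA mulrCA.
  + by move=> f sf; rewrite scalrfctE v0 // scaler0.
Qed.
HB.instance Definition _ x := GRing.isSubmodClosed.Build R ((M -> R) -> R^o)
  (tangent_pred x) (tangent_pred_closed x).

Definition tangent x : Type := {v : (M -> R) -> R^o | v \in tangent_pred x}.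
HB.instance Definition _ x := SubChoice.on (tangent x).
HB.instance Definition _ x := [SubChoice_isSubLmodule of tangent x by <:].

Definition tapp x (v : tangent x) (f : M -> R) : R := val v f.

Lemma tangentP x (v : tangent x) : is_derivation x (tapp v).
Proof. by apply/asboolP; exact: (valP v). Qed.

Definition mktangent x (v : (M -> R) -> R) (hv : is_derivation x v) :
  tangent x := exist _ v (asboolT hv).

Record vfield := VField {
  vfield_val :> forall x, tangent x;
  vfield_smooth : forall f, smooth f ->
    smooth (fun x => tapp (vfield_val x) f) }.

Definition vapp (X : vfield) f : M -> R := fun x => tapp (X x) f.

Lemma vapp_lin (X : vfield) a f g : smooth f -> smooth g ->
  vapp X (fun y => a * f y + g y) = (fun y => a * vapp X f y + vapp X g y).
Proof.
move=> sf sg; apply/funext => x; rewrite /vapp.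
by have [-> //] := tangentP (X x).
Qed.

Lemma vapp_leibniz (X : vfield) f g : smooth f -> smooth g ->
  vapp X (fun y => f y * g y) = (fun y => vapp X f y * g y + f y * vapp X g y).
Proof.
move=> sf sg; apply/funext => x; rewrite /vapp.
by have [_ -> //] := tangentP (X x).
Qed.

Lemma tapp0 x (v : tangent x) : tapp v (fun=> 0) = 0.
Proof.
have [vl _ _] := tangentP v.
have := vl (-1) (fun=> 0) (fun=> 0) (@smooth_cst R M 0) (@smooth_cst R M 0).
rewrite (_ : (fun=> _) = (fun=> 0)).
  by rewrite mulN1r addNr.
by apply/funext => y; rewrite mulr0 addr0.
Qed.

Definition bracket_fun (X Y : vfield) x f : R :=
  tapp (X x) (vapp Y f) - tapp (Y x) (vapp X f).

Fact bracket_derivation (X Y : vfield) x : is_derivation x (bracket_fun X Y x).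
Proof.
have sm (Z : vfield) f : smooth f -> smooth (vapp Z f).
  by move=> sf; exact: vfield_smooth.
have [Xl XL X0] := tangentP (X x); have [Yl YL Y0] := tangentP (Y x).
rewrite /bracket_fun; split.
- move=> a f g sf sg; rewrite !vapp_lin // Xl ?Yl //; try exact: sm.
  by rewrite mulrBr opprD addrACA.
- move=> f g sf sg; rewrite !vapp_leibniz //.
  have addl (v : tangent x) F G : smooth F -> smooth G ->
      tapp v (fun y => F y + G y) = tapp v F + tapp v G.
    move=> sF sG; have [vl _ _] := tangentP v.
    rewrite -[in RHS](mul1r (tapp v F)) -vl //.
    by congr tapp; apply/funext => y; rewrite mul1r.
  rewrite !addl; try (by apply: smoothM => //; exact: sm).
  rewrite !XL // ?YL //; try exact: sm.
  rewrite /vapp mulrBl mulrBr; ring.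
- move=> f nsf; have z (Z : vfield) : vapp Z f = fun=> 0.
    by apply/funext => y; rewrite /vapp; have [_ _ ->] := tangentP (Z y).
  by rewrite !z !tapp0 subrr.
Qed.

Fact bracket_smooth (X Y : vfield) f : smooth f ->
  smooth (fun x => tapp (mktangent (bracket_derivation X Y x)) f).
Proof.
move=> sf; have := smoothD (vfield_smooth X (vfield_smooth Y sf))
  (smoothZ (-1) (vfield_smooth Y (vfield_smooth X sf))).
congr smooth; apply/funext => x.
by rewrite mulN1r.
Qed.

Definition bracket (X Y : vfield) : vfield :=
  VField (@bracket_smooth X Y).

End tangent.

Section tangent_map.
Variables (R : realType) (M N : fspace R) (F : smooth_map M N).

Lemma smooth_comp (g : N -> R) : smooth g -> smooth (g \o F).
Proof.
by move=> sg; have := smooth_fun_comp F openT sg; rewrite preimage_setT.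
Qed.

Definition tangent_map_fun (x : M) (v : tangent x) (g : N -> R) : R :=
  if `[< smooth g >] then tapp v (g \o F) else 0.

Fact tangent_map_derivation x (v : tangent x) :
  is_derivation (F x) (tangent_map_fun v).
Proof.
have [vl vL _] := tangentP v; rewrite /tangent_map_fun; split.
- move=> a f g sf sg; rewrite !asboolT //; last exact/smoothD/sg/smoothZ.
  by rewrite -vl //; exact: smooth_comp.
- move=> f g sf sg; rewrite !asboolT //; last exact: smoothM.
  by rewrite -[in RHS]vL //; exact: smooth_comp.
- by move=> f nsf; rewrite asboolF.
Qed.

Definition tangent_map x (v : tangent x) : tangent (F x) :=
  mktangent (tangent_map_derivation v).

End tangent_map.

Definition locally_constant (M : topologicalType) (T : Type) (U : set M)
    (f : M -> T) : Prop :=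
  forall x, U x -> \forall y \near x, f y = f x.

(* A sheaf of K-modules given by its stalks and, for each open U, the families
   of elements of the stalks that are its sections on U; sect U s only depends
   on the restriction of s to U.  It is locally isomorphic to a constant sheaf
   K^n. *)
Record local_system (K : fieldType) (M : topologicalType) := LocalSystem {
  stalk :> M -> lmodType K;
  sect : set M -> (forall x, stalk x) -> Prop;
  sect_local : forall U s, open U -> sect U s <->
    forall x, U x -> exists V t, [/\ open V, V x, sect V t &
      forall y, U y -> V y -> s y = t y];
  stalk_trivial : forall x, exists U n
      (phi : forall y, {linear 'rV[K]_n -> stalk y}),
    [/\ open U, U x, forall y, U y -> bijective (phi y) &
        forall W s, open W -> W `<=` U ->
          (sect W s <-> exists f : M -> 'rV[K]_n,
             locally_constant W f /\ forall y, W y -> s y = phi y (f y))] }.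

Section const_system.
Variables (K : fieldType) (M : topologicalType).

Definition const_stalk : M -> lmodType K := fun=> K^o.

Fact const_sect_local (U : set M) (s : forall x, const_stalk x) :
  open U -> locally_constant U s <->
  forall x, U x -> exists V (t : forall x, const_stalk x),
    [/\ open V, V x, locally_constant V t & forall y, U y -> V y -> s y = t y].
Proof.
move=> oU; split=> [sU x Ux|h x Ux]; first by exists U, s.
have [V [t [oV Vx tV st]]] := h x Ux.
have nV : \forall y \near x, V y by exact: open_nbhs_nbhs.
have nU : \forall y \near x, U y by exact: open_nbhs_nbhs.
near=> y; rewrite st; [|by near: y|by near: y].
rewrite (st x) //; near: y; exact: tV.
Unshelve. all: by end_near. Qed.

Fact const_stalk_trivial (x : M) : exists (U : set M) n
    (phi : forall y, {linear 'rV[K]_n -> const_stalk y}),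
  [/\ open U, U x, forall y, U y -> bijective (phi y) &
      forall W (s : forall x, const_stalk x), open W -> W `<=` U ->
        (locally_constant W s <-> exists f : M -> 'rV[K]_n,
           locally_constant W f /\ forall y, W y -> s y = phi y (f y))].
Proof.
have ph_lin : linear (fun w : 'rV[K]_1 => (w 0 0 : K^o)).
  by move=> k v w; rewrite !mxE.
pose ph : {linear 'rV[K]_1 -> K^o} :=
  HB.pack (fun w : 'rV[K]_1 => (w 0 0 : K^o))
    (GRing.isLinear.Build _ _ _ _ _ ph_lin).
exists setT, 1%N, (fun=> ph); split=> //; first exact: openT.
  move=> y _; exists (fun a => const_mx a) => [w|a]; last by rewrite /= mxE.
  by apply/rowP => i; rewrite mxE /= ord1.
move=> W s oW _; split=> [sW|[f [fW sf]] x' Wx].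
  exists (fun y => const_mx (s y)); split.
    move=> y Wy; have h := sW y Wy; near=> z; congr const_mx.
    by near: z.
  by move=> y _; rewrite /= mxE.
have nW : \forall y \near x', W y by exact: open_nbhs_nbhs.
have h := fW _ Wx; near=> y; rewrite !sf //; last by near: y.
by congr (ph _); near: y.
Unshelve. all: by end_near. Qed.

Definition const_system : local_system K M :=
  LocalSystem const_sect_local const_stalk_trivial.

End const_system.

(* The inverse image of a local system: the stalk at x is the stalk at f x, and
   the sections are locally the composites with f of sections. *)
Section inverse_image.
Variables (K : fieldType) (M N : topologicalType) (f : M -> N).
Hypothesis fC : continuous f.
Variable L : local_system K N.

Definition inv_stalk : M -> lmodType K := fun x => L (f x).

Definition inv_sect (U : set M) (s : forall x, inv_stalk x) : Prop :=
  forall x, U x -> exists O (t : forall y, L y),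
    [/\ open O, O (f x), sect O t & \forall z \near x, s z = t (f z)].

Fact inv_sect_local (U : set M) (s : forall x, inv_stalk x) :
  open U -> inv_sect U s <->
  forall x, U x -> exists V t,
    [/\ open V, V x, inv_sect V t & forall y, U y -> V y -> s y = t y].
Proof.
move=> oU; split=> [sU x Ux|h x Ux]; first by exists U, s.
have [V [t [oV Vx tV st]]] := h x Ux.
have [O [t' [oO Ox t'O tt']]] := tV x Vx.
exists O, t'; split=> //.
have nV : \forall y \near x, V y by exact: open_nbhs_nbhs.
have nU : \forall y \near x, U y by exact: open_nbhs_nbhs.
near=> y; rewrite st; [|by near: y|by near: y].
by near: y.
Unshelve. all: by end_near. Qed.

Lemma sectS (U V : set N) (t : forall y, L y) :
  open U -> open V -> V `<=` U -> sect U t -> sect V t.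
Proof.
move=> oU oV VU tU; apply/sect_local => // x Vx.
by exists U, t; split=> //; exact: VU.
Qed.

Fact inv_stalk_trivial (x : M) : exists U n
    (phi : forall y, {linear 'rV[K]_n -> inv_stalk y}),
  [/\ open U, U x, forall y, U y -> bijective (phi y) &
      forall W s, open W -> W `<=` U ->
        (inv_sect W s <-> exists g : M -> 'rV[K]_n,
           locally_constant W g /\ forall y, W y -> s y = phi y (g y))].
Proof.
have [U [n [phi [oU Ux phib phiP]]]] := stalk_trivial L (f x).
have oU' : open (f @^-1` U) by apply: open_comp => // y _; exact: fC.
exists (f @^-1` U), n, (fun y => phi (f y)); split=> //.
  by move=> y; exact: phib.
move=> W s oW WU; split=> [sW|[g [gW sg]] y Wy]; last first.
  exists U, (fun z => phi z (g y)); split=> //; first exact: WU.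
    by apply/phiP => //; exists (fun=> g y); split=> // z _; exact: nearW.
  have nW : \forall z \near y, W z by exact: open_nbhs_nbhs.
  have h := gW y Wy; near=> z.
  by rewrite sg; [congr (phi _ _); near: z | near: z].
have ex (y : M) : exists a, W y -> s y = phi (f y) a.
  have [Wy|nWy] := pselect (W y); last by exists 0.
  have [psi _ psiK] := phib _ (WU _ Wy).
  by exists (psi (s y)) => _; rewrite psiK.
have [g gP] := choice ex; exists g; split=> // y Wy.
have [O [t [oO Oy tO st]]] := sW y Wy.
have oOU : open (O `&` U) by exact: openI.
have [h [hOU th]] : exists h : N -> 'rV[K]_n,
    locally_constant (O `&` U) h /\
    forall z, (O `&` U) z -> t z = phi z (h z).
  apply/(phiP _ t oOU); first by move=> z [].
  by apply: sectS tO => // z [].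
have nW : \forall z \near y, W z by exact: open_nbhs_nbhs.
have nO : \forall z \near y, O (f z).
  by apply: fC; exact: open_nbhs_nbhs.
have nh : \forall z \near y, h (f z) = h (f y).
  have hn : \forall w \near f y, h w = h (f y).
    by apply: hOU; split => //; exact: WU.
  exact: (fC hn).
have key z : W z -> O (f z) -> s z = t (f z) -> g z = h (f z).
  move=> Wz Oz szt; have inj := bij_inj (phib _ (WU _ Wz)).
  by apply: inj; rewrite -gP // szt th //; split => //; exact: WU.
near=> z; rewrite (key z); [|by near: z..].
rewrite (key y) //; first by near: z.
exact: (nbhs_singleton st).
Unshelve. all: by end_near. Qed.

Definition inverse_image : local_system K M :=
  LocalSystem inv_sect_local inv_stalk_trivial.

End inverse_image.

Record supports (X : topologicalType) := Supports {
  supports_mem :> set X -> Prop;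
  supports_closed : forall A, supports_mem A -> closed A;
  supports0 : supports_mem set0;
  supportsU : forall A B, supports_mem A -> supports_mem B ->
    supports_mem (A `|` B);
  supports_sub : forall A B, supports_mem A -> closed B -> B `<=` A ->
    supports_mem B }.

Definition paracompactifying (X : topologicalType) (Phi : supports X) : Prop :=
  forall A, Phi A ->
    paracompact (set_type A) /\
    exists2 B, Phi B & A `<=` interior B.

Definition closed_supports (X : topologicalType) : supports X :=
  @Supports X closed (fun _ => id) (@closed0 X) (@closedU X)
    (fun _ _ _ cB _ => cB).

Section inverse_supports.
Variables (Z X : topologicalType) (f : Z -> X) (Phi : supports X).

Definition inverse_supports_mem (A : set Z) : Prop :=
  closed A /\ exists2 B, Phi B & A `<=` f @^-1` B.

Let inv_closed A : inverse_supports_mem A -> closed A.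
Proof. by case. Qed.
Let inv0 : inverse_supports_mem set0.
Proof. by split; [exact: closed0|exists set0 => //; exact: supports0]. Qed.
Let invU A B : inverse_supports_mem A -> inverse_supports_mem B ->
  inverse_supports_mem (A `|` B).
Proof.
move=> [cA [A' PA AA']] [cB [B' PB BB']]; split; first exact: closedU.
exists (A' `|` B'); first exact: supportsU.
by move=> x [/AA'|/BB'] ?; [left|right].
Qed.
Let inv_sub A B : inverse_supports_mem A -> closed B -> B `<=` A ->
  inverse_supports_mem B.
Proof.
move=> [_ [A' PA AA']] cB BA; split => //.
by exists A' => //; exact: subset_trans BA AA'.
Qed.

Definition inverse_supports : supports Z :=
  Supports inv_closed inv0 invU inv_sub.

End inverse_supports.

Section forms.
Variables (R : realType) (c : coef) (M : fspace R).
Let K : fieldType := coef_field R c.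

(* No linearity or smoothness is required here. *)
Definition pform (S : M -> lmodType K) (p : nat) : lmodType K :=
  dprod (fun x => (('I_p -> tangent x) -> S x) : lmodType K).

Definition ksmooth (g : M -> K) : Prop :=
  smooth (fun x => repart (g x)) /\ smooth (fun x => impart (g x)).

Definition ktapp (x : M) (v : tangent x) (g : M -> K) : K :=
  mkcoef c (tapp v (fun y => repart (g y))) (tapp v (fun y => impart (g y))).

Definition update (T : Type) (p : nat) (v : 'I_p -> T) (i : 'I_p) (t : T) :
  'I_p -> T := fun k => if k == i then t else v k.

Definition alternating (p : nat) (x : M) (w : ('I_p -> tangent x) -> K) :
  Prop :=
  (forall i v (a : R) t t',
     w (update v i (a *: t + t')) =
     mkcoef c a 0 * w (update v i t) + w (update v i t')) /\
  (forall v i j, i != j -> v i = v j -> w v = 0).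

Definition kform (p : nat) : lmodType K := pform (@const_stalk K M) p.

Definition smooth_kform (p : nat) (a : kform p) : Prop :=
  (forall x, alternating (a x)) /\
  forall X : 'I_p -> vfield M, ksmooth (fun x => a x (fun i => X i x)).

(* The right-hand side of
     da (X_0, ..., X_p) = sum_i (-1)^i X_i (a (X_0, ., ^X_i, ., X_p))
       + sum_(i < j) (-1)^j a (X_0, ., [X_i, X_j], ., ^X_j, ., X_p)
   with [X_i, X_j] in the place of X_i; moving it to the front gives the usual
   sign (-1)^(i + j). *)
Definition koszul (p : nat) (a : kform p) (X : 'I_p.+1 -> vfield M) (x : M) :
  K :=
  \sum_(i < p.+1)
     (-1) ^+ i * ktapp (X i x) (fun y => a y (fun k => X (lift i k) y)) +
  \sum_(i < p.+1) \sum_(j < p.+1 | (i < j)%N)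
     (-1) ^+ j * a x (fun k => if lift j k == i then bracket (X i) (X j) x
                               else X (lift j k) x).

Definition ext_derivative (p : nat) (a : kform p) (b : kform p.+1) : Prop :=
  [/\ smooth_kform a, smooth_kform b &
      forall (X : 'I_p.+1 -> vfield M) x, b x (fun i => X i x) = koszul a X x].

Section coefficients.
Variable L : local_system K M.

(* w is, locally, a sum of products of smooth K-valued p-forms by sections
   of L.  It is enough to use globally defined K-valued forms, since on a
   manifold every germ of form is the germ of a global form. *)
Definition smooth_form (p : nat) (w : pform L p) : Prop :=
  forall x0, exists U m (s : 'I_m -> forall x, L x) (a : 'I_m -> kform p),
    [/\ open U /\ U x0, forall j, sect U (s j), forall j, smooth_kform (a j) &
        forall x v, U x -> w x v = \sum_j (a j x v : K) *: s j x].

(* dw = w', where d (a s) = (da) s for a section s of L *)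
Definition is_d (p : nat) (w : pform L p) (w' : pform L p.+1) : Prop :=
  forall x0, exists U m (s : 'I_m -> forall x, L x) (a : 'I_m -> kform p)
      (b : 'I_m -> kform p.+1),
    [/\ open U /\ U x0, forall j, sect U (s j),
        forall j, ext_derivative (a j) (b j),
        forall x v, U x -> w x v = \sum_j (a j x v : K) *: s j x &
        forall x v, U x -> w' x v = \sum_j (b j x v : K) *: s j x].

Definition form_support (p : nat) (w : pform L p) : set M :=
  closure [set x | w x <> 0].

End coefficients.

Let repart_lin (k z w : K) :
  repart (k * z + w) = repart k * repart z - impart k * impart z + repart w.
Proof.
rewrite /K in k z w *; case: c k z w => [k z w|[a b] [a' b'] [a'' b'']] //=.
by rewrite mul0r subr0.
Qed.

Let impart_lin (k z w : K) :
  impart (k * z + w) = repart k * impart z + impart k * repart z + impart w.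
Proof.
rewrite /K in k z w *; case: c k z w => [k z w|[a b] [a' b'] [a'' b'']] //=.
by rewrite mulr0 mul0r !addr0.
Qed.

Let mkcoef_lin (k : K) (x y x' y' : R) :
  mkcoef c (repart k * x - impart k * y + x')
    (repart k * y + impart k * x + y') =
  k * mkcoef c x y + mkcoef c x' y'.
Proof.
rewrite /K in k *; case: c k => [k|[a b]] //=.
by rewrite mul0r subr0.
Qed.

Let ksmooth_lin (k : K) g h : ksmooth g -> ksmooth h ->
  ksmooth (fun x => k * g x + h x).
Proof.
move=> [gr gi] [hr hi]; split.
  have := smoothD (smoothD (smoothZ (repart k) gr)
    (smoothZ (- impart k) gi)) hr.
  by congr smooth; apply/funext => x; rewrite repart_lin mulNr.
have := smoothD (smoothD (smoothZ (repart k) gi) (smoothZ (impart k) gr)) hi.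
by congr smooth; apply/funext => x; rewrite impart_lin.
Qed.

Let ktapp_lin (x : M) (v : tangent x) (k : K) g h : ksmooth g -> ksmooth h ->
  ktapp v (fun y => k * g y + h y) = k * ktapp v g + ktapp v h.
Proof.
move=> [gr gi] [hr hi]; rewrite /ktapp -mkcoef_lin.
have [vl _ _] := tangentP v.
congr mkcoef.
  rewrite -addrA -mulNr -!vl //; last exact/smoothD/hr/smoothZ.
  by congr tapp; apply/funext => y; rewrite repart_lin mulNr addrA.
rewrite -addrA -!vl //; last exact/smoothD/hi/smoothZ.
by congr tapp; apply/funext => y; rewrite impart_lin addrA.
Qed.

Let kformE p (k : K) (a b : kform p) x v :
  (k *: a + b) x v = k * (a x v : K) + (b x v : K) :> K.
Proof. by []. Qed.

Lemma smooth_kform_lin p (k : K) (a b : kform p) :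
  smooth_kform a -> smooth_kform b -> smooth_kform (k *: a + b).
Proof.
move=> [aa as_] [ba bs]; split=> [x|X]; last first.
  exact: ksmooth_lin (as_ X) (bs X).
have [al a0] := aa x; have [bl b0] := ba x.
split=> [i v r t t'|v i j ij vij].
  rewrite !kformE al bl !mulrDr addrACA.
  by congr (_ + _ + _); rewrite mulrCA.
by rewrite kformE (a0 _ _ _ ij vij) (b0 _ _ _ ij vij) mulr0 addr0.
Qed.

Lemma smooth_kform0 p : smooth_kform (0 : kform p).
Proof.
split=> [x|X]; first by split=> *; rewrite ?mulr0 ?addr0.
have z (h : K -> R) : h 0 = 0 ->
    smooth (fun x : M => h ((0 : kform p) x (fun i => X i x))).
  by move=> h0; under eq_fun do rewrite h0; exact: smooth_cst.
by split; apply: z; rewrite /K; case: c.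
Qed.

Lemma ext_derivative_lin p (k : K) (a a' : kform p) b b' :
  ext_derivative a b -> ext_derivative a' b' ->
  ext_derivative (k *: a + a') (k *: b + b').
Proof.
move=> [sa sb ab] [sa' sb' ab']; split; try exact: smooth_kform_lin.
move=> X x; rewrite kformE ab ab' /koszul mulrDr addrACA; congr (_ + _).
  rewrite mulr_sumr -big_split; apply: eq_bigr => i _ /=.
  rewrite ktapp_lin; [|exact: sa.2|exact: sa'.2].
  by rewrite mulrDr mulrCA.
rewrite mulr_sumr -big_split; apply: eq_bigr => i _ /=.
rewrite mulr_sumr -big_split; apply: eq_bigr => j _ /=.
by rewrite mulrDr mulrCA.
Qed.

Lemma ext_derivative0 p : ext_derivative (0 : kform p) 0.
Proof.
split; try exact: smooth_kform0.
have r0 : repart (0 : K) = 0 by rewrite /K; case: c.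
have i0 : impart (0 : K) = 0 by rewrite /K; case: c.
have k0 : mkcoef c 0 0 = 0 :> K by rewrite /K; case: c.
move=> X x; rewrite /koszul !big1 ?addr0 // => i _.
  by rewrite big1 // => j _; rewrite mulr0.
rewrite /ktapp; under [X in tapp _ X]eq_fun do rewrite r0.
under [X in mkcoef _ _ (tapp _ X)]eq_fun do rewrite i0.
by rewrite tapp0 k0 mulr0.
Qed.

Section submodules.
Variable L : local_system K M.

Let cat_fun (T : Type) m1 m2 (f : 'I_m1 -> T) (g : 'I_m2 -> T) :
  'I_(m1 + m2) -> T :=
  fun j => match fintype.split j with inl i => f i | inr i => g i end.

Let cat_funP (T : Type) (P : T -> Prop) m1 m2
    (f : 'I_m1 -> T) (g : 'I_m2 -> T) :
  (forall i, P (f i)) -> (forall i, P (g i)) -> forall j, P (cat_fun f g j).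
Proof. by move=> Pf Pg j; rewrite /cat_fun; case: fintype.split. Qed.

Let cat_funl (T : Type) m1 m2 (f : 'I_m1 -> T) (g : 'I_m2 -> T) i :
  cat_fun f g (lshift m2 i) = f i.
Proof. by rewrite /cat_fun (unsplitK (inl i)). Qed.

Let cat_funr (T : Type) m1 m2 (f : 'I_m1 -> T) (g : 'I_m2 -> T) i :
  cat_fun f g (rshift m1 i) = g i.
Proof. by rewrite /cat_fun (unsplitK (inr i)). Qed.

Let cat_sum p m1 m2 (k : K)
    (s1 : 'I_m1 -> forall x, L x) (s2 : 'I_m2 -> forall x, L x)
    (a1 : 'I_m1 -> kform p) (a2 : 'I_m2 -> kform p) (w1 w2 : pform L p) x v :
  w1 x v = \sum_j (a1 j x v : K) *: s1 j x ->
  w2 x v = \sum_j (a2 j x v : K) *: s2 j x ->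
  (k *: w1 + w2) x v =
  \sum_j (cat_fun (fun i => k *: a1 i) a2 j x v : K) *: cat_fun s1 s2 j x.
Proof.
move=> w1E w2E; rewrite big_split_ord /=.
have -> : (k *: w1 + w2) x v = k *: w1 x v + w2 x v by [].
rewrite w1E w2E scaler_sumr; congr (_ + _); apply: eq_bigr => i _.
  by rewrite !cat_funl scalerA.
by rewrite !cat_funr.
Qed.

Let is_d0 p : is_d (0 : pform L p) 0.
Proof.
move=> x0; exists setT, 0%N, (fun=> fun=> 0), (fun=> 0), (fun=> 0).
split; [split=> //; exact: openT|by case|by case| |];
  by move=> x v _; rewrite big_ord0.
Qed.

Lemma is_d_lin p (k : K) (w1 w2 : pform L p) w1' w2' :
  is_d w1 w1' -> is_d w2 w2' -> is_d (k *: w1 + w2) (k *: w1' + w2').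
Proof.
move=> h1 h2 x0.
have [U1 [m1 [s1 [a1 [b1 [[oU1 U1x] s1U d1 e1 e1']]]]]] := h1 x0.
have [U2 [m2 [s2 [a2 [b2 [[oU2 U2x] s2U d2 e2 e2']]]]]] := h2 x0.
have oU : open (U1 `&` U2) by exact: openI.
exists (U1 `&` U2), (m1 + m2)%N, (cat_fun s1 s2),
  (cat_fun (fun i => k *: a1 i) a2), (cat_fun (fun i => k *: b1 i) b2).
split=> //.
- apply: cat_funP => i.
    by apply: sectS (s1U i) => // x [].
  by apply: sectS (s2U i) => // x [].
- move=> j; rewrite /cat_fun; case: fintype.split => i //.
  have := ext_derivative_lin k (d1 i) (ext_derivative0 p); by rewrite !addr0.
- by move=> x v [Ux1 Ux2]; apply: cat_sum; [exact: e1|exact: e2].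
- by move=> x v [Ux1 Ux2]; apply: cat_sum; [exact: e1'|exact: e2'].
Qed.

Lemma smooth_form_lin p (k : K) (w1 w2 : pform L p) :
  smooth_form w1 -> smooth_form w2 -> smooth_form (k *: w1 + w2).
Proof.
move=> h1 h2 x0.
have [U1 [m1 [s1 [a1 [[oU1 U1x] s1U d1 e1]]]]] := h1 x0.
have [U2 [m2 [s2 [a2 [[oU2 U2x] s2U d2 e2]]]]] := h2 x0.
have oU : open (U1 `&` U2) by exact: openI.
exists (U1 `&` U2), (m1 + m2)%N, (cat_fun s1 s2),
  (cat_fun (fun i => k *: a1 i) a2).
split=> //.
- apply: cat_funP => i.
    by apply: sectS (s1U i) => // x [].
  by apply: sectS (s2U i) => // x [].
- apply: cat_funP => // i; rewrite -[_ *: _]addr0.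
  by apply: smooth_kform_lin => //; exact: smooth_kform0.
- by move=> x v [Ux1 Ux2]; apply: cat_sum; [exact: e1|exact: e2].
Qed.

Let smooth_form0 p : smooth_form (0 : pform L p).
Proof.
move=> x0; exists setT, 0%N, (fun=> fun=> 0), (fun=> 0).
split; [split=> //; exact: openT|by case|by case|].
by move=> x v _; rewrite big_ord0.
Qed.

Let form_support0 p : form_support (0 : pform L p) = set0.
Proof.
rewrite /form_support (_ : [set x | _] = set0) ?closure0 //.
by apply/seteqP; split => x //=; apply.
Qed.

Let form_support_lin p (k : K) (w1 w2 : pform L p) :
  form_support (k *: w1 + w2) `<=` form_support w1 `|` form_support w2.
Proof.
rewrite /form_support -closureU; apply: closureS => x /= nz.
apply: contrapT => /not_orP[/contrapT z1 /contrapT z2]; apply: nz.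
have -> : (k *: w1 + w2) x = k *: w1 x + w2 x by [].
by rewrite z1 z2 scaler0 addr0.
Qed.

Variable Phi : supports M.

Definition cochain (p : nat) (w : pform L p) : Prop :=
  smooth_form w /\ Phi (form_support w).

Definition cocycle (p : nat) (w : pform L p) : Prop :=
  cochain w /\ is_d w 0.

Definition coboundary (p : nat) : pform L p -> Prop :=
  match p return pform L p -> Prop with
  | 0 => fun w => w = 0
  | q.+1 => fun w => exists2 w', cochain w' & is_d w' w
  end.

Let cochain_lin p (k : K) (w1 w2 : pform L p) :
  cochain w1 -> cochain w2 -> cochain (k *: w1 + w2).
Proof.
move=> [s1 P1] [s2 P2]; split; first exact: smooth_form_lin.
have := supportsU P1 P2 => P12; apply: (supports_sub P12).
  exact: closed_closure.
exact: form_support_lin.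
Qed.

Let cochain0 p : cochain (0 : pform L p).
Proof.
by split; [exact: smooth_form0|rewrite form_support0; exact: supports0].
Qed.

Fact cocycle_submod p : is_submod (@cocycle p).
Proof.
split; first by split; [exact: cochain0|exact: is_d0].
move=> k v w [cv dv] [cw dw]; split; first exact: cochain_lin.
by rewrite -[0](scaler0 _ k) -[X in is_d _ X]addr0; exact: is_d_lin.
Qed.

Fact coboundary_submod p : is_submod (@coboundary p).
Proof.
case: p => [|p]; split => //=.
- by move=> k v w -> ->; rewrite scaler0 addr0.
- by exists 0; [exact: cochain0|exact: is_d0].
- move=> k v w [v' cv dv] [w' cw dw].
  by exists (k *: v' + w'); [exact: cochain_lin|exact: is_d_lin].
Qed.

Definition cohomology (p : nat) : lmodType K :=
  subquotient (cocycle_submod p) (coboundary_submod p).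

Definition coh_class (p : nat) (w : pform L p) : cohomology p :=
  subq_class (cocycle_submod p) (coboundary_submod p) w.

Definition coh_repr (p : nat) (h : cohomology p) : pform L p := subq_repr h.

End submodules.
End forms.

Arguments coh_class {R c M} L Phi {p} w.

Definition const_coef (R : realType) (c : coef) (M : fspace R) :
  local_system (coef_field R c) M := const_system (coef_field R c) M.
Arguments const_coef {R} c M.

Definition HdR (R : realType) (c : coef) (M : fspace R) (p : nat) :
  lmodType (coef_field R c) :=
  cohomology (const_coef c M) (closed_supports M) p.

Definition pullback_form (R : realType) (c : coef) (M N : fspace R)
    (F : smooth_map M N) (S : N -> lmodType (coef_field R c)) (p : nat)
    (w : pform S p) : pform (fun x => S (F x)) p :=
  fun x v => w (F x) (fun i => tangent_map F (v i)).

Definition wedge (R : realType) (c : coef) (M : fspace R)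
    (S : M -> lmodType (coef_field R c)) (p q n : nat) (pqn : (p + q = n)%N)
    (a : pform S p) (b : kform c M q) : pform S n :=
  fun x v => ((p`! * q`!)%:R : coef_field R c)^-1 *:
    \sum_(s : 'S_n) ((-1) ^+ s *
        (b x (fun j => v (s (cast_ord pqn (rshift p j)))) : coef_field R c)) *:
      a x (fun i => v (s (cast_ord pqn (lshift q i)))).

(* These operations are computed on chosen representatives; on manifolds their
   values do not depend on the choice, as f^* commutes with d and
   d (a /\ b) = da /\ b + (-1)^p a /\ db. *)
Section cohomology_operations.
Variables (R : realType) (c : coef).
Let K : fieldType := coef_field R c.

Definition inverse_system (M N : fspace R) (F : smooth_map M N)
    (L : local_system K N) : local_system K M :=
  inverse_image (@smooth_fun_continuous R M N F) L.

Definition pullback (M N : fspace R) (F : smooth_map M N)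
    (L : local_system K N) (Phi : supports N) (p : nat)
    (h : cohomology L Phi p) :
    cohomology (inverse_system F L) (inverse_supports F Phi) p :=
  coh_class (inverse_system F L) (inverse_supports F Phi)
    (pullback_form F (coh_repr h)).

Definition pullback_dR (M N : fspace R) (F : smooth_map M N) (p : nat)
    (h : HdR c N p) : HdR c M p :=
  coh_class (const_coef c M) (closed_supports M) (pullback_form F (coh_repr h)).

Definition cup (M : fspace R) (L : local_system K M) (Phi : supports M)
    (p q n : nat) (pqn : (p + q = n)%N)
    (h : cohomology L Phi p) (e : HdR c M q) : cohomology L Phi n :=
  coh_class L Phi (wedge pqn (coh_repr h) (coh_repr e)).

(* The map sum_i pi^*(.) u e_i in degree n.  Since H^m = 0 for m < 0, only the
   indices i with u i <= n occur. *)
Definition leray_hirsch_map (E X : fspace R) (pi : smooth_map E X)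
    (L : local_system K X) (Phi : supports X) (r : nat) (u : 'I_r -> nat)
    (e : forall i, HdR c E (u i)) (n : nat)
    (h : dprod (fun i : {i : 'I_r | (u i <= n)%N} =>
                  cohomology L Phi (n - u (val i)))) :
    cohomology (inverse_system pi L) (inverse_supports pi Phi) n :=
  \sum_(i : {i : 'I_r | (u i <= n)%N})
     cup (subnK (valP i)) (pullback pi (h i)) (e (val i)).

End cohomology_operations.

(* Main.v *)
From HB Require Import structures.
From mathcomp Require Import boot.all_boot order.order algebra.all_algebra.
From mathcomp Require Import fingroup.perm.
From mathcomp Require Import complex.
From mathcomp Require Import all_classical all_reals all_analysis.
From mathcomp Require Import ring lra.
Require Import Defs.

(** Choose closed forms eps_i on E that represent the classes e_i.  Sending
    (a_i) to the sum of the forms pi^* a_i /\ eps_i is a morphism of complexes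
    from the sum of the complexes of L-valued forms on X, shifted by the u_i, to
    the complex of forms on E with values in pi^-1 L.  The theorem says that
    this morphism induces isomorphisms in cohomology with supports, and this
    holds because its mapping cone, regarded as a complex of sheaves on X, is
    acyclic.

    These sheaves are modules over the smooth functions.  For such complexes,
    local acyclicity implies acyclicity over every open set, and with supports
    in every paracompactifying family (locally_exact_exact, exact_supports): a
    solution is built along a countable cover, and two solutions on an overlap
    are reconciled by cutting off a primitive of their difference.  Neither
    spectral sequences nor good covers occur; what is used of the topology of X
    is that a connected paracompact manifold has a countable base
    (connected_countable_base).

    The local statement (lh_locally_exact) concerns a star-shaped chart U of X
    over which E and L are trivial.  By the Poincare lemma on U, closed families
    (a_i) are flat up to boundaries; and the hypothesis on the e_i is an
    assertion on the fibre E_x of a point x of U.  So everything follows once a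
    closed form over pi^-1(U) whose restriction to E_x is a boundary is itself a
    boundary (fiberwise_exact).  This is again an instance of the same
    principle: the cone of the restriction from forms over pi^-1(U) to forms on
    E_x is a complex of sheaves on the typical fibre F, locally acyclic by the
    Poincare lemma in product charts.  It takes the place of the Kunneth formula
    and of homotopy invariance.

    Forms are functions on tuples of derivations, and their differential is
    defined by the invariant formula.  All computations are done instead with
    local expressions as sums of terms f dg_1 ... dg_p s, where f and the g_k
    are global functions and s is a flat section (rD and LD).  For these, d,
    pullbacks, wedge products and d d = 0 are immediate.  The two notions are
    compared by koszul_elem, which computes the invariant formula on such a
    term, and by alt_rD, which finds such expressions in a chart.  The latter, like
    the Poincare lemma, rests on calculus in R^n: the chain rule, bump functions,
    the symmetry of second derivatives, Hadamard's lemma, and integration along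
    segments. *)

Set Implicit Arguments.
Unset Strict Implicit.
Unset Printing Implicit Defensive.

Import Order.TTheory GRing.Theory Num.Theory numFieldNormedType.Exports.

Local Open Scope classical_set_scope.
Local Open Scope ring_scope.

(** * Calculus in R^n *)

Section smooth_calculus.
Variable R : realType.
Implicit Types n m : nat.

Definition evec n (i : 'I_n) : 'rV[R]_n := delta_mx 0 i.

Lemma evecE n (v : 'rV[R]_n) : v = \sum_i v 0 i *: evec i.
Proof. exact: row_sum_delta. Qed.

Lemma nbhs_rVP n (x : 'rV[R]_n) (A : set 'rV[R]_n) : nbhs x A <->
  exists2 e : R, 0 < e & forall y : 'rV[R]_n, (forall i, `|y 0 i - x 0 i| < e) -> A y.
Proof.
split=> [/nbhs_ballP[e /= e0 eA]|[e e0 eA]].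
  exists e => // y ye; apply: eA; split=> // i j.
  by rewrite (ord1 i) /ball /= distrC; exact: ye.
apply/nbhs_ballP; exists e => // y [_ ye]; apply: eA => i.
by have := ye 0 i; rewrite /ball /= distrC.
Qed.

Lemma cvg_rV n T (F : set_system T) (FF : Filter F) (g : T -> 'rV[R]_n) (x : 'rV[R]_n) :
  (forall i, g t 0 i @[t --> F] --> x 0 i) -> g t @[t --> F] --> x.
Proof.
move=> gi A /nbhs_rVP[e e0 eA].
have : \forall t \near F, forall i, `|g t 0 i - x 0 i| < e.
  apply: filter_forall => i.
  have /cvgrPdist_lt/(_ e e0) := gi i.
  by apply: filterS => t; rewrite distrC.
by apply: filterS => t; exact: eA.
Qed.

Lemma continuous_rV n (T : topologicalType) (g : T -> 'rV[R]_n) x :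
  (forall i, {for x, continuous (fun y => g y 0 i)}) -> {for x, continuous g}.
Proof. by move=> gi; apply: (@cvg_rV n T (nbhs x) (nbhs_filter x)); exact: gi. Qed.

Lemma coord_continuous n (i : 'I_n) : continuous (fun x : 'rV[R]_n => x 0 i).
Proof.
move=> x A /nbhs_ballP[e /= e0 eA]; apply/nbhs_rVP; exists e => // y ye.
by apply: eA; rewrite /ball /= distrC.
Qed.

Lemma cvg_sumr T (F : set_system T) (FF : Filter F) (I : Type) (r : seq I)
    (f : I -> T -> R) (a : I -> R) :
  (forall i, f i t @[t --> F] --> a i) ->
  \sum_(i <- r) f i t @[t --> F] --> \sum_(i <- r) a i.
Proof.
move=> fa; elim: r => [|i r IH].
  under eq_fun do rewrite big_nil; rewrite big_nil; exact: cvg_cst.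
under eq_fun do rewrite big_cons; rewrite big_cons.
by apply: cvgD.
Qed.

Lemma is_deriveP (V : normedModType R) (f : V -> R) x v d :
  is_derive x v f d <->
  h^-1 * (f (h *: v + x) - f x) @[h --> 0^'] --> d.
Proof.
split=> [[fd <-]|fd]; first exact: fd.
have fd' : derivable f x v by apply/cvg_ex; exists d.
by split=> //; exact: cvg_lim.
Qed.

(** Reduces directional derivatives to derivatives of functions of one
    variable. *)
Lemma is_derive_line (V : normedModType R) (f : V -> R) (a v : V) t d :
  is_derive (t *: v + a) v f d <-> is_derive t 1 (fun s => f (s *: v + a)) d.
Proof.
rewrite !is_deriveP.
by under [X in _ <-> X @ _ --> _]eq_fun do
  rewrite [_ *: 1]mulr1 scalerDl -addrA.
Qed.

Lemma is_derive_line0 (V : normedModType R) (f : V -> R) (a v : V) d :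
  is_derive a v f d <-> is_derive (0 : R) 1 (fun s : R => f (s *: v + a)) d.
Proof. by have := is_derive_line f a v 0 d; rewrite scale0r add0r. Qed.

Lemma cvg_shift (t : R) : h *: (1 : R) + t @[h --> 0^'] --> t.
Proof.
have -> : (fun h : R => h *: (1 : R) + t) = (fun h => h + t).
  by apply/funext => h; rewrite [_ *: _]mulr1.
rewrite -[X in _ --> X]add0r; apply: cvgD; last exact: cvg_cst.
exact: nbhs_dnbhs.
Qed.

Lemma is_derive_near (V : normedModType R) (f g : V -> R) (x v : V) d :
  (\near x, f x = g x) -> is_derive x v f d -> is_derive x v g d.
Proof. exact: near_eq_is_derive. Qed.

Lemma is_deriveZdir (V : normedModType R) (f : V -> R) (x v : V) k d :
  is_derive x v f d -> is_derive x (k *: v) f (k * d).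
Proof.
move=> fd; apply/is_derive_line0.
rewrite (_ : (fun s => _) = (fun s => f (s *: v + x)) \o ( *%R k)); last first.
  by apply/funext => s /=; rewrite scalerA mulrC.
rewrite mulrC; apply: is_derive1_comp.
  by rewrite mulr0; apply: (is_derive_line0 f x v d).1.
have -> : k = k *: (1 : R) by rewrite [_ *: _]mulr1.
rewrite (_ : *%R _ = k *: (@id R)).
  exact: is_deriveZ.
by apply/funext => y /=; rewrite [_ *: 1]mulr1.
Qed.

(** Walk from x to y changing one coordinate at a time, and apply the mean value
    theorem to each step. *)
Lemma telescoping_MVT n (f : 'rV[R]_n -> R) (x y : 'rV[R]_n) :
  (forall (w : 'rV[R]_n) i, (forall j, `|w 0 j - x 0 j| <= `|y 0 j - x 0 j|) ->
     derivable f w (evec i)) ->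
  exists xi : 'I_n -> 'rV[R]_n,
    (forall i j, `|xi i 0 j - x 0 j| <= `|y 0 j - x 0 j|) /\
    f y - f x = \sum_i (y 0 i - x 0 i) * 'D_(evec i) f (xi i).
Proof.
move=> fd; pose hyb k := \row_(j < n) if (j < k)%N then y 0 j else x 0 j.
have hybP (i : 'I_n) (s : R) j : 0 <= s <= 1 ->
    `|(s *: ((y 0 i - x 0 i) *: evec i) + hyb i) 0 j - x 0 j| <= `|y 0 j - x 0 j|.
  move=> /andP[s0 s1]; rewrite !mxE eqxx /=; case: (eqVneq j i) => [->|_].
    rewrite ltnn mulr1 addrK normrM ger0_norm //.
    by rewrite ler_piMl // ger0_norm.
  by rewrite !mulr0 add0r; case: ifP => // _; rewrite subrr normr0.
have step (i : 'I_n) : exists xi : 'rV[R]_n,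
    (forall j, `|xi 0 j - x 0 j| <= `|y 0 j - x 0 j|) /\
    f (hyb i.+1) - f (hyb i) = (y 0 i - x 0 i) * 'D_(evec i) f xi.
  pose v := (y 0 i - x 0 i) *: evec i.
  pose g s := f (s *: v + hyb i).
  pose dg s := (y 0 i - x 0 i) * 'D_(evec i) f (s *: v + hyb i).
  have gd (s : R) : 0 <= s <= 1 -> is_derive s 1 g (dg s).
    move=> s01; apply: (is_derive_line f (hyb i) v s _).1.
    apply: is_deriveZdir; apply: derivableP.
    by apply: fd => j; exact: hybP.
  have gc : {within `[0, 1], continuous g}.
    apply: derivable_within_continuous => s; rewrite in_itv /= => s01.
    by have [] := gd s s01.
  have [||c cI] := @MVT_segment R g dg 0 1 ler01.
  - move=> s; rewrite in_itv /= => /andP[s0 s1]; apply: gd.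
    by rewrite !ltW.
  - exact: gc.
  move: cI; rewrite in_itv /= => cI; rewrite subr0 mulr1.
  have -> : g 0 = f (hyb i) by rewrite /g scale0r add0r.
  have -> : g 1 = f (hyb i.+1).
    rewrite /g scale1r; congr f; apply/rowP => j; rewrite !mxE eqxx /=.
    case: (eqVneq j i) => [->|ji]; first by rewrite ltnn ltnSn mulr1 subrK.
    by rewrite mulr0 add0r ltnS [(j <= i)%N]leq_eqVlt (_ : (j == i :> nat) = false) //; apply/negbTE.
  by move=> ->; exists (c *: v + hyb i); split=> // j; exact: hybP.
have [xi xiP] := choice step.
exists xi; split; first by move=> i; have [] := xiP i.
rewrite (eq_bigr (fun i : 'I_n => f (hyb i.+1) - f (hyb i))); last first.
  by move=> i _; have [_ ->] := xiP i.
rewrite -(big_mkord xpredT (fun i => f (hyb i.+1) - f (hyb i))).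
rewrite telescope_sumr //; congr (f _ - f _).
  by apply/rowP => j; rewrite !mxE ltn_ord.
by apply/rowP => j; rewrite !mxE.
Qed.

(** By telescoping_MVT the increment of f is a sum over the coordinates; the
    continuity of the partial derivatives at g t0 gives the limit of each term. *)
Lemma is_derive_curve n (f : 'rV[R]_n -> R) (g : R -> 'rV[R]_n) (d : 'I_n -> R)
    t0 :
  (\forall w \near g t0, forall i, derivable f w (evec i)) ->
  (forall i, {for g t0, continuous ('D_(evec i) f)}) ->
  (forall i, is_derive t0 1 (fun t => g t 0 i) (d i)) ->
  is_derive t0 1 (f \o g) (\sum_i d i * 'D_(evec i) f (g t0)).
Proof.
move=> /nbhs_rVP[e e0 fd] fc gd.
have gc : g (h *: 1 + t0) @[h --> 0^'] --> g t0.
  apply: cvg_rV => i; have [gid _] := gd i.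
  have : {for t0, continuous (fun t => g t 0 i)}.
    by apply: differentiable_continuous; apply/derivable1_diffP.
  rewrite /prop_for /continuous_at => gic.
  apply: (@cvg_comp _ _ _ (fun h : R => h *: 1 + t0) (fun t => g t 0 i) _ (nbhs t0)).
    exact: cvg_shift.
  exact: gic.
have near_g (e' : R) : 0 < e' ->
    \forall h \near 0^', forall i, `|g (h *: 1 + t0) 0 i - g t0 0 i| < e'.
  move=> e'0; have := gc [set w | forall i, `|w 0 i - g t0 0 i| < e'].
  by apply; apply/nbhs_rVP; exists e'.
have gcl := near_g _ e0.
pose P (h : R) (xi : 'I_n -> 'rV[R]_n) :=
  (forall i, `|g (h *: 1 + t0) 0 i - g t0 0 i| < e) ->
  (forall i j, `|xi i 0 j - g t0 0 j| <= `|g (h *: 1 + t0) 0 j - g t0 0 j|) /\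
  f (g (h *: 1 + t0)) - f (g t0) =
  \sum_i (g (h *: 1 + t0) 0 i - g t0 0 i) * 'D_(evec i) f (xi i).
have exP h : exists xi, P h xi.
  have [he|nhe] := pselect (forall i, `|g (h *: 1 + t0) 0 i - g t0 0 i| < e).
    have [|xi xiP] := @telescoping_MVT n f (g t0) (g (h *: 1 + t0)); last by exists xi.
    by move=> w i wP; apply: fd => j; apply: le_lt_trans (wP j) (he j).
  by exists (fun=> 0).
have [xi xiP] := choice exP.
have xic i : xi h i @[h --> 0^'] --> g t0.
  move=> A /nbhs_rVP[e' e'0 eA].
  have gcl' := near_g _ e'0.
  apply: filterS (filterI gcl gcl') => h [hg hg']; apply: eA => j.
  by have [xh _] := xiP h hg; apply: le_lt_trans (xh i j) (hg' j).
apply/is_deriveP.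
have : \sum_i (h^-1 * (g (h *: 1 + t0) 0 i - g t0 0 i)) * 'D_(evec i) f (xi h i)
    @[h --> 0^'] --> \sum_i d i * 'D_(evec i) f (g t0).
  apply: cvg_sumr => i; apply: cvgM.
    by have /is_deriveP := gd i.
  exact: (continuous_cvg _ (fc i) (xic i)).
apply: cvg_trans; apply: near_eq_cvg; near=> h => /=.
have [|_ ->] := xiP h; first by near: h.
by rewrite mulr_sumr; apply: eq_bigr => i _; rewrite mulrA.
Unshelve. all: by end_near. Qed.

Lemma continuous_near_eq (T : topologicalType) (U : topologicalType)
    (f g : T -> U) x :
  {for x, continuous f} -> (\near x, f x = g x) -> {for x, continuous g}.
Proof.
move=> fc fg A; rewrite /= -(nbhs_singleton fg) => /fc; rewrite !nbhs_simpl /=.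
by apply: filterS2 fg => y /= <-.
Qed.

Lemma continuous_cst (T : topologicalType) (U : topologicalType) (a : U) (x : T) :
  {for x, continuous (fun=> a)}.
Proof. exact: cst_continuous. Qed.

Lemma derivable_near_eq (V : normedModType R) (f g : V -> R) x v :
  derivable f x v -> (\near x, f x = g x) -> derivable g x v.
Proof. by move=> fd fg; apply: near_eq_derivable fg fd. Qed.

Lemma line_MVT (V : normedModType R) (f : V -> R) (a v : V) (h : R) :
  0 <= h -> (forall s, 0 <= s <= h -> derivable f (s *: v + a) v) ->
  exists2 c, 0 <= c <= h & f (h *: v + a) - f a = h * 'D_v f (c *: v + a).
Proof.
move=> h0 fd; pose g s := f (s *: v + a); pose dg s := 'D_v f (s *: v + a).
have gd (s : R) : 0 <= s <= h -> is_derive s 1 g (dg s).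
  move=> sh; apply: (is_derive_line f a v s _).1.
  by apply: derivableP; exact: fd.
have gc : {within `[0, h], continuous g}.
  apply: derivable_within_continuous => s; rewrite in_itv /= => s01.
  by have [] := gd s s01.
have [||c cI] := @MVT_segment R g dg 0 h h0.
- by move=> s; rewrite in_itv /= => /andP[s0 s1]; apply: gd; rewrite !ltW.
- exact: gc.
rewrite /g scale0r add0r subr0 => ->; exists c; last by rewrite mulrC.
by move: cI; rewrite in_itv.
Qed.

(** The coinduction principle behind the smoothness proofs below: by induction on
    vs, iderive vs f agrees on O with a member of P. *)
Lemma rV_smooth_coind n (O : set 'rV[R]_n) (P : set ('rV[R]_n -> R)) :
  open O ->
  (forall f, P f -> forall x, O x ->
     {for x, continuous f} /\ forall v, derivable f x v) ->
  (forall f v, P f -> exists2 g, P g & forall x, O x -> 'D_v f x = g x) ->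
  forall f, P f -> rV_smooth_on O f.
Proof.
move=> oO Pcd PD f Pf vs.
have [g Pg fg] : exists2 g, P g & forall x, O x -> iderive vs f x = g x.
  elim: vs => [|v vs [g Pg fg]]; first by exists f.
  have [g' Pg' gg'] := PD g v Pg; exists g' => // x Ox /=.
  rewrite -gg' //; apply: near_eq_derive.
  by apply: filterS (open_nbhs_nbhs (conj oO Ox)) => y; exact: fg.
move=> x Ox; have near_gf : \near x, g x = iderive vs f x.
  by apply: filterS (open_nbhs_nbhs (conj oO Ox)) => y /fg.
have [gc gd] := Pcd g Pg x Ox; split.
  exact: continuous_near_eq gc near_gf.
by move=> v; apply: derivable_near_eq (gd v) near_gf.
Qed.

Lemma rV_smooth_continuous n (O : set 'rV[R]_n) f x : rV_smooth_on O f -> O x ->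
  {for x, continuous f}.
Proof. by move=> fO Ox; have [] := fO [::] x Ox. Qed.

Lemma rV_smooth_derivable n (O : set 'rV[R]_n) f x v : rV_smooth_on O f -> O x -> derivable f x v.
Proof. by move=> fO Ox; have [] := fO [::] x Ox. Qed.

Lemma rV_smooth_D n (O : set 'rV[R]_n) f v : rV_smooth_on O f -> rV_smooth_on O ('D_v f).
Proof.
move=> fO vs; rewrite (_ : iderive vs ('D_v f) = iderive (rcons vs v) f).
  exact: fO.
by elim: vs => //= w vs ->.
Qed.

Section smooth_on_rV.
Variables (n : nat) (O : set 'rV[R]_n).
Hypothesis oO : open O.

Lemma rV_smooth_ext f g : (forall x, O x -> f x = g x) ->
  rV_smooth_on O f -> rV_smooth_on O g.
Proof.
move=> fg fO.
apply: (@rV_smooth_coind n O (fun h => exists2 h', rV_smooth_on O h' &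
  forall x, O x -> h x = h' x)) => //; last by exists f => // x /fg.
  move=> h [h' h'O hh'] x Ox.
  have nh : \near x, h' x = h x.
    by apply: filterS (open_nbhs_nbhs (conj oO Ox)) => y /hh'.
  split; first exact: continuous_near_eq (rV_smooth_continuous h'O Ox) nh.
  move=> v; have hd : derivable h' x v by exact: (@rV_smooth_derivable n O h' x v h'O Ox).
  exact: derivable_near_eq hd nh.
move=> h v [h' h'O hh']; exists ('D_v h').
  by exists ('D_v h'); [exact: rV_smooth_D|].
move=> x Ox; apply: near_eq_derive.
by apply: filterS (open_nbhs_nbhs (conj oO Ox)) => y /hh'.
Qed.

Lemma derive_curve_rV m (Q : set 'rV[R]_m) (F : 'rV[R]_m -> R)
    (V : normedModType R) (g : V -> 'rV[R]_m) (x v : V) (d : 'I_m -> R) :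
  open Q -> rV_smooth_on Q F -> Q (g x) ->
  (forall i, is_derive x v (fun y => g y 0 i) (d i)) ->
  is_derive x v (F \o g) (\sum_i d i * 'D_(evec i) F (g x)).
Proof.
move=> oQ FQ Qgx gd; apply/is_derive_line0.
have := @is_derive_curve m F (fun s => g (s *: v + x)) d 0.
rewrite scale0r add0r; apply.
- apply: filterS (open_nbhs_nbhs (conj oQ Qgx)) => y Qy i.
  by have [_] := FQ [::] y Qy; apply.
- by move=> i; have [] := FQ [:: evec i] (g x) Qgx.
- by move=> i; apply: (is_derive_line0 (fun y => g y 0 i) x v _).1.
Qed.

(** Functions obtained from smooth ones by the operations under which
    smoothness is to be shown: the class is stable under derivatives by the
    usual rules, which gives all the closure properties at once. *)
Inductive smooth_closure : ('rV[R]_n -> R) -> Prop :=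
| SCbase f : rV_smooth_on O f -> smooth_closure f
| SCadd f g : smooth_closure f -> smooth_closure g ->
    smooth_closure (fun x => f x + g x)
| SCmul f g : smooth_closure f -> smooth_closure g ->
    smooth_closure (fun x => f x * g x)
| SCinv f : smooth_closure f -> (forall x, O x -> f x != 0) ->
    smooth_closure (fun x => (f x)^-1)
| SCcomp m Q (F : 'rV[R]_m -> R) (g : 'rV[R]_n -> 'rV[R]_m) :
    open Q -> rV_smooth_on Q F -> (forall x, O x -> Q (g x)) ->
    (forall i, smooth_closure (fun x => g x 0 i)) ->
    smooth_closure (F \o g).

Lemma rV_smooth_cst (a : R) : rV_smooth_on O (fun=> a).
Proof.
apply: (@rV_smooth_coind n O (fun f => exists b, f = (fun=> b))) => //.
- move=> _ [b ->] x Ox; split; first exact: continuous_cst.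
  by move=> v; exact: derivable_cst.
- move=> _ v [b ->]; exists (fun=> 0); first by exists 0.
  by move=> x _; rewrite derive_cst.
- by exists a.
Qed.

Lemma is_derive_coord i (x v : 'rV[R]_n) :
  is_derive x v (fun y => y 0 i) (v 0 i).
Proof.
apply/is_deriveP; rewrite (_ : (fun h : R => _) = fun h : R => h^-1 * (h * v 0 i)).
  apply: cvg_trans (_ : (cst (v 0 i : R)) @ 0^' --> _); last exact: cvg_cst.
  apply: near_eq_cvg; near=> h; rewrite mulKf //.
  by near: h; exact: nbhs_dnbhs_neq.
by apply/funext => h; rewrite !mxE addrK.
Unshelve. all: by end_near. Qed.

Lemma rV_smooth_coord i : rV_smooth_on O (fun x => x 0 i).
Proof.
apply: (@rV_smooth_coind n O (fun f => f = (fun x => x 0 i) \/ exists b, f = (fun=> b))) => //; last by left.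
  move=> _ [->|[b ->]] x Ox; split; first exact: coord_continuous.
  - by move=> v; have [] := is_derive_coord i x v.
  - exact: continuous_cst.
  - by move=> v; exact: derivable_cst.
move=> _ v [->|[b ->]].
  exists (fun=> v 0 i); first by right; exists (v 0 i).
  by move=> x _; have [_ ->] := is_derive_coord i x v.
exists (fun=> 0); first by right; exists 0.
by move=> x _; rewrite derive_cst.
Qed.

Lemma SCsum (I : Type) (r : seq I) (f : I -> 'rV[R]_n -> R) :
  (forall i, smooth_closure (f i)) ->
  smooth_closure (fun x => \sum_(i <- r) f i x).
Proof.
move=> fO; elim: r => [|i r IH].
  under eq_fun do rewrite big_nil; exact/SCbase/rV_smooth_cst.
by under eq_fun do rewrite big_cons; apply: SCadd.
Qed.

Lemma smooth_closure_smooth f : smooth_closure f -> rV_smooth_on O f.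
Proof.
have key f' : smooth_closure f' -> [/\ smooth_closure f',
    forall x, O x -> {for x, continuous f'} /\ forall v, derivable f' x v &
    forall v, exists2 g, smooth_closure g & forall x, O x -> 'D_v f' x = g x].
  elim=> {f'} [f' f'O|f' g sf [_ fcd fD] sg [_ gcd gD]
    |f' g sf [_ fcd fD] sg [_ gcd gD]|f' sf [_ fcd fD] f0
    |m Q F g oQ FQ gQ sg IH].
  - split; first exact: SCbase.
      move=> x Ox; split; first exact: (rV_smooth_continuous f'O Ox).
      by move=> v; exact: (@rV_smooth_derivable n O f' x v f'O Ox).
    by move=> v; exists ('D_v f') => //; apply/SCbase/rV_smooth_D.
  - split; first exact: SCadd.
      move=> x Ox; have [fc fd] := fcd x Ox; have [gc gd] := gcd x Ox.
      split; first exact: (continuousD fc gc).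
      by move=> v; apply: (derivableD (fd v) (gd v)).
    move=> v; have [df sdf dfE] := fD v; have [dg sdg dgE] := gD v.
    exists (fun x => df x + dg x); first exact: SCadd.
    move=> x Ox; have [_ fd] := fcd x Ox; have [_ gd] := gcd x Ox.
    by rewrite (deriveD (fd v) (gd v)) dfE // dgE.
  - split; first exact: SCmul.
      move=> x Ox; have [fc fd] := fcd x Ox; have [gc gd] := gcd x Ox.
      split; first exact: (continuousM fc gc).
      by move=> v; apply: (derivableM (fd v) (gd v)).
    move=> v; have [df sdf dfE] := fD v; have [dg sdg dgE] := gD v.
    exists (fun x => f' x * dg x + g x * df x).
      by apply: SCadd; apply: SCmul.
    move=> x Ox; have [_ fd] := fcd x Ox; have [_ gd] := gcd x Ox.
    by rewrite (deriveM (fd v) (gd v)) dfE // dgE.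
  - split; first exact: SCinv.
      move=> x Ox; have [fc fd] := fcd x Ox.
      split; first exact: (cvgV (f0 x Ox) fc).
      by move=> v; apply: (derivableV (f0 x Ox) (fd v)).
    move=> v; have [df sdf dfE] := fD v.
    exists (fun x => (-1) * (((f' x)^-1 * (f' x)^-1) * df x)).
      apply: SCmul; first exact/SCbase/rV_smooth_cst.
      by apply: SCmul => //; apply: SCmul; exact: SCinv.
    move=> x Ox; have [_ fd] := fcd x Ox.
    rewrite (deriveV (f0 x Ox) (fd v)) dfE // mulN1r scaleNr.
    by rewrite -invfM -expr2.
  - have gd x v i : O x -> is_derive x v (fun y => g y 0 i) ('D_v (fun y => g y 0 i) x).
      by move=> Ox; have [_ gcd _] := IH i; have [_ h] := gcd x Ox; apply: derivableP.
    have Fgd x v (Ox : O x) := derive_curve_rV oQ FQ (gQ x Ox) (fun i => gd x v i Ox).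
    split; first exact: SCcomp FQ gQ sg.
      move=> x Ox; split; last by move=> v; have [] := Fgd x v Ox.
      apply: continuous_comp; last by have [] := FQ [::] _ (gQ x Ox).
      apply: continuous_rV => i; have [_ gcd _] := IH i.
      by have [h _] := gcd x Ox; exact: h.
    move=> v; have /choice[dg dgP] i : exists g', smooth_closure g' /\
        forall x, O x -> 'D_v (fun y => g y 0 i) x = g' x.
      by have [_ _ h] := IH i; have [g' ? ?] := h v; exists g'.
    exists (fun x => \sum_i dg i x * ('D_(evec i) F \o g) x).
      apply: SCsum => i; apply: SCmul; first by have [] := dgP i.
      by apply: SCcomp gQ sg => //; exact: rV_smooth_D.
    move=> x Ox; have [_ ->] := Fgd x v Ox.
    by apply: eq_bigr => i _; have [_ ->] := dgP i.
apply: (@rV_smooth_coind n O smooth_closure) => //.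
  by move=> f' sf; have [] := key f' sf.
by move=> f' v sf; have [_ _] := key f' sf; apply.
Qed.

Lemma rV_smoothD f g : rV_smooth_on O f -> rV_smooth_on O g ->
  rV_smooth_on O (fun x => f x + g x).
Proof. by move=> ? ?; apply/smooth_closure_smooth/SCadd; exact: SCbase. Qed.

Lemma rV_smoothM f g : rV_smooth_on O f -> rV_smooth_on O g ->
  rV_smooth_on O (fun x => f x * g x).
Proof. by move=> ? ?; apply/smooth_closure_smooth/SCmul; exact: SCbase. Qed.

Lemma rV_smoothV f : rV_smooth_on O f -> (forall x, O x -> f x != 0) ->
  rV_smooth_on O (fun x => (f x)^-1).
Proof. by move=> ? ?; apply/smooth_closure_smooth/SCinv => //; exact: SCbase. Qed.

Lemma rV_smooth_comp m Q (F : 'rV[R]_m -> R) (g : 'rV[R]_n -> 'rV[R]_m) :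
  open Q -> rV_smooth_on Q F -> (forall x, O x -> Q (g x)) ->
  (forall i, rV_smooth_on O (fun x => g x 0 i)) -> rV_smooth_on O (F \o g).
Proof.
move=> oQ FQ gQ gO; apply/smooth_closure_smooth/(SCcomp oQ FQ gQ) => i.
exact: SCbase.
Qed.

Lemma rV_smooth_sum (I : Type) (r : seq I) (f : I -> 'rV[R]_n -> R) :
  (forall i, rV_smooth_on O (f i)) ->
  rV_smooth_on O (fun x => \sum_(i <- r) f i x).
Proof. by move=> fO; apply/smooth_closure_smooth/SCsum => i; exact: SCbase. Qed.

Lemma rV_smooth_prod (I : Type) (r : seq I) (f : I -> 'rV[R]_n -> R) :
  (forall i, rV_smooth_on O (f i)) ->
  rV_smooth_on O (fun x => \prod_(i <- r) f i x).
Proof.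
move=> fO; elim: r => [|i r IH].
  under eq_fun do rewrite big_nil; exact: rV_smooth_cst.
by under eq_fun do rewrite big_cons; exact: (rV_smoothM (fO i) IH).
Qed.

Lemma derive_coords F x v : rV_smooth_on O F -> O x ->
  'D_v F x = \sum_i v 0 i * 'D_(evec i) F x.
Proof.
move=> FO Ox; have [_ <-] := @derive_curve_rV n O F _ id x v _ oO FO Ox (fun i => is_derive_coord i x v).
by [].
Qed.

End smooth_on_rV.

End smooth_calculus.

(** * Bump functions, second derivatives and integrals along segments *)

Section continuity_kit.
Variables (R : realType) (T : topologicalType).
Implicit Types (f g : T -> R) (x : T).

Lemma cont_epsP f x : {for x, continuous f} <->
  forall e : R, 0 < e -> \forall y \near x, `|f y - f x| < e.
Proof.
split=> [fc e e0|fc].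
  have /cvgrPdist_lt/(_ _ e0) h := fc.
  by near=> y; rewrite distrC; near: y; exact: h.
apply/cvgrPdist_lt => e e0; near=> y; rewrite distrC; near: y; exact: fc.
Unshelve. all: by end_near. Qed.

Lemma contM f g x : {for x, continuous f} -> {for x, continuous g} ->
  {for x, continuous (fun y => f y * g y)}.
Proof. by move=> fc gc; apply: cvgM; [exact: fc|exact: gc]. Qed.

Lemma contD f g x : {for x, continuous f} -> {for x, continuous g} ->
  {for x, continuous (fun y => f y + g y)}.
Proof. by move=> fc gc; apply: cvgD; [exact: fc|exact: gc]. Qed.

Lemma cont_comp (U W : topologicalType) (h : T -> U) (k : U -> W) x :
  {for x, continuous h} -> {for h x, continuous k} ->
  {for x, continuous (fun y => k (h y))}.
Proof. by move=> hc kc; exact: continuous_comp. Qed.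

Lemma cont_line (V : normedModType R) f (h : T -> V) (a b : V) x :
  {for x, continuous f} -> {for x, continuous h} ->
  {for x, continuous (fun y => f y *: (h y - a) + b)}.
Proof.
move=> fc hc; apply: cvgD; last exact: cvg_cst.
by apply: cvgZ; [exact: fc|apply: cvgB; [exact: hc|exact: cvg_cst]].
Qed.

Lemma cont_sum (I : Type) (r : seq I) (h : I -> T -> R) x :
  (forall i, {for x, continuous (h i)}) ->
  {for x, continuous (fun y => \sum_(i <- r) h i y)}.
Proof. by move=> hc; apply: cvg_sumr => i; exact: hc. Qed.

End continuity_kit.

Section bump.
Variable R : realType.
Implicit Types (p q : {poly R}) (t : R).

Lemma expR_gt_exprn n (y : R) : 0 <= y -> (y / n.+1%:R) ^+ n.+1 <= expR y.
Proof.
move=> y0; have {2}-> : y = (y / n.+1%:R) * n.+1%:R.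
  by rewrite divfK // pnatr_eq0.
rewrite expRM_natr; apply: lerXn2r; rewrite ?nnegrE ?expR_ge0 ?divr_ge0 //.
by apply: le_trans (expR_ge1Dx _); rewrite lerDr.
Qed.

(** The functions p(1/t) exp(-1/t), extended by 0 to t <= 0: they are the
    derivatives of exp(-1/t), and each is flat at 0. *)
Definition flat p t : R := if 0 < t then p.[t^-1] * expR (- t^-1) else 0.

(** Every power of y is dominated by exp y, so the factor exp(-1/t) absorbs the
    powers of 1/t in p(1/t) and leaves two powers of t to spare: enough for the
    derivative at 0. *)
Lemma flat_le p : exists2 C, 0 <= C & forall t, `|flat p t| <= C * t ^+ 2.
Proof.
pose C i : R := i.+2%:R ^+ i.+2.
exists (\sum_(i < size p) `|p`_i| * C i).
  by apply: sumr_ge0 => i _; rewrite mulr_ge0 // exprn_ge0.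
move=> t; rewrite /flat; case: ltP => [t0|t0]; last first.
  rewrite normr0 mulr_ge0 ?sqr_ge0 //.
  by apply: sumr_ge0 => i _; rewrite mulr_ge0 // exprn_ge0.
rewrite horner_coef mulr_suml mulr_suml.
apply: le_trans (ler_norm_sum _ _ _) _; apply: ler_sum => i _.
rewrite -mulrA normrM -mulrA; apply: ler_wpM2l => //.
rewrite ger0_norm ?mulr_ge0 ?exprn_ge0 ?invr_ge0 ?expR_ge0 ?(ltW t0) //.
rewrite expRN ler_pdivrMr ?expR_gt0 //.
have -> : t^-1 ^+ i = C i * t ^+ 2 * (t^-1 / i.+2%:R) ^+ i.+2.
  rewrite expr_div_n /C; set c := _%:R ^+ i.+2.
  have c0 : c != 0 by rewrite expf_neq0 // pnatr_eq0.
  have t0' : t != 0 by rewrite gt_eqF.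
  have -> : t^-1 ^+ i.+2 = t^-1 ^+ i * (t^-1 * t^-1) by rewrite !exprSr mulrA.
  set w := t^-1 ^+ i; field; by rewrite c0 t0'.
apply: ler_wpM2l; last by apply: expR_gt_exprn; rewrite invr_ge0 ltW.
by rewrite mulr_ge0 ?sqr_ge0 // exprn_ge0.
Qed.

Lemma is_derive_inv t : t != 0 -> is_derive t 1 (fun s : R => s^-1) (- (t^-1 ^+ 2)).
Proof.
move=> t0; have d : derivable (@id R) t 1 by exact: derivable_id.
have E := @deriveV R _ id t 1 t0 d.
rewrite derive_id in E; apply: DeriveDef; first exact: (@derivableV R _ id t 1 t0 d).
by rewrite E [_ *: _]mulr1 exprVn.
Qed.

Lemma is_derive_horner p t : is_derive t 1 (horner p) p^`().[t].
Proof.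
rewrite -[_.[t]]/((horner p^`()) t) derivE derive1E.
by apply: derivableP; exact: derivable_horner.
Qed.

(** Away from 0 this is the product rule; at 0 the difference quotient is O(t) by
    flat_le. *)
Lemma is_derive_flat p t : is_derive t 1 (flat p) (flat ('X^2 * (p - p^`())) t).
Proof.
case: (ltgtP t 0) => t0.
- have -> : flat ('X^2 * (p - p^`())) t = 0 by rewrite /flat ltNge ltW.
  have h0 : is_derive t 1 (fun _ : R => 0 : R) 0.
    by apply/is_deriveP; under eq_fun do rewrite subrr mulr0; exact: cvg_cst.
  apply: is_derive_near h0.
  have : \forall s \near t, s < 0 by exact: lt_nbhsl.
  by apply: filterS => s s0; rewrite /flat ltNge ltW.
- apply: (@is_derive_near R _ (fun t => p.[t^-1] * expR (- t^-1))).
    have : \forall s \near t, 0 < s.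
      by apply: open_nbhs_nbhs; split => //; exact: open_gt.
    by apply: filterS => s s0; rewrite /flat s0.
  have inv := is_derive_inv (lt0r_neq0 t0).
  have h1 := is_derive1_comp (is_derive_horner p t^-1) inv.
  have h2 := @is_derive1_comp R expR (fun s => - s^-1) t _ _ (is_derive_expR _) (is_deriveN inv).
  have := is_deriveM h1 h2; rewrite /comp => h3.
  apply: (is_derive_eq h3); rewrite /flat t0 !hornerE.
  rewrite /GRing.scale /=; ring.
- subst t; have -> : flat ('X^2 * (p - p^`())) 0 = 0 by rewrite /flat ltxx.
  have [C C0 pC] := flat_le p; apply/is_deriveP.
  have f0 : flat p 0 = 0 by rewrite /flat ltxx.
  apply/cvgr0Pnorm_lt => e e0.
  have : \forall h \near (0 : R)^', `|h| < e / (C + 1).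
    apply: nbhs_dnbhs; have := @nbhs0_lt R R^o (e / (C + 1)).
    by apply; rewrite divr_gt0 // ltr_wpDl.
  apply: filterS2 (nbhs_dnbhs_neq (0 : R)) => h h0 hC.
  rewrite [_ *: 1]mulr1 addr0 f0 subr0 normrM normfV ltr_pdivrMl ?normr_gt0 //.
  apply: le_lt_trans (pC h) _; rewrite -(real_normK (num_real h)).
  rewrite expr2 mulrA mulrC ltr_pM2l ?normr_gt0 //.
  apply: (@le_lt_trans _ _ ((C + 1) * `|h|)).
    by rewrite ler_wpM2r // lerDl.
  by rewrite mulrC -ltr_pdivlMr // ltr_wpDl.
Qed.

Lemma is_derive_comp1 (V : normedModType R) (f : R -> R) (g : V -> R) x v a b :
  is_derive (g x) 1 f a -> is_derive x v g b -> is_derive x v (f \o g) (a * b).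
Proof.
move=> fa /is_derive_line0 gb; apply/is_derive_line0.
have := @is_derive1_comp R f (fun s => g (s *: v + x)) 0 a b.
by rewrite scale0r add0r; apply.
Qed.

Lemma flat_smooth n (O : set 'rV[R]_n) p (a b : R) i : open O ->
  rV_smooth_on O (fun w => flat p (a * w 0 i + b)).
Proof.
move=> oO; apply: (@rV_smooth_coind R n O (fun f =>
  exists c p, f = fun w => c * flat p (a * w 0 i + b))) => //; last first.
- by exists 1, p; apply/funext => w; rewrite mul1r.
- move=> _ v [c [q ->]].
  exists (fun w => (c * (a * v 0 i)) * flat ('X^2 * (q - q^`())) (a * w 0 i + b)).
    by exists (c * (a * v 0 i)), ('X^2 * (q - q^`())).
  move=> x _.
  have h : is_derive x v (fun w : 'rV[R]_n => a * w 0 i + b) (a * v 0 i + 0).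
    apply: is_deriveD; apply: (@is_deriveZ _ _ _ (fun w : 'rV[R]_n => w 0 i)).
    exact: is_derive_coord.
  have h2 := is_derive_comp1 (is_derive_flat q _) h.
  have [_ ->] := @is_deriveZ _ _ _ _ c x v _ h2.
  by rewrite addr0 /GRing.scale /=; ring.
- move=> _ [c [q ->]] x _.
  have h v : is_derive x v (fun w : 'rV[R]_n => a * w 0 i + b) (a * v 0 i + 0).
    apply: is_deriveD; apply: (@is_deriveZ _ _ _ (fun w : 'rV[R]_n => w 0 i)).
    exact: is_derive_coord.
  split; last first.
    move=> v; have h2 := is_derive_comp1 (is_derive_flat q _) (h v).
    by have [] := @is_deriveZ _ _ _ _ c x v _ h2.
  have c2 : {for x, continuous (fun w : 'rV[R]_n => a * w 0 i + b)}.
    apply: (@rV_smooth_continuous R n setT) => //.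
    apply: rV_smoothD; [exact: openT| |exact/rV_smooth_cst/openT].
    apply: rV_smoothM; [exact: openT|exact/rV_smooth_cst/openT|].
    exact/rV_smooth_coord/openT.
  have c3 : {for a * x 0 i + b, continuous (flat q)}.
    apply: differentiable_continuous; apply/derivable1_diffP.
    by have [] := is_derive_flat q (a * x 0 i + b).
  apply: (@contM R 'rV[R]_n (fun=> c) (fun w => flat q (a * w 0 i + b)) x).
    exact: continuous_cst.
  exact: (cont_comp c2 c3).
Qed.

Definition theta t := flat 1 t.

Lemma theta_gt0 t : 0 < t -> 0 < theta t.
Proof. by move=> t0; rewrite /theta /flat t0 hornerC mul1r expR_gt0. Qed.

Lemma theta0 t : t <= 0 -> theta t = 0.
Proof. by rewrite /theta /flat leNgt => /negbTE ->. Qed.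

Lemma theta_ge0 t : 0 <= theta t.
Proof. by case: (ltP 0 t) => [/theta_gt0/ltW|/theta0 ->]. Qed.

Definition step t := theta t / (theta t + theta (1 - t)).

Lemma step_den t : 0 < theta t + theta (1 - t).
Proof.
case: (ltP 0 t) => [t0|t0]; first exact: ltr_pwDl (theta_gt0 t0) (theta_ge0 _).
by rewrite ltr_wpDl ?theta_ge0 // theta_gt0 // subr_gt0 (le_lt_trans t0).
Qed.

Lemma step0 t : t <= 0 -> step t = 0.
Proof. by move=> t0; rewrite /step theta0 // mul0r. Qed.

Lemma step1 t : 1 <= t -> step t = 1.
Proof.
move=> t1; rewrite /step [theta (1 - t)]theta0 ?subr_le0 // addr0 divff //.
by rewrite gt_eqF // theta_gt0 // (lt_le_trans _ t1).
Qed.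

Lemma step_smooth n (O : set 'rV[R]_n) (a b : R) i : open O ->
  rV_smooth_on O (fun w => step (a * w 0 i + b)).
Proof.
move=> oO; apply: rV_smoothM => //; first exact: flat_smooth.
apply: rV_smoothV => //; last by move=> x _; rewrite gt_eqF // step_den.
apply: rV_smoothD => //; first exact: flat_smooth.
have := @flat_smooth n O 1 (- a) (1 - b) i oO.
congr rV_smooth_on; apply/funext => w; congr theta; ring.
Qed.

(** The product over the coordinates of two smooth steps, which take the values 0
    and 1 outside intervals of length e. *)
Lemma rV_bump n (y : 'rV[R]_n) (e : R) : 0 < e -> exists B : 'rV[R]_n -> R,
  [/\ rV_smooth_on setT B,
      forall w : 'rV[R]_n, (forall i, `|w 0 i - y 0 i| <= e) -> B w = 1 &
      forall w : 'rV[R]_n, (exists i, 2 * e <= `|w 0 i - y 0 i|) -> B w = 0].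
Proof.
move=> e0; pose s (w : 'rV[R]_n) i := (w 0 i - y 0 i) / e.
exists (fun w => \prod_i (step (2 + s w i) * step (2 - s w i))); split.
- apply: rV_smooth_prod; first exact: openT.
  move=> i; apply: rV_smoothM; first exact: openT.
    have := @step_smooth n setT e^-1 (2 - y 0 i / e) i openT.
    by congr rV_smooth_on; apply/funext => w; congr step; rewrite /s; ring.
  have := @step_smooth n setT (- e^-1) (2 + y 0 i / e) i openT.
  by congr rV_smooth_on; apply/funext => w; congr step; rewrite /s; ring.
- move=> w we; apply: big1 => i _.
  have /andP[h1 h2] : - 1 <= s w i <= 1.
    by rewrite -ler_norml /s normrM normfV (gtr0_norm e0) ler_pdivrMr // mul1r we.
  by rewrite !step1 ?mulr1 //; lra.
- move=> w [i wi]; rewrite (bigD1 i) //=.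
  have : 2 <= `|s w i| by rewrite /s normrM normfV (gtr0_norm e0) ler_pdivlMr.
  rewrite ler_normr => /orP[h|h].
    by rewrite [step (2 - _)]step0 ?mulr0 ?mul0r //; lra.
  by rewrite [step (2 + _)]step0 ?mul0r ?mul0r //; lra.
Qed.

End bump.

Section clairaut.
Variables (R : realType) (n : nat) (O : set 'rV[R]_n).
Hypothesis oO : open O.

Let close_neq (a b c : R) : `|a - c| < `|a - b| / 2 -> `|b - c| < `|a - b| / 2 ->
  False.
Proof.
move=> ac bc; have : `|a - b| < `|a - b|.
  rewrite [X in _ < X]splitr -{1}(subrK c a) -addrA.
  by apply: le_lt_trans (ler_normD _ _) _; rewrite ltrD // [X in X < _]distrC.
by rewrite ltxx.
Qed.

(** Two applications of the mean value theorem write the second difference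
    F(x + h v + h w) - F(x + h v) - F(x + h w) + F(x) as h^2 times a mixed
    derivative at a point near x, in either order of v and w. *)
Lemma clairaut (F : 'rV[R]_n -> R) x v w : rV_smooth_on O F -> O x ->
  'D_v ('D_w F) x = 'D_w ('D_v F) x.
Proof.
move=> FO Ox.
(* The left-hand side is symmetric in v1 and w1 up to the order of its terms. *)
have key v1 w1 (A : set 'rV[R]_n) : nbhs x A -> \forall h \near (0 : R)^'+,
   exists2 y, A y & F (h *: w1 + (h *: v1 + x)) - F (h *: v1 + x)
      - F (h *: w1 + x) + F x = h * (h * 'D_w1 ('D_v1 F) y).
  move=> nA; have nOA : nbhs x (O `&` A).
    by apply: filterI => //; exact: open_nbhs_nbhs.
  have /nbhs_ballP[e /= e0 eOA] := nOA.
  have [r r0 rP] : exists2 r : R, 0 < r & forall s t, 0 <= s <= r -> 0 <= t <= r ->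
      (O `&` A) (t *: w1 + (s *: v1 + x)).
    have N0 : 0 < `|v1| + `|w1| + 1 by rewrite ltr_wpDl // addr_ge0.
    exists (e / (`|v1| + `|w1| + 1)); first exact: divr_gt0.
    move=> s t /andP[s0 sr] /andP[t0 tr]; apply: eOA.
    rewrite -ball_normE /ball_ /= addrA opprD addrCA subrr addr0 normrN.
    apply: le_lt_trans (ler_normD _ _) _; rewrite !normrZ !ger0_norm //.
    apply: (@le_lt_trans _ _ (e / (`|v1| + `|w1| + 1) * (`|w1| + `|v1|))).
      by rewrite mulrDr lerD // ler_wpM2r.
    by rewrite mulrAC ltr_pdivrMr // ltr_pM2l // [X in X < _]addrC ltrDl.
  near=> h.
  have h0 : 0 < h by [].
  have hr : h <= r by near: h; exact: nbhs_right_le.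
  have sm s t : 0 <= s <= h -> 0 <= t <= h -> (O `&` A) (t *: w1 + (s *: v1 + x)).
    move=> /andP[? sh] /andP[? th].
    by apply: rP; apply/andP; split => //; apply: le_trans hr.
  pose G y := F (h *: w1 + y) - F y.
  have Gd s : 0 <= s <= h -> is_derive (s *: v1 + x) v1 G
      ('D_v1 F (h *: w1 + (s *: v1 + x)) - 'D_v1 F (s *: v1 + x)).
    move=> sh; apply: is_deriveB.
      apply/is_deriveP; under eq_fun do rewrite addrCA.
      apply/is_deriveP/derivableP; apply: (@rV_smooth_derivable R n O) => //.
      by have [] := sm s h sh; rewrite ?lexx ?andbT // ltW.
    apply: derivableP; apply: (@rV_smooth_derivable R n O) => //.
    by have [] := sm s 0 sh; rewrite ?lexx ?(ltW h0) // scale0r add0r.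
  have [|c c0 GE] := @line_MVT R _ G x v1 h (ltW h0).
    by move=> s /Gd[].
  have [|c' c'0 FE] := @line_MVT R _ ('D_v1 F) (c *: v1 + x) w1 h (ltW h0).
    move=> s sh; apply: (rV_smooth_derivable (O := O)); first exact: rV_smooth_D.
    by have [] := sm c s c0 sh.
  exists (c' *: w1 + (c *: v1 + x)).
    by have [] := sm c c' c0 c'0.
  move: GE; rewrite /G; have [_ ->] := Gd c c0; rewrite FE => <-.
  ring.
pose a : R := 'D_v ('D_w F) x; pose b : R := 'D_w ('D_v F) x.
rewrite -/a -/b; apply/eqP; apply: contrapT => /negP; rewrite -subr_eq0 -normr_gt0.
move=> ab; have e0 : 0 < `|a - b| / 2 by rewrite divr_gt0.
have nb v1 w1 : nbhs x [set y | `|'D_v1 ('D_w1 F) x - 'D_v1 ('D_w1 F) y| < `|a - b| / 2].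
  have cD : {for x, continuous ('D_v1 ('D_w1 F))}.
    by apply: rV_smooth_continuous Ox; do 2! apply: rV_smooth_D; exact: FO.
  by have /cvgrPdist_lt/(_ _ e0) := cD.
have : \forall h \near (0 : R)^'+, False.
  near=> h; have h0 : 0 < h by [].
  have [|y ya yE] := near (key w v _ (nb v w)) h; first by [].
  have [|z za zE] := near (key v w _ (nb w v)) h; first by [].
  have : h * (h * 'D_v ('D_w F) y) = h * (h * 'D_w ('D_v F) z).
    have E : h *: w + (h *: v + x) = h *: v + (h *: w + x) by rewrite addrCA.
    rewrite E in zE; apply: etrans (esym yE) _; apply: etrans _ zE.
    by congr (_ + _); exact: addrAC.
  move=> /(mulfI (lt0r_neq0 h0))/(mulfI (lt0r_neq0 h0)) yz.
  have zb : `|'D_w ('D_v F) x - 'D_w ('D_v F) z| < `|a - b| / 2 := za.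
  rewrite -yz in zb; exact: (close_neq ya zb).
by move=> /(@filter_ex _ _ _) [].
Unshelve. all: by end_near. Qed.

End clairaut.

Section star_integral.
Variables (R : realType) (n : nat).
Implicit Types (F : 'rV[R]_n -> R) (O : set 'rV[R]_n).

Local Notation mu := (@lebesgue_measure R).
Local Notation I01 := `[0 : R, 1]%classic.

Definition star_shaped (x0 : 'rV[R]_n) O :=
  forall y (t : R), O y -> 0 <= t <= 1 -> O (t *: (y - x0) + x0).

Lemma int01_integrable (f : R -> R) : {within I01, continuous f} ->
  mu.-integrable I01 (EFin \o f).
Proof.
by move=> fc; apply: continuous_compact_integrable => //; exact: segment_compact.
Qed.

Lemma int01_cst_le (f : R -> R) e : {within I01, continuous f} ->
  (forall t, 0 <= t <= 1 -> `|f t| <= e) -> `|\int[mu]_(t in I01) f t| <= e.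
Proof.
move=> fc fe; have fi := int01_integrable fc.
have m01 : measurable I01 by exact: measurable_itv.
have := @le_normr_Rintegral _ _ R mu I01 f (measurable_itv _) fi.
have ei : mu.-integrable I01 (EFin \o (fun=> e)).
  by apply: int01_integrable; apply: continuous_subspaceT => x; exact: cst_continuous.
have : \int[mu]_(t in I01) `|f t| <= \int[mu]_(t in I01) e.
  apply: le_Rintegral => //.
    exact: (integrable_norm fi).
move=> h1 h2; apply: (le_trans h2 (le_trans h1 _)); rewrite Rintegral_cst //.
have m1 : @lebesgue_measure R `[0 : R, 1]%classic = 1%:E.
  by rewrite lebesgue_measure_itv /= lte01 oppr0 adde0.
rewrite (_ : fine _ = 1) ?mulr1 //; exact: (congr1 fine m1).
Qed.

Lemma int01_FTC (f f' : R -> R) :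
  (forall t : R, 0 <= t <= 1 -> is_derive t 1 f (f' t)) ->
  {within I01, continuous f'} -> \int[mu]_(t in I01) f' t = f 1 - f 0.
Proof.
move=> fd f'c; rewrite /Rintegral (@continuous_FTC2 _ f' f) //.
- have cf (t : R) : 0 <= t <= 1 -> {for t, continuous f}.
    move=> t01; apply: differentiable_continuous; apply/derivable1_diffP.
    by have [] := fd t t01.
  split.
  + move=> t; rewrite in_itv /= => /andP[t0 t1].
    by have [] := fd t; rewrite ?ltW.
  + apply: cvg_at_right_filter; apply: cf; lra.
  + apply: cvg_at_left_filter; apply: cf; lra.
- move=> t; rewrite in_itv /= => /andP[t0 t1].
  by rewrite derive1E; have [_ ->] := fd t (introT andP (conj (ltW t0) (ltW t1))).
Qed.

Lemma MVT_signed (g g' : R -> R) (h : R) :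
  (forall s : R, `|s| <= `|h| -> is_derive s 1 g (g' s)) ->
  exists2 s, `|s| <= `|h| & g h - g 0 = h * g' s.
Proof.
move=> gd.
have gc (a b : R) : (forall s : R, a <= s <= b -> `|s| <= `|h|) ->
    {within `[a, b], continuous g}.
  move=> ab; apply: derivable_within_continuous => s; rewrite in_itv /= => sab.
  by have [] := gd s (ab s sab).
case: (lerP 0 h) => h0.
  have ab (s : R) : 0 <= s <= h -> `|s| <= `|h|.
    by move=> /andP[s0 sh]; rewrite !ger0_norm.
  have [||s] := @MVT_segment R g g' 0 h h0; last first.
  - by rewrite in_itv /= => sh ->; exists s; [exact: ab|rewrite subr0 mulrC].
  - exact: gc.
  - by move=> s; rewrite in_itv /= => /andP[s0 sh]; apply: gd; apply: ab; rewrite !ltW.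
have ab (s : R) : h <= s <= 0 -> `|s| <= `|h|.
  by move=> /andP[s0 sh]; rewrite !ler0_norm ?lerN2 // ltW.
have [||s] := @MVT_segment R g g' h 0 (ltW h0); last first.
- rewrite in_itv /= => sh E; exists s; first exact: ab.
  by apply: oppr_inj; rewrite opprB E sub0r mulrN mulrC.
- exact: gc.
- by move=> s; rewrite in_itv /= => /andP[s0 sh]; apply: gd; apply: ab; rewrite !ltW.
Qed.

Section star.
Variables (x0 : 'rV[R]_n) (O : set 'rV[R]_n).
Hypotheses (oO : open O) (starO : star_shaped x0 O).

Let c (y : 'rV[R]_n) (t : R) := t *: (y - x0) + x0.

(** The tube lemma, [0, 1] being compact. *)
Lemma star_uniform F y e : (forall x, O x -> {for x, continuous F}) -> O y ->
  0 < e -> \forall y' \near y, forall t, 0 <= t <= 1 ->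
    `|F (c y' t) - F (c y t)| < e.
Proof.
move=> Fc Oy e0.
have /compact_near_coveringP/(_ _ (nbhs y) (fun y' t => `|F (c y' t) - F (c y t)| < e)) :=
  @segment_compact R 0 1.
move=> h; have {}h : \forall y' \near y, `[0, 1] `<=` (fun t => `|F (c y' t) - F (c y t)| < e).
  apply: h => t; rewrite /= in_itv /= => t01.
  have cc : {for (t, y), continuous (fun p : R * 'rV[R]_n => F (c p.2 p.1))}.
    apply: (@cont_comp _ 'rV[R]_n R (fun p : R * 'rV[R]_n => c p.2 p.1)); last first.
      exact: Fc (starO Oy t01).
    by apply: cont_line; [exact: cvg_fst|exact: cvg_snd].
  have e20 : 0 < e / 2 by rewrite divr_gt0.
  have /cont_epsP/(_ _ e20) := cc.
  move=> [[A B] /= [nA nB] AB].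
  exists (A, B) => //= -[t' y'] /= [At' By'].
  have h1 := AB (t', y') (conj At' By').
  have h2 := AB (t', y) (conj At' (nbhs_singleton nB)).
  rewrite -(subrK (F (c y t)) (F (c y' t'))) -addrA [X in _ < X]splitr.
  apply: le_lt_trans (ler_normD _ _) _; apply: ltrD => //.
  by rewrite distrC.
by apply: filterS h => y' hy t t01; apply: hy; rewrite /= in_itv.
Qed.

(** The mean over the segment from x0 to y with weight t ^ k: each derivative in y
    brings out a factor t. *)
Definition star_int k F y : R := \int[mu]_(t in I01) (t ^+ k * F (c y t)).

Lemma star_int_within k F y : (forall x, O x -> {for x, continuous F}) -> O y ->
  {within I01, continuous (fun t => t ^+ k * F (c y t))}.
Proof.
move=> Fc Oy; apply: continuous_in_subspaceT => t; rewrite inE /= in_itv /= => t01.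
suff: {for t, continuous (fun t0 : R => t0 ^+ k * F (c y t0))} by [].
apply: contM; first exact: exprn_continuous.
apply: (@cont_comp _ 'rV[R]_n R (c y)); last exact: Fc (starO Oy t01).
by apply: cont_line; [exact: cvg_id|exact: cvg_cst].
Qed.

Lemma star_intD k F G y : (forall x, O x -> {for x, continuous F}) ->
  (forall x, O x -> {for x, continuous G}) -> O y ->
  star_int k (fun x => F x + G x) y = star_int k F y + star_int k G y.
Proof.
move=> Fc Gc Oy; rewrite /star_int -RintegralD //.
- by congr Rintegral; apply/funext => t; rewrite mulrDr.
- exact/int01_integrable/star_int_within.
- exact/int01_integrable/star_int_within.
Qed.

Lemma star_intZ k a F y : (forall x, O x -> {for x, continuous F}) -> O y ->
  star_int k (fun x => a * F x) y = a * star_int k F y.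
Proof.
move=> Fc Oy; rewrite /star_int -RintegralZl //.
  by congr Rintegral; apply/funext => t; rewrite mulrCA.
exact/int01_integrable/star_int_within.
Qed.

Lemma star_int_sum k (I : Type) (r : seq I) (a : I -> R) (F : I -> 'rV[R]_n -> R) y :
  (forall i x, O x -> {for x, continuous (F i)}) -> O y ->
  star_int k (fun x => \sum_(i <- r) a i * F i x) y =
  \sum_(i <- r) a i * star_int k (F i) y.
Proof.
move=> Fc Oy; elim: r => [|i r IH].
  rewrite big_nil /star_int (_ : (fun t => _) = (fun=> 0)) ?Rintegral_cst ?mul0r //.
  by apply/funext => t; rewrite big_nil mulr0.
rewrite big_cons -IH -star_intZ //; last exact: Fc.
rewrite -star_intD //.
- by congr star_int; apply/funext => x; rewrite big_cons.
- move=> x Ox; apply: contM; [exact: continuous_cst|exact: Fc].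
- move=> x Ox; apply: cont_sum => j; apply: contM; [exact: continuous_cst|exact: Fc].
Qed.

Lemma star_int_continuous k F y : (forall x, O x -> {for x, continuous F}) ->
  O y -> {for y, continuous (star_int k F)}.
Proof.
move=> Fc Oy; apply/cont_epsP => e e0.
have e20 : 0 < e / 2 by rewrite divr_gt0.
apply: filterS2 (open_nbhs_nbhs (conj oO Oy)) (star_uniform Fc Oy e20) => y' Oy' h.
rewrite /star_int -RintegralB //; try exact/int01_integrable/star_int_within.
apply: (@le_lt_trans _ _ (e / 2)); last by rewrite ltr_pdivrMr // ltr_pMr // ltr1n.
apply: int01_cst_le.
  by move=> t; apply: cvgB; exact: star_int_within.
move=> t t01; rewrite -mulrBr normrM; have /andP[t0 t1] := t01.
rewrite -[X in _ <= X]mul1r; apply: ler_pM => //; last exact/ltW/h.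
by rewrite ger0_norm ?exprn_ge0 // exprn_ile1.
Qed.

(** Differentiation under the integral sign: by the mean value theorem the
    difference quotients of F(x0 + t (y - x0)) are derivatives at nearby points,
    and these converge uniformly in t. *)
Lemma is_derive_star_int k F y v : rV_smooth_on O F -> O y ->
  is_derive y v (star_int k F) (star_int k.+1 ('D_v F) y).
Proof.
move=> FO Oy.
have Fc x : O x -> {for x, continuous F} by exact: rV_smooth_continuous.
have DFc x : O x -> {for x, continuous ('D_v F)}.
  by apply: rV_smooth_continuous; exact: rV_smooth_D.
apply/is_deriveP/cvgrPdist_lt => e e0.
have e20 : 0 < e / 2 by rewrite divr_gt0.
have nb := @filterI _ (nbhs y) (nbhs_filter y) _ _ (open_nbhs_nbhs (conj oO Oy)) (star_uniform DFc Oy e20).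
have /nbhs_ballP[r /= r0 rP] := nb.
have N0 : 0 < `|v| + 1 by rewrite ltr_wpDl.
have seg (s : R) : `|s| < r / (`|v| + 1) -> O (s *: v + y) /\
    forall t, 0 <= t <= 1 -> `|'D_v F (c (s *: v + y) t) - 'D_v F (c y t)| < e / 2.
  move=> sr; apply: rP; rewrite -ball_normE /ball_ /= opprD addrCA subrr addr0.
  rewrite normrN normrZ; apply: (@le_lt_trans _ _ (`|s| * (`|v| + 1))).
    by rewrite ler_wpM2l // lerDl.
  by rewrite -ltr_pdivlMr.
have : \forall h \near (0 : R)^', `|h| < r / (`|v| + 1).
  by apply: nbhs_dnbhs; apply: (@nbhs0_lt R R^o); rewrite divr_gt0.
apply: filterS2 (nbhs_dnbhs_neq (0 : R)) => h h0 hr.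
have [Ohy _] := seg h hr.
have i1 := @star_int_within k _ _ Fc Ohy; have i2 := @star_int_within k _ _ Fc Oy.
have i3 := @star_int_within k.+1 _ _ DFc Oy.
pose d t := t ^+ k.+1 * 'D_v F (c y t)
  - h^-1 * (t ^+ k * F (c (h *: v + y) t) - t ^+ k * F (c y t)).
have i12 : {within I01, continuous (fun t => t ^+ k * F (c (h *: v + y) t) - t ^+ k * F (c y t))}.
  by move=> t; apply: cvgB; [exact: i1|exact: i2].
have i12h : {within I01, continuous (fun t => h^-1 * (t ^+ k * F (c (h *: v + y) t) - t ^+ k * F (c y t)))}.
  by move=> t; apply: cvgM; [exact: cvg_cst|exact: i12].
have ic : {within I01, continuous d}.
  by move=> t; apply: cvgB; [exact: i3|exact: i12h].
have -> : star_int k.+1 ('D_v F) y - h^-1 * (star_int k F (h *: v + y) - star_int k F y)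
    = \int[mu]_(t in I01) d t.
  rewrite /d RintegralB //; try exact: int01_integrable.
  rewrite RintegralZl //; last exact: int01_integrable.
  by rewrite RintegralB //; exact: int01_integrable.
apply: (@le_lt_trans _ _ (e / 2)); last by rewrite ltr_pdivrMr // ltr_pMr // ltr1n.
apply: int01_cst_le => // t t01; have /andP[t0 t1] := t01.
have cE s : c (s *: v + y) t = (t * s) *: v + c y t.
  by rewrite /c -addrA scalerDr scalerA -addrA.
have [s sh FE] : exists2 s, `|s| <= `|h| &
    F (c (h *: v + y) t) - F (c y t) = (t * h) * 'D_v F (c (s *: v + y) t).
  pose g s := F (c (s *: v + y) t).
  have gd (s : R) : `|s| <= `|h| -> is_derive s 1 g (t * 'D_v F (c (s *: v + y) t)).
    move=> sh; have [Os _] := seg s (le_lt_trans sh hr).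
    rewrite /g; under eq_fun do rewrite cE mulrC -scalerA.
    apply: (is_derive_line F (c y t) (t *: v) s _).1; apply: is_deriveZdir.
    rewrite scalerA mulrC -cE; apply: derivableP.
    exact: (@rV_smooth_derivable R n O F _ v FO (starO Os t01)).
  by have [s sh gE] := MVT_signed gd; exists s => //; rewrite -/(g h) -[X in _ - X]/(F _) -[X in F (c X t)](add0r y) -(scale0r v) -/(g 0) gE mulrCA mulrA.
have [_ Ds] := seg s (le_lt_trans sh hr); rewrite /d -mulrBr FE.
rewrite (_ : _ - _ = t ^+ k.+1 * ('D_v F (c y t) - 'D_v F (c (s *: v + y) t))).
  rewrite normrM -[X in _ <= X]mul1r; apply: ler_pM => //.
    by rewrite ger0_norm ?exprn_ge0 // exprn_ile1.
  by rewrite distrC; apply/ltW/Ds.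
rewrite exprS; field; exact: h0.
Qed.

Lemma star_int_smooth k F : rV_smooth_on O F -> rV_smooth_on O (star_int k F).
Proof.
move=> FO; apply: (@rV_smooth_coind R n O (fun f =>
  exists k F, rV_smooth_on O F /\ f = star_int k F)) => //.
- move=> _ [j [G [GO ->]]] x Ox; split.
    by apply: star_int_continuous => // y; exact: rV_smooth_continuous.
  by move=> v; have [] := is_derive_star_int j v GO Ox.
- move=> _ v [j [G [GO ->]]]; exists (star_int j.+1 ('D_v G)).
    by exists j.+1, ('D_v G); split; [exact: rV_smooth_D|].
  by move=> x Ox; have [_ ->] := is_derive_star_int j v GO Ox.
- by exists k, F.
Qed.

(** Integrate the derivative of t ^ p F(x0 + t (y - x0)) over [0, 1]; the factor
    0 ^+ p is the value of t ^ p at the lower end, which is 1 when p = 0. *)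
Lemma star_FTC p F y : rV_smooth_on O F -> O y ->
  p%:R * star_int p.-1 F y + star_int p ('D_(y - x0) F) y =
  F y - 0 ^+ p * F x0.
Proof.
move=> FO Oy; set w := y - x0.
have Fc x : O x -> {for x, continuous F} by exact: rV_smooth_continuous.
have DFc x : O x -> {for x, continuous ('D_w F)}.
  by apply: rV_smooth_continuous; exact: rV_smooth_D.
have i1 := @star_int_within p.-1 _ _ Fc Oy; have i2 := @star_int_within p _ _ DFc Oy.
have i1p : {within I01, continuous (fun t => p%:R * (t ^+ p.-1 * F (c y t)))}.
  by move=> t; apply: cvgM; [exact: cvg_cst|exact: i1].
rewrite /star_int -RintegralZl //; last exact: int01_integrable.
rewrite -RintegralD //; try exact: int01_integrable.
have sum_c : {within I01, continuous (fun t => p%:R * (t ^+ p.-1 * F (c y t)) + t ^+ p * 'D_w F (c y t))}.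
  by move=> t; apply: cvgD; [exact: i1p|exact: i2].
rewrite (@int01_FTC (fun t => t ^+ p * F (c y t)) _ _ sum_c).
  by rewrite /c expr1n mul1r scale1r subrK scale0r add0r.
move=> t t01.
have h1 : is_derive t 1 (fun t => F (c y t)) ('D_w F (c y t)).
  apply: (is_derive_line F x0 w t _).1; apply: derivableP.
  exact: (@rV_smooth_derivable R n O F _ w FO (starO Oy t01)).
have h2 : is_derive t 1 (fun t : R => t ^+ p) (p%:R * t ^+ p.-1).
  by apply: DeriveDef; [exact: exprn_derivable|rewrite exp_derive [_ *: _]mulr1].
apply: (is_derive_eq (is_deriveM h2 h1)); rewrite /GRing.scale /=; ring.
Qed.

End star.

End star_integral.

(** * Complexes of fine sheaves *)

Lemma dep_choice (I : Type) (V : I -> Type) (P : forall i, V i -> Prop) :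
  (forall i, exists v, P i v) -> exists f : forall i, V i, forall i, P i (f i).
Proof.
move=> h; exists (fun i => projT1 (cid (h i))) => i; exact: projT2 (cid (h i)).
Qed.

Section topology.
Variables (T : topologicalType).

(** Second countability of the subspace W, in terms of open sets of T. *)
Definition countable_base (W : set T) := exists b : nat -> set T,
  (forall i, open (b i)) /\
  forall (O : set T) x, open O -> O x -> W x -> exists2 i, b i x & b i `<=` O.

(** For each basic open set choose a member of C whose interior contains it, if
    there is one. *)
Lemma countable_base_lindelof (C : set (set T)) (W : set T) : countable_base W ->
  (forall x, W x -> exists2 U, C U & (interior U) x) ->
  (exists U, C U) ->
  exists U : nat -> set T, (forall i, C (U i)) /\
    forall x, W x -> exists i, (interior (U i)) x.
Proof.
move=> [b [ob bP]] WC [U0 CU0].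
have /choice[U UP] i : exists U, C U /\
    ((exists2 U', C U' & b i `<=` interior U') -> b i `<=` interior U).
  have [[U' CU' bU']|nU] := pselect (exists2 U', C U' & b i `<=` interior U').
    by exists U'.
  by exists U0.
exists U; split; first by move=> i; have [] := UP i.
move=> x Wx; have [U' CU' U'x] := WC x Wx.
have [i bix biU'] := bP _ x (@open_interior _ U') U'x Wx.
by exists i; have [_ h] := UP i; apply: h => //; exists U'.
Qed.

End topology.

(** A complex of sheaves of modules over T, presented by global families of germs:
    zero_on W a says that a vanishes on W, and dif W a b that a and b are sections
    on W and b is the differential of a.  Only the values over W matter, which
    replaces restriction maps.  Multiplication by the functions in S, used to cut
    off sections, makes the sheaves fine: r a only has to have a differential where
    a has one, and is not related to it by a Leibniz rule. *)
Record scomplex (K : fieldType) (R : realType) (T : topologicalType)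
    (S : set (T -> R)) := SComplex {
  car : nat -> lmodType K;
  zero_on : forall n, set T -> car n -> Prop;
  dif : forall n, set T -> car n -> car n.+1 -> Prop;
  smul : forall n, (T -> R) -> car n -> car n;
  zero_on0 : forall n W, @zero_on n W 0;
  zero_onL : forall n W k a b, @zero_on n W a -> @zero_on n W b ->
    @zero_on n W (k *: a + b);
  zero_on_pt : forall n W a, @zero_on n W a <->
    forall x, W x -> @zero_on n [set x] a;
  zero_on_glue : forall n (I : Type) (W : I -> set T) (a : I -> car n),
    (forall i, open (W i)) ->
    (forall i j, @zero_on n (W i `&` W j) (a i - a j)) ->
    exists b, forall i, @zero_on n (W i) (b - a i);
  dif00 : forall n W, @dif n W 0 0;
  difL : forall n W k a a' b b', @dif n W a a' -> @dif n W b b' ->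
    @dif n W (k *: a + b) (k *: a' + b');
  dif_local : forall n W a b, open W -> @dif n W a b <->
    forall x, W x -> exists V a' b', [/\ open V, V x, @dif n V a' b',
      @zero_on n V (a - a') & @zero_on n.+1 V (b - b')];
  dif_zero : forall n W a b, open W -> @dif n W a b -> @zero_on n W a ->
    @zero_on n.+1 W b;
  dif_dif : forall n W a b, open W -> @dif n W a b -> @dif n.+1 W b 0;
  smul_dif : forall n W r a b, open W -> S r -> @dif n W a b ->
    exists b', @dif n W (smul r a) b';
  smul_1 : forall n W r a, (forall x, W x -> r x = 1) ->
    @zero_on n W (smul r a - a);
  smul_0 : forall n W r a, (forall x, W x -> r x = 0) ->
    @zero_on n W (smul r a) }.

Arguments scomplex K {R T} S.
Arguments zero_on {K R T S} A {n} W a : rename.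
Arguments dif {K R T S} A {n} W a b : rename.
Arguments smul {K R T S} A {n} r a : rename.

Section scomplex_theory.
Variables (K : fieldType) (R : realType) (T : topologicalType) (S : set (T -> R)).
Variable A : scomplex K S.
Implicit Types (W V U : set T).

Lemma zero_onS n W V (a : car A n) : V `<=` W -> zero_on A W a -> zero_on A V a.
Proof. by move=> VW /zero_on_pt aW; apply/zero_on_pt => x /VW; exact: aW. Qed.

Lemma zero_on_local n W (a : car A n) :
  (forall x, W x -> exists2 V : set T, V x & zero_on A V a) -> zero_on A W a.
Proof.
move=> h; apply/zero_on_pt => x /h[V Vx]; apply: zero_onS.
by move=> y ->.
Qed.

Lemma zero_onB n W (a b : car A n) : zero_on A W a -> zero_on A W b ->
  zero_on A W (a - b).
Proof.
by move=> aW bW; have := zero_onL (-1) bW aW; rewrite scaleN1r addrC.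
Qed.

Lemma zero_onN n W (a : car A n) : zero_on A W a -> zero_on A W (- a).
Proof. by move=> aW; rewrite -[- a]add0r; exact/zero_onB/aW/zero_on0. Qed.

Lemma zero_onD n W (a b : car A n) : zero_on A W a -> zero_on A W b ->
  zero_on A W (a + b).
Proof. by move=> aW /zero_onN/(zero_onB aW); rewrite opprK. Qed.

Lemma zero_on_sub n W (a b : car A n) : zero_on A W (a - b) -> zero_on A W b ->
  zero_on A W a.
Proof. by move=> ab bW; rewrite -(subrK b a); exact: zero_onD. Qed.

Lemma dif_local_eq n W (a a' : car A n) c c' : open W -> dif A W a' c' ->
  zero_on A W (a - a') -> zero_on A W (c - c') -> dif A W a c.
Proof. by move=> oW h ha hc; apply/dif_local => // x Wx; exists W, a', c'. Qed.

Lemma difS n W V (a : car A n) b : open W -> open V -> V `<=` W ->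
  dif A W a b -> dif A V a b.
Proof.
move=> oW oV VW ab; apply/dif_local => // x /VW Wx.
by exists W, a, b; split => //; rewrite subrr; exact: zero_on0.
Qed.

Lemma difB n W (a b : car A n) a' b' : dif A W a a' -> dif A W b b' ->
  dif A W (a - b) (a' - b').
Proof.
by move=> ha hb; have := difL (-1) hb ha; rewrite !scaleN1r addrC [- b' + _]addrC.
Qed.

Lemma difD n W (a b : car A n) a' b' : dif A W a a' -> dif A W b b' ->
  dif A W (a + b) (a' + b').
Proof. by move=> ha hb; have := difL 1 ha hb; rewrite !scale1r. Qed.

Lemma dif_set0 n (a : car A n) b : dif A set0 a b.
Proof. by apply/dif_local => //; exact: open0. Qed.

Lemma difU n W V (a : car A n) b : open W -> open V -> dif A W a b ->
  dif A V a b -> dif A (W `|` V) a b.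
Proof.
move=> oW oV hW hV; apply/dif_local; first exact: openU.
move=> x [Wx|Vx]; [exists W, a, b|exists V, a, b]; split=> //;
  by rewrite subrr; exact: zero_on0.
Qed.

(** In degree 0 there is nothing to integrate to: exactness means that the
    differential is injective. *)
Definition exact_on n U : Prop :=
  match n return Prop with
  | 0 => forall a : car A 0, dif A U a 0 -> zero_on A U a
  | m.+1 => forall a : car A m.+1, dif A U a 0 -> exists a', dif A U a' a
  end.

(** Normality, witnessed by a function of S. *)
Definition separated (C V : set T) := exists r, S r /\ exists V' V'',
  [/\ open V' /\ open V'', C `<=` V', ~` V `<=` V'',
      forall x, V' x -> r x = 1 & forall x, V'' x -> r x = 0].

Definition normal_for := forall C V, closed C -> open V -> C `<=` V ->
  separated C V.

(** The Lindelof property together with a shrinking of the cover; P set0 provides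
    members when W is empty. *)
Definition shrinkable := forall W (P : set (set T)), open W ->
  (forall x, W x -> exists U, [/\ open U, U x, U `<=` W & P U]) -> P set0 ->
  exists U C : nat -> set T,
    (forall i, [/\ open (U i), closed (C i), C i `<=` U i, U i `<=` W & P (U i)]) /\
    forall x, W x -> exists i, (interior (C i)) x.

Section gluing.
Hypotheses (nT : normal_for) (shT : shrinkable).

(** A section killed by the differential on V and U can be prolonged to U from
    a neighbourhood of C, when exactness in its degree writes it as d w: cut
    off w. *)
Lemma cutoff n C V U (e : car A n) : (forall W, open W -> exact_on n W) ->
  closed C -> open V -> C `<=` V -> open U -> dif A (V `&` U) e 0 ->
  exists V' e', [/\ open V', C `<=` V', V' `<=` V, dif A U e' 0 &
    zero_on A (V' `&` U) (e' - e)].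
Proof.
move=> ex cC oV CV oU de.
have oVU : open (V `&` U) by exact: openI.
case: n e ex de => [|m] e ex de.
  exists V, 0; split=> //; first exact: dif00.
  by rewrite sub0r; apply: zero_onN; exact: (ex _ oVU).
have [w dw] := ex _ oVU e de.
have [r [Sr [V1 [V0 [[oV1 oV0] CV1 VV0 r1 r0]]]]] := nT cC oV CV.
have [e1 de1] := smul_dif oVU Sr dw.
have oV0U : open (V0 `&` U) by exact: openI.
have z0 : zero_on A (V0 `&` U) (smul A r w).
  by apply: smul_0 => x [V0x _]; exact: r0.
pose Wd (b : bool) := if b then V `&` U else V0 `&` U.
pose ed (b : bool) := if b then e1 else 0.
have oWd b : open (Wd b) by case: b.
have [e' e'P] : exists e', forall b, zero_on A (Wd b) (e' - ed b).
  have zz : zero_on A ((V `&` U) `&` (V0 `&` U)) e1.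
    have oo : open ((V `&` U) `&` (V0 `&` U)) by exact: openI.
    apply: (dif_zero oo (a := smul A r w)).
      by apply: difS de1 => // x [].
    by apply: zero_onS z0 => x [].
  apply: zero_on_glue => //; case; case; rewrite /= ?subrr ?subr0 ?sub0r //.
  - exact: zero_on0.
  - by rewrite setIC; exact: zero_onN.
  - exact: zero_on0.
have dwe : dif A U (smul A r w) e'.
  apply/dif_local => // x Ux; have [Vx|nVx] := pselect (V x).
    exists (V `&` U), (smul A r w), e1; split=> //; last exact: (e'P true).
    by rewrite subrr; exact: zero_on0.
  exists (V0 `&` U), 0, 0; split=> //.
  - by split=> //; exact: VV0.
  - exact: dif00.
  - by rewrite subr0.
  - exact: (e'P false).
exists (V1 `&` V), e'; split.
- exact: openI.
- by move=> x Cx; split; [exact: CV1|exact: CV].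
- by move=> x [].
- exact: dif_dif dwe.
- have oo : open (V1 `&` V `&` U) by apply: openI => //; exact: openI.
  apply: (dif_zero oo (a := smul A r w - w)).
    apply: difB; first by apply: difS dwe => // x [].
    by apply: difS dw => // x [[]].
  by apply: smul_1 => x [[V1x _] _]; exact: r1.
Qed.

(** On the overlap y - y' is killed by the differential; correct y' by a
    prolongation of it. *)
Lemma extend_solution n C V U (y y' : car A n) z :
  (forall W, open W -> exact_on n W) ->
  closed C -> open V -> C `<=` V -> open U -> dif A V y z -> dif A U y' z ->
  exists V' y'', [/\ open V', C `<=` V', dif A (V' `|` U) y'' z &
    zero_on A V' (y'' - y)].
Proof.
move=> ex cC oV CV oU dy dy'.
have oVU : open (V `&` U) by exact: openI.
have de : dif A (V `&` U) (y - y') 0.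
  rewrite -(subrr z); apply: difB; first by apply: difS dy => // x [].
  by apply: difS dy' => // x [].
have [V' [e [oV' CV' V'V dU ze]]] := cutoff ex cC oV CV oU de.
have dU' : dif A U (y' + e) z by rewrite -[z]addr0; exact: difD.
pose Wd (b : bool) := if b then V' else U.
pose ed (b : bool) := if b then y else y' + e.
have oWd b : open (Wd b) by case: b.
have [y'' yP] : exists e', forall b, zero_on A (Wd b) (e' - ed b).
  apply: zero_on_glue => //.
  have h : zero_on A (V' `&` U) (y - (y' + e)).
    by move/zero_onN: ze; rewrite opprB opprD addrA.
  case; case; rewrite /= ?subrr //; try exact: zero_on0.
  by rewrite setIC -opprB; exact: zero_onN.
exists V', y''; split=> //; last exact: (yP true).
apply: difU => //.
  apply: (dif_local_eq oV' (difS oV oV' V'V dy)); first exact: (yP true).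
  by rewrite subrr; exact: zero_on0.
apply: (dif_local_eq oU dU'); first exact: (yP false).
by rewrite subrr; exact: zero_on0.
Qed.

(** Solve on the members of a countable cover and glue the solutions one after the
    other: step k changes the solution only outside the interior of the union of
    the first k shrunken members, so that the sequence is stationary near every
    point. *)
Lemma exact_glue n W : open W -> (forall V, open V -> exact_on n V) ->
  (forall x, W x -> exists U, [/\ open U, U x, U `<=` W & exact_on n.+1 U]) ->
  exact_on n.+1 W.
Proof.
move=> oW ex loc z dz.
have ex0 : exact_on n.+1 set0 by move=> a _; exists 0; exact: dif_set0.
have [U [C [UC CW]]] := shT oW loc ex0.
have /choice[y' y'P] i : exists y', dif A (U i) y' z.
  by have [oU _ _ UW exU] := UC i; apply: exU; exact: difS dz.
pose Ck k := \big[setU/set0]_(i < k) C i.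
have cCk k : closed (Ck k).
  by apply: closed_bigsetU => i _; have [] := UC i.
pose St := (set T * car A n)%type.
(* A state is an open set together with a solution on it. *)
pose Inv k (s : St) := [/\ open s.1, Ck k `<=` s.1 & dif A s.1 s.2 z].
have step (ks : nat * St) : exists s' : St, Inv ks.1 ks.2 ->
    Inv ks.1.+1 s' /\ zero_on A (interior (Ck ks.1)) (s'.2 - ks.2.2).
  case: ks => k [V y] /=.
  have [[oV CV dV]|nI] := pselect (Inv k (V, y)); last by exists (V, y).
  have [oU cC CU _ _] := UC k.
  have [V' [y'' [oV' CV' d'' z'']]] :=
    extend_solution ex (cCk k) oV CV oU dV (y'P k).
  exists (V' `|` U k, y'') => _; split; last first.
    by apply: zero_onS z'' => x /interior_subset; exact: CV'.
  split=> //=; first exact: openU.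
  rewrite /Ck big_ord_recr /= => x [Cx|/CU]; [left; exact: CV'|by right].
have [nx nxP] := choice step.
pose sq := fix sq k : St := if k is k'.+1 then nx (k', sq k') else (set0, 0).
have sqI k : Inv k (sq k).
  elim: k => [|k IH]; last by have [] := nxP (k, sq k) IH.
  split=> //=; [exact: open0|by rewrite /Ck big_ord0|exact: dif_set0].
have Cmono k l : (k <= l)%N -> Ck k `<=` Ck l.
  move=> kl x; rewrite /Ck -!bigcup_mkord => -[i ik Cx].
  by exists i => //=; exact: leq_trans kl.
have oI k : open (interior (Ck k)) by exact: open_interior.
have sqE k l : (k <= l)%N -> zero_on A (interior (Ck k)) ((sq l).2 - (sq k).2).
  elim: l => [|l IH]; first by rewrite leqn0 => /eqP->; rewrite subrr; exact: zero_on0.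
  rewrite leq_eqVlt => /orP[/eqP->|]; first by rewrite subrr; exact: zero_on0.
  rewrite ltnS => kl; rewrite -(subrK (sq l).2 (sq l.+1).2) -addrA.
  apply: zero_onD; last exact: IH.
  have [_ h] := nxP (l, sq l) (sqI l); apply: zero_onS h.
  exact/interiorS/Cmono.
have [y yP] : exists y, forall k, zero_on A (interior (Ck k)) (y - (sq k).2).
  apply: zero_on_glue => // k l; case: (leqP k l) => [kl|/ltnW lk].
    rewrite -opprB; by apply: zero_onN; apply: zero_onS (sqE k l kl) => x [].
  by apply: zero_onS (sqE l k lk) => x [].
exists y; apply/dif_local => // x Wx; have [i Cix] := CW x Wx.
exists (interior (Ck i.+1)), (sq i.+1).2, z; split=> //.
- apply: interiorS Cix => t Ct; rewrite /Ck big_ord_recr; by right.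
- have [ho hs hd] := sqI i.+1; apply: difS hd => // t /interior_subset; exact: hs.
- by rewrite subrr; exact: zero_on0.
Qed.

(** Gluing solutions in degree n + 1 uses exactness in degree n on all open sets,
    whence the induction. *)
Theorem locally_exact_exact :
  (forall n W x, open W -> W x ->
     exists U, [/\ open U, U x, U `<=` W & exact_on n U]) ->
  forall n W, open W -> exact_on n W.
Proof.
move=> loc; elim=> [|n IH] W oW; last by apply: exact_glue => // x; exact: loc.
move=> a da; apply: zero_on_local => x Wx.
have [U [oU Ux UW exU]] := loc 0 W x oW Wx; exists U => //.
by apply: exU; exact: difS da.
Qed.

(** Outside P a primitive y of z is closed.  Prolong its restriction from a
    neighbourhood of the complement of the interior of Q to a closed section, and
    subtract that. *)
Lemma exact_supports n (P Q : set T) z : (forall m W, open W -> exact_on m W) ->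
  closed P -> P `<=` interior Q -> dif A setT (z : car A n.+1) 0 ->
  zero_on A (~` P) z -> exists2 y, dif A setT y z & zero_on A (~` Q) y.
Proof.
move=> ex cP PQ dz zP.
have [y dy] := ex n.+1 setT openT z dz.
have oP : open (~` P) by exact: closed_openC.
have dP : dif A (~` P `&` setT) y 0.
  rewrite setIT; apply: (dif_local_eq oP (difS openT oP (fun _ _ => I) dy)).
    by rewrite subrr; exact: zero_on0.
  by rewrite sub0r; exact: zero_onN.
have [||V' [e [oV' CV' _ de ze]]] := @cutoff n (~` interior Q) _ setT y (ex n) _ oP _ openT dP.
- by apply: open_closedC; exact: open_interior.
- exact: subsetC.
exists (y - e); first by rewrite -[z]subr0; exact: difB.
have : zero_on A (V' `&` setT) (y - e) by rewrite -opprB; exact: zero_onN.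
rewrite setIT; apply: zero_onS => x nQ; apply: CV'.
by apply: contra_not nQ => /interior_subset.
Qed.

End gluing.

End scomplex_theory.

(** The mapping cone of a morphism phi: in degree n it is A_n + B_(n-1), with
    differential (a, b) |-> (da, phi a - db). *)
Section cone.
Variables (K : fieldType) (R : realType) (T : topologicalType) (S : set (T -> R)).
Variables (A B : scomplex K S) (phi : forall n, car A n -> car B n).
Hypothesis phiL : forall n k a b, phi (k *: a + b) = k *: phi a + phi b :> car B n.
Hypothesis phi_zero : forall n W (a : car A n), zero_on A W a ->
  zero_on B W (phi a).
Hypothesis phi_dif : forall n W (a : car A n) a', open W -> dif A W a a' ->
  dif B W (phi a) (phi a').

Let phiB n (a b : car A n) : phi (a - b) = phi a - phi b.
Proof. by rewrite -scaleN1r addrC phiL scaleN1r addrC. Qed.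

Let phi0 n : phi (0 : car A n) = 0.
Proof. by rewrite -(subrr 0) phiB subrr. Qed.

Definition cone_car n : lmodType K :=
  match n with 0 => car A 0 | m.+1 => (car A m.+1 * car B m)%type end.

Definition cone_zero n : set T -> cone_car n -> Prop :=
  match n return set T -> cone_car n -> Prop with
  | 0 => fun W a => zero_on A W a
  | m.+1 => fun W a => zero_on A W a.1 /\ zero_on B W a.2
  end.

Definition cone_dif n : set T -> cone_car n -> cone_car n.+1 -> Prop :=
  match n return set T -> cone_car n -> cone_car n.+1 -> Prop with
  | 0 => fun W a b => dif A W a b.1 /\ zero_on B W (b.2 - phi a)
  | m.+1 => fun W a b => dif A W a.1 b.1 /\ dif B W a.2 (phi a.1 - b.2)
  end.

Definition cone_smul n : (T -> R) -> cone_car n -> cone_car n :=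
  match n return (T -> R) -> cone_car n -> cone_car n with
  | 0 => fun r a => smul A r a
  | m.+1 => fun r a => (smul A r a.1, smul B r a.2)
  end.

Fact cone_zero0 n W : cone_zero W (0 : cone_car n).
Proof. by case: n => [|n]; [|split]; exact: zero_on0. Qed.

Fact cone_zeroL n W k (a b : cone_car n) : cone_zero W a -> cone_zero W b ->
  cone_zero W (k *: a + b).
Proof.
case: n a b => [|n] a b; first exact: zero_onL.
by move=> [? ?] [? ?]; split; exact: zero_onL.
Qed.

Fact cone_zero_pt n W (a : cone_car n) : cone_zero W a <->
  forall x, W x -> cone_zero [set x] a.
Proof.
case: n a => [|n] a; first exact: zero_on_pt.
split=> [[/zero_on_pt h1 /zero_on_pt h2] x Wx|h]; first by split; [exact: h1|exact: h2].
by split; apply/zero_on_pt => x /h[].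
Qed.

Fact cone_zero_glue n (I : Type) (W : I -> set T) (a : I -> cone_car n) :
  (forall i, open (W i)) ->
  (forall i j, cone_zero (W i `&` W j) (a i - a j)) ->
  exists b, forall i, cone_zero (W i) (b - a i).
Proof.
case: n a => [|n] a oW h; first exact: zero_on_glue.
have [b1 h1] := @zero_on_glue _ _ _ _ A _ _ W (fun i => (a i).1) oW (fun i j => (h i j).1).
have [b2 h2] := @zero_on_glue _ _ _ _ B _ _ W (fun i => (a i).2) oW (fun i j => (h i j).2).
by exists (b1, b2) => i; split; [exact: h1|exact: h2].
Qed.

Fact cone_dif00 n W : cone_dif W (0 : cone_car n) 0.
Proof.
case: n => [|n]; split; try exact: dif00.
  by rewrite /= phi0 subr0; exact: zero_on0.
by rewrite /= phi0 subr0; exact: dif00.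
Qed.

Fact cone_difL n W k (a : cone_car n) a' b b' : cone_dif W a a' ->
  cone_dif W b b' -> cone_dif W (k *: a + b) (k *: a' + b').
Proof.
case: n a a' b b' => [|n] a a' b b' [h1 h2] [h3 h4]; split; try exact: difL.
  rewrite /= phiL opprD addrACA -scalerBr; exact: zero_onL.
by rewrite /= phiL opprD addrACA -scalerBr; exact: difL.
Qed.

Fact cone_dif_local n W (a : cone_car n) b : open W -> cone_dif W a b <->
  forall x, W x -> exists V a' b', [/\ open V, V x, cone_dif V a' b',
    cone_zero V (a - a') & cone_zero V (b - b')].
Proof.
move=> oW; split=> [h x Wx|h].
  by exists W, a, b; split=> //; rewrite subrr; exact: cone_zero0.
case: n a b h => [|n] a b h; split.
- apply/dif_local => // x /h[V [a' [b' [oV Vx [h1 h2] h3 [h4 h5]]]]].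
  by exists V, a', b'.1.
- apply: zero_on_local => x /h[V [a' [b' [oV Vx [h1 h2] h3 [h4 h5]]]]].
  exists V => //; rewrite (_ : _ - _ = (b - b').2 + (b'.2 - phi a') - phi (a - a')).
    by apply: zero_onB; [exact: zero_onD|exact: phi_zero].
  rewrite phiB (_ : (b - b').2 = b.2 - b'.2) //.
  by rewrite opprB (addrA (b.2 - b'.2)) subrK addrA subrK.
- apply/dif_local => // x /h[V [a' [b' [oV Vx [h1 h2] [h3 h3'] [h4 h5]]]]].
  by exists V, a'.1, b'.1.
- apply/dif_local => // x /h[V [a' [b' [oV Vx [h1 h2] [h3 h3'] [h4 h5]]]]].
  exists V, a'.2, (phi a'.1 - b'.2); split=> //.
  rewrite (_ : _ - _ = phi (a - a').1 - (b - b').2); last first.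
    by rewrite (_ : (b - b').2 = b.2 - b'.2) // (_ : (a - a').1 = a.1 - a'.1) //
      phiB !opprB addrACA [RHS]addrACA; congr (_ + _); rewrite addrC.
  by apply: zero_onB; [exact: phi_zero|].
Qed.

Fact cone_dif_zero n W (a : cone_car n) b : open W -> cone_dif W a b ->
  cone_zero W a -> cone_zero W b.
Proof.
move=> oW; case: n a b => [|n] a b [h1 h2] h3.
  split; first exact: dif_zero h3.
  by apply: zero_on_sub h2 _; exact: phi_zero.
case: h3 => h3 h4; split; first exact: dif_zero h3.
have h5 := dif_zero oW h2 h4.
rewrite -[b.2](subKr (phi a.1)); apply: zero_onB h5; exact: phi_zero.
Qed.

Fact cone_dif_dif n W (a : cone_car n) b : open W -> cone_dif W a b ->
  cone_dif W b 0.
Proof.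
move=> oW; case: n a b => [|n] a b [h1 h2]; split; try exact: dif_dif h1.
  rewrite /= subr0; apply: (dif_local_eq oW (phi_dif oW h1)) => //.
  by rewrite subrr; exact: zero_on0.
rewrite /= subr0 -[b.2](subKr (phi a.1)) -[phi b.1]subr0.
by apply: difB; [exact: phi_dif|exact: dif_dif h2].
Qed.

Fact cone_smul_dif n W r (a : cone_car n) b : open W -> S r -> cone_dif W a b ->
  exists b', cone_dif W (cone_smul r a) b'.
Proof.
move=> oW Sr; case: n a b => [|n] a b [h1 h2].
  have [b1 hb1] := smul_dif oW Sr h1; exists (b1, phi (smul A r a)); split=> //.
  by rewrite subrr; exact: zero_on0.
have [b1 hb1] := smul_dif oW Sr h1; have [b2 hb2] := smul_dif oW Sr h2.
exists (b1, phi (smul A r a.1) - b2); split=> //.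
by rewrite /= subKr.
Qed.

Fact cone_smul_1 n W r (a : cone_car n) : (forall x, W x -> r x = 1) ->
  cone_zero W (cone_smul r a - a).
Proof. by case: n a => [|n] a h; [|split]; exact: smul_1. Qed.

Fact cone_smul_0 n W r (a : cone_car n) : (forall x, W x -> r x = 0) ->
  cone_zero W (cone_smul r a).
Proof. by case: n a => [|n] a h; [|split]; exact: smul_0. Qed.

Definition cone : scomplex K S :=
  SComplex cone_zero0 cone_zeroL cone_zero_pt cone_zero_glue cone_dif00
    cone_difL cone_dif_local cone_dif_zero cone_dif_dif cone_smul_dif
    cone_smul_1 cone_smul_0.

End cone.

(** The sum of copies of A indexed by I, the i-th shifted up by u i.  In degree n
    a component is indexed by i and by a p with p + u i = n.  The differential
    carries no sign (-1)^(u i), in agreement with d (a /\ b) = da /\ b for closed b. *)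
Section shifted_sum.
Variables (K : fieldType) (R : realType) (T : topologicalType) (S : set (T -> R)).
Variables (A : scomplex K S) (I : Type) (u : I -> nat).

Record shift_index (n : nat) := ShiftIndex {
  shift_i : I; shift_p : nat; shift_eq : (shift_p + u shift_i = n)%N }.

Definition shift_car n : lmodType K :=
  dprod (fun k : shift_index n => car A (shift_p k)).

Definition shift_zero n W (a : shift_car n) := forall k, zero_on A W (a k).

Definition shift_dif n W (a : shift_car n) (b : shift_car n.+1) :=
  (forall i p H H', dif A W (a (@ShiftIndex n i p H)) (b (@ShiftIndex n.+1 i p.+1 H'))) /\
  (forall i H, zero_on A W (b (@ShiftIndex n.+1 i 0 H))).

Definition shift_smul n r (a : shift_car n) : shift_car n :=
  fun k => smul A r (a k).

Fact shift_zero0 n W : shift_zero W (0 : shift_car n).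
Proof. by move=> k; exact: zero_on0. Qed.

Fact shift_zeroL n W k (a b : shift_car n) : shift_zero W a -> shift_zero W b ->
  shift_zero W (k *: a + b).
Proof. by move=> ha hb j; exact: zero_onL. Qed.

Fact shift_zero_pt n W (a : shift_car n) : shift_zero W a <->
  forall x, W x -> shift_zero [set x] a.
Proof.
split=> [h x Wx k|h k]; first by have /zero_on_pt := h k; apply.
by apply/zero_on_pt => x /h.
Qed.

Fact shift_zero_glue n (J : Type) (W : J -> set T) (a : J -> shift_car n) :
  (forall i, open (W i)) ->
  (forall i j, shift_zero (W i `&` W j) (a i - a j)) ->
  exists b, forall i, shift_zero (W i) (b - a i).
Proof.
move=> oW h.
have /dep_choice[b bP] k : exists b, forall i, zero_on A (W i) (b - a i k).
  by apply: (@zero_on_glue _ _ _ _ A) => // i j; exact: h.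
by exists b => i k; exact: bP.
Qed.

Fact shift_dif00 n W : shift_dif W (0 : shift_car n) 0.
Proof. by split=> *; [exact: dif00|exact: zero_on0]. Qed.

Fact shift_difL n W k (a : shift_car n) a' b b' : shift_dif W a a' ->
  shift_dif W b b' -> shift_dif W (k *: a + b) (k *: a' + b').
Proof.
move=> [h1 h2] [h3 h4]; split=> *; first by apply: difL; [exact: h1|exact: h3].
by apply: zero_onL; [exact: h2|exact: h4].
Qed.

Fact shift_dif_local n W (a : shift_car n) b : open W -> shift_dif W a b <->
  forall x, W x -> exists V a' b', [/\ open V, V x, shift_dif V a' b',
    shift_zero V (a - a') & shift_zero V (b - b')].
Proof.
move=> oW; split=> [h x Wx|h].
  by exists W, a, b; split=> //; rewrite subrr; exact: shift_zero0.
split=> [i p H H'|i H].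
  apply/dif_local => // x /h[V [a' [b' [oV Vx [h1 h2] h3 h4]]]].
  exists V, (a' (ShiftIndex H)), (b' (@ShiftIndex n.+1 i p.+1 H')); split=> //.
  exact: (h4 (@ShiftIndex n.+1 i p.+1 H')).
apply: zero_on_local => x /h[V [a' [b' [oV Vx [h1 h2] h3 h4]]]].
exists V => //; apply: zero_on_sub (h2 i H).
exact: (h4 (@ShiftIndex n.+1 i 0 H)).
Qed.

Fact shift_dif_zero n W (a : shift_car n) b : open W -> shift_dif W a b ->
  shift_zero W a -> shift_zero W b.
Proof.
move=> oW [h1 h2] h3 [i [|p] H]; first exact: h2.
have H0 : (p + u i = n)%N by case: H.
by apply: dif_zero (h1 i p H0 H) _ => //; exact: (h3 (ShiftIndex H0)).
Qed.

Fact shift_dif_dif n W (a : shift_car n) b : open W -> shift_dif W a b ->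
  shift_dif W b 0.
Proof.
move=> oW [h1 h2]; split=> [i [|p] H H'|i H]; last exact: zero_on0.
  apply: (dif_local_eq oW (dif00 A 0 W)); rewrite ?subr0; first exact: h2.
  exact: zero_on0.
have H0 : (p + u i = n)%N by case: H.
exact: dif_dif (h1 i p H0 H).
Qed.

Fact shift_smul_dif n W r (a : shift_car n) b : open W -> S r -> shift_dif W a b ->
  exists b', shift_dif W (shift_smul r a) b'.
Proof.
move=> oW Sr [h1 h2].
(* The cast along e : shift_p k = p.+1 states in which degree c lives. *)
have /dep_choice[b' bP] (k : shift_index n.+1) : exists c : car A (shift_p k),
    (forall p (e : shift_p k = p.+1) H,
      dif A W (smul A r (a (@ShiftIndex n (shift_i k) p H)))
        (ecast q (car A q) e c)) /\ (shift_p k = 0%N -> c = 0).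
  case: k => i [|p] H /=; first by exists 0; split.
  have H0 : (p + u i = n)%N by case: H.
  have [c hc] := smul_dif oW Sr (h1 i p H0 H); exists c; split=> // q e H1.
  have pq : p = q by case: e.
  by subst q; rewrite (eq_axiomK e) /= (eq_irrelevance H1 H0).
exists b'; split=> [i p H H'|i H].
  by have [h _] := bP (@ShiftIndex n.+1 i p.+1 H'); exact: (h p erefl H).
by have [_ ->] := bP (@ShiftIndex n.+1 i 0 H) => //; exact: zero_on0.
Qed.

Fact shift_smul_1 n W r (a : shift_car n) : (forall x, W x -> r x = 1) ->
  shift_zero W (shift_smul r a - a).
Proof. by move=> h k; exact: smul_1. Qed.

Fact shift_smul_0 n W r (a : shift_car n) : (forall x, W x -> r x = 0) ->
  shift_zero W (shift_smul r a).
Proof. by move=> h k; exact: smul_0. Qed.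

Definition shifted_sum : scomplex K S :=
  SComplex shift_zero0 shift_zeroL shift_zero_pt shift_zero_glue shift_dif00
    shift_difL shift_dif_local shift_dif_zero shift_dif_dif shift_smul_dif
    shift_smul_1 shift_smul_0.

End shifted_sum.

(** * Charts and tangent vectors *)

Lemma nbhs_forall (T : topologicalType) (I : finType) (x : T) (P : I -> set T) :
  (forall i, nbhs x (P i)) -> nbhs x [set y | forall i, P i y].
Proof. by move=> h; apply: filter_forall. Qed.

Lemma box_open (R : realType) n (w0 : 'rV[R]_n) (e : R) :
  open [set w : 'rV[R]_n | forall i, `|w 0 i - w0 0 i| < e].
Proof.
rewrite openE => w Qw; rewrite /interior.
apply: (@nbhs_forall 'rV[R]_n 'I_n w (fun i w => `|w 0 i - w0 0 i| < e)) => i.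
have cc : {for w, continuous (fun w : 'rV[R]_n => `|w 0 i - w0 0 i|)}.
  apply: (@cont_comp 'rV[R]_n R R (fun w => w 0 i - w0 0 i)).
    by apply: contD; [exact: coord_continuous|exact: continuous_cst].
  exact: norm_continuous.
by have := cc [set t | t < e]; apply; apply: open_nbhs_nbhs; split; [exact: open_lt|exact: Qw].
Qed.

Lemma box_star_shaped (R : realType) n (w0 : 'rV[R]_n) (e : R) :
  star_shaped w0 [set w : 'rV[R]_n | forall i, `|w 0 i - w0 0 i| < e].
Proof.
move=> w t Qw /andP[t0 t1] i; rewrite !mxE addrK normrM ger0_norm //.
by apply: le_lt_trans (Qw i); rewrite ler_piMl.
Qed.

Section charted.
Variables (R : realType) (M : fspace R).
Implicit Types (U V O W : set M) (f g r : M -> R) (x y z : M).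

Definition charted := forall x : M, exists U n (phi : M -> 'rV[R]_n) psi,
  is_chart U phi psi /\ U x.

Section chart.
Variables (U : set M) (n : nat) (phi : M -> 'rV[R]_n) (psi : 'rV[R]_n -> M).
Hypothesis hc : is_chart U phi psi.

Lemma chart_open : open U. Proof. by case: hc => [[]]. Qed.

Lemma chart_openI : open (phi @` U). Proof. by case: hc => [[]]. Qed.

Lemma chartK x : U x -> psi (phi x) = x.
Proof. by case: hc => _ h _ _ _; exact: h. Qed.

Lemma chartV w : (phi @` U) w -> U (psi w) /\ phi (psi w) = w.
Proof. by move=> [x Ux <-]; rewrite chartK. Qed.

Lemma chart_continuous x : U x -> {for x, continuous phi}.
Proof. by case: hc => _ _ h _ _; exact: h. Qed.

Lemma chartV_continuous w : (phi @` U) w -> {for w, continuous psi}.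
Proof. by case: hc => _ _ _ h _; exact: h. Qed.

Lemma chart_imageE V : V `<=` U -> phi @` V = (phi @` U) `&` psi @^-1` V.
Proof.
move=> VU; apply/seteqP; split=> [w [x Vx <-]|w [[x Ux <-]]].
  by split; [exists x => //; exact: VU|rewrite /= chartK //; exact: VU].
by rewrite /= chartK // => Vx; exists x.
Qed.

Lemma chart_image_open V : open V -> V `<=` U -> open (phi @` V).
Proof.
move=> oV VU; rewrite openE => w Vw; rewrite /interior.
have := Vw; rewrite chart_imageE // => -[Uw Vpw].
apply: filterI; first exact: open_nbhs_nbhs (conj chart_openI Uw).
apply: (chartV_continuous Uw); exact: open_nbhs_nbhs (conj oV Vpw).
Qed.

Lemma chart_preim_open (Q : set 'rV[R]_n) : open Q -> open (U `&` phi @^-1` Q).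
Proof.
move=> oQ; rewrite openE => x [Ux Qx]; rewrite /interior.
apply: filterI; first exact: open_nbhs_nbhs (conj chart_open Ux).
apply: (chart_continuous Ux); exact: open_nbhs_nbhs (conj oQ Qx).
Qed.

Lemma chart_preim_image (Q : set 'rV[R]_n) : Q `<=` phi @` U ->
  phi @` (U `&` phi @^-1` Q) = Q.
Proof.
move=> QU; apply/seteqP; split=> [w [x [_ Qx] <-]//|w Qw].
by have [x Ux xw] := QU w Qw; exists x => //; split=> //; rewrite /= xw.
Qed.

Lemma chart_smoothP V f : open V -> V `<=` U ->
  smooth_on V f <-> rV_smooth_on (phi @` V) (f \o psi).
Proof. by case: hc => _ _ _ _; apply. Qed.

Lemma chart_coord i : smooth_on U (fun x => phi x 0 i).
Proof.
apply/chart_smoothP; [exact: chart_open|by []|].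
apply: rV_smooth_ext; [exact: chart_openI| |exact: rV_smooth_coord chart_openI i].
by move=> w /chartV[_] /= ->.
Qed.

Lemma chart_restrict V : open V -> V `<=` U -> is_chart V phi psi.
Proof.
move=> oV VU; split.
- by split=> //; exact: chart_image_open.
- by move=> x /VU; exact: chartK.
- by move=> x /VU; exact: chart_continuous.
- by move=> w Vw; apply: chartV_continuous; move: Vw => [x /VU Ux <-]; exists x.
- move=> V' f oV' V'V; apply: chart_smoothP => //; exact: subset_trans VU.
Qed.

End chart.

Lemma smooth_on_ext O f g : open O -> (forall x, O x -> f x = g x) ->
  smooth_on O f -> smooth_on O g.
Proof.
move=> oO fg fO; apply/smooth_on_local => // x Ox.
by exists O, f; split=> // y /fg.
Qed.

Lemma smooth_on_cover O f : open O ->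
  (forall x, O x -> exists V, [/\ open V, V x & smooth_on V f]) -> smooth_on O f.
Proof.
by move=> oO h; apply/smooth_on_local => // x /h[V [oV Vx fV]]; exists V, f.
Qed.

Hypothesis chM : charted.

Lemma smooth_on_comp_rV n O Q (F : 'rV[R]_n -> R) (g : M -> 'rV[R]_n) :
  open O -> open Q -> rV_smooth_on Q F -> (forall x, O x -> Q (g x)) ->
  (forall i, smooth_on O (fun x => g x 0 i)) -> smooth_on O (F \o g).
Proof.
move=> oO oQ FQ gQ gO; apply: smooth_on_cover => // x Ox.
have [U [m [phi [psi [hc Ux]]]]] := chM x.
have oUO : open (U `&` O) by apply: openI => //; exact: chart_open hc.
exists (U `&` O); split=> //; apply/(chart_smoothP hc) => //.
have oI : open (phi @` (U `&` O)) by apply: (chart_image_open hc) => // y [].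
rewrite (_ : (F \o g) \o psi = F \o (g \o psi)) //.
apply: (rV_smooth_comp oI oQ FQ).
  move=> w [y [Uy Oy] <-] /=; rewrite (chartK hc Uy); exact: gQ.
move=> i; apply/(chart_smoothP hc (V := U `&` O) (fun x => g x 0 i)) => //.
by apply: smooth_onS (gO i) => // y [].
Qed.

Lemma smooth_on_continuous_rV n O (g : M -> 'rV[R]_n) x : open O -> O x ->
  (forall i, smooth_on O (fun x => g x 0 i)) -> {for x, continuous g}.
Proof.
move=> oO Ox gO; apply: continuous_rV => i; exact: smooth_on_continuous (gO i) x Ox.
Qed.

Hypothesis hM : hausdorff_space M.

(** A bump function of the coordinates, extended by 0: it vanishes outside the
    image of a compact box, which is closed as M is a Hausdorff space. *)
Lemma bump_at O x : open O -> O x -> exists r : M -> R, smooth r /\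
  exists V V0, [/\ open V /\ open V0, V x, ~` O `<=` V0,
    forall y, V y -> r y = 1 & forall y, V0 y -> r y = 0].
Proof.
move=> oO Ox; have [U [n [phi [psi [hc Ux]]]]] := chM x.
have oUO : open (U `&` O) by apply: openI => //; exact: chart_open hc.
have UOU : U `&` O `<=` U by move=> y [].
have oI := chart_image_open hc oUO UOU.
have nI : nbhs (phi x) (phi @` (U `&` O)).
  by apply: open_nbhs_nbhs; split=> //; exists x.
have /nbhs_rVP[e e0 eI] := nI.
have e30 : 0 < e / 3 by rewrite divr_gt0.
have [B [sB B1 B0]] := rV_bump (phi x) e30.
(* The bump function vanishes outside this box, whose radius is less than e. *)
pose Bx := [set w : 'rV[R]_n | forall i, `[phi x 0 i - 2 * (e / 3), phi x 0 i + 2 * (e / 3)]%classic (w 0 i)].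
have cBx : compact Bx by apply: (@rV_compact R n (fun i => `[phi x 0 i - 2 * (e / 3), phi x 0 i + 2 * (e / 3)]%classic)) => i; exact: segment_compact.
have BxI : Bx `<=` phi @` (U `&` O).
  move=> w Bw; apply: eI => i; have := Bw i; rewrite /= in_itv /= => /andP[h1 h2].
  by rewrite ltr_norml; apply/andP; split; lra.
have cK : closed (psi @` Bx).
  apply: compact_closed => //; apply: continuous_compact cBx.
  apply: continuous_in_subspaceT => w; rewrite inE => /BxI [y [Uy _] <-].
  by apply: (chartV_continuous hc); exists y.
pose r z := if `[< U z >] then B (phi z) else 0.
have r0 z : ~ (psi @` Bx) z -> r z = 0.
  move=> nz; rewrite /r; case: asboolP => // Uz; apply: B0.
  apply: contrapT => nex; apply: nz; exists (phi z); last exact: (chartK hc).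
  move=> i; rewrite /= in_itv /=.
  have : ~ (2 * (e / 3) <= `|phi z 0 i - phi x 0 i|) by move=> h; apply: nex; exists i.
  by move=> /negP; rewrite -ltNge ltr_norml => /andP[h1 h2]; apply/andP; split; lra.
have oV0 : open (~` (psi @` Bx)) by exact: closed_openC.
exists r; split.
  apply: smooth_on_cover openT _ => z _; have [Uz|nUz] := pselect (U z).
    exists U; split=> //; first exact: chart_open hc.
    apply: (@smooth_on_ext _ (B \o phi)); first exact: chart_open hc.
      by move=> y Uy; rewrite /r /= asboolT.
    apply: smooth_on_comp_rV openT sB _ _; [exact: chart_open hc|by []|].
    exact: chart_coord hc.
  exists (~` (psi @` Bx)); split=> //.
    by move=> [w /BxI[y [Uy _] <-]]; rewrite (chartK hc) // => yz; apply: nUz; rewrite -yz.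
  apply: (@smooth_on_ext _ (fun=> 0)) => //; last exact: smooth_on_cst.
  by move=> y /r0 ->.
pose Q := [set w : 'rV[R]_n | forall i, `|w 0 i - phi x 0 i| < e / 3].
exists (interior (U `&` phi @^-1` Q)), (~` (psi @` Bx)); split=> //.
- by split=> //; exact: open_interior.
- rewrite /interior; apply: filterI; first exact: open_nbhs_nbhs (conj (chart_open hc) Ux).
  by apply: (chart_continuous hc Ux); apply/nbhs_rVP; exists (e / 3).
- move=> z nOz [w /BxI[y [Uy Oy] <-]]; rewrite (chartK hc) // => yz.
  by apply: nOz; rewrite -yz.
- move=> y /interior_subset[Uy Qy]; rewrite /r asboolT //.
  by apply: B1 => i; exact/ltW/Qy.
Qed.

(** The product is smooth on O and vanishes on the neighbourhood V0 of the
    complement. *)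
Lemma smooth_cut O V0 r h : open O -> open V0 -> ~` O `<=` V0 -> smooth r ->
  (forall y, V0 y -> r y = 0) -> smooth_on O h -> smooth (fun y => r y * h y).
Proof.
move=> oO oV0 OV0 sr r0 hO; apply: smooth_on_cover openT _ => z _.
have [Oz|nOz] := pselect (O z).
  exists O; split=> //; apply: smooth_onM => //.
  by apply: smooth_onS sr => //; exact: openT.
exists V0; split=> //; first exact: OV0.
apply: (@smooth_on_ext _ (fun=> 0)) => //; last exact: smooth_on_cst.
by move=> y /r0 ->; rewrite mul0r.
Qed.

Definition smooth_at x f := exists O, [/\ open O, O x & smooth_on O f].

Lemma germ_ext x f : smooth_at x f -> exists2 G, smooth G & \near x, G x = f x.
Proof.
move=> [ O [oO Ox fO]].
have [r [sr [V [V0 [[oV oV0] Vx OV0 r1 r0]]]]] := bump_at oO Ox.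
exists (fun y => r y * f y); first exact: smooth_cut oO oV0 OV0 sr r0 fO.
by apply: filterS (open_nbhs_nbhs (conj oV Vx)) => y /r1 ->; rewrite mul1r.
Qed.

Section derivation.
Variables (x : M) (v : tangent x).

Lemma tapp_lin a f g : smooth f -> smooth g ->
  tapp v (fun y => a * f y + g y) = a * tapp v f + tapp v g.
Proof. by move=> sf sg; have [-> ] := tangentP v. Qed.

Lemma tapp_leibniz f g : smooth f -> smooth g ->
  tapp v (fun y => f y * g y) = tapp v f * g x + f x * tapp v g.
Proof. by move=> sf sg; have [_ ->] := tangentP v. Qed.

Lemma tapp_nsmooth f : ~ smooth f -> tapp v f = 0.
Proof. by have [_ _] := tangentP v; apply. Qed.

(** Apply the Leibniz rule to the product of f - g with a cut-off, which is 0. *)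
Lemma tapp_local f g : smooth f -> smooth g -> (\near x, f x = g x) ->
  tapp v f = tapp v g.
Proof.
move=> sf sg fg; have nfg := nbhs_interior fg.
have oO := @open_interior _ [set y | f y = g y].
have [r [sr [V [V0 [_ Vx OV0 r1 r0]]]]] := bump_at oO (nbhs_singleton nfg).
have sd : smooth (fun y => -1 * g y + f y) by apply: smoothD => //; exact: smoothZ.
have E : (fun y => r y * (-1 * g y + f y)) = (fun=> 0).
  apply/funext => y; have [h|h] := pselect (interior [set y | f y = g y] y).
    by rewrite (interior_subset h) mulN1r addNr mulr0.
  by rewrite r0 ?mul0r //; exact: OV0.
have := tapp_leibniz sr sd; rewrite E tapp0 r1 // mul1r.
rewrite (interior_subset (nbhs_singleton nfg)) mulN1r addNr mulr0 add0r.
by rewrite tapp_lin // mulN1r => /esym/eqP; rewrite addrC subr_eq0 => /eqP.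
Qed.

Lemma tapp_cst a : tapp v (fun=> a) = 0.
Proof.
have c1 := smooth_cst M 1; have c0 := smooth_cst M 0.
have t1 : tapp v (fun=> 1) = 0.
  have := tapp_leibniz c1 c1; rewrite !mul1r mulr1.
  by rewrite -[LHS]addr0 => /addrI.
have -> : (fun _ : M => a) = (fun y => a * (fun=> 1) y + (fun=> 0) y).
  by apply/funext => y; rewrite mulr1 addr0.
by rewrite tapp_lin // t1 tapp0 mulr0 addr0.
Qed.

(** A derivation is applied to germs through any global extension. *)
Definition gtapp f : R :=
  if pselect (exists2 G, smooth G & \near x, G x = f x) is left h
  then tapp v (projT1 (cid2 h)) else 0.

Lemma gtappE f G : smooth G -> (\near x, G x = f x) -> gtapp f = tapp v G.
Proof.
move=> sG Gf; rewrite /gtapp; case: pselect => [h|]; last by case; exists G.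
case: cid2 => G' /= sG' G'f; apply: tapp_local => //.
by apply: filterS2 G'f Gf => y -> ->.
Qed.

Lemma gtapp_smooth f : smooth f -> gtapp f = tapp v f.
Proof. by move=> sf; apply: gtappE => //; exact: nearW. Qed.

Lemma gtapp_near f g : (\near x, f x = g x) -> gtapp f = gtapp g.
Proof.
move=> fg; have [[G sG Gf]|nG] := pselect (exists2 G, smooth G & \near x, G x = f x).
  by rewrite (gtappE sG Gf) (gtappE sG) //; apply: filterS2 fg Gf => y <-.
rewrite /gtapp; case: pselect => // _; case: pselect => // -[G sG Gg]; case: nG.
by exists G => //; apply: filterS2 fg Gg => y ->.
Qed.

Lemma gtappD f g : smooth_at x f -> smooth_at x g ->
  gtapp (fun y => f y + g y) = gtapp f + gtapp g.
Proof.
move=> /germ_ext[F sF Ff] /germ_ext[G sG Gg].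
rewrite (gtappE sF Ff) (gtappE sG Gg) -[in RHS](mul1r (tapp v F)) -tapp_lin //.
apply: gtappE; first by apply: smoothD => //; exact: smoothZ.
by apply: filterS2 Ff Gg => y <- <-; rewrite mul1r.
Qed.

Lemma gtappM f g : smooth_at x f -> smooth_at x g ->
  gtapp (fun y => f y * g y) = gtapp f * g x + f x * gtapp g.
Proof.
move=> /germ_ext[F sF Ff] /germ_ext[G sG Gg].
rewrite (gtappE sF Ff) (gtappE sG Gg) -(nbhs_singleton Ff) -(nbhs_singleton Gg).
rewrite -tapp_leibniz //; apply: gtappE; first exact: smoothM.
by apply: filterS2 Ff Gg => y <- <-.
Qed.

Lemma gtapp_cst a : gtapp (fun=> a) = 0.
Proof. by rewrite gtapp_smooth ?tapp_cst //; exact: smooth_cst. Qed.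

End derivation.

Lemma smooth_atD x f g : smooth_at x f -> smooth_at x g ->
  smooth_at x (fun y => f y + g y).
Proof.
move=> [ O [oO Ox fO]] [P [oP Px gP]]; have oOP := openI oO oP.
exists (O `&` P); split=> //.
by apply: smooth_onD => //; [apply: smooth_onS fO|apply: smooth_onS gP] => // y [].
Qed.

Lemma smooth_atM x f g : smooth_at x f -> smooth_at x g ->
  smooth_at x (fun y => f y * g y).
Proof.
move=> [ O [oO Ox fO]] [P [oP Px gP]]; have oOP := openI oO oP.
exists (O `&` P); split=> //.
by apply: smooth_onM => //; [apply: smooth_onS fO|apply: smooth_onS gP] => // y [].
Qed.

Lemma smooth_at_cst x a : smooth_at x (fun=> a).
Proof. by exists setT; split=> //; [exact: openT|exact: smooth_cst]. Qed.

Lemma smooth_atE x f : smooth f -> smooth_at x f.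
Proof. by move=> sf; exists setT; split=> //; exact: openT. Qed.

Lemma smooth_at_sum x (I : Type) (s : seq I) (f : I -> M -> R) :
  (forall i, smooth_at x (f i)) -> smooth_at x (fun y => \sum_(i <- s) f i y).
Proof.
move=> h; elim: s => [|i s IH].
  by under eq_fun do rewrite big_nil; exact: smooth_at_cst.
by under eq_fun do rewrite big_cons; exact: smooth_atD.
Qed.

Lemma gtapp_sum x (v : tangent x) (I : Type) (s : seq I) (f : I -> M -> R) :
  (forall i, smooth_at x (f i)) ->
  gtapp v (fun y => \sum_(i <- s) f i y) = \sum_(i <- s) gtapp v (f i).
Proof.
move=> h; elim: s => [|i s IH].
  by under eq_fun do rewrite big_nil; rewrite big_nil gtapp_cst.
under eq_fun do rewrite big_cons.
by rewrite big_cons gtappD // ?IH //; exact: smooth_at_sum.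
Qed.

Section chart_tangent.
Variables (U : set M) (n : nat) (phi : M -> 'rV[R]_n) (psi : 'rV[R]_n -> M).
Hypothesis hc : is_chart U phi psi.

Definition dphi x (v : tangent x) : 'rV[R]_n :=
  \row_i gtapp v (fun y => phi y 0 i).

Lemma smooth_at_chart x f : U x -> smooth_at x f -> exists O, [/\ open O, O x,
  O `<=` U, smooth_on O f & rV_smooth_on (phi @` O) (f \o psi)].
Proof.
move=> Ux [ O [oO Ox fO]]; have oUO := openI (chart_open hc) oO.
have h : smooth_on (U `&` O) f by apply: smooth_onS fO => // y [].
exists (U `&` O); split=> //.
by apply/(chart_smoothP hc) => // y [].
Qed.

(** Hadamard's lemma: near x, f - f(x) is the sum of (phi_i - phi_i(x)) G_i with
    smooth functions G_i, the means of the partial derivatives along segments, and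
    a derivation at x only depends on the values G_i(x). *)
Lemma gtapp_chart x (v : tangent x) f : U x -> smooth_at x f ->
  gtapp v f = 'D_(dphi v) (f \o psi) (phi x).
Proof.
move=> Ux sf; have [ O [oO Ox OU fO FO]] := smooth_at_chart Ux sf.
set F := f \o psi in FO *; set w0 := phi x.
have oI := chart_image_open hc oO OU.
have Iw0 : (phi @` O) w0 by exists x.
have /nbhs_rVP[e e0 eI] : nbhs w0 (phi @` O) by exact: open_nbhs_nbhs.
pose Q := [set w : 'rV[R]_n | forall i, `|w 0 i - w0 0 i| < e].
have oQ : open Q by exact: box_open.
have Q0 : Q w0 by move=> i; rewrite subrr normr0.
have stQ : star_shaped w0 Q by exact: box_star_shaped.
have FQ : rV_smooth_on Q F by move=> vs w Qw; apply: FO; exact: eI.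
have DFQ i : rV_smooth_on Q ('D_(evec R i) F) by exact: rV_smooth_D.
pose G i := star_int w0 0 ('D_(evec R i) F).
have GQ i : rV_smooth_on Q (G i) by exact: (star_int_smooth oQ stQ 0 (DFQ i)).
have Fc i w : Q w -> {for w, continuous ('D_(evec R i) F)}.
  by exact: rV_smooth_continuous (DFQ i).
have FE w : Q w -> F w = F w0 + \sum_i (w 0 i - w0 0 i) * G i w.
  move=> Qw; have := star_FTC stQ 0 FQ Qw; rewrite mul0r add0r expr0 mul1r => E.
  rewrite -[F w](subrK (F w0)) -E addrC; congr (_ + _).
  rewrite -(star_int_sum stQ) //.
  rewrite /star_int; apply: eq_Rintegral => t; rewrite inE /= in_itv /= => t01.
  congr (_ * _); rewrite (derive_coords oQ (w - w0) FQ); last exact: stQ.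
  by apply: eq_bigr => i _; rewrite !mxE.
have GE i : G i w0 = 'D_(evec R i) F w0.
    rewrite /G /star_int (_ : (fun t => _) = (fun=> 'D_(evec R i) F w0)); last first.
    by apply/funext => t; rewrite subrr scaler0 add0r expr0 mul1r.
  rewrite Rintegral_cst //.
  have m1 : @lebesgue_measure R `[0 : R, 1]%classic = 1%:E.
    by rewrite lebesgue_measure_itv /= lte01 oppr0 adde0.
  by rewrite (_ : fine _ = 1) ?mulr1 //; exact: (congr1 fine m1).
pose P := U `&` phi @^-1` Q.
have oP : open P by exact: (chart_preim_open hc oQ).
have Px : P x by [].
have GP i : smooth_at x (fun y => G i (phi y)).
  exists P; split=> //; apply: (smooth_on_comp_rV oP oQ (GQ i)).
    by move=> y [].
  by move=> j; apply: smooth_onS (chart_coord hc j) => //; [exact: chart_open hc|move=> y []].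
have cP i : smooth_at x (fun y => phi y 0 i - w0 0 i).
  apply: smooth_atD; last exact: smooth_at_cst.
  by exists U; split=> //; [exact: chart_open hc|exact: chart_coord hc i].
have fE : \near x, f x = F w0 + \sum_i (phi x 0 i - w0 0 i) * G i (phi x).
  apply: filterS (open_nbhs_nbhs (conj oP Px)) => y [Uy Qy].
  by rewrite -FE // /F /= (chartK hc).
rewrite (gtapp_near v fE) gtappD; last 2 first.
- exact: smooth_at_cst.
- by apply: smooth_at_sum => i; exact: smooth_atM.
rewrite gtapp_cst add0r gtapp_sum; last by move=> i; exact: smooth_atM.
rewrite (derive_coords oQ (dphi v) FQ Q0); apply: eq_bigr => i _.
rewrite gtappM // subrr mul0r addr0 GE mxE; congr (_ * _).
rewrite gtappD ?gtapp_cst ?addr0 //; last exact: smooth_at_cst.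
by exists U; split=> //; [exact: chart_open hc|exact: chart_coord hc i].
Qed.

(** The coordinate vector xi as a derivation at x; the value 0 outside U makes it
    a derivation for every x. *)
Definition tvec_fun x (xi : 'rV[R]_n) f : R :=
  if `[< U x /\ smooth f >] then 'D_xi (f \o psi) (phi x) else 0.

Lemma chart_derivable x xi f : U x -> smooth_at x f ->
  derivable (f \o psi) (phi x) xi.
Proof.
move=> Ux /(smooth_at_chart Ux)[ O [oO Ox OU _ FO]].
exact: (@rV_smooth_derivable R n (phi @` O) _ (phi x) xi FO (imageP phi Ox)).
Qed.

Fact tvec_derivation x xi : is_derivation x (tvec_fun x xi).
Proof.
have [Ux|nUx] := pselect (U x); last first.
  have z f : tvec_fun x xi f = 0 by rewrite /tvec_fun asboolF // => -[].
  by split=> *; rewrite !z ?mulr0 ?mul0r ?addr0.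
have tE f : smooth f -> tvec_fun x xi f = 'D_xi (f \o psi) (phi x).
  by move=> sf; rewrite /tvec_fun asboolT.
split.
- move=> a f g sf sg; rewrite !tE //; last by apply: smoothD => //; exact: smoothZ.
  have df := @chart_derivable x xi _ Ux (smooth_atE x sf).
  have dg := @chart_derivable x xi _ Ux (smooth_atE x sg).
  rewrite (_ : _ \o psi = a *: (f \o psi) + (g \o psi)) //.
  by rewrite (deriveD (derivableZ (k := a) df) dg) (deriveZ a df).
- move=> f g sf sg; rewrite !tE //; last exact: smoothM.
  have df := @chart_derivable x xi _ Ux (smooth_atE x sf).
  have dg := @chart_derivable x xi _ Ux (smooth_atE x sg).
  rewrite (_ : _ \o psi = (f \o psi) * (g \o psi)) //.
  rewrite (deriveM df dg) /= (chartK hc) // addrC /GRing.scale /=; congr (_ + _).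
  exact: mulrC.
- by move=> f nsf; rewrite /tvec_fun asboolF // => -[].
Qed.

Definition tvec x (xi : 'rV[R]_n) : tangent x := mktangent (tvec_derivation x xi).

Lemma tapp_tvec x xi f : U x -> smooth f ->
  tapp (tvec x xi) f = 'D_xi (f \o psi) (phi x).
Proof. by move=> Ux sf; rewrite /tapp /= /tvec_fun asboolT. Qed.

Lemma gtapp_tvec x xi f : U x -> smooth_at x f ->
  gtapp (tvec x xi) f = 'D_xi (f \o psi) (phi x).
Proof.
move=> Ux sf; have [G sG Gf] := germ_ext sf.
rewrite (gtappE _ sG Gf) tapp_tvec //; apply: near_eq_derive.
have cpsi : {for phi x, continuous psi} by apply: (chartV_continuous hc); exists x.
have : nbhs (psi (phi x)) [set y | G y = f y] by rewrite (chartK hc).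
exact: cpsi.
Qed.

Lemma dphi_tvec x xi : U x -> dphi (tvec x xi) = xi.
Proof.
move=> Ux; apply/rowP => i; rewrite mxE gtapp_tvec //; last first.
  by exists U; split=> //; [exact: chart_open hc|exact: chart_coord hc i].
have [_ E] := is_derive_coord i (phi x) xi; rewrite -[RHS]E.
apply: near_eq_derive.
apply: filterS (open_nbhs_nbhs (conj (chart_openI hc) (imageP phi Ux))) => w.
by move=> /(chartV hc)[_] /= ->.
Qed.

Lemma tangent_eq x (v w : tangent x) : (forall f, smooth f -> tapp v f = tapp w f) ->
  v = w.
Proof.
move=> h; apply: val_inj; apply/funext => f.
have [sf|nsf] := pselect (smooth f); first exact: h.
by rewrite -[LHS]/(tapp v f) -[RHS]/(tapp w f) !tapp_nsmooth.
Qed.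

Lemma tvec_dphi x (v : tangent x) : U x -> tvec x (dphi v) = v.
Proof.
move=> Ux; apply: tangent_eq => f sf; rewrite tapp_tvec // -gtapp_chart //.
  exact: gtapp_smooth.
exact: smooth_atE.
Qed.

Lemma smooth_on_D O xi f : open O -> O `<=` U -> smooth_on O f ->
  smooth_on O (fun x => 'D_xi (f \o psi) (phi x)).
Proof.
move=> oO OU fO; have FO := (chart_smoothP hc f oO OU).1 fO.
apply: (smooth_on_comp_rV oO (chart_image_open hc oO OU) (rV_smooth_D xi FO)).
  by move=> x Ox; exists x.
by move=> i; apply: smooth_onS (chart_coord hc i) => //; exact: chart_open hc.
Qed.

(** The constant field xi of the chart, cut off. *)
Lemma vfield_ext x xi : U x -> exists X : vfield M, \near x, X x = tvec x xi.
Proof.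
move=> Ux.
have [r [sr [V [V0 [[oV oV0] Vx UV0 r1 r0]]]]] := bump_at (chart_open hc) Ux.
have sX f : smooth f -> smooth (fun y => tapp (r y *: tvec y xi) f).
  move=> sf; apply: (@smooth_on_ext setT (fun y => r y *
      'D_xi (f \o psi) (phi y))); first exact: openT.
    move=> y _; have [Uy|nUy] := pselect (U y).
      by rewrite -tapp_tvec.
    by rewrite r0 ?mul0r ?scale0r //; exact: UV0.
  apply: smooth_cut (chart_open hc) oV0 UV0 sr r0 _.
  apply: smooth_on_D => //; first exact: chart_open hc.
  by apply: smooth_onS sf => //; [exact: openT|exact: chart_open hc].
exists (VField sX); apply: filterS (open_nbhs_nbhs (conj oV Vx)) => y /r1 /= ->.
by rewrite scale1r.
Qed.

End chart_tangent.

Lemma vfield_through x (v : tangent x) : exists X : vfield M, X x = v.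
Proof.
have [U [n [phi [psi [hc Ux]]]]] := chM x.
have [X /nbhs_singleton Xx] := vfield_ext hc (dphi phi v) Ux.
by exists X; rewrite Xx tvec_dphi.
Qed.

End charted.

(** * Alternating maps and elementary forms *)

Lemma det_rowE (R : comNzRingType) n (B : 'M[R]_n) :
  \det B = \sum_(s : 'S_n) (-1) ^+ s * \prod_k B (s k) k.
Proof.
by rewrite -det_tr; apply: eq_bigr => s _; congr (_ * _); apply: eq_bigr => k _; rewrite mxE.
Qed.

Section alternating_maps.
Variables (R : realType) (V : lmodType R).
Implicit Types (p n : nat).

Definition ralt p (A : ('I_p -> V) -> R) : Prop :=
  (forall i v (a : R) t t', A (update v i (a *: t + t')) =
     a * A (update v i t) + A (update v i t')) /\
  (forall v i j, i != j -> v i = v j -> A v = 0).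

Lemma update_id p (v : 'I_p -> V) i : update v i (v i) = v.
Proof. by apply/funext => k; rewrite /update; case: eqP => [->|]. Qed.

Lemma updateC p (v : 'I_p -> V) i j t t' : i != j ->
  update (update v i t) j t' = update (update v j t') i t.
Proof.
move=> ij; apply/funext => k; rewrite /update.
by case: (eqVneq k j) => [->|//]; rewrite eq_sym (negbTE ij).
Qed.

Section one_map.
Variables (p : nat) (A : ('I_p -> V) -> R).
Hypothesis hA : ralt A.

Lemma ralt_add v i t t' : A (update v i (t + t')) =
  A (update v i t) + A (update v i t').
Proof. by have [h _] := hA; rewrite -[t]scale1r h mul1r scale1r. Qed.

Lemma ralt0 v i : A (update v i 0) = 0.
Proof.
have := ralt_add v i 0 0; rewrite addr0 => /eqP.
by rewrite -subr_eq0 opprD addrA subrr sub0r oppr_eq0 => /eqP.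
Qed.

Lemma ralt_sum v i (I : Type) (r : seq I) (c : I -> R) (t : I -> V) :
  A (update v i (\sum_(k <- r) c k *: t k)) = \sum_(k <- r) c k * A (update v i (t k)).
Proof.
elim: r => [|k r IH]; first by rewrite !big_nil ralt0.
by rewrite !big_cons; have [-> _] := hA; rewrite IH.
Qed.

Lemma ralt_tperm v i j : i != j -> A (v \o tperm i j) = - A v.
Proof.
move=> ij; have [_ h0] := hA.
pose B t t' := A (update (update v i t) j t').
have B0 t : B t t = 0.
  by apply: (h0 _ i j ij); rewrite /update eqxx (negbTE ij) eqxx.
have Bl t t' u : B (t + t') u = B t u + B t' u.
  by rewrite /B !(updateC _ _ _ ij) ralt_add.
have Br u t t' : B u (t + t') = B u t + B u t' by rewrite /B ralt_add.
have := B0 (v i + v j); rewrite Bl !Br !B0 add0r addr0.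
have -> : B (v i) (v j) = A v by rewrite /B update_id update_id.
have -> : B (v j) (v i) = A (v \o tperm i j).
  congr A; apply/funext => k; rewrite /update /=.
  case: tpermP => [->|->|/eqP ki /eqP kj]; rewrite ?eqxx ?(negbTE ij) //.
  by rewrite (negbTE ki) (negbTE kj).
by move/eqP; rewrite addrC addr_eq0 => /eqP.
Qed.

Lemma ralt_perm v (s : 'S_p) : A (v \o s) = (-1) ^+ s * A v.
Proof.
have [ts -> dts] := prod_tpermP s.
elim: ts dts v => [_|[i j] ts IH /= /andP[ij dts]] v.
  by rewrite big_nil odd_perm1 mul1r; congr A; apply/funext => k; rewrite /= perm1.
rewrite big_cons odd_permM odd_tperm ij signr_addb mulN1r mulNr -IH //.
rewrite -(ralt_tperm _ ij); congr A; apply/funext => k /=.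
by rewrite permM.
Qed.

(** Replace the arguments by generators, one at a time. *)
Lemma multilinear_eq0 n (b : 'I_n -> V) :
  (forall v, exists c : 'I_n -> R, v = \sum_i c i *: b i) ->
  forall B : ('I_p -> V) -> R,
  (forall i v (a : R) t t', B (update v i (a *: t + t')) =
     a * B (update v i t) + B (update v i t')) ->
  (forall h : 'I_p -> 'I_n, B (b \o h) = 0) -> forall v, B v = 0.
Proof.
move=> span B Bl B0.
have Bsum v i (r : seq 'I_n) (c : 'I_n -> R) : B (update v i (\sum_(k <- r) c k *: b k)) =
    \sum_(k <- r) c k * B (update v i (b k)).
  elim: r => [|k r IH]; last by rewrite !big_cons Bl IH.
  rewrite !big_nil; have := Bl i v 1 0 0.
  rewrite scaler0 addr0 mul1r => /eqP.
  by rewrite -subr_eq0 opprD addrA subrr sub0r oppr_eq0 => /eqP.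
suff key : forall t v, (t <= p)%N -> (forall k : 'I_p, (t <= k)%N -> exists i, v k = b i) ->
    B v = 0 by move=> v; apply: (key p v) => // k; rewrite leqNgt ltn_ord.
elim=> [|t IH] v tp hv.
  have [h hE] := choice (fun k => hv k (leq0n k)).
  by rewrite (_ : v = b \o h) ?B0 //; apply/funext => k; rewrite hE.
pose i := Ordinal tp; have [c vi] := span (v i).
rewrite -(update_id v i) vi Bsum big1 // => k _; rewrite IH ?mulr0 //; first exact: ltnW.
move=> l tl; rewrite /update; case: eqP => [_|/eqP li]; first by exists k.
by apply: hv; rewrite ltn_neqAle tl andbT eq_sym; exact: li.
Qed.

End one_map.

Lemma ralt_det p (L : 'I_p -> V -> R) :
  (forall j a t t', L j (a *: t + t') = a * L j t + L j t') ->
  ralt (fun v => \det (\matrix_(i, j) L j (v i))).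
Proof.
move=> Ll; split=> [i v a t t'|v i j ij vij].
  rewrite -[in RHS](mul1r (\det (\matrix_(_, _) L _ (update v i t' _)))).
  apply: (determinant_multilinear (i0 := i)).
  - by apply/rowP => j; rewrite !mxE /update eqxx Ll mul1r.
  - by apply/matrixP => k j; rewrite !mxE /update eq_sym (negbTE (neq_lift _ _)).
  - by apply/matrixP => k j; rewrite !mxE /update eq_sym (negbTE (neq_lift _ _)).
by apply: (determinant_alternate ij) => k; rewrite !mxE vij.
Qed.

(** By multilinearity it suffices to compare both sides on tuples b o h, where
    expanding the determinants leaves the terms f = h o s with s a permutation.
    All maps f are summed over, not only the increasing ones, whence the factor
    1 / p!. *)
Lemma ralt_expand p n (A : ('I_p -> V) -> R) (b : 'I_n -> V) (xi : 'I_n -> V -> R) :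
  ralt A -> (forall i a t t', xi i (a *: t + t') = a * xi i t + xi i t') ->
  (forall v, v = \sum_i xi i v *: b i) -> (forall i j, xi i (b j) = (i == j)%:R) ->
  forall v, A v = \sum_(f : {ffun 'I_p -> 'I_n})
    (p`!%:R)^-1 * A (b \o f) * \det (\matrix_(k, l) xi (f l) (v k)).
Proof.
move=> hA xil span dual v; apply/eqP; rewrite -subr_eq0; apply/eqP; move: v.
have p0 : p`!%:R != 0 :> R by rewrite pnatr_eq0 -lt0n fact_gt0.
have hd (f : {ffun 'I_p -> 'I_n}) : ralt (fun v => \det (\matrix_(k, l) xi (f l) (v k))).
  by apply: (ralt_det (L := fun l => xi (f l))) => *; exact: xil.
apply: (multilinear_eq0 (b := b)).
- by move=> v; exists (xi ^~ v).
- move=> i v a t t'; have [-> _] := hA.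
  pose S w := \sum_(f : {ffun 'I_p -> 'I_n}) (p`!%:R)^-1 * A (b \o f) *
    \det (\matrix_(k, l) xi (f l) (w k)).
  have Sl : S (update v i (a *: t + t')) = a * S (update v i t) + S (update v i t').
    rewrite /S mulr_sumr -big_split; apply: eq_bigr => f _ /=.
    by have [-> _] := hd f; rewrite mulrDr; congr (_ + _); rewrite mulrCA.
  by rewrite -!/(S _) Sl; ring.
- move=> h; apply/eqP; rewrite subr_eq0; apply/eqP.
  under eq_bigr => f _ do rewrite det_rowE mulr_sumr.
  rewrite exchange_big /=.
  under eq_bigr => s _.
    rewrite (bigD1 (finfun (h \o s))) //= [X in _ + X]big1 ?addr0; last first.
      move=> f fs; rewrite (_ : \prod_k _ = 0) ?mulr0 //.
      have [k hk] : exists k, f k != h (s k).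
        apply: contrapT => nk; move/eqP: fs; apply; apply/ffunP => k; rewrite ffunE /=.
        by apply/eqP; apply: contrapT => /negP fk; apply: nk; exists k.
      by rewrite (bigD1 k) //= mxE /= dual (negbTE hk) mul0r.
    rewrite big1 => [|k _]; last by rewrite mxE ffunE /= dual eqxx.
    rewrite mulr1 (_ : b \o _ = (b \o h) \o s); last by apply/funext => k; rewrite /= ffunE.
    rewrite (ralt_perm hA) mulrAC -mulrA [_ * (_ * A _)]mulrCA [_ * (_ * A _)]mulrA.
    rewrite -signr_addb addbb mul1r.
    over.
  rewrite (_ : \sum_s _ = \sum_(s : 'S_p) (p`!%:R)^-1 * A (b \o h)) //.
  by rewrite sumr_const card_Sn -[RHS]mulr_natl mulrA divff // mul1r.
Qed.

Definition fcons (T : Type) p (t : T) (v : 'I_p -> T) : 'I_p.+1 -> T :=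
  fun k => oapp v t (unlift ord0 k).

Lemma fcons0 (T : Type) p (t : T) (v : 'I_p -> T) : fcons t v ord0 = t.
Proof. by rewrite /fcons unlift_none. Qed.

Lemma fconsS (T : Type) p (t : T) (v : 'I_p -> T) k : fcons t v (lift ord0 k) = v k.
Proof. by rewrite /fcons liftK. Qed.

(** The permutation that moves the i-th argument to the front has sign (-1)^i. *)
Lemma ralt_front p (A : ('I_p.+1 -> V) -> R) (v : 'I_p.+1 -> V) (i : 'I_p.+1) : ralt A ->
  A (fcons (v i) (fun k => v (lift i k))) = (-1) ^+ i * A v.
Proof.
move=> hA; have := ralt_perm hA v (lift_perm ord0 i 1).
rewrite odd_lift_perm odd_perm1 /= addbF signr_odd => <-; congr A.
apply/funext => k /=; case: (unliftP ord0 k) => [j ->|->].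
  by rewrite fconsS lift_perm_lift perm1.
by rewrite fcons0 lift_perm_id.
Qed.

End alternating_maps.

Section permutation_sums.
Variable R : comNzRingType.

(** A permutation of p + 1 elements amounts to the image of the first one and a
    permutation of the others. *)
Lemma sum_lift_perm p (F : 'S_p.+1 -> R) :
  \sum_s F s = \sum_(i < p.+1) \sum_(t : 'S_p) F (lift_perm ord0 i t).
Proof.
rewrite pair_big /=.
pose h (x : 'I_p.+1 * 'S_p) := lift_perm ord0 x.1 x.2.
have h_inj : injective h.
  move=> [i s] [j t] /= e.
  have ij : i = j by have := congr1 (fun u : 'S_p.+1 => u ord0) e; rewrite /h /= !lift_perm_id.
  subst j; congr (_, _); apply/permP => k.
  have := congr1 (fun u : 'S_p.+1 => u (lift ord0 k)) e; rewrite /h /= !lift_perm_lift.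
  exact: lift_inj.
have h_bij : bijective h.
  by apply: inj_card_bij => //; rewrite card_prod !card_Sn card_ord factS.
by rewrite (reindex h) //; exact: onW_bij.
Qed.

(** The terms with second derivatives in the exterior derivative: h i j k stands
    for X_i X_j g_k, and the commutators cancel the sum of all of them. *)
Lemma antisym_sum p (h : 'I_p.+1 -> 'I_p.+1 -> 'I_p -> R) (g : 'I_p.+1 -> 'I_p -> R) :
  \sum_(i < p.+1) \sum_(t : 'S_p) (-1) ^+ i * ((-1) ^+ t *
     \sum_k h i (lift i (t k)) k * \prod_(l | l != k) g (lift i (t l)) l) +
  \sum_(i < p.+1) \sum_(j < p.+1 | (i < j)%N) (-1) ^+ j * \sum_(t : 'S_p) (-1) ^+ t *
     \prod_k (if lift j (t k) == i then h i j k - h j i k else g (lift j (t k)) k) = 0.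
Proof.
pose P (s : 'S_p.+1) k := \prod_(l | l != k) g (s (lift ord0 l)) l.
pose Fi := \sum_(s : 'S_p.+1) \sum_k (-1) ^+ s * (h (s ord0) (s (lift ord0 k)) k * P s k).
pose Se := \sum_(s : 'S_p.+1) \sum_(k | (s (lift ord0 k) < s ord0)%N)
  (-1) ^+ s * ((h (s (lift ord0 k)) (s ord0) k - h (s ord0) (s (lift ord0 k)) k) * P s k).
have signE i (t : 'S_p) : (-1) ^+ (lift_perm ord0 i t) = (-1) ^+ i * (-1) ^+ t :> R.
  by rewrite odd_lift_perm /= signr_addb signr_odd.
have -> : \sum_(i < p.+1) \sum_(t : 'S_p) (-1) ^+ i * ((-1) ^+ t *
     \sum_k h i (lift i (t k)) k * \prod_(l | l != k) g (lift i (t l)) l) = Fi.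
  rewrite /Fi sum_lift_perm; apply: eq_bigr => i _; apply: eq_bigr => t _.
  rewrite mulrA -signE mulr_sumr; apply: eq_bigr => k _.
  rewrite lift_perm_id lift_perm_lift; congr (_ * (_ * _)).
  by apply: eq_bigr => l _; rewrite lift_perm_lift.
have -> : \sum_(i < p.+1) \sum_(j < p.+1 | (i < j)%N) (-1) ^+ j * (\sum_(t : 'S_p) (-1) ^+ t *
     \prod_k (if lift j (t k) == i then h i j k - h j i k else g (lift j (t k)) k)) = Se.
  rewrite /Se sum_lift_perm (exchange_big_dep xpredT) //=.
  apply: eq_bigr => j _.
  under eq_bigr do rewrite mulr_sumr.
  rewrite exchange_big /=; apply: eq_bigr => t _.
  rewrite big_mkcond (bigD1_ord j) //= ltnn add0r -big_mkcond /=.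
  rewrite (reindex_inj (@perm_inj _ t)) /=; apply: eq_big => k.
    by rewrite lift_perm_id lift_perm_lift.
  move=> _; rewrite signE -mulrA lift_perm_id lift_perm_lift; congr (_ * (_ * _)).
  rewrite (bigD1 k) //= eqxx; congr (_ * _); apply: eq_bigr => l lk.
  by rewrite (inj_eq (@lift_inj _ j)) (inj_eq perm_inj) (negbTE lk) lift_perm_lift.
have -> : Fi = \sum_k \sum_(s : 'S_p.+1)
    (-1) ^+ s * (h (s ord0) (s (lift ord0 k)) k * P s k) by exact: exchange_big.
have -> : Se = \sum_k \sum_(s : 'S_p.+1 | (s (lift ord0 k) < s ord0)%N)
    (-1) ^+ s * ((h (s (lift ord0 k)) (s ord0) k - h (s ord0) (s (lift ord0 k)) k) * P s k).
  by rewrite /Se (exchange_big_dep xpredT).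
rewrite -big_split /=.
rewrite big1 // => k _.
rewrite (bigID (fun s : 'S_p.+1 => (s (lift ord0 k) < s ord0)%N)) /=.
have -> : \sum_(s : 'S_p.+1 | ~~ (s (lift ord0 k) < s ord0)%N)
      (-1) ^+ s * (h (s ord0) (s (lift ord0 k)) k * P s k) =
    \sum_(s : 'S_p.+1 | (s (lift ord0 k) < s ord0)%N)
      - ((-1) ^+ s * (h (s (lift ord0 k)) (s ord0) k * P s k)).
  rewrite (reindex_inj (mulgI (tperm ord0 (lift ord0 k)))) /=.
  apply: eq_big => [s|s _].
    rewrite !permM tpermL tpermR -leqNgt leq_eqVlt orbC.
    rewrite (_ : (_ == _ :> nat) = false) ?orbF //; apply/negbTE/eqP => /val_inj/perm_inj/eqP.
    by rewrite eq_sym (negbTE (neq_lift _ _)).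
  rewrite !permM tpermL tpermR odd_permM odd_tperm neq_lift signr_addb mulN1r mulNr.
  congr (- (_ * (_ * _))); apply: eq_bigr => l lk; rewrite permM tpermD ?neq_lift //.
  by apply: contra lk => /eqP/lift_inj ->.
rewrite -addrA -big_split -big_split big1 // => s _ /=.
by rewrite mulrBl mulrBr addKr subrr.
Qed.

Lemma det_lift_perm p (B : 'M[R]_p.+1) :
  \det B = \sum_(i < p.+1) \sum_(t : 'S_p)
    (-1) ^+ i * ((-1) ^+ t * (B i ord0 * \prod_k B (lift i (t k)) (lift ord0 k))).
Proof.
rewrite -det_tr -[LHS]/(\sum_(s : 'S_p.+1) _) sum_lift_perm; apply: eq_bigr => i _; apply: eq_bigr => t _.
rewrite odd_lift_perm /= signr_addb signr_odd -mulrA; congr (_ * (_ * _)).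
rewrite big_ord_recl lift_perm_id mxE; congr (_ * _).
by apply: eq_bigr => k _; rewrite lift_perm_lift mxE.
Qed.

(** Laplace expansion along the first p columns, in the form of the wedge
    product: the row permutations that preserve the blocks contribute p! q!
    copies of each product of minors. *)
Lemma det_wedge p q (B : 'M[R]_(p + q)) :
  \sum_(s : 'S_(p + q)) (-1) ^+ s *
     (\det (\matrix_(i < p, j < p) B (s (lshift q i)) (lshift q j)) *
      \det (\matrix_(i < q, j < q) B (s (rshift p i)) (rshift p j))) =
  (p`! * q`!)%:R * \det B.
Proof.
have key (t : 'S_p) (r : 'S_q) : \sum_(s : 'S_(p + q)) (-1) ^+ s *
    ((-1) ^+ t * \prod_i B (s (lshift q i)) (lshift q (t i)) *
     ((-1) ^+ r * \prod_i B (s (rshift p i)) (rshift p (r i)))) = \det B.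
  pose Q : 'M[R]_(p + q) := block_mx (perm_mx t)^T 0 0 (perm_mx r)^T.
  have dQ : \det Q = (-1) ^+ t * (-1) ^+ r.
    by rewrite det_ublock !det_tr !det_perm.
  have BQl i j : (B *m Q) i (lshift q j) = B i (lshift q (t j)).
    rewrite mxE big_split_ord /= [X in _ + X]big1 ?addr0; last first.
      by move=> k _; rewrite block_mxEdl mxE mulr0.
    rewrite (bigD1 (t j)) //= block_mxEul !mxE eqxx mulr1 big1 ?addr0 // => k kt.
    by rewrite block_mxEul !mxE eq_sym (negbTE kt) mulr0.
  have BQr i j : (B *m Q) i (rshift p j) = B i (rshift p (r j)).
    rewrite mxE big_split_ord /= big1 ?add0r; last first.
      by move=> k _; rewrite block_mxEur mxE mulr0.
    rewrite (bigD1 (r j)) //= block_mxEdr !mxE eqxx mulr1 big1 ?addr0 // => k kt.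
    by rewrite block_mxEdr !mxE eq_sym (negbTE kt) mulr0.
  have : \det (B *m Q) * \det Q = \det B.
    by rewrite det_mulmx dQ -mulrA mulrACA -!signr_addb !addbb !expr0 !mulr1.
  move=> <-; rewrite det_rowE mulr_suml; apply: eq_bigr => s _.
  rewrite big_split_ord /= dQ.
  under [X in _ = _ * (X * _) * _]eq_bigr do rewrite BQl.
  under [X in _ = _ * (_ * X) * _]eq_bigr do rewrite BQr.
  by rewrite -[RHS]mulrA; congr (_ * _); rewrite mulrACA mulrC.
transitivity (\sum_(t : 'S_p) \sum_(r : 'S_q) \det B); last first.
  by rewrite !sumr_const !card_Sn -mulrnA mulr_natl mulnC.
under [RHS]eq_bigr => t _ do under eq_bigr => r _ do rewrite -(key t r).
under [RHS]eq_bigr do rewrite exchange_big.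
rewrite [RHS]exchange_big /=; apply: eq_bigr => s _.
rewrite /determinant big_distrlr /= mulr_sumr; apply: eq_bigr => t _.
rewrite mulr_sumr; apply: eq_bigr => r _; congr (_ * (_ * _ * (_ * _))).
  by apply: eq_bigr => i _; rewrite mxE.
by apply: eq_bigr => i _; rewrite mxE.
Qed.

End permutation_sums.

Section elementary_forms.
Variables (R : realType) (M : fspace R).
Implicit Types (f : M -> R) (x : M).

Definition rform p := forall x : M, ('I_p -> tangent x) -> R.

(** f dg_1 ... dg_p *)
Definition elem p f (g : 'I_p -> M -> R) : rform p :=
  fun x v => f x * \det (\matrix_(i, j) tapp (v i) (g j)).

(** df dg_1 ... dg_p *)
Definition delem p f (g : 'I_p -> M -> R) : rform p.+1 :=
  fun x v => \det (\matrix_(i, j) tapp (v i) (fcons f g j)).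

Lemma tapp_scale x (a : R) (t t' : tangent x) f :
  tapp (a *: t + t') f = a * tapp t f + tapp t' f.
Proof. by []. Qed.

Lemma delemE p f (g : 'I_p -> M -> R) : delem f g = elem (fun=> 1) (fcons f g).
Proof. by apply: functional_extensionality_dep => x; apply/funext => v; rewrite /elem mul1r. Qed.

Lemma elem_ralt p f (g : 'I_p -> M -> R) x : ralt (elem f g (x := x)).
Proof.
have [h1 h2] := @ralt_det R (tangent x) p (fun j t => tapp t (g j)) (fun j a t t' => tapp_scale a t t' (g j)).
split=> [i v a t t'|v i j ij vij].
  by rewrite /elem h1 mulrDr; congr (_ + _); rewrite mulrCA.
by rewrite /elem (h2 _ _ _ ij vij) mulr0.
Qed.

Lemma delem_cst p (a : R) (g : 'I_p -> M -> R) x v : delem (fun=> a) g (x := x) v = 0.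
Proof.
rewrite /delem (expand_det_col _ ord0) big1 // => i _.
by rewrite mxE fcons0 (tapp_cst (v i) a) mul0r.
Qed.

Lemma smooth_sum (I : Type) (r : seq I) (h : I -> M -> R) :
  (forall i, smooth (h i)) -> smooth (fun x => \sum_(i <- r) h i x).
Proof.
move=> hs; elim: r => [|i r IH].
  by under eq_fun do rewrite big_nil; exact: smooth_cst.
by under eq_fun do rewrite big_cons; exact: smoothD.
Qed.

Lemma smooth_prod (I : Type) (r : seq I) (P : pred I) (h : I -> M -> R) :
  (forall i, smooth (h i)) -> smooth (fun x => \prod_(i <- r | P i) h i x).
Proof.
move=> hs; elim: r => [|i r IH].
  by under eq_fun do rewrite big_nil; exact: smooth_cst.
by under eq_fun do rewrite big_cons; case: (P i) => //; exact: smoothM.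
Qed.

Lemma smooth_det p (h : 'I_p -> 'I_p -> M -> R) : (forall i j, smooth (h i j)) ->
  smooth (fun x => \det (\matrix_(i, j) h i j x)).
Proof.
move=> hs; rewrite /determinant; apply: smooth_sum => s; apply: smoothM.
  exact: smooth_cst.
rewrite (_ : (fun x => _) = (fun x => \prod_i h i (s i) x)); first exact: smooth_prod.
by apply/funext => x; apply: eq_bigr => i _; rewrite mxE.
Qed.

Lemma elem_smooth p f (g : 'I_p -> M -> R) (X : 'I_p -> vfield M) : smooth f ->
  (forall j, smooth (g j)) -> smooth (fun x => elem f g (fun i => X i x)).
Proof.
move=> sf sg; apply: smoothM => //; apply: smooth_det => i j.
exact: vfield_smooth.
Qed.

Lemma tapp_sum x (v : tangent x) (I : Type) (r : seq I) (h : I -> M -> R) :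
  (forall i, smooth (h i)) ->
  tapp v (fun y => \sum_(i <- r) h i y) = \sum_(i <- r) tapp v (h i).
Proof.
move=> hs; elim: r => [|i r IH].
  by under eq_fun do rewrite big_nil; rewrite big_nil tapp0.
rewrite big_cons -IH; have [vl _ _] := tangentP v.
rewrite -[X in X + _]mul1r -vl //; last exact: smooth_sum.
by congr tapp; apply/funext => y; rewrite big_cons mul1r.
Qed.

Lemma tapp_scaler x (v : tangent x) a h : smooth h -> tapp v (fun y => a * h y) = a * tapp v h.
Proof.
move=> hs; have [vl _ _] := tangentP v.
rewrite -[RHS]addr0 -(tapp0 v) -vl //; last exact: smooth_cst.
by congr tapp; apply/funext => y; rewrite addr0.
Qed.

Lemma tapp_prod x (v : tangent x) (I : eqType) (r : seq I) (h : I -> M -> R) :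
  uniq r -> (forall i, smooth (h i)) ->
  tapp v (fun y => \prod_(i <- r) h i y) =
  \sum_(i <- r) tapp v (h i) * \prod_(l <- r | l != i) h l x.
Proof.
move=> + hs; elim: r => [_|i r IH /= /andP[ir ur]].
  under eq_fun do rewrite big_nil; rewrite big_nil.
  exact: tapp_cst.
under eq_fun do rewrite big_cons; have [_ vL _] := tangentP v.
rewrite vL ?IH //; last exact: smooth_prod.
rewrite big_cons big_cons eqxx /=; congr (_ * _ + _).
  rewrite big_seq_cond [RHS]big_seq_cond; apply: eq_bigl => l.
  by rewrite andbT; case: (eqVneq l i) => [->|]; rewrite ?(negbTE ir) ?andbT.
rewrite mulr_sumr; apply: eq_big_seq => k kr.
rewrite big_cons (_ : (i != k)); last by apply: contraNneq ir => ->.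
by rewrite mulrCA.
Qed.

Definition rkoszul p (a : rform p) (X : 'I_p.+1 -> vfield M) x : R :=
  \sum_(i < p.+1)
     (-1) ^+ i * tapp (X i x) (fun y => a y (fun k => X (lift i k) y)) +
  \sum_(i < p.+1) \sum_(j < p.+1 | (i < j)%N)
     (-1) ^+ j * a x (fun k => if lift j k == i then bracket (X i) (X j) x
                               else X (lift j k) x).

(** Expand X_i (f det (X_k g_l)) by the Leibniz rule.  The derivatives of f give
    the expansion of df dg_1 ... dg_p along its first column, and the second
    derivatives of the g_l cancel against the bracket terms by antisym_sum. *)
Lemma koszul_elem p f (g : 'I_p -> M -> R) (X : 'I_p.+1 -> vfield M) x :
  smooth f -> (forall j, smooth (g j)) ->
  delem f g (fun i => X i x) = rkoszul (elem f g) X x.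
Proof.
move=> sf sg.
pose G (i : 'I_p.+1) k : M -> R := vapp (X i) (g k).
have sG i k : smooth (G i k) by exact: vfield_smooth.
have T1 (i : 'I_p.+1) : tapp (X i x) (fun y => elem f g (fun k => X (lift i k) y)) =
    tapp (X i x) f * \det (\matrix_(k, l) G (lift i k) l x) +
    f x * \sum_(t : 'S_p) (-1) ^+ t *
      \sum_k tapp (X i x) (G (lift i (t k)) k) * \prod_(l | l != k) G (lift i (t l)) l x.
  pose D y := \sum_(t : 'S_p) (-1) ^+ t * \prod_k G (lift i (t k)) k y.
  have DE y : \det (\matrix_(k, l) tapp (X (lift i k) y) (g l)) = D y.
    by rewrite det_rowE; apply: eq_bigr => t _; congr (_ * _); apply: eq_bigr => k _; rewrite mxE.
  have st t : smooth (fun y => (-1) ^+ (t : 'S_p) * \prod_k G (lift i (t k)) k y).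
    by apply: smoothZ; exact: smooth_prod.
  rewrite /elem; under eq_fun do rewrite DE.
  have [_ vL _] := tangentP (X i x).
  rewrite vL //; last exact: smooth_sum.
  congr (_ * _ + _ * _); first by rewrite -DE.
  rewrite tapp_sum //; apply: eq_bigr => t _; rewrite tapp_scaler; last exact: smooth_prod.
  by congr (_ * _); rewrite tapp_prod ?index_enum_uniq.
rewrite /rkoszul; under [X in _ = X + _]eq_bigr do rewrite T1 mulrDr.
rewrite big_split /= -addrA -[LHS]addr0; congr (_ + _).
  rewrite /delem det_lift_perm; apply: eq_bigr => i _.
  rewrite det_rowE !mulr_sumr; apply: eq_bigr => t _; congr (_ * _).
  rewrite mxE fcons0 mulrCA; congr (_ * (_ * _)).
  by apply: eq_bigr => k _; rewrite !mxE fconsS.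
have AS := antisym_sum (fun i j k => tapp (X i x) (G j k)) (fun i k => G i k x).
apply: (etrans (esym (mulr0 (f x)))); apply: (etrans (congr1 ( *%R (f x)) (esym AS))).
rewrite mulrDr; congr (_ + _).
  rewrite mulr_sumr; apply: eq_bigr => i _.
  by rewrite -mulr_sumr mulrCA.
rewrite mulr_sumr; apply: eq_bigr => i _; rewrite mulr_sumr; apply: eq_bigr => j _.
rewrite /elem mulrCA; congr (_ * (_ * _)); rewrite det_rowE.
apply: eq_bigr => t _; congr (_ * _); apply: eq_bigr => k _.
by rewrite mxE; case: ifP.
Qed.

End elementary_forms.

(** * Real forms in charts and the Poincare lemma *)

Section real_forms.
Variables (R : realType) (M : fspace R).
Hypotheses (chM : charted M) (hM : hausdorff_space M).
Implicit Types (U O : set M).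

Definition smooth_data p (I : Type) (f : I -> M -> R) (g : I -> 'I_p -> M -> R) :=
  (forall j, smooth (f j)) /\ (forall j k, smooth (g j k)).

Definition esum p (I : finType) (f : I -> M -> R) (g : I -> 'I_p -> M -> R) : rform M p :=
  fun x v => \sum_j elem (f j) (g j) v.

Definition desum p (I : finType) (f : I -> M -> R) (g : I -> 'I_p -> M -> R) :
  rform M p.+1 := fun x v => \sum_j delem (f j) (g j) v.

(** The differential of a over U is a': locally they are sums of terms
    f dg_1 ... dg_p and df dg_1 ... dg_p.  The functions are global because
    tangent vectors are derivations of global functions. *)
Definition rD p U (a : rform M p) (a' : rform M p.+1) := forall z, U z ->
  exists O (I : finType) (f : I -> M -> R) (g : I -> 'I_p -> M -> R),
  [/\ open O, O z, smooth_data f g,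
      forall x (v : 'I_p -> tangent x), O x -> a x v = esum f g v &
      forall x (v : 'I_p.+1 -> tangent x), O x -> a' x v = desum f g v].

Lemma esum_ralt p (I : finType) (f : I -> M -> R) (g : I -> 'I_p -> M -> R) x :
  ralt (esum f g (x := x)).
Proof.
split=> [i v a t t'|v i j ij vij].
  rewrite /esum mulr_sumr -big_split; apply: eq_bigr => k _ /=.
  by have [-> _] := elem_ralt (f k) (g k) x.
by rewrite /esum big1 // => k _; have [_ h] := elem_ralt (f k) (g k) x; exact: h ij vij.
Qed.

Lemma esum_smooth p (I : finType) (f : I -> M -> R) (g : I -> 'I_p -> M -> R)
    (X : 'I_p -> vfield M) :
  smooth_data f g -> smooth (fun x => esum f g (fun i => X i x)).
Proof. by move=> [sf sg]; apply: smooth_sum => j; exact: elem_smooth. Qed.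

Lemma koszul_esum p (I : finType) (f : I -> M -> R) (g : I -> 'I_p -> M -> R)
    (X : 'I_p.+1 -> vfield M) x : smooth_data f g ->
  desum f g (fun i => X i x) = rkoszul (esum f g) X x.
Proof.
move=> [sf sg]; rewrite /desum; under eq_bigr do rewrite koszul_elem //.
rewrite /rkoszul big_split /=; congr (_ + _); rewrite exchange_big; apply: eq_bigr => i _ /=.
  rewrite -mulr_sumr tapp_sum // => j.
  exact: (elem_smooth (fun k => X (lift i k)) (sf j) (sg j)).
by rewrite exchange_big; apply: eq_bigr => j _; rewrite mulr_sumr.
Qed.

Lemma rkoszul_local p (a b : rform M p) (X : 'I_p.+1 -> vfield M) x O :
  open O -> O x -> (forall y v, O y -> a y v = b y v) ->
  (forall Y : 'I_p -> vfield M, smooth (fun y => a y (fun i => Y i y))) ->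
  (forall Y : 'I_p -> vfield M, smooth (fun y => b y (fun i => Y i y))) ->
  rkoszul a X x = rkoszul b X x.
Proof.
move=> oO Ox ab sa sb; rewrite /rkoszul; congr (_ + _); apply: eq_bigr => i _.
  congr (_ * _); apply: (tapp_local chM hM).
  - exact: (sa (fun k => X (lift i k))).
  - exact: (sb (fun k => X (lift i k))).
  by apply: filterS (open_nbhs_nbhs (conj oO Ox)) => y Oy; rewrite ab.
by apply: eq_bigr => j _; rewrite ab.
Qed.

Lemma vfields_through p x (v : 'I_p -> tangent x) :
  exists X : 'I_p -> vfield M, (fun i => X i x) = v.
Proof.
have /choice[X XE] i : exists X : vfield M, X x = v i by exact: (vfield_through chM hM).
by exists X; apply/funext.
Qed.

(** The differential is determined by the form: both values are given by the
    invariant formula. *)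
Lemma rD_uniq p U (a : rform M p) a' b' : rD U a a' -> rD U a b' ->
  forall x v, U x -> a' x v = b' x v.
Proof.
move=> ha hb x v Ux; have [ O [I [f [g [oO Ox sfg aE a'E]]]]] := ha x Ux.
have [P [J [f' [g' [oP Px sfg' aE' b'E]]]]] := hb x Ux.
rewrite a'E // b'E //; have [X <-] := vfields_through v.
rewrite !koszul_esum //; apply: (@rkoszul_local _ _ _ _ _ (O `&` P)).
- exact: openI.
- by [].
- by move=> y w [Oy Py]; rewrite -aE // aE'.
- by move=> Y; exact: esum_smooth.
- by move=> Y; exact: esum_smooth.
Qed.

Lemma rD_koszul p U (a : rform M p) a' (X : 'I_p.+1 -> vfield M) x : rD U a a' ->
  (forall Y : 'I_p -> vfield M, smooth (fun y => a y (fun i => Y i y))) -> U x ->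
  a' x (fun i => X i x) = rkoszul a X x.
Proof.
move=> ha sa Ux; have [ O [I [f [g [oO Ox sfg aE a'E]]]]] := ha x Ux.
rewrite a'E // koszul_esum //; apply/esym/(@rkoszul_local _ _ _ _ _ O) => // Y.
exact: esum_smooth.
Qed.

Lemma rDS p U V (a : rform M p) a' : V `<=` U -> rD U a a' -> rD V a a'.
Proof. by move=> VU h z /VU; exact: h. Qed.

Lemma rD_ext p U (a b : rform M p) a' b' : open U ->
  (forall x v, U x -> a x v = b x v) -> (forall x v, U x -> a' x v = b' x v) ->
  rD U a a' -> rD U b b'.
Proof.
move=> oU ab ab' h z Uz; have [ O [I [f [g [oO Oz sfg aE a'E]]]]] := h z Uz.
exists (O `&` U), I, f, g; split=> //; first exact: openI.
  by move=> x v [Ox Ux]; rewrite -ab // aE.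
by move=> x v [Ox Ux]; rewrite -ab' // a'E.
Qed.

Lemma rD0 p U : @rD p U (fun _ _ => 0) (fun _ _ => 0).
Proof.
move=> z Uz; exists setT, 'I_0, (fun _ _ => 0), (fun _ _ _ => 0); split=> //.
- exact: openT.
- by split; case.
- by move=> x v _; rewrite /esum big_ord0.
- by move=> x v _; rewrite /desum big_ord0.
Qed.

Section chart.
Variables (U : set M) (n : nat) (phi : M -> 'rV[R]_n) (psi : 'rV[R]_n -> M).
Hypothesis hc : is_chart U phi psi.

(** Forms in the coordinates of the chart, evaluated on constant fields. *)
Definition cform p := 'rV[R]_n -> ('I_p -> 'rV[R]_n) -> R.

Definition cform_of p (a : rform M p) : cform p :=
  fun w xi => a (psi w) (fun k => tvec hc (psi w) (xi k)).

Definition form_of p (B : cform p) : rform M p :=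
  fun x v => B (phi x) (fun k => dphi phi (v k)).

Definition cdif p (B : cform p) : cform p.+1 := fun w xi =>
  \sum_(i < p.+1) (-1) ^+ i * 'D_(xi i) (fun w => B w (fun k => xi (lift i k))) w.

Lemma cform_ofE p (a : rform M p) x xi : U x ->
  cform_of a (phi x) xi = a x (fun k => tvec hc x (xi k)).
Proof. by move=> Ux; rewrite /cform_of (chartK hc Ux). Qed.

Lemma cform_ofK p (a : rform M p) x v : U x ->
  cform_of a (phi x) (fun k => dphi phi (v k)) = a x v.
Proof.
move=> Ux; rewrite cform_ofE //; congr (a x _); apply/funext => k.
exact: (tvec_dphi chM hM hc).
Qed.

Lemma form_ofK p (B : cform p) w xi : (phi @` U) w -> cform_of (form_of B) w xi = B w xi.
Proof.
move=> /(chartV hc)[Uw wE]; rewrite /cform_of /form_of wE; congr B; apply/funext => k.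
exact: (dphi_tvec chM hM hc).
Qed.

Lemma cdif_near p (B C : cform p) Q w xi : open Q -> Q w ->
  (forall w xi, Q w -> B w xi = C w xi) -> cdif B w xi = cdif C w xi.
Proof.
move=> oQ Qw BC; apply: eq_bigr => i _; congr (_ * _); apply: near_eq_derive.
by apply: filterS (open_nbhs_nbhs (conj oQ Qw)) => y Qy; rewrite BC.
Qed.

Lemma chart_fields p (xi : 'I_p -> 'rV[R]_n) x : U x ->
  exists (X : 'I_p -> vfield M) O, [/\ open O, O x, O `<=` U &
    forall y k, O y -> X k y = tvec hc y (xi k)].
Proof.
move=> Ux; have /choice[X XE] k := vfield_ext chM hM hc (xi k) Ux.
have nX := nbhs_forall XE.
exists X, (U `&` interior [set y | forall k, X k y = tvec hc y (xi k)]); split.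
- by apply: openI; [exact: chart_open hc|exact: open_interior].
- by split=> //; exact: nX.
- by move=> y [].
- by move=> y k [_ /interior_subset].
Qed.

Lemma near_chart O x : open O -> O x -> U x -> \forall w \near phi x,
  O (psi w) /\ (phi @` U) w.
Proof.
move=> oO Ox Ux; apply: filterI; last first.
  by apply: open_nbhs_nbhs; split; [exact: chart_openI hc|exists x].
apply: (chartV_continuous hc); first by exists x.
by rewrite (chartK hc Ux); exact: open_nbhs_nbhs.
Qed.

Lemma cform_smooth p O (a : rform M p) xi : open O -> O `<=` U ->
  (forall z, O z -> exists P, [/\ open P, P z & forall X : 'I_p -> vfield M,
    exists2 h, smooth h & forall y, P y -> a y (fun i => X i y) = h y]) ->
  rV_smooth_on (phi @` O) (fun w => cform_of a w xi).
Proof.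
move=> oO OU h; have oI := chart_image_open hc oO OU.
suff : smooth_on O (fun y => a y (fun k => tvec hc y (xi k))).
  by move/(chart_smoothP hc _ oO OU); exact: rV_smooth_ext.
apply: smooth_on_cover => // z Oz.
have [P [oP Pz hP]] := h z Oz; have [X [Q [oQ Qz QU XE]]] := chart_fields xi (OU _ Oz).
have [h1 sh hE] := hP X; have oPQ := openI oP oQ.
exists (P `&` Q); split=> //; apply: (@smooth_on_ext _ _ _ h1) => //.
  move=> y [Py Qy]; rewrite -hE //; congr (a y _); apply/funext => k; exact: XE.
by apply: smooth_onS sh => //; exact: openT.
Qed.

Lemma tvec_lin x b t s : U x -> tvec hc x (b *: t + s) = b *: tvec hc x t + tvec hc x s.
Proof.
move=> Ux; rewrite -[RHS](tvec_dphi chM hM hc) //; congr (tvec hc x _).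
apply: (can_inj (fun xi => dphi_tvec chM hM hc xi Ux)).
apply: tangent_eq => F sF; rewrite (tvec_dphi chM hM hc) //.
have sFx := smooth_atE x sF.
have [Q [oQ Qx QU _ FQ]] := smooth_at_chart hc Ux sFx.
have oI := chart_image_open hc oQ QU.
rewrite tapp_scale !(tapp_tvec hc) //.
rewrite !(derive_coords oI _ FQ (imageP phi Qx)) mulr_sumr -big_split /=.
by apply: eq_bigr => i _; rewrite !mxE mulrDl mulrA.
Qed.

Lemma cform_ralt p (a : rform M p) x : U x -> ralt (a x) -> ralt (cform_of a (phi x)).
Proof.
move=> Ux [h1 h2].
have upd v i t : (fun k => tvec hc x (update v i t k)) =
    update (fun k : 'I_p => tvec hc x (v k)) i (tvec hc x t).
  by apply/funext => k; rewrite /update; case: eqP.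
split=> [i v b t t'|v i j ij vij]; rewrite !cform_ofE //.
  have E t0 := congr1 (a x) (upd v i t0).
  rewrite (E (b *: t + t')) (E t) (E t') tvec_lin //; exact: h1.
by apply: (h2 _ i j ij); rewrite vij.
Qed.

(** In a chart the bracket terms of the invariant formula vanish for constant
    fields. *)
Lemma chart_dif p O (a : rform M p) a' : open O -> O `<=` U -> rD O a a' ->
  [/\ forall xi, rV_smooth_on (phi @` O) (fun w => cform_of a w xi),
      forall w, (phi @` O) w -> ralt (cform_of a w) &
      forall w xi, (phi @` O) w -> cform_of a' w xi = cdif (cform_of a) w xi].
Proof.
move=> oO OU ha; split.
- move=> xi; apply: cform_smooth => // z Oz.
  have [P [I [f [g [oP Pz sfg aE _]]]]] := ha z Oz; exists P; split=> // X.
  exists (fun y => esum f g (fun i => X i y)); first exact: esum_smooth.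
  by move=> y Py; rewrite aE.
- move=> w [x Ox <-]; have [P [I [f [g [oP Px sfg aE _]]]]] := ha x Ox.
  apply: cform_ralt; first exact: OU.
  by rewrite (_ : a x = esum f g (x := x)); [exact: esum_ralt|apply/funext => v; exact: aE].
- move=> w xi [x Ox <-]; have [P [I [f [g [oP Px sfg aE a'E]]]]] := ha x Ox.
  have Ux := OU _ Ox; have [X [Q [oQ Qx QU XE]]] := chart_fields xi Ux.
  rewrite cform_ofE // a'E // (_ : (fun k => _) = (fun k => X k x)); last first.
    by apply/funext => k; rewrite XE.
  rewrite koszul_esum // /rkoszul [X in _ + X]big1 ?addr0.
    apply: eq_bigr => i _; congr (_ * _); rewrite XE // (tapp_tvec hc) //; last first.
      exact: (esum_smooth (fun k => X (lift i k)) sfg).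
    apply: near_eq_derive; apply: filterS (near_chart (openI oP oQ) (conj Px Qx) Ux).
    move=> w' [[Pw Qw] Uw] /=; rewrite /cform_of aE //; congr (esum f g _).
    by apply/funext => k; rewrite XE.
  move=> i _; rewrite big1 // => j ij.
  have br : bracket (X i) (X j) x = 0.
    apply: tangent_eq => F sF.
    rewrite (_ : tapp 0 F = 0) // -[LHS]/(bracket_fun (X i) (X j) x F) /bracket_fun.
    have sFx := smooth_atE x sF.
    have [P1 [oP1 P1x P1U _ FP]] := smooth_at_chart hc Ux sFx.
    have oI := chart_image_open hc oP1 P1U.
    have D k l : tapp (X k x) (vapp (X l) F) =
        'D_(xi k) ('D_(xi l) (F \o psi)) (phi x).
      rewrite XE // (tapp_tvec hc) //; last exact: vfield_smooth.
      apply: near_eq_derive; apply: filterS (near_chart oQ Qx Ux) => w' [Qw Uw].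
      have [Uw' wE] := chartV hc Uw.
      by rewrite /= /vapp XE // (tapp_tvec hc) // wE.
    by rewrite !D (clairaut oI _ _ FP (imageP phi P1x)) subrr.
  have [k kE] : exists k, lift j k = i.
    have /unlift_some[k kE _] : j != i by apply: contraTneq ij => ->; rewrite ltnn.
    by exists k.
  set v := (fun _ => _ : tangent x).
  have -> : v = update v k 0 :> ('I_p -> tangent x).
    apply/funext => l; rewrite /update; case: eqP => // ->.
    by rewrite /v kE eqxx br.
  by rewrite (ralt0 (esum_ralt f g x)) mulr0.
Qed.

(** The coordinates, cut off so as to be global functions, and ralt_expand give an
    expression of the form by elementary ones; its differential is then computed
    by chart_dif. *)
Lemma form_of_dif p (B : cform p) : (forall xi, rV_smooth_on (phi @` U) (fun w => B w xi)) ->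
  (forall w, (phi @` U) w -> ralt (B w)) -> rD U (form_of B) (form_of (cdif B)).
Proof.
move=> sB altB z Uz; have oU := chart_open hc.
have [r [sr [V [V0 [[oV oV0] Vz UV0 r1 r0]]]]] := bump_at chM hM oU Uz.
pose f (h : {ffun 'I_p -> 'I_n}) y :=
  r y * (p`!%:R^-1 * B (phi y) ((fun i => evec R i) \o h)).
pose g (h : {ffun 'I_p -> 'I_n}) (l : 'I_p) y := r y * phi y 0 (h l).
have sc i := chart_coord hc i.
have sfg : smooth_data f g.
  split=> [h|h l]; last exact: smooth_cut oU oV0 UV0 sr r0 (sc (h l)).
  apply: (smooth_cut oU oV0 UV0 sr r0); apply: smooth_onM => //; first exact: smooth_on_cst.
  apply: (smooth_on_comp_rV chM oU (chart_openI hc) (sB _)) => //.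
have oVU := openI oV oU.
have aE (x : M) (v : 'I_p -> tangent x) : (V `&` U) x -> form_of B v = esum f g v.
  move=> [Vx Ux]; rewrite /form_of (ralt_expand (b := fun i => evec R i) (xi := fun i (w : 'rV[R]_n) => w 0 i)).
  - apply: eq_bigr => h _; rewrite /elem /f r1 // mul1r; congr (_ * \det _).
    apply/matrixP => k l; rewrite !mxE; apply: (gtappE chM hM); first exact: sfg.2.
    by apply: filterS (open_nbhs_nbhs (conj oV Vx)) => y /r1 h1; rewrite /g h1 mul1r.
  - by apply: altB; exists x.
  - by move=> i a t t'; rewrite !mxE.
  - by move=> w; exact: evecE.
  - by move=> i j; rewrite !mxE eqxx eq_sym.
exists (V `&` U), _, f, g; split=> // x v VUx; have [Vx Ux] := VUx.
have h : rD (V `&` U) (form_of B) (desum f g).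
  by move=> y VUy; exists (V `&` U), _, f, g; split.
have VU' : V `&` U `<=` U by move=> y [].
have [_ _ hd] := chart_dif oVU VU' h.
have Ix : (phi @` (V `&` U)) (phi x) by exists x.
rewrite -[RHS](cform_ofK (desum f g) v Ux) hd // /form_of.
apply: (cdif_near (Q := phi @` (V `&` U))) => //.
- exact: (chart_image_open hc).
- by move=> w xi [y [_ Uy] <-]; rewrite form_ofK //; exists y.
Qed.

(** The homotopy formula: contract the form with the radial field and integrate
    along the segments from w0. *)
Lemma real_poincare p w0 (a : rform M p.+1) : star_shaped w0 (phi @` U) ->
  rD U a (fun _ _ => 0) -> exists b, rD U b a.
Proof.
set Q := phi @` U => stQ da; have oQ : open Q := chart_openI hc.
have oU := chart_open hc.
have [sW altW dW] := chart_dif oU (@subset_refl _ U) da.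
set W := cform_of a in sW altW dW.
pose Wi i eta w := W w (fcons (evec R i) eta).
have sWi i eta : rV_smooth_on Q (Wi i eta) by exact: sW.
pose B : cform p := fun w eta => \sum_i (w - w0) 0 i * star_int w0 p (Wi i eta) w.
have sS k F : rV_smooth_on Q F -> rV_smooth_on Q (star_int w0 k F).
  exact: star_int_smooth.
have fcons_update (zeta : 'rV[R]_n) (eta : 'I_p -> 'rV[R]_n) : forall t,
    fcons t eta = update (fcons zeta eta) ord0 t.
  move=> t; apply/funext => k; rewrite /update; case: (unliftP ord0 k) => [j ->|->].
    by rewrite !fconsS (_ : (_ == _) = false) // eq_sym (negbTE (neq_lift _ _)).
  by rewrite fcons0 eqxx.
have Wcons w (zeta : 'rV[R]_n) eta : Q w -> W w (fcons zeta eta) = \sum_i zeta 0 i * Wi i eta w.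
  move=> Qw; rewrite (fcons_update 0) {1}(evecE zeta) (ralt_sum (altW w Qw)).
  by apply: eq_bigr => i _; rewrite -fcons_update.
have cW F : rV_smooth_on Q F -> forall x, Q x -> {for x, continuous F}.
  by move=> sF x; exact: rV_smooth_continuous.
have Icons k w (zeta : 'rV[R]_n) eta : Q w -> star_int w0 k (fun y => W y (fcons zeta eta)) w =
    \sum_i zeta 0 i * star_int w0 k (Wi i eta) w.
  move=> Qw; rewrite -(star_int_sum stQ) //; last by move=> i; exact/cW.
  apply: eq_Rintegral => t; rewrite inE /= in_itv /= => t01; congr (_ * _).
  by rewrite Wcons //; exact: stQ.
have sB eta : rV_smooth_on Q (fun w => B w eta).
  apply: rV_smooth_sum => // i; apply: rV_smoothM => //; last exact: sS.
  apply: (@rV_smooth_ext _ _ _ oQ (fun w : 'rV[R]_n => w 0 i + - w0 0 i)).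
    by move=> w _; rewrite !mxE.
  by apply: rV_smoothD => //; [exact: rV_smooth_coord|exact: rV_smooth_cst].
have BE w eta : Q w -> B w eta = star_int w0 p (fun y => W y (fcons (w - w0) eta)) w.
  by move=> Qw; rewrite Icons.
have fcu (zeta : 'rV[R]_n) (eta : 'I_p -> 'rV[R]_n) i t :
    fcons zeta (update eta i t) = update (fcons zeta eta) (lift ord0 i) t.
  apply/funext => k; rewrite /update; case: (unliftP ord0 k) => [j ->|->].
    by rewrite !fconsS (inj_eq (@lift_inj _ ord0)).
  by rewrite !fcons0 (negbTE (neq_lift _ _)).
have altB w : Q w -> ralt (B w).
  move=> Qw; split=> [i v b t t'|v i j ij vij].
    rewrite !BE //; rewrite -(star_intZ stQ) //; last exact/cW/sW.
    rewrite -(star_intD stQ) //; last 2 first.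
    - by apply: cW; apply: rV_smoothM => //; exact: rV_smooth_cst.
    - exact/cW/sW.
    apply: eq_Rintegral => s; rewrite inE /= in_itv /= => s01; congr (_ * _).
    by rewrite !fcu; have [-> _] := altW _ (stQ w s Qw s01).
  rewrite BE // (_ : star_int w0 p _ w = star_int w0 p (fun=> 0 * 0) w).
    by rewrite (@star_intZ _ _ _ _ stQ p 0 (fun=> 0)) ?mul0r // => y _; exact: continuous_cst.
  apply: eq_Rintegral => s; rewrite inE /= in_itv /= => s01; congr (_ * _).
  have [_ h] := altW _ (stQ w s Qw s01); rewrite mul0r.
  by apply: (h _ (lift ord0 i) (lift ord0 j)); rewrite ?(inj_eq (@lift_inj _ ord0)) // !fconsS.
exists (form_of B); have := form_of_dif sB altB; apply: rD_ext => // x v Ux.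
rewrite -[RHS](cform_ofK a v Ux) -/W /form_of.
have Qx : Q (phi x) by exists x.
move: (phi x) Qx (fun k => dphi phi (v k)) => w Qw xi {x v Ux}.
(* The derivative of the contracted form: one term from the radial field and one
   from the coefficients. *)
have DB (zeta : 'rV[R]_n) eta : 'D_zeta (fun w => B w eta) w =
    star_int w0 p (fun y => W y (fcons zeta eta)) w +
    star_int w0 p.+1 ('D_zeta (fun y => W y (fcons (w - w0) eta))) w.
  rewrite Icons // (_ : star_int w0 p.+1 _ w =
      \sum_i (w - w0) 0 i * star_int w0 p.+1 ('D_zeta (Wi i eta)) w).
    rewrite -big_split /=.
    have dS i := is_derive_star_int oQ stQ p zeta (sWi i eta) Qw.
    have dc i : is_derive w zeta (fun y : 'rV[R]_n => (y - w0) 0 i) (zeta 0 i).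
      rewrite (_ : (fun y => _) = (fun y : 'rV[R]_n => y 0 i + - w0 0 i)); last first.
        by apply/funext => y; rewrite !mxE.
      rewrite -[zeta 0 i]addr0.
      exact: (is_deriveD (is_derive_coord i w zeta) (is_derive_cst (- w0 0 i) w zeta)).
    have dP i := is_deriveM (dc i) (dS i).
    rewrite (_ : (fun w => B w eta) = \sum_i
       ((fun y : 'rV[R]_n => (y - w0) 0 i) * star_int w0 p (Wi i eta))); last first.
      by apply/funext => y; rewrite fct_sumE.
    rewrite derive_sum; last by move=> i; have [] := dP i.
    apply: eq_bigr => i _; have [_ ->] := dP i.
    by rewrite addrC; congr (_ + _); exact: mulrC.
  rewrite -(star_int_sum stQ) //; last by move=> i; apply: cW; exact: rV_smooth_D.
  apply: eq_Rintegral => t; rewrite inE /= in_itv /= => t01; congr (_ * _).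
  have Qt := stQ w t Qw t01; move: (t *: _ + _) Qt => y Qy.
  have -> : 'D_zeta (fun y0 => W y0 (fcons (w - w0) eta)) y =
      'D_zeta (\sum_i (w - w0) 0 i *: Wi i eta) y.
    apply: near_eq_derive; apply: filterS (open_nbhs_nbhs (conj oQ Qy)) => y' Qy'.
    by rewrite Wcons // fct_sumE.
  rewrite derive_sum; last first.
    by move=> i; apply: derivableZ; exact: (@rV_smooth_derivable R n Q _ y zeta (sWi i eta) Qy).
  apply: eq_bigr => i _.
  by rewrite (deriveZ _ (@rV_smooth_derivable R n Q _ y zeta (sWi i eta) Qy)).
rewrite /cdif; under eq_bigr do rewrite DB mulrDr.
rewrite big_split /=.
(* The first terms add up to (p + 1) W as W is alternating, and the second ones
   to the radial derivative of W as W is closed; star_FTC adds the two. *)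
have -> : \sum_(i < p.+1) (-1) ^+ i *
    star_int w0 p (fun y => W y (fcons (xi i) (fun k => xi (lift i k)))) w =
    p.+1%:R * star_int w0 p (W ^~ xi) w.
  rewrite (eq_bigr (fun=> star_int w0 p (W ^~ xi) w)); last first.
    move=> i _; rewrite -(star_intZ stQ) //; last exact/cW/sW.
    apply: eq_Rintegral => t; rewrite inE /= in_itv /= => t01; congr (_ * _).
    by rewrite (ralt_front xi i (altW _ (stQ w t Qw t01))) signrMK.
  by rewrite sumr_const card_ord mulr_natl.
have -> : \sum_(i < p.+1) (-1) ^+ i * star_int w0 p.+1
      ('D_(xi i) (fun y => W y (fcons (w - w0) (fun k => xi (lift i k))))) w =
    star_int w0 p.+1 ('D_(w - w0) (W ^~ xi)) w.
  rewrite -(star_int_sum stQ) //; last by move=> i; apply: cW; apply: rV_smooth_D; exact: sW.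
  apply: eq_Rintegral => t; rewrite inE /= in_itv /= => t01; congr (_ * _).
  have Qt := stQ w t Qw t01; move: (t *: _ + _) Qt => y Qy.
  have := dW y (fcons (w - w0) xi) Qy; rewrite /cdif big_ord_recl /= expr0 mul1r fcons0.
  rewrite (_ : (fun _ => fcons _ _ (lift ord0 _)) = xi); last by apply/funext => k; rewrite fconsS.
  move=> /esym/eqP; rewrite addr_eq0 => /eqP ->; rewrite -sumrN; apply: eq_bigr => i _.
  have -> : (fun k => fcons (w - w0) xi (lift (lift ord0 i) k)) =
      fcons (w - w0) (fun k => xi (lift i k)).
    apply/funext => k; case: (unliftP ord0 k) => [j ->|->]; last first.
      rewrite fcons0 (_ : lift (lift ord0 i) ord0 = ord0) ?fcons0 //.
      exact: val_inj.
    rewrite fconsS (_ : lift (lift ord0 i) (lift ord0 j) = lift ord0 (lift i j)) ?fconsS //.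
    by apply: val_inj; rewrite /= !bumpS.
  by rewrite fconsS /bump /= add1n exprS mulN1r mulNr opprK.
by have := star_FTC stQ p.+1 (sW xi) Qw; rewrite /= expr0n /= mul0r subr0.
Qed.

(** A function is recovered from its derivatives by integration along segments. *)
Lemma real_poincare0 w0 (a : rform M 0) : star_shaped w0 (phi @` U) ->
  rD U a (fun _ _ => 0) -> exists k, forall x v, U x -> a x v = k.
Proof.
set Q := phi @` U => stQ da; have oU := chart_open hc.
have [sW _ dW] := chart_dif oU (@subset_refl _ U) da.
set W := cform_of a in sW dW.
exists (W w0 (fun=> 0)) => x v Ux.
have Qx : Q (phi x) by exists x.
have := star_FTC stQ 0 (sW (fun=> 0)) Qx; rewrite mul0r add0r expr0 mul1r.
have v0 (T : Type) (h h' : 'I_0 -> T) : h = h' by apply/funext; case.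
rewrite (_ : star_int w0 0 _ (phi x) = star_int w0 0 (fun=> 0 * 0) (phi x)).
  rewrite (@star_intZ _ _ _ _ stQ 0 0 (fun=> 0)) ?mul0r //; last by move=> y _; exact: continuous_cst.
  move/esym/eqP; rewrite subr_eq0 => /eqP <-; rewrite -[LHS](cform_ofK a v Ux) -/W.
  by congr W; exact: v0.
apply: eq_Rintegral => t; rewrite inE /= in_itv /= => t01; rewrite mul0r; congr (_ * _).
have := dW _ (fun=> phi x - w0) (stQ _ t Qx t01).
rewrite /cdif big_ord_recl big_ord0 addr0 expr0 mul1r => E.
by rewrite (v0 _ (fun=> (0 : 'rV[R]_n)) (fun=> phi x - w0)) -E.
Qed.

End chart.

(** In a chart, the coefficients of a on the coordinate fields are smooth, so that
    form_of_dif applies. *)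
Lemma alt_rD p (a : rform M p) z : (forall x, ralt (a x)) ->
  (forall X : 'I_p -> vfield M, smooth (fun x => a x (fun i => X i x))) ->
  exists U a', [/\ open U, U z & rD U a a'].
Proof.
move=> alta sa; have [U [n [phi [psi [hc Uz]]]]] := chM z.
have oU := chart_open hc; have UU := @subset_refl _ U.
have h : rD U (form_of phi (cform_of hc a)) (form_of phi (cdif (cform_of hc a))).
  apply: (form_of_dif hc).
    move=> xi; apply: cform_smooth => // y Uy; exists setT; split=> //; first exact: openT.
    by move=> X; exists (fun y => a y (fun i => X i y)).
  by move=> w [x Ux <-]; exact: cform_ralt.
exists U, (form_of phi (cdif (cform_of hc a))); split=> //.
by apply: rD_ext h => // x v Ux; rewrite /form_of cform_ofK.
Qed.

(** A form for which the invariant formula makes sense has local elementary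
    expressions, whose differential satisfies the same formula. *)
Lemma koszul_rD p (a : rform M p) (b : rform M p.+1) : (forall x, ralt (a x)) ->
  (forall X : 'I_p -> vfield M, smooth (fun x => a x (fun i => X i x))) ->
  (forall (X : 'I_p.+1 -> vfield M) x, b x (fun i => X i x) = rkoszul a X x) ->
  rD setT a b.
Proof.
move=> alta sa bE z _; have [U [a' [oU Uz h]]] := alt_rD z alta sa.
suff : rD U a b by apply.
have h' := h; apply: rD_ext h' => // x v Ux; have [X <-] := vfields_through v.
by rewrite bE; exact: (rD_koszul X h sa Ux).
Qed.

End real_forms.

(** * Local systems and forms with coefficients *)

Section real_scalars.
Variables (R : realType) (c : coef).
Let K : fieldType := coef_field R c.

Definition rinj (a : R) : coef_field R c := mkcoef c a 0.

Fact rinj_zmod_morphism : zmod_morphism rinj.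
Proof.
rewrite /rinj; case: c => x y //=.
by apply/eqP; rewrite eq_complex /= subr0 !eqxx.
Qed.
HB.instance Definition _ := GRing.isZmodMorphism.Build R (coef_field R c) rinj
  rinj_zmod_morphism.

Fact rinj_monoid_morphism : monoid_morphism rinj.
Proof.
rewrite /rinj; split; case: c => // x y /=.
by apply/eqP; rewrite eq_complex /= !mulr0 !mul0r subr0 addr0 !eqxx.
Qed.
HB.instance Definition _ := GRing.isMonoidMorphism.Build R (coef_field R c) rinj
  rinj_monoid_morphism.

Definition iunit : K := mkcoef c 0 1.

Lemma coef_decomp (z : K) : z = rinj (repart z) + rinj (impart z) * iunit.
Proof.
rewrite /rinj /iunit /K in z *; case: c z => [z|[a b]] /=; first by rewrite mul0r addr0.
by apply/eqP; rewrite eq_complex /= !mulr0 !mul0r !mulr1 subrr addr0 addr0 add0r !eqxx.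
Qed.

Lemma repart_rinj_lin a (z w : K) : repart (rinj a * z + w) = a * repart z + repart w.
Proof.
rewrite /rinj /K in z w *; case: c z w => [z w|[x y] [x' y']] //=.
by rewrite mul0r subr0.
Qed.

Lemma impart_rinj_lin a (z w : K) : impart (rinj a * z + w) = a * impart z + impart w.
Proof.
rewrite /rinj /K in z w *; case: c z w => [z w|[x y] [x' y']] //=.
  by rewrite mulr0 addr0.
by rewrite mul0r addr0.
Qed.

Lemma repart_rinj a : repart (rinj a) = a.
Proof. by rewrite /rinj; case: c. Qed.

Lemma impart_rinj a : impart (rinj a) = 0.
Proof. by rewrite /rinj; case: c. Qed.

End real_scalars.

Arguments rinj {R} c a.

Lemma locally_constantS (M : topologicalType) (T : Type) (U V : set M) (f : M -> T) :
  V `<=` U -> locally_constant U f -> locally_constant V f.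
Proof. by move=> VU h x /VU; exact: h. Qed.

Lemma locally_constant_comp (M : topologicalType) (T T' : Type) (U : set M)
  (f : M -> T) (g : T -> T') : locally_constant U f -> locally_constant U (g \o f).
Proof. by move=> h x /h; apply: filterS => y /= ->. Qed.

Lemma locally_constant_op2 (M : topologicalType) (T1 T2 T' : Type) (U : set M)
  (f : M -> T1) (f' : M -> T2) (g : T1 -> T2 -> T') : locally_constant U f ->
  locally_constant U f' -> locally_constant U (fun x => g (f x) (f' x)).
Proof. by move=> h h' x Ux; apply: filterS2 (h x Ux) (h' x Ux) => y -> ->. Qed.

Lemma locally_constant_ext (M : topologicalType) (T : Type) (U : set M) (f g : M -> T) :
  open U -> (forall x, U x -> f x = g x) -> locally_constant U f -> locally_constant U g.
Proof.
move=> oU fg h x Ux; have nU : nbhs x U by exact: open_nbhs_nbhs.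
by apply: filterS2 nU (h x Ux) => y Uy; rewrite -!fg.
Qed.

Lemma sect_scale (K : fieldType) (M : topologicalType) (L : local_system K M) (U : set M)
    (k : M -> K) (s : forall x, L x) : open U -> locally_constant U k -> sect U s ->
  sect U (fun x => k x *: s x).
Proof.
move=> oU kU sU; apply/sect_local => // x Ux.
have [V [n [phi [oV Vx bij P]]]] := stalk_trivial L x.
have oW : open (U `&` V) by exact: openI.
have WV : U `&` V `<=` V by move=> y [].
have WU : U `&` V `<=` U by move=> y [].
have /(P _ _ oW WV)[f [fW sf]] := sectS oU oW WU sU.
exists (U `&` V), (fun y => k y *: s y); split=> //; apply/(P _ _ oW WV).
exists (fun y => k y *: f y); split; last by move=> y Wy; rewrite linearZ sf.
apply: (locally_constant_op2 (fun a b => a *: b)) fW; exact: locally_constantS kU.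
Qed.

Section flat_frames.
Variables (R : realType) (c : coef) (M : topologicalType).
Let K : fieldType := coef_field R c.
Variable L : local_system K M.

(** Flat sections t_i that generate the stalks over the real numbers, with a
    choice of coordinates that is linear, and locally constant on flat sections.
    They reduce forms with coefficients to real forms.  The t_i may be dependent. *)
Definition flat_frame U (J : finType) (t : J -> forall x, L x)
    (co : J -> forall x, L x -> R) :=
  [/\ open U, forall i, sect U (t i),
      forall i x a l l', U x -> co i x (rinj c a *: l + l') = a * co i x l + co i x l',
      forall x l, U x -> l = \sum_i rinj c (co i x l) *: t i x &
      forall O s i, open O -> O `<=` U -> sect O s ->
        locally_constant O (fun x => co i x (s x))].

Lemma flat_frameS U V J t co : open V -> V `<=` U -> @flat_frame U J t co ->
  @flat_frame V J t co.
Proof.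
move=> oV VU [oU tU col cob coc]; split=> //.
- by move=> i; exact: sectS (tU i).
- by move=> i x a l l' /VU; exact: col.
- by move=> x l /VU; exact: cob.
- by move=> O s i oO OV; apply: coc => //; exact: subset_trans VU.
Qed.

(** A trivialization of L over U, with its inverse. *)
Definition kframe U N (phi : forall y, {linear 'rV[K]_N -> L y}) (inv : forall y, L y -> 'rV[K]_N) :=
  [/\ open U, forall y, U y -> cancel (phi y) (inv y) /\ cancel (inv y) (phi y) &
      forall W s, open W -> W `<=` U -> (sect W s <-> exists f : M -> 'rV[K]_N,
        locally_constant W f /\ forall y, W y -> s y = phi y (f y))].

Lemma kframe_at x : exists U N phi inv, @kframe U N phi inv /\ U x.
Proof.
have [U [n [phi [oU Ux bij P]]]] := stalk_trivial L x.
have /dep_choice[inv invP] y : exists h : L y -> 'rV[K]_n, U y -> cancel (phi y) h /\ cancel h (phi y).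
  have [Uy|nUy] := pselect (U y); last by exists (fun=> 0).
  by have [h h1 h2] := bij y Uy; exists h.
by exists U, n, phi, inv.
Qed.

Lemma kframeS U V N phi inv : open V -> V `<=` U -> @kframe U N phi inv -> @kframe V N phi inv.
Proof.
move=> oV VU [oU invP P]; split=> // [y /VU|W s oW WV]; first exact: invP.
by apply: P => //; exact: subset_trans VU.
Qed.

Lemma kframe_inv_lin U N phi inv y a l l' : @kframe U N phi inv -> U y ->
  inv y (a *: l + l') = a *: inv y l + inv y l'.
Proof.
move=> [_ invP _] Uy; have [h1 h2] := invP y Uy.
by apply: (can_inj h1); rewrite h2 linearP !h2.
Qed.

Lemma kframe_sect U N phi inv (k : 'rV[K]_N) : @kframe U N phi inv -> sect U (fun y => phi y k).
Proof.
move=> [oU _ P]; apply/P => //; exists (fun=> k); split=> // y _; exact: nearW.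
Qed.

(** A K-basis (k_j) gives the generators k_j and i k_j over the reals; when K is
    the field of real numbers, i is read as 0 and so is the imaginary part. *)
Lemma kframe_flat U N phi inv : @kframe U N phi inv ->
  exists (J : finType) (k : J -> 'rV[K]_N) co, @flat_frame U J (fun j y => phi y (k j)) co.
Proof.
move=> hk; have [oU invP P] := hk.
exists ('I_N * bool)%type, (fun i => (if i.2 then iunit R c else 1) *: delta_mx 0 i.1).
exists (fun i y l => (if i.2 then (@impart R c) else (@repart R c)) (inv y l 0 i.1)).
split=> //.
- by move=> i; exact: kframe_sect hk.
- move=> [i b] y a l l' Uy; rewrite (kframe_inv_lin _ _ _ hk Uy).
  by case: b; rewrite !mxE /= ?impart_rinj_lin ?repart_rinj_lin.
- move=> y l Uy; have [h1 h2] := invP y Uy.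
  rewrite -[LHS]h2 {1}[inv y l]row_sum_delta linear_sum /=.
  rewrite -(pair_bigA _ (fun i b => rinj c
      ((if b then (@impart R c) else (@repart R c)) (inv y l 0 i)) *:
      phi y ((if b then iunit R c else 1) *: delta_mx 0 i))) /=.
  apply: eq_bigr => i _; rewrite big_bool /= !linearZ /= scale1r addrC scalerA -scalerDl [iunit R c * _]mulrC.
  by rewrite -coef_decomp.
- move=> O s [i b] oO OU /(P _ _ oO OU)[f [fO sf]].
  have E y : O y -> inv y (s y) = f y by move=> Oy; have [h1 _] := invP y (OU _ Oy); rewrite sf.
  apply: (@locally_constant_ext _ _ _ (fun y => (if b then (@impart R c) else (@repart R c)) (f y 0 i))) => //.
    by move=> y Oy; rewrite E.
  exact: (locally_constant_comp (fun w : 'rV[K]_N => (if b then (@impart R c) else (@repart R c)) (w 0 i)) fO).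
Qed.

Lemma flat_frame_at x : exists U J t co, @flat_frame U J t co /\ U x.
Proof.
have [U [N [phi [inv [hk Ux]]]]] := kframe_at x.
by have [J [k [co hf]]] := kframe_flat hk; exists U, J, (fun j y => phi y (k j)), co.
Qed.

Section coordinates.
Variables (U : set M) (J : finType) (t : J -> forall x, L x) (co : J -> forall x, L x -> R).
Hypothesis hf : flat_frame U t co.

Lemma frame_coD i x l l' : U x -> co i (l + l' : L x) = co i l + co i l'.
Proof.
move=> Ux; have [_ _ h _ _] := hf.
by have := h i x 1 l l' Ux; rewrite rmorph1 scale1r mul1r.
Qed.

Lemma frame_co0 i x : U x -> co i (0 : L x) = 0.
Proof.
move=> Ux; have := frame_coD i 0 (0 : L x) Ux; rewrite addr0 => /eqP.
by rewrite -subr_eq0 opprD addrA subrr sub0r oppr_eq0 => /eqP.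
Qed.

Lemma frame_coZ i x a l : U x -> co i (rinj c a *: l : L x) = a * co i l.
Proof.
by move=> Ux; have [_ _ h _ _] := hf; have := h i x a l 0 Ux; rewrite addr0 frame_co0 // addr0.
Qed.

Lemma frame_co_sum i x (I : finType) (l : I -> L x) : U x ->
  co i (\sum_j l j) = \sum_j co i (l j).
Proof.
move=> Ux; apply: (big_morph (co i (x := x))); last exact: frame_co0.
by move=> l1 l2; exact: frame_coD.
Qed.

End coordinates.

End flat_frames.

Section forms_with_coefficients.
Variables (R : realType) (c : coef) (M : fspace R).
Hypotheses (chM : charted M) (hM : hausdorff_space M).
Let K : fieldType := coef_field R c.
Implicit Types (U V O : set M).

Section coefficients.
Variable L : local_system K M.
Implicit Types (p : nat).

Definition lsum p (I : finType) (f : I -> M -> R) (g : I -> 'I_p -> M -> R)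
    (s : I -> forall x, L x) : pform L p :=
  fun x v => \sum_j rinj c (elem (f j) (g j) v) *: s j x.

Definition dlsum p (I : finType) (f : I -> M -> R) (g : I -> 'I_p -> M -> R)
    (s : I -> forall x, L x) : pform L p.+1 :=
  fun x v => \sum_j rinj c (delem (f j) (g j) v) *: s j x.

(** w' is the differential of w over U: locally they are sums of f dg_1 ... dg_p s
    and df dg_1 ... dg_p s with s flat. *)
Definition LD p U (w : pform L p) (w' : pform L p.+1) := forall z, U z ->
  exists O (I : finType) (f : I -> M -> R) (g : I -> 'I_p -> M -> R)
    (s : I -> forall x, L x),
  [/\ open O /\ O z, smooth_data f g, forall j, sect O (s j),
      forall x v, O x -> w x v = lsum f g s v &
      forall x v, O x -> w' x v = dlsum f g s v].

Lemma LDS p U V (w : pform L p) w' : V `<=` U -> LD U w w' -> LD V w w'.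
Proof. by move=> VU h z /VU; exact: h. Qed.

Lemma LD_cover p U (w : pform L p) w' :
  (forall z, U z -> exists2 O, O z & LD O w w') -> LD U w w'.
Proof. by move=> h z /h[ O Oz]; apply. Qed.

Lemma LD_ext p U (w v : pform L p) w' v' : open U -> (forall x, U x -> w x = v x) ->
  (forall x, U x -> w' x = v' x) -> LD U w w' -> LD U v v'.
Proof.
move=> oU wv wv' h z Uz; have [ O [I [f [g [s [[oO Oz] sfg sO wE w'E]]]]]] := h z Uz.
have oOU := openI oO oU.
exists (O `&` U), I, f, g, s; split=> //.
- by move=> j; apply: sectS (sO j) => // x [].
- by move=> x y [Ox Ux]; rewrite -wv // wE.
- by move=> x y [Ox Ux]; rewrite -wv' // w'E.
Qed.

Lemma LD00 p U : LD U (0 : pform L p) 0.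
Proof.
move=> z Uz; exists setT, 'I_0, (fun _ _ => 0), (fun _ _ _ => 0), (fun _ _ => 0); split=> //.
- by split=> //; exact: openT.
- by split; case.
- by case.
- by move=> x v _; rewrite /lsum big_ord0.
- by move=> x v _; rewrite /dlsum big_ord0.
Qed.

Lemma LDL p U k (w v : pform L p) w' v' : LD U w w' -> LD U v v' ->
  LD U (k *: w + v) (k *: w' + v').
Proof.
move=> h h' z Uz; have [ O [I [f [g [s [[oO Oz] [sf sg] sO wE w'E]]]]]] := h z Uz.
have [P [I' [f1 [g1 [s1 [[oP Pz] [sf1 sg1] sP vE v'E]]]]]] := h' z Uz.
have oOP := openI oO oP.
pose F j := match j with inl i => f i | inr i => f1 i end.
pose G j := match j with inl i => g i | inr i => g1 i end.
pose S j : forall x, L x := match j with inl i => fun x => k *: s i x | inr i => s1 i end.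
exists (O `&` P), (I + I')%type, F, G, S; split=> //.
- by split; case.
- case=> j /=; last by apply: sectS (sP j) => // x [].
  have OPO : O `&` P `<=` O by move=> x [].
  apply: (sectS oO oOP OPO).
  by apply: sect_scale => // x _; exact: nearW.
- move=> x y [Ox Px]; rewrite /lsum big_sumType /= -[LHS]/(k *: w x y + v x y) wE // vE //.
  congr (_ + _); rewrite scaler_sumr; apply: eq_bigr => j _.
  by rewrite !scalerA mulrC.
- move=> x y [Ox Px]; rewrite /dlsum big_sumType /= -[LHS]/(k *: w' x y + v' x y) w'E // v'E //.
  congr (_ + _); rewrite scaler_sumr; apply: eq_bigr => j _.
  by rewrite !scalerA mulrC.
Qed.

Lemma LDB p U (w v : pform L p) w' v' : LD U w w' -> LD U v v' ->
  LD U (w - v) (w' - v').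
Proof.
move=> h h'; have := LDL (-1) h' h; rewrite !scaleN1r.
by rewrite addrC [- v' + _]addrC.
Qed.

Lemma LD_sum p U (I : finType) (w : I -> pform L p) w' : (forall i, LD U (w i) (w' i)) ->
  LD U (\sum_i w i) (\sum_i w' i).
Proof.
move=> h; elim: (index_enum I) => [|i r IH]; first by rewrite !big_nil; exact: LD00.
by rewrite !big_cons; have := LDL 1 (h i) IH; rewrite !scale1r.
Qed.

Definition lform p (a : rform M p) (t : forall x, L x) : pform L p :=
  fun x v => rinj c (a x v) *: t x.

Lemma LD_lform p U (a : rform M p) a' t : open U -> rD U a a' -> sect U t ->
  LD U (lform a t) (lform a' t).
Proof.
move=> oU h tU z Uz; have [ O [I [f [g [oO Oz sfg aE a'E]]]]] := h z Uz.
have oOU := openI oO oU.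
exists (O `&` U), I, f, g, (fun=> t); split=> //.
- by move=> j; apply: sectS tU => // x [].
- by move=> x v [Ox _]; rewrite /lform aE // rmorph_sum scaler_suml.
- by move=> x v [Ox _]; rewrite /lform a'E // rmorph_sum scaler_suml.
Qed.

Lemma delem_scale p k f (g : 'I_p -> M -> R) x (v : 'I_p.+1 -> tangent x) : smooth f ->
  delem (fun y => k * f y) g v = k * delem f g v.
Proof.
move=> sf; rewrite /delem !(expand_det_col _ ord0) mulr_sumr; apply: eq_bigr => i _.
rewrite !mxE !fcons0 tapp_scaler // -mulrA; congr (_ * (_ * _)).
rewrite /cofactor; congr (_ * \det _); apply/matrixP => a b; rewrite !mxE.
by rewrite !fconsS.
Qed.

(** The coordinates of flat sections are locally constant, and can be absorbed in
    the coefficients f. *)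
Lemma LD_coord p O U J t co (w : pform L p) w' i : @flat_frame R c M L U J t co ->
  open O -> O `<=` U -> LD O w w' ->
  rD O (fun x v => co i x (w x v)) (fun x v => co i x (w' x v)).
Proof.
move=> hf oO OU h z Oz; have [_ _ _ _ coc] := hf.
have [P [I [f [g [s [[oP Pz] [sf sg] sP wE w'E]]]]]] := h z Oz.
have oOP := openI oO oP.
have sOP j : sect (O `&` P) (s j) by apply: sectS (sP j) => // x [].
have lc j : \forall y \near z, co i y (s j y) = co i z (s j z).
  have OPU : O `&` P `<=` U by move=> y [/OU].
  by have := coc _ _ i oOP OPU (sOP j); apply; split.
have nlc := nbhs_forall lc.
pose Q := (O `&` P) `&` interior [set y | forall j, co i y (s j y) = co i z (s j z)].
have oQ : open Q by apply: openI => //; exact: open_interior.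
exists Q, I, (fun j y => co i z (s j z) * f j y), g; split=> //.
- by split=> // j; exact: smoothZ.
- move=> x v [[Ox Px] /interior_subset lx]; have Ux := OU _ Ox.
  rewrite wE // /lsum (frame_co_sum hf) //; apply: eq_bigr => j _.
  by rewrite (frame_coZ hf) // lx /elem mulrC mulrA.
- move=> x v [[Ox Px] /interior_subset lx]; have Ux := OU _ Ox.
  rewrite w'E // /dlsum (frame_co_sum hf) //; apply: eq_bigr => j _.
  by rewrite (frame_coZ hf) // lx delem_scale // mulrC.
Qed.

Lemma frame_expand p U J t co (w : pform L p) x : @flat_frame R c M L U J t co -> U x ->
  w x = (\sum_i lform (fun x v => co i x (w x v)) (t i) : pform L p) x.
Proof.
move=> hf Ux; have [_ _ _ cob _] := hf.
apply/funext => v; rewrite {1}(cob x (w x v) Ux).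
rewrite (_ : (\sum_i lform _ _) x v = \sum_i lform (fun x v => co i x (w x v)) (t i) v) //.
elim: (index_enum J) => [|j r IH]; first by rewrite !big_nil.
by rewrite !big_cons -[LHS]/(_ + _) -IH.
Qed.

(** Take coordinates in a flat frame: there it is the uniqueness of the real
    differential. *)
Lemma LD_zero p U (w : pform L p) w' : open U -> LD U w w' ->
  (forall x, U x -> w x = 0) -> forall x, U x -> w' x = 0.
Proof.
move=> oU h w0 x Ux; have [V [J [t [co [hf Vx]]]]] := flat_frame_at L x.
have [oV _ _ _ _] := hf; have oW := openI oU oV.
have WV : U `&` V `<=` V by move=> y [].
have WU : U `&` V `<=` U by move=> y [].
have h0 i : forall v, co i x (w' x v) = 0.
  move=> v; have hw := LD_coord i hf oW WV (LDS WU h).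
  apply: (@rD_uniq _ _ chM hM _ _ _ _ (fun _ _ => 0) hw _ x v) => //.
  by apply: (rD_ext oW _ _ (@rD0 R M p _)) => // y u [Uy Vy]; rewrite w0 // (frame_co0 hf).
rewrite (frame_expand w' hf Vx); apply/funext => v.
have [_ _ _ cob _] := hf.
rewrite -(frame_expand w' hf Vx) (cob x (w' x v) Vx) big1 // => i _.
by rewrite h0 rmorph0 scale0r.
Qed.

Lemma LD_uniq p U (w : pform L p) w' w'' : open U -> LD U w w' -> LD U w w'' ->
  forall x, U x -> w' x = w'' x.
Proof.
move=> oU h h' x Ux; apply/eqP; rewrite -subr_eq0; apply/eqP.
have := LD_zero oU (LDB h h') _ Ux; apply=> y _; rewrite subrr; by [].
Qed.

(** The form df dg_1 ... dg_p is elementary, with coefficient 1. *)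
Lemma LD_dd p U (w : pform L p) w' : LD U w w' -> LD U w' 0.
Proof.
move=> h z Uz; have [ O [I [f [g [s [[oO Oz] [sf sg] sO wE w'E]]]]]] := h z Uz.
exists O, I, (fun=> fun=> 1), (fun j => fcons (f j) (g j)), s; split=> //.
- split=> j; first exact: smooth_cst.
  by move=> k; rewrite /fcons; case: unlift => [l|] /=.
- move=> x v Ox; rewrite w'E //; apply: eq_bigr => j _.
  by rewrite delemE.
- move=> x v Ox; rewrite /dlsum big1 // => j _.
  by rewrite delem_cst rmorph0 scale0r.
Qed.

(** Local differentials agree on the overlaps by uniqueness. *)
Lemma LD_exists p U (w : pform L p) : open U ->
  (forall z, U z -> exists O w', [/\ open O, O z & LD O w w']) -> exists w', LD U w w'.
Proof.
move=> oU h.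
have /choice[wz wzP] z : exists wz : pform L p.+1, U z -> exists O, [/\ open O, O z & LD O w wz].
  have [Uz|nUz] := pselect (U z); last by exists 0.
  by have [ O [w' hw']] := h z Uz; exists w' => _; exists O.
exists (fun x => wz x x) => z Uz; have [ O [oO Oz hO]] := wzP z Uz.
have oOU := openI oO oU.
have := LDS (@subIsetl _ O U) hO; move/(LD_ext oOU (v := w) (v' := fun x => wz x x)).
apply=> // x [Ox Ux].
have [P [oP Px hP]] := wzP x Ux.
have := LD_uniq (openI oO oP) (LDS (@subIsetl _ O P) hO) (LDS (@subIsetr _ O P) hP).
by apply; split.
Qed.

(** Near each point r is the germ of a global function, which can be absorbed in
    the coefficients. *)
Lemma LD_smul p U (r : M -> R) (w : pform L p) w' : open U -> smooth_on U r ->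
  LD U w w' -> exists w'', LD U (fun x v => rinj c (r x) *: w x v) w''.
Proof.
move=> oU sr h; apply: LD_exists => // z Uz.
have [ O [I [f [g [s [[oO Oz] [sf sg] sO wE w'E]]]]]] := h z Uz.
have [G sG Gr] : exists2 G, smooth G & \near z, G z = r z.
  by apply: (germ_ext chM hM); exists U.
pose Q := O `&` interior [set y | G y = r y].
have oQ : open Q by apply: openI => //; exact: open_interior.
exists Q, (dlsum (fun j y => G y * f j y) g s); split=> //.
move=> y Qy; exists Q, I, (fun j y => G y * f j y), g, s; split=> //.
- by split=> // j; exact: smoothM.
- by move=> j; apply: sectS (sO j) => // x [].
- move=> x v [Ox /interior_subset Gx]; rewrite wE // scaler_sumr; apply: eq_bigr => j _.
  by rewrite scalerA -rmorphM /elem Gx mulrA.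
Qed.

(** The shape of closed forms: locally sums of terms dg_1 ... dg_p s with s flat.
    It makes products with them easy to differentiate. *)
Definition exact_sum p U (w : pform L p) := forall z, U z ->
  exists O (I : finType) (g : I -> 'I_p -> M -> R) (s : I -> forall x, L x),
  [/\ open O /\ O z, forall j k, smooth (g j k), forall j, sect O (s j) &
      forall x v, O x -> w x v = lsum (fun=> fun=> 1) g s v].

Lemma poincare_chart O z : open O -> O z -> exists U n (phi : M -> 'rV[R]_n) psi w0,
  [/\ is_chart U phi psi, U z, U `<=` O & star_shaped w0 (phi @` U)].
Proof.
move=> oO Oz; have [U [n [phi [psi [hc Uz]]]]] := chM z.
have UOU : U `&` O `<=` U by move=> y [].
have oUO := openI (chart_open hc) oO.
have /nbhs_rVP[e e0 eI] : nbhs (phi z) (phi @` (U `&` O)).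
  by apply: open_nbhs_nbhs; split; [exact: chart_image_open hc _ oUO UOU|exists z].
set Q := [set w : 'rV[R]_n | forall i, `|w 0 i - phi z 0 i| < e].
have Q0 : Q (phi z) by move=> i; rewrite subrr normr0.
have oP : open (U `&` phi @^-1` Q) by apply: (chart_preim_open hc); exact: box_open.
exists (U `&` phi @^-1` Q), n, phi, psi, (phi z); split=> //.
- by apply: (chart_restrict hc) => // y [].
- move=> y [Uy Qy]; have [y' [Uy' Oy'] yy'] := eI _ Qy.
  by rewrite -(chartK hc Uy) -yy' (chartK hc Uy').
- rewrite (chart_preim_image (phi := phi)); first exact: box_star_shaped.
  by move=> w /eI[y [Uy _] <-]; exists y.
Qed.

Lemma poincare p U n (phi : M -> 'rV[R]_n) psi w0 J t co (w : pform L p.+1) :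
  is_chart U phi psi -> star_shaped w0 (phi @` U) -> @flat_frame R c M L U J t co ->
  LD U w 0 -> exists b, LD U b w.
Proof.
move=> hc stU hf dw; have [oU tU _ _ _] := hf.
have /choice[b bP] i : exists b : rform M p, rD U b (fun x v => co i x (w x v)).
  apply: (real_poincare chM hM hc stU).
  have := LD_coord i hf oU (@subset_refl _ U) dw; apply: rD_ext => // x v Ux.
  exact: (frame_co0 hf).
exists (\sum_i lform (b i) (t i)).
have := LD_sum (fun i => LD_lform oU (bP i) (tU i)).
by apply: LD_ext => // x Ux; exact: (esym (frame_expand _ hf Ux)).
Qed.

Lemma poincare0 U n (phi : M -> 'rV[R]_n) psi w0 J t co (w : pform L 0) :
  is_chart U phi psi -> star_shaped w0 (phi @` U) -> @flat_frame R c M L U J t co ->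
  LD U w 0 -> exists k : J -> R, forall x v, U x -> w x v = \sum_i rinj c (k i) *: t i x.
Proof.
move=> hc stU hf dw; have [oU tU _ cob _] := hf.
have /choice[k kP] i : exists k, forall x v, U x -> co i x (w x v) = k.
  apply: (real_poincare0 chM hM hc stU (a := fun x v => co i x (w x v))).
  have := LD_coord i hf oU (@subset_refl _ U) dw; apply: rD_ext => // x v Ux.
  exact: (frame_co0 hf).
exists k => x v Ux; rewrite (cob x (w x v) Ux); apply: eq_bigr => i _.
by rewrite kP.
Qed.

Lemma poincare0_kframe U n (phi : M -> 'rV[R]_n) psi w0 N ph inv (w : pform L 0) :
  is_chart U phi psi -> star_shaped w0 (phi @` U) -> @kframe R c M L U N ph inv ->
  LD U w 0 -> exists k : 'rV[K]_N, forall x v, U x -> w x v = ph x k.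
Proof.
move=> hc stU hk dw; have [J [k0 [co hf]]] := kframe_flat hk.
have [k kE] := poincare0 hc stU hf dw.
exists (\sum_i rinj c (k i) *: k0 i) => x v Ux; rewrite kE // linear_sum.
by apply: eq_bigr => i _; rewrite linearZ.
Qed.

(** By the Poincare lemma a closed form is locally the differential of a sum of
    terms f dg_1 ... dg_p s, or a combination of flat sections in degree 0. *)
Lemma closed_exact_sum p U (w : pform L p) : open U -> LD U w 0 -> exact_sum U w.
Proof.
move=> oU dw z Uz; have [V [J [t [co [hf Vz]]]]] := flat_frame_at L z.
have [oV _ _ _ _] := hf; have oW := openI oU oV.
have [P [n [phi [psi [w0 [hc Pz PW stP]]]]]] := poincare_chart oW (conj Uz Vz).
have oP := chart_open hc.
have hfP : flat_frame P t co by apply: flat_frameS hf => // y /PW[].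
have dwP : LD P w 0 by apply: LDS dw => y /PW[].
case: p w dw dwP => [|p] w dw dwP.
  have [k kE] := poincare0 hc stP hfP dwP.
  exists P, J, (fun _ _ _ => 0), (fun i x => rinj c (k i) *: t i x); split=> //.
  - by move=> _ [].
  - move=> j; apply: sect_scale => //; first by move=> x _; exact: nearW.
    by have [_ tP _ _ _] := hfP.
  - move=> x v Px; rewrite kE //; apply: eq_bigr => j _.
    by rewrite /elem det_mx00 mulr1 rmorph1 scale1r.
have [b db] := poincare hc stP hfP dwP.
have [ O [I [f [g [s [[oO Oz] [sf sg] sO bE wE]]]]]] := db z Pz.
exists O, I, (fun j => fcons (f j) (g j)), s; split=> //.
  by move=> j k; rewrite /fcons; case: unlift => [l|] /=.
move=> x v Ox; rewrite wE //; apply: eq_bigr => j _.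
by rewrite delemE.
Qed.

Lemma exact_sum_closed p U (w : pform L p) : exact_sum U w -> LD U w 0.
Proof.
move=> h z Uz; have [ O [I [g [s [[oO Oz] sg sO wE]]]]] := h z Uz.
exists O, I, (fun=> fun=> 1), g, s; split=> //.
  by split=> // j; exact: smooth_cst.
move=> x v Ox; rewrite /dlsum big1 // => j _.
by rewrite delem_cst rmorph0 scale0r.
Qed.

End coefficients.

End forms_with_coefficients.

(** * The invariant formula, pullbacks and wedge products *)

Lemma pform_sumE (R : realType) (c : coef) (M : fspace R)
    (S : M -> lmodType (coef_field R c)) p (I : Type) (r : seq I) (w : I -> pform S p) x v :
  (\sum_(i <- r) w i : pform S p) x v = \sum_(i <- r) w i x v.
Proof.
elim: r => [|j r IH]; first by rewrite !big_nil.
by rewrite !big_cons -IH.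
Qed.

Section invariant_formula.
Variables (R : realType) (c : coef) (M : fspace R).
Hypotheses (chM : charted M) (hM : hausdorff_space M).
Let K : fieldType := coef_field R c.
Implicit Types (U V O : set M).

Definition coef_part (b : bool) : K -> R :=
  if b then (@impart R c) else (@repart R c).

Lemma coef_part_lin b a (z w : K) :
  coef_part b (rinj c a * z + w) = a * coef_part b z + coef_part b w.
Proof. by case: b; [exact: impart_rinj_lin|exact: repart_rinj_lin]. Qed.

Lemma coef_part0 b : coef_part b 0 = 0.
Proof. by case: b; rewrite /coef_part -(rmorph0 (rinj c)) ?impart_rinj ?repart_rinj. Qed.

Lemma coef_partD b (z w : K) : coef_part b (z + w) = coef_part b z + coef_part b w.
Proof. by have := coef_part_lin b 1 z w; rewrite rmorph1 !mul1r. Qed.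

Lemma coef_partZ b a (z : K) : coef_part b (rinj c a * z) = a * coef_part b z.
Proof. by have := coef_part_lin b a z 0; rewrite !addr0 coef_part0 addr0. Qed.

Lemma coef_part_sign b (i : nat) (z : K) : coef_part b ((-1) ^+ i * z) = (-1) ^+ i * coef_part b z.
Proof. by rewrite -coef_partZ rmorph_sign. Qed.

Lemma coef_part_sum b (I : Type) (r : seq I) (P : pred I) (F : I -> K) :
  coef_part b (\sum_(i <- r | P i) F i) = \sum_(i <- r | P i) coef_part b (F i).
Proof. apply: (big_morph (coef_part b)); [exact: coef_partD|exact: coef_part0]. Qed.

Definition part_form p b (a : kform c M p) : rform M p :=
  fun x v => coef_part b (a x v : K).

Lemma coef_part_ktapp b (x : M) (v : tangent x) g :
  coef_part b (ktapp v g) = tapp v (fun y => coef_part b (g y)).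
Proof.
rewrite /ktapp; move: g; rewrite /coef_part /K; case: c => g /=; case: b => //=.
by rewrite tapp0.
Qed.

Lemma part_koszul p b (a : kform c M p) X x :
  coef_part b (koszul a X x) = rkoszul (part_form b a) X x.
Proof.
rewrite /koszul coef_partD !coef_part_sum; congr (_ + _); apply: eq_bigr => i _.
  by rewrite coef_part_sign coef_part_ktapp.
by rewrite coef_part_sum; apply: eq_bigr => j _; rewrite coef_part_sign.
Qed.

Lemma part_ralt p b (a : kform c M p) x : alternating (a x) -> ralt (part_form b a (x := x)).
Proof.
move=> [h1 h2]; split=> [i v t t' t''|v i j ij vij].
  by rewrite /part_form h1 coef_part_lin.
by rewrite /part_form (h2 _ _ _ ij vij) coef_part0.
Qed.

Lemma part_smooth p b (a : kform c M p) (X : 'I_p -> vfield M) : smooth_kform a ->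
  smooth (fun x => part_form b a (fun i => X i x)).
Proof. by move=> [_ /(_ X)[? ?]]; case: b. Qed.

Lemma elem_smooth_kform p f (g : 'I_p -> M -> R) : smooth f -> (forall j, smooth (g j)) ->
  smooth_kform ((fun x v => rinj c (elem f g v)) : kform c M p).
Proof.
move=> sf sg; split=> [x|X].
  have [h1 h2] := elem_ralt f g x; split=> [i v r t t'|v i j ij vij].
    by rewrite h1 rmorphD rmorphM.
  by rewrite (h2 _ _ _ ij vij) rmorph0.
split.
  under eq_fun do rewrite repart_rinj.
  exact: elem_smooth.
under eq_fun do rewrite impart_rinj.
exact: smooth_cst.
Qed.

Lemma koszul_rinj p (a : rform M p) X x :
  koszul ((fun x v => rinj c (a x v)) : kform c M p) X x = rinj c (rkoszul a X x).
Proof.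
rewrite /koszul /rkoszul rmorphD !rmorph_sum; congr (_ + _); apply: eq_bigr => i _.
  rewrite rmorphM rmorph_sign; congr (_ * _); rewrite /ktapp.
  under [X in tapp _ X]eq_fun do rewrite repart_rinj.
  under [X in mkcoef _ _ (tapp _ X)]eq_fun do rewrite impart_rinj.
  by rewrite tapp0.
by rewrite rmorph_sum; apply: eq_bigr => j _; rewrite rmorphM rmorph_sign.
Qed.

Lemma elem_ext_derivative p f (g : 'I_p -> M -> R) : smooth f -> (forall j, smooth (g j)) ->
  ext_derivative ((fun x v => rinj c (elem f g v)) : kform c M p)
    ((fun x v => rinj c (delem f g v)) : kform c M p.+1).
Proof.
move=> sf sg; split; first exact: elem_smooth_kform.
  rewrite delemE; apply: elem_smooth_kform; first exact: smooth_cst.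
  by move=> j; rewrite /fcons; case: unlift.
by move=> X x; rewrite koszul_rinj koszul_elem.
Qed.

Variable L : local_system K M.

Let enum_sum (V : nmodType) (I : finType) (F : I -> V) :
  \sum_j F j = \sum_(k < #|I|) F (enum_val k).
Proof. by rewrite (reindex (@enum_val I I)) //; exact/onW_bij/enum_val_bij. Qed.

Lemma LD_is_d p (w : pform L p) w' : LD setT w w' -> is_d w w'.
Proof.
move=> h z; have [ O [I [f [g [s [[oO Oz] [sf sg] sO wE w'E]]]]]] := h z I.
exists O, #|I|, (fun k => s (enum_val k)), (fun k x v => rinj c (elem (f (enum_val k)) (g (enum_val k)) v)),
  (fun k x v => rinj c (delem (f (enum_val k)) (g (enum_val k)) v)); split=> //.
- by move=> k; exact: elem_ext_derivative.
- by move=> x v Ox; rewrite wE // /lsum enum_sum.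
- by move=> x v Ox; rewrite w'E // /dlsum enum_sum.
Qed.

Lemma LD_smooth_form p (w : pform L p) w' : LD setT w w' -> smooth_form w.
Proof.
move=> h z; have [ O [I [f [g [s [[oO Oz] [sf sg] sO wE w'E]]]]]] := h z I.
exists O, #|I|, (fun k => s (enum_val k)), (fun k x v => rinj c (elem (f (enum_val k)) (g (enum_val k)) v)).
split=> //.
- by move=> k; exact: elem_smooth_kform.
- by move=> x v Ox; rewrite wE // /lsum enum_sum.
Qed.

Lemma LD_ksum p U m (s : 'I_m -> forall x, L x) (a : 'I_m -> kform c M p) b : open U ->
  (forall j, sect U (s j)) -> (forall i j, rD U (part_form i (a j)) (part_form i (b j))) ->
  LD U ((fun x v => \sum_j (a j x v : K) *: s j x) : pform L p)
    ((fun x v => \sum_j (b j x v : K) *: s j x) : pform L p.+1).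
Proof.
move=> oU sU h.
have E q (a0 : kform c M q) x v j : (a0 x v : K) *: s j x =
    rinj c (part_form false a0 v) *: s j x + rinj c (part_form true a0 v) *: (iunit R c *: s j x).
  by rewrite scalerA -scalerDl -coef_decomp.
have siU j : sect U (fun x => iunit R c *: s j x).
  by apply: sect_scale => // x _; exact: nearW.
have := LD_sum (fun j => LDL 1 (LD_lform oU (h false j) (sU j)) (LD_lform oU (h true j) (siU j))).
apply: LD_ext => // x Ux; apply/funext => v; rewrite pform_sumE; apply: eq_bigr => j _.
  by rewrite scale1r (E p).
by rewrite scale1r (E p.+1).
Qed.

(** Split the K-valued forms into real and imaginary parts; these have local
    elementary expressions by koszul_rD. *)
Lemma is_d_LD p (w : pform L p) w' : is_d w w' -> LD setT w w'.
Proof.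
move=> h z _; have [U [m [s [a [b [[oU Uz] sU dab wE w'E]]]]]] := h z.
suff : LD U w w' by apply.
have hab i j : rD U (part_form i (a j)) (part_form i (b j)).
  have [sa sb abE] := dab j; apply: (@rDS _ _ _ setT) => //; apply: (koszul_rD chM hM).
  - by move=> x; apply: part_ralt; case: sa.
  - by move=> X; exact: part_smooth.
  - by move=> X x; rewrite -part_koszul -abE.
by apply: LD_ext (LD_ksum oU sU hab) => // x Ux; apply/funext => v; rewrite ?wE ?w'E.
Qed.

End invariant_formula.

Section functoriality.
Variables (R : realType) (c : coef) (M : fspace R).
Let K : fieldType := coef_field R c.

Lemma tapp_tangent_map (N : fspace R) (F : smooth_map M N) x (v : tangent x) g :
  smooth g -> tapp (tangent_map F v) g = tapp v (g \o F).
Proof. by move=> sg; rewrite /tapp /= /tangent_map_fun asboolT. Qed.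

Lemma pull_elem (N : fspace R) (F : smooth_map M N) p f (g : 'I_p -> N -> R) x
    (v : 'I_p -> tangent x) : (forall j, smooth (g j)) ->
  elem f g (fun i => tangent_map F (v i)) = elem (f \o F) (fun j => g j \o F) v.
Proof.
move=> sg; rewrite /elem; congr (_ * \det _); apply/matrixP => i j.
by rewrite !mxE tapp_tangent_map.
Qed.

Lemma LD_pullback (N : fspace R) (F : smooth_map M N) (L : local_system K N) p U
    (w : pform L p) w' : LD U w w' ->
  LD (L := inverse_system F L) (F @^-1` U) (pullback_form F w) (pullback_form F w').
Proof.
move=> h z Uz; have [ O [I [f [g [s [[oO Oz] [sf sg] sO wE w'E]]]]]] := h (F z) Uz.
exists (F @^-1` O), I, (fun j => f j \o F), (fun j k => g j k \o F), (fun j x => s j (F x)).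
split=> //.
- by split=> //; apply: open_comp => // x _; exact: smooth_fun_continuous.
- by split=> *; exact: smooth_comp.
- move=> j; suff : @inv_sect _ _ _ F L (F @^-1` O) (fun x => s j (F x)) by [].
  by move=> x Ox; exists O, (s j); split=> //; exact: nearW.
- move=> x v Ox; rewrite /pullback_form wE //; apply: eq_bigr => j _.
  by rewrite pull_elem.
- move=> x v Ox; rewrite /pullback_form w'E //; apply: eq_bigr => j _.
  rewrite !delemE pull_elem; last by move=> k; rewrite /fcons; case: unlift => [l|] /=.
  congr (rinj c (elem _ _ v) *: _); apply/funext => k.
  by rewrite /fcons; case: unlift.
Qed.

(** A morphism of local systems maps flat sections to flat sections, hence commutes
    with d. *)
Lemma LD_coef (L L' : local_system K M) (tau : forall x, L x -> L' x) p (U O : set M)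
    (w : pform L p) w' : open O -> O `<=` U ->
  (forall x a l l', U x -> tau x (rinj c a *: l + l') = rinj c a *: tau x l + tau x l') ->
  (forall P s, open P -> P `<=` U -> sect P s -> sect P (fun x => tau x (s x))) ->
  LD O w w' -> LD O ((fun x v => tau x (w x v)) : pform L' p) ((fun x v => tau x (w' x v)) : pform L' p.+1).
Proof.
move=> oO OU tl ts h z Oz.
have tau0 x : U x -> tau x 0 = 0.
  move=> Ux; have := tl x 1 0 0 Ux; rewrite rmorph1 !scale1r addr0 => /eqP.
  by rewrite -subr_eq0 opprD addrA subrr sub0r oppr_eq0 => /eqP.
have tsum x (I : finType) (k : I -> R) (l : I -> L x) : U x ->
    tau x (\sum_j rinj c (k j) *: l j) = \sum_j rinj c (k j) *: tau x (l j).
  move=> Ux; elim: (index_enum I) => [|j r IH]; first by rewrite !big_nil tau0.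
  by rewrite !big_cons tl // IH.
have [P [I [f [g [s [[oP Pz] [sf sg] sP wE w'E]]]]]] := h z Oz.
have oOP := openI oO oP.
exists (O `&` P), I, f, g, (fun j x => tau x (s j x)); split=> //.
- move=> j; apply: ts => //; first by move=> x [/OU].
  by apply: sectS (sP j) => // x [].
- by move=> x v [Ox Px]; rewrite wE // /lsum tsum //; exact: OU.
- by move=> x v [Ox Px]; rewrite w'E // /dlsum tsum //; exact: OU.
Qed.

Definition fcat (T : Type) p q n (pqn : (p + q = n)%N) (g : 'I_p -> T) (h : 'I_q -> T)
    (k : 'I_n) : T :=
  match fintype.split (cast_ord (esym pqn) k) with inl i => g i | inr j => h j end.

Lemma fcons_fcat (T : Type) p q n (pqn : (p + q = n)%N) (pqn' : (p.+1 + q = n.+1)%N)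
    (f : T) (g : 'I_p -> T) (h : 'I_q -> T) :
  fcons f (fcat pqn g h) = fcat pqn' (fcons f g) h.
Proof.
apply/funext => k; case: (unliftP ord0 k) => [j ->|->].
  rewrite fconsS /fcat; case: splitP => i /= iE; case: splitP => l /= lE.
  - by rewrite (_ : l = lift ord0 i) ?fconsS //; apply: val_inj; rewrite /= -iE -lE.
  - by have := ltn_ord i; rewrite -iE; move: lE; rewrite /bump /= add1n addSn => -[->]; rewrite ltnNge leq_addr.
  - by have := ltn_ord l; rewrite -lE /bump /= add1n iE ltnS ltnNge leq_addr.
  - congr h; apply: val_inj; apply/eqP; rewrite -(eqn_add2l p) -iE.
    by move: lE; rewrite /bump /= add1n addSn => -[->].
rewrite fcons0 /fcat; case: splitP => l /= lE; last by move: lE; rewrite addSn.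
by rewrite (_ : l = ord0) ?fcons0 //; apply: val_inj.
Qed.

(** The wedge product concatenates elementary forms: this is the Laplace expansion
    det_wedge. *)
Lemma wedge_elem p q n (pqn : (p + q = n)%N) f (g : 'I_p -> M -> R) (h : 'I_q -> M -> R) x
    (v : 'I_n -> tangent x) :
  (p`! * q`!)%:R^-1 * (\sum_(s : 'S_n) (-1) ^+ s *
     (elem (fun=> 1) h (fun j => v (s (cast_ord pqn (rshift p j)))) *
      elem f g (fun i => v (s (cast_ord pqn (lshift q i)))))) = elem f (fcat pqn g h) v.
Proof.
subst n; set B : 'M[R]_(p + q) := \matrix_(i, j) tapp (v i) (fcat erefl g h j).
rewrite /elem -/B -[\det B](mulKf (_ : (p`! * q`!)%:R != 0)); last first.
  by rewrite pnatr_eq0 -lt0n muln_gt0 !fact_gt0.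
rewrite -det_wedge mulrCA; congr (_ * _); rewrite mulr_sumr; apply: eq_bigr => s _.
rewrite mul1r [RHS]mulrCA; congr (_ * _).
rewrite [LHS]mulrCA; congr (_ * _); rewrite [LHS]mulrC; congr (_ * _).
  congr (\det _); apply/matrixP => i j; rewrite !mxE !cast_ord_id /fcat cast_ord_id.
  by rewrite (unsplitK (inl j)).
congr (\det _); apply/matrixP => i j; rewrite !mxE !cast_ord_id /fcat cast_ord_id.
by rewrite (unsplitK (inr j)).
Qed.

Variable L : local_system K M.

Lemma wedge_lsum p q n (pqn : (p + q = n)%N) (I J : finType) f (g : I -> 'I_p -> M -> R) s
    (h : J -> 'I_q -> M -> R) k (a : pform L p) (b : kform c M q) x (v : 'I_n -> tangent x) :
  (forall v, a x v = lsum (L := L) f g s v) ->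
  (forall v, b x v = lsum (L := const_coef c M) (fun=> fun=> 1) h k v) ->
  wedge pqn a b v = lsum (L := L) (fun ij : I * J => f ij.1)
    (fun ij => fcat pqn (g ij.1) (h ij.2)) (fun ij y => (k ij.2 y : K) *: s ij.1 y) v.
Proof.
move=> aE bE; rewrite /wedge /lsum.
rewrite -(pair_bigA _ (fun i j => rinj c (elem (f i) (fcat pqn (g i) (h j)) v) *: ((k j x : K) *: s i x))) /=.
under [RHS]eq_bigr => i _ do under eq_bigr => j _ do
  rewrite -wedge_elem rmorphM fmorphV rmorph_nat rmorph_sum -scalerA scaler_suml.
under [RHS]eq_bigr => i _ do rewrite -scaler_sumr.
rewrite -scaler_sumr; congr (_ *: _).
under [RHS]eq_bigr => i _ do rewrite exchange_big.
rewrite [RHS]exchange_big; apply: eq_bigr => t _ /=.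
rewrite aE /lsum scaler_sumr; apply: eq_bigr => i _.
rewrite bE /lsum mulr_sumr scaler_suml; apply: eq_bigr => j _.
rewrite !scalerA (rmorphM _ ((-1) ^+ t)) rmorph_sign (rmorphM _ (elem (fun=> 1) _ _)).
congr (_ *: _).
rewrite -!mulrA; congr (_ * (_ * _)); exact: mulrC.
Qed.

(** Locally b is a sum of terms dh_1 ... dh_q, so d only acts on the coefficient f
    of a term f dg_1 ... dg_p of a; as f comes first, there is no sign. *)
Lemma LD_wedge p q n (pqn : (p + q = n)%N) (pqn' : (p.+1 + q = n.+1)%N) U (a : pform L p) a'
    (b : kform c M q) : LD U a a' -> exact_sum (L := const_coef c M) U b ->
  LD U (wedge pqn a b) (wedge pqn' a' b).
Proof.
move=> ha hb z Uz; have [ O [I [f [g [s [[oO Oz] [sf sg] sO aE a'E]]]]]] := ha z Uz.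
have [P [J [h [k [[oP Pz] sh kP bE]]]]] := hb z Uz.
have oOP := openI oO oP.
exists (O `&` P), (I * J)%type, (fun ij => f ij.1), (fun ij => fcat pqn (g ij.1) (h ij.2)),
  (fun ij y => (k ij.2 y : K) *: s ij.1 y); split=> //.
- split=> [j|j l]; first exact: sf.
  by rewrite /fcat; case: fintype.split.
- move=> j; apply: sect_scale => //; last by apply: sectS (sO j.1) => // x [].
  by apply: (@locally_constantS _ _ P); [move=> x []|exact: kP].
- by move=> x v [Ox Px]; apply: wedge_lsum => u; [exact: aE|exact: bE].
- move=> x v [Ox Px].
  have a'E' u : a' x u = lsum (L := L) (fun=> fun=> 1) (fun j => fcons (f j) (g j)) s u.
    by rewrite a'E //; apply: eq_bigr => j _; rewrite delemE.
  rewrite (wedge_lsum pqn' v a'E' (fun u => bE x u Px)).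
  by apply: eq_bigr => j _; rewrite delemE (fcons_fcat pqn pqn').
Qed.

Lemma wedge_linl p q n (pqn : (p + q = n)%N) k (a a' : pform L p) (b : kform c M q) :
  wedge pqn (k *: a + a') b = k *: (wedge pqn a b : pform L n) + wedge pqn a' b.
Proof.
apply: functional_extensionality_dep => x; apply/funext => v.
rewrite -[RHS]/(k *: wedge pqn a b v + wedge pqn a' b v) /wedge.
rewrite scalerA [k * _]mulrC -scalerA -scalerDr; congr (_ *: _).
rewrite scaler_sumr -big_split; apply: eq_bigr => t _ /=.
by rewrite -[in LHS]/(k *: a x _ + a' x _) scalerDr !scalerA [k * _]mulrC.
Qed.

Lemma wedge_eq0 p q n (pqn : (p + q = n)%N) (a : pform L p) (b : kform c M q) x :
  a x = 0 -> (wedge pqn a b : pform L n) x = 0.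
Proof.
move=> ax; apply/funext => v; rewrite /wedge big1 ?scaler0 // => t _.
by rewrite ax scaler0.
Qed.

Lemma wedge_deg0 q (a : pform L 0) (b : kform c M q) U x (v : 'I_q -> tangent x) u :
  exact_sum (L := const_coef c M) U b -> U x ->
  wedge (erefl : (0 + q = q)%N) a b v = (b x v : K) *: a x u.
Proof.
move=> hb Ux; have [P [J [h [k [[oP Px] sh kP bE]]]]] := hb x Ux.
have bs (t : 'S_q) : b x (v \o t) = (-1) ^+ t * (b x v : K) :> K.
  rewrite !bE // /lsum mulr_sumr; apply: eq_bigr => j _.
  rewrite (ralt_perm (elem_ralt _ _ x)) rmorphM rmorph_sign -scalerA.
  by rewrite -[RHS]/(_ *: _).
rewrite /wedge fact0 mul1n.
rewrite (eq_bigr (fun=> (b x v : K) *: a x u)).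
  rewrite sumr_const card_Sn -scalerMnr scalerMnl -mulr_natr mulVf ?scale1r //.
  rewrite -(rmorph_nat (rinj c)) fmorph_eq0 pnatr_eq0 -lt0n; exact: fact_gt0.
move=> t _; rewrite (_ : (fun j => v (t _)) = v \o t); last first.
  by apply/funext => j; rewrite /= cast_ord_id; congr (v (t _)); exact: val_inj.
rewrite bs mulrA -signr_addb addbb mul1r; congr (_ *: a x _).
by apply/funext; case.
Qed.

End functoriality.

(** The L-valued forms on an open subset M0 of M as a complex of sheaves on T, for
    a map fm from M0 to T: the sections over W are the forms on the preimage of W. *)
Section form_complex.
Variables (R : realType) (c : coef) (M : fspace R).
Hypotheses (chM : charted M) (hM : hausdorff_space M).
Let K : fieldType := coef_field R c.
Variables (T : topologicalType) (S : set (T -> R)) (M0 : set M) (fm : M -> T).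
Hypotheses (oM0 : open M0) (fC : forall x, M0 x -> {for x, continuous fm}).
Hypothesis (fS : forall r, S r -> smooth_on M0 (r \o fm)).
Variable L : local_system K M.
Implicit Types (W : set T).

Definition over W : set M := M0 `&` fm @^-1` W.

Lemma over_open W : open W -> open (over W).
Proof.
move=> oW; rewrite openE => x [Mx Wx]; rewrite /interior; apply: filterI.
  exact: open_nbhs_nbhs.
by apply: (fC Mx); exact: open_nbhs_nbhs.
Qed.

Definition form_zero n W (a : pform L n) := forall x, over W x -> a x = 0.
Definition form_dif n W (a : pform L n) a' := LD (over W) a a'.
Definition form_smul n (r : T -> R) (a : pform L n) : pform L n :=
  fun x v => rinj c (r (fm x)) *: a x v.

Fact form_zero0 n W : form_zero W (0 : pform L n). Proof. by []. Qed.

Fact form_zeroL n W k (a b : pform L n) : form_zero W a -> form_zero W b ->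
  form_zero W (k *: a + b).
Proof.
move=> ha hb x Wx; rewrite -[LHS]/(k *: a x + b x) ha // hb //.
by rewrite scaler0 addr0.
Qed.

Fact form_zero_pt n W (a : pform L n) : form_zero W a <->
  forall x, W x -> form_zero [set x] a.
Proof.
split=> [h x Wx y [My yx]|h x [Mx Wx]]; first by apply: h; split=> //; rewrite /preimage /= yx.
by apply: (h _ Wx).
Qed.

Fact form_zero_glue n (I : Type) (W : I -> set T) (a : I -> pform L n) :
  (forall i, open (W i)) -> (forall i j, form_zero (W i `&` W j) (a i - a j)) ->
  exists b, forall i, form_zero (W i) (b - a i).
Proof.
move=> oW h.
have /dep_choice[b bP] x : exists bx : ('I_n -> tangent x) -> L x,
    forall i, over (W i) x -> bx = a i x.
  have [[i Wi]|nW] := pselect (exists i, over (W i) x); last first.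
    by exists 0 => i Wi; case: nW; exists i.
  exists (a i x) => j Wj; apply/eqP; rewrite -subr_eq0; apply/eqP.
  by apply: (h i j x); split; [case: Wi|split; [case: Wi|case: Wj]].
exists b => i x Wx; rewrite -[LHS]/(b x - a i x) (bP x i Wx); exact: subrr.
Qed.

Fact form_dif00 n W : form_dif W (0 : pform L n) 0.
Proof. exact: LD00. Qed.

Fact form_difL n W k (a : pform L n) a' b b' : form_dif W a a' -> form_dif W b b' ->
  form_dif W (k *: a + b) (k *: a' + b').
Proof. exact: LDL. Qed.

Fact form_dif_local n W (a : pform L n) b : open W -> form_dif W a b <->
  forall x, W x -> exists V a' b', [/\ open V, V x, form_dif V a' b',
    form_zero V (a - a') & form_zero V (b - b')].
Proof.
move=> oW; split=> [h x Wx|h].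
  by exists W, a, b; split=> //; rewrite subrr.
apply: LD_cover => x [Mx Wx]; have [V [a' [b' [oV Vx h' ha hb]]]] := h _ Wx.
exists (over V) => //; apply: LD_ext h'; first exact: over_open.
- by move=> y Vy; apply/esym/eqP; rewrite -subr_eq0; apply/eqP; exact: ha.
- by move=> y Vy; apply/esym/eqP; rewrite -subr_eq0; apply/eqP; exact: hb.
Qed.

Fact form_dif_zero n W (a : pform L n) b : open W -> form_dif W a b ->
  form_zero W a -> form_zero W b.
Proof. by move=> oW; apply: (LD_zero chM hM); exact: over_open. Qed.

Fact form_dif_dif n W (a : pform L n) b : open W -> form_dif W a b -> form_dif W b 0.
Proof. by move=> _; exact: LD_dd. Qed.

Fact form_smul_dif n W r (a : pform L n) b : open W -> S r -> form_dif W a b ->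
  exists b', form_dif W (form_smul r a) b'.
Proof.
move=> oW Sr; apply: (LD_smul chM hM); first exact: over_open.
by apply: smooth_onS (fS Sr) => //; [exact: over_open|move=> x []].
Qed.

Fact form_smul_1 n W r (a : pform L n) : (forall x, W x -> r x = 1) ->
  form_zero W (form_smul r a - a).
Proof.
move=> h x [Mx Wx]; apply/funext => v; rewrite -[LHS]/(rinj c (r (fm x)) *: a x v - a x v).
by rewrite h // rmorph1 scale1r subrr.
Qed.

Fact form_smul_0 n W r (a : pform L n) : (forall x, W x -> r x = 0) ->
  form_zero W (form_smul r a).
Proof.
move=> h x [Mx Wx]; apply/funext => v; rewrite /form_smul h //.
by rewrite rmorph0 scale0r.
Qed.

Definition form_complex : scomplex K S :=
  SComplex form_zero0 form_zeroL form_zero_pt form_zero_glue form_dif00 form_difL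
    form_dif_local form_dif_zero form_dif_dif
    form_smul_dif form_smul_1 form_smul_0.

End form_complex.

(** * Topology of connected manifolds *)

Lemma countable_enum (T : Type) (A : set T) (x0 : T) : A x0 -> countable A ->
  exists e : nat -> T, (forall i, A (e i)) /\ forall x, A x -> exists i, e i = x.
Proof.
move=> Ax0 /countable_injP[f injf].
have /choice[e eP] i : exists x, A x /\ ((exists2 y, A y & f y = i) -> f x = i).
  have [[y Ay yi]|nex] := pselect (exists2 y, A y & f y = i); first by exists y.
  by exists x0.
exists e; split=> [i|x Ax]; first by case: (eP i).
exists (f x); have [h1 h2] := eP (f x); apply: injf; rewrite ?inE //.
by apply: h2; exists x.
Qed.

Section manifold_topology.
Variables (R : realType) (M : fspace R).
Hypothesis chM : charted M.
Implicit Types (U V W O C : set M).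

(** The preimages of boxes with rational centres and radii. *)
Lemma chart_countable_base U n (phi : M -> 'rV[R]_n) psi : is_chart U phi psi ->
  countable_base U.
Proof.
move=> hc.
pose Q (c : 'rV[rat]_n) (e : rat) :=
  [set w : 'rV[R]_n | forall i, `|w 0 i - (\row_j ratr (c 0 j)) 0 i| < ratr e].
pose b i := if @unpickle ('rV[rat]_n * rat)%type i is Some ce then
  U `&` phi @^-1` (Q ce.1 ce.2) else set0.
exists b; split=> [i|O x oO Ox Ux].
  rewrite /b; case: unpickle => [[q e]|]; last exact: open0.
  by apply: (chart_preim_open hc); exact: box_open.
have oUO : open (U `&` O) by apply: openI => //; exact: chart_open hc.
have UOU : U `&` O `<=` U by move=> y [].
have /nbhs_rVP[e e0 eI] : nbhs (phi x) (phi @` (U `&` O)).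
  by apply: open_nbhs_nbhs; split; [exact: chart_image_open hc _ oUO UOU|exists x].
have e20 : 0 < e / 2 by rewrite divr_gt0.
have [e' he'] := rat_in_itvoo e20.
move: he'; rewrite in_itv /= => /andP[e'0 e'e].
have /choice[q qP] j : exists q : rat, `|phi x 0 j - ratr q| < ratr e'.
  have h : phi x 0 j - ratr e' < phi x 0 j + ratr e' by lra.
  have [q] := rat_in_itvoo h; rewrite in_itv /= => /andP[h1 h2]; exists q.
  by rewrite ltr_norml; apply/andP; split; lra.
pose qv := \row_j q j : 'rV[rat]_n.
have Qx : Q qv e' (phi x) by move=> j; rewrite !mxE.
exists (pickle (qv, e')); rewrite /b pickleK //= => y [Uy Qy].
have [y' [Uy' Oy'] yy'] : (phi @` (U `&` O)) (phi y).
  apply: eI => j; have := Qy j; have := Qx j; rewrite !mxE => h1 h2.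
  rewrite (_ : phi y 0 j - phi x 0 j =
    (phi y 0 j - ratr (q j)) - (phi x 0 j - ratr (q j))); last by ring.
  apply: le_lt_trans (ler_normB _ _) _.
  by apply: lt_trans (ltrD h2 h1) _; lra.
by rewrite -(chartK hc Uy) -yy' (chartK hc Uy').
Qed.

(** Starting from one member of a locally finite cover by chart domains,
    countably many members can be reached by chains of intersecting members, and
    by connectedness they cover everything. *)
Lemma connected_countable_base : paracompact M -> connected [set: M] ->
  countable_base [set: M].
Proof.
move=> [hM pc] cM.
have [[x0 _]|nM] := pselect (exists x : M, True); last first.
  by exists (fun=> set0); split=> [i|O x]; [exact: open0|case: nM; exists x].
pose C := [set U : set M | exists n (phi : M -> 'rV[R]_n) psi, is_chart U phi psi].
have [||D [oD cD DC fD]] := pc C.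
- by move=> U [n [phi [psi hc]]]; exact: chart_open hc.
- apply/seteqP; split=> // x _; have [U [n [phi [psi [hc Ux]]]]] := chM x.
  by exists U => //; exists n, phi, psi.
have bD W : D W -> countable_base W.
  move=> DW; have [U [n [phi [psi hc]]] WU] := DC W DW.
  have [b [ob bP]] := chart_countable_base hc.
  by exists b; split=> // O x oO Ox /WU; exact: bP.
have coverD x : exists2 W, D W & W x by have : [set: M] x by []; rewrite -cD => -[W DW Wx]; exists W.
pose meet W := [set W' | D W' /\ W' `&` W !=set0].
have meet_countable W : D W -> countable (meet W).
  move=> DW; pose F := [set N : set M | finite_set [set W | D W /\ W `&` N !=set0]].
  have FW x : W x -> exists2 N, F N & (interior N) x.
    by move=> _; have [N nN fN] := fD x; exists N.
  have F0 : exists N, F N.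
    by have [N _ fN] := fD x0; exists N.
  have [N [FN NW]] := countable_base_lindelof (bD W DW) FW F0.
  apply: (@sub_countable _ _ _ (\bigcup_i [set W' | D W' /\ W' `&` N i !=set0])); last first.
    by apply: bigcup_countable => // i _; apply: finite_set_countable; exact: FN.
  apply: subset_card_le => W' [DW' [y [W'y Wy]]].
  have [i Niy] := NW y Wy; exists i => //; split=> //; exists y; split=> //.
  exact: interior_subset Niy.
have [W0 DW0 W0x] := coverD x0.
(* Members that can be reached from W0 in n steps. *)
pose St := fix St n : set (set M) := if n is m.+1 then \bigcup_(W in St m) meet W else [set W0].
have StD n W : St n W -> D W by case: n => [|n] /=; [move=> ->|move=> [? _ []]].
have cSt n : countable (St n).
  elim: n => [|n IH] /=; first exact: countable1.
  by apply: bigcup_countable => // W /StD; exact: meet_countable.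
pose A := \bigcup_n St n.
have cA : countable A by apply: bigcup_countable.
have AD W : A W -> D W by move=> [n _ /StD].
have AW0 : A W0 by exists 0%N.
pose UA := \bigcup_(W in A) W.
have oUA : open UA by apply: bigcup_open => W /AD; exact: oD.
have UAT : UA = [set: M].
  apply: cM; first by exists x0; exists W0.
    by exists UA => //; rewrite setTI.
  exists UA; last by rewrite setTI.
  rewrite -[UA]setCK; apply: open_closedC; rewrite openE => x nx; rewrite /interior.
  have [W DW Wx] := coverD x; apply: filterS (open_nbhs_nbhs (conj (oD W DW) Wx)).
  move=> y Wy [W' [n _ StW'] W'y]; apply: nx; exists W => //; exists n.+1 => //.
  by exists W' => //; split=> //; exists y.
have [e [eA eP]] := countable_enum AW0 cA.
have /choice[b bP] i : exists b : nat -> set M, (forall k, open (b k)) /\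
    forall O x, open O -> O x -> e i x -> exists2 k, b k x & b k `<=` O.
  by have [b hb] := bD _ (AD _ (eA i)); exists b.
exists (fun k => if @unpickle (nat * nat)%type k is Some ij then b ij.1 ij.2 else set0).
split=> [k|O x oO Ox _]; first by case: unpickle => [[i j]|]; [exact: (bP i).1|exact: open0].
have [W AW Wx] : UA x by rewrite UAT.
have [i eiW] := eP W AW.
have [k bk bO] := (bP i).2 O x oO Ox (eq_ind_r (fun W => W x) Wx eiW).
by exists (pickle (i, k)); rewrite pickleK.
Qed.

Hypotheses (hM : hausdorff_space M) (cbM : countable_base [set: M]).

Lemma countable_baseS (T : topologicalType) (W V : set T) : V `<=` W ->
  countable_base W -> countable_base V.
Proof. by move=> VW [b [ob bP]]; exists b; split=> // O x oO Ox /VW; exact: bP. Qed.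

(** Around each point, the complement of an open set where a bump function is 0 is
    a closed neighbourhood inside the given open set. *)
Lemma smooth_shrinkable : shrinkable M.
Proof.
move=> W P oW WP P0.
pose F := [set C : set M | exists U, [/\ open U, closed C, C `<=` U, U `<=` W & P U]].
have FW x : W x -> exists2 C, F C & (interior C) x.
  move=> Wx; have [U [oU Ux UW PU]] := WP x Wx.
  have [r [sr [V [V0 [[oV oV0] Vx UV0 r1 r0]]]]] := bump_at chM hM oU Ux.
  exists (~` V0).
    exists U; split=> //; first exact: open_closedC.
    by move=> y V0y; apply: contrapT => /UV0.
  apply: filterS (open_nbhs_nbhs (conj oV Vx)) => y /r1 ry /r0.
  by rewrite ry => /eqP; rewrite oner_eq0.
have F0 : exists C, F C.
  by exists set0, set0; split=> //; [exact: open0|exact: closed0].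
have [C [FC CW]] := countable_base_lindelof (countable_baseS (@subsetT _ W) cbM) FW F0.
have /choice[U UP] i := FC i.
by exists U, C.
Qed.

(** With cut-offs chi_k vanishing near C or near the complement of V and equal
    to 1 on open sets that cover M, the functions chi_k prod_(j < k) (1 - chi_j)
    are a partition of unity; sum those of the second kind. *)
Lemma smooth_normal : normal_for [set r : M -> R | smooth r].
Proof.
move=> C V cC oV CV; pose Z (k : bool) := if k then ~` V else C.
pose good (ck : (M -> R) * bool) := smooth ck.1 /\
  exists V0 : set M, [/\ open V0, Z ck.2 `<=` V0 & forall y, V0 y -> ck.1 y = 0].
pose F := [set D : set M | exists ck, good ck /\ forall y, D y -> ck.1 y = 1].
have FT x : [set: M] x -> exists2 D, F D & (interior D) x.
  move=> _; have [k [oZ Zx]] : exists k, open (~` Z k) /\ (~` Z k) x.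
    have [Vx|nVx] := pselect (V x); first by exists true; rewrite /Z setCK; split.
    by exists false; split; [exact: closed_openC|move=> /CV].
  have [r [sr [D [V0 [[oD oV0] Dx ZV0 r1 r0]]]]] := bump_at chM hM oZ Zx.
  exists D; last by apply: filterS (open_nbhs_nbhs (conj oD Dx)).
  exists (r, k); split=> //; split=> //; exists V0; split=> //.
  by move=> y Zy; apply: ZV0; rewrite setCK.
have F0 : exists D, F D.
  exists set0, (fun=> 0, true); split=> //; split; first exact: smooth_cst.
  by exists setT; split=> //; exact: openT.
have [D [FD DT]] := countable_base_lindelof cbM FT F0.
have /choice[ck ckP] i := FD i.
pose chi i := (ck i).1; pose kind i := (ck i).2.
have schi i : smooth (chi i) by have [[]] := ckP i.
have chi1 i y : D i y -> chi i y = 1 by have [_] := ckP i; apply.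
pose P k y := \prod_(j < k) (1 - chi j y).
pose r m y := \sum_(k < m) (if kind k then chi k y * P k y else 0).
have sP k : smooth (P k).
  apply: smooth_prod => j; have := smoothD (smooth_cst M 1) (smoothZ (-1) (schi j)).
  by congr smooth; apply/funext => y; rewrite mulN1r.
have sr m : smooth (r m).
  apply: smooth_sum => k; case: (kind k); last exact: smooth_cst.
  exact: smoothM.
have P0 j k y : D j y -> (j < k)%N -> P k y = 0.
  move=> Djy jk; rewrite /P (bigD1 (Ordinal jk)) //= chi1 // subrr mul0r //.
have rstab j m y : D j y -> (j < m)%N -> r m y = r j.+1 y.
  move=> Djy; elim: m => // m IH; rewrite ltnS leq_eqVlt => /orP[/eqP->//|jm].
  rewrite /r big_ord_recr /= -/(r m y) IH //.
  by case: (kind m); rewrite ?addr0 // (P0 j) // mulr0 addr0.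
have /choice[mx mxP] x : exists i, (interior (D i)) x by exact: DT.
pose rr y := r (mx y).+1 y.
have rrE j y : D j y -> rr y = r j.+1 y.
  move=> Djy; have Dm := interior_subset (mxP y); rewrite /rr.
  by rewrite -(rstab j (maxn j (mx y)).+1) ?ltnS ?leq_maxl // (rstab (mx y)) ?ltnS ?leq_maxr.
have srr : smooth rr.
  apply: smooth_on_cover openT _ => x _; exists (interior (D (mx x))); split=> //.
    exact: open_interior.
  apply: (@smooth_on_ext _ _ _ (r (mx x).+1)); first exact: open_interior.
    by move=> y /interior_subset /rrE.
  by apply: smooth_onS (sr _) => //; [exact: openT|exact: open_interior].
have vanish k0 x : Z k0 x -> \forall y \near x, forall k : 'I_(mx x).+1, kind k = k0 -> chi k y = 0.
  move=> Zx; apply: nbhs_forall => k.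
  have [kk|nk] := pselect (kind k = k0); last by apply: nearW => y.
  have [[_ [V0 [oV0 ZV0 r0]]] _] := ckP k.
  have V0x : V0 x by apply: ZV0; rewrite -/(kind k) kk.
  by apply: filterS (open_nbhs_nbhs (conj oV0 V0x)) => y /r0 h _.
have nD x := open_nbhs_nbhs (conj (@open_interior _ (D (mx x))) (mxP x)).
have rC x : C x -> \near x, rr x = 1.
  move=> Cx; apply: filterS2 (nD x) (vanish false x Cx) => y /interior_subset Dy v0.
  rewrite (rrE _ _ Dy).
  have -> : r (mx x).+1 y = \sum_(k < (mx x).+1) chi k y * P k y.
    apply: eq_bigr => k _; case E: (kind k) => //.
    by rewrite v0 // mul0r.
  (* Multiplying out: the sum telescopes. *)
  have tel m : \sum_(k < m) chi k y * P k y = 1 - P m y.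
    elim: m => [|m IH]; first by rewrite big_ord0 /P big_ord0 subrr.
    by rewrite big_ord_recr /= IH /P [in RHS]big_ord_recr /=; ring.
  by rewrite tel (P0 _ _ _ Dy) // subr0.
have rV x : (~` V) x -> \near x, rr x = 0.
  move=> nVx; apply: filterS2 (nD x) (vanish true x nVx) => y /interior_subset Dy v0.
  rewrite (rrE _ _ Dy) /r big1 // => k _; case E: (kind k) => //.
  by rewrite v0 // mul0r.
exists rr; split=> //; exists (interior [set y | rr y = 1]), (interior [set y | rr y = 0]).
split=> //.
- by split; exact: open_interior.
- by move=> y /interior_subset.
- by move=> y /interior_subset.
Qed.

End manifold_topology.

(** * Charts of a fibre bundle *)

Lemma cont_preim (T T' : topologicalType) (h : T -> T') x (A : set T') :
  {for x, continuous h} -> open A -> A (h x) -> nbhs x [set y | A (h y)].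
Proof. by move=> hc oA Ax; exact: (hc A (open_nbhs_nbhs (conj oA Ax))). Qed.

Lemma cont_pair (T A B : topologicalType) (h : T -> A) (k : T -> B) x :
  {for x, continuous h} -> {for x, continuous k} -> {for x, continuous (fun y => (h y, k y))}.
Proof. by move=> hc kc; exact: cvg_pair. Qed.

Lemma split_continuous (R : realType) m n (w : 'rV[R]_(m + n)) :
  {for w, continuous (fun w : 'rV[R]_(m + n) => lsubmx w)} /\
  {for w, continuous (fun w : 'rV[R]_(m + n) => rsubmx w)}.
Proof.
split; apply: continuous_rV => i.
  rewrite (_ : (fun _ => _) = (fun y : 'rV[R]_(m + n) => y 0 (lshift n i))); first exact: coord_continuous.
  by apply/funext => y; rewrite mxE.
rewrite (_ : (fun _ => _) = (fun y : 'rV[R]_(m + n) => y 0 (rshift m i))); first exact: coord_continuous.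
by apply/funext => y; rewrite mxE.
Qed.

Lemma split_open (R : realType) m n (A : set 'rV[R]_m) (B : set 'rV[R]_n) : open A -> open B ->
  open [set w : 'rV[R]_(m + n) | A (lsubmx w) /\ B (rsubmx w)].
Proof.
move=> oA oB; rewrite openE => w [Aw Bw]; rewrite /interior.
have [cl cr] := split_continuous w.
exact: filterI (cont_preim cl oA Aw) (cont_preim cr oB Bw).
Qed.

Section trivialization.
Variables (R : realType) (E X F : fspace R) (pi : smooth_map E X).
Hypotheses (chE : charted E) (chX : charted X).
Variables (U : set X) (q : E -> F) (g : X * F -> E).
Hypotheses (oU : open U) (triv : is_trivialization pi U q g).

Lemma triv_gK z : U (pi z) -> g (pi z, q z) = z.
Proof. by case: triv => [[h _] _ _ _ _]; exact: h. Qed.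

Lemma triv_pi y : U y.1 -> pi (g y) = y.1.
Proof. by case: triv => [[_ h] _ _ _ _] /h[]. Qed.

Lemma triv_q y : U y.1 -> q (g y) = y.2.
Proof. by case: triv => [[_ h] _ _ _ _] /h[]. Qed.

Lemma triv_q_continuous z : U (pi z) -> {for z, continuous q}.
Proof. by case: triv => [_ h _ _ _]; exact: h. Qed.

Lemma triv_g_continuous y : U y.1 -> {for y, continuous g}.
Proof. by case: triv => [_ _ _ h _]; exact: h. Qed.

Lemma triv_q_smooth (V : set F) h : open V -> smooth_on V h ->
  smooth_on (pi @^-1` U `&` q @^-1` V) (h \o q).
Proof. by case: triv => [_ _ h' _ _]; exact: h'. Qed.

Lemma pi_open (W : set X) : open W -> open (pi @^-1` W).
Proof. by move=> oW; apply: open_comp => // x _; exact: smooth_fun_continuous. Qed.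

Lemma triv_open (W : set X) (V : set F) : open W -> W `<=` U -> open V ->
  open (pi @^-1` W `&` q @^-1` V).
Proof.
move=> oW WU oV; rewrite openE => z [Wz Vz]; rewrite /interior; apply: filterI.
  exact: open_nbhs_nbhs (conj (pi_open oW) Wz).
by apply: (triv_q_continuous (WU _ Wz)); exact: open_nbhs_nbhs.
Qed.

Lemma triv_slice_continuous x y : U x -> {for y, continuous (fun y => g (x, y))}.
Proof.
move=> Ux; apply: (@cont_comp F (X * F)%type E (fun y => (x, y)) g).
  by apply: cont_pair; [exact: cvg_cst|exact: cvg_id].
exact: triv_g_continuous.
Qed.

Lemma triv_countable_base x : U x -> countable_base [set: E] -> countable_base [set: F].
Proof.
move=> Ux [b [ob bP]]; exists (fun i => [set y | b i (g (x, y))]); split=> [i|O y oO Oy _].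
  rewrite openE => y by_; rewrite /interior.
  exact: (cont_preim (triv_slice_continuous Ux) (ob i) by_).
have oW : open (pi @^-1` U `&` q @^-1` O) by exact: triv_open.
have [|//|i bi bO] := bP _ (g (x, y)) oW.
  by split; rewrite /preimage /= ?triv_pi ?triv_q.
exists i => // y' /bO[_]; by rewrite /preimage /= triv_q.
Qed.

Section product_chart.
Variables (U1 : set X) (m : nat) (phi : X -> 'rV[R]_m) (phi' : 'rV[R]_m -> X).
Variables (V : set F) (n : nat) (psi : F -> 'rV[R]_n) (psi' : 'rV[R]_n -> F).
Hypotheses (hcX : is_chart U1 phi phi') (U1U : U1 `<=` U) (hcF : is_chart V psi psi').

Definition prod_dom : set E := pi @^-1` U1 `&` q @^-1` V.
Definition prod_phi (z : E) : 'rV[R]_(m + n) := row_mx (phi (pi z)) (psi (q z)).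
Definition prod_psi (w : 'rV[R]_(m + n)) : E := g (phi' (lsubmx w), psi' (rsubmx w)).

Lemma prod_dom_open : open prod_dom.
Proof. by apply: triv_open => //; [exact: chart_open hcX|exact: chart_open hcF]. Qed.

Lemma prod_phiK z : prod_dom z -> prod_psi (prod_phi z) = z.
Proof.
move=> [Uz Vz]; rewrite /prod_psi /prod_phi row_mxKl row_mxKr (chartK hcX) // (chartK hcF) //.
by apply: triv_gK; exact: U1U.
Qed.

Lemma prod_psiK w : (phi @` U1) (lsubmx w) -> (psi @` V) (rsubmx w) ->
  prod_dom (prod_psi w) /\ prod_phi (prod_psi w) = w.
Proof.
move=> /(chartV hcX)[h1 h2] /(chartV hcF)[h3 h4]; have U1' := U1U h1.
rewrite /prod_dom /prod_phi /prod_psi /preimage /= triv_pi // triv_q //=.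
by rewrite h2 h4 hsubmxK.
Qed.

Lemma prod_image : prod_phi @` prod_dom =
  [set w | (phi @` U1) (lsubmx w) /\ (psi @` V) (rsubmx w)].
Proof.
apply/seteqP; split=> [w [z [Uz Vz] <-]|w [h1 h2]].
  by rewrite /= /prod_phi row_mxKl row_mxKr; split; [exists (pi z)|exists (q z)].
by have [h3 h4] := prod_psiK h1 h2; exists (prod_psi w).
Qed.

Lemma prod_phi_smooth i : smooth_on prod_dom (fun z => prod_phi z 0 i).
Proof.
case: (split_ordP i) => j ->.
  apply: (@smooth_on_ext _ _ _ ((fun x => phi x 0 j) \o pi)); first exact: prod_dom_open.
    by move=> z _; rewrite /prod_phi row_mxEl.
  have := smooth_fun_comp pi (chart_open hcX) (chart_coord hcX j).
  apply: smooth_onS; [exact: pi_open (chart_open hcX)|exact: prod_dom_open|by move=> z []].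
apply: (@smooth_on_ext _ _ _ ((fun x => psi x 0 j) \o q)); first exact: prod_dom_open.
  by move=> z _; rewrite /prod_phi row_mxEr.
have := triv_q_smooth (chart_open hcF) (chart_coord hcF j).
apply: smooth_onS; [exact: triv_open oU _ (chart_open hcF)|exact: prod_dom_open|].
by move=> z [Uz Vz]; split=> //; exact: U1U.
Qed.

(** A function that is smooth in some product chart is smooth in the given one:
    compose with the change of coordinates. *)
Lemma transition_smooth m2 n2 (U2 : set X) (a : X -> 'rV[R]_m2) a' (V2 : set F)
    (b : F -> 'rV[R]_n2) b' P (H : E -> R) : is_chart U2 a a' -> is_chart V2 b b' ->
  open P -> P `<=` [set w | (phi @` (U1 `&` U2)) (lsubmx w) /\ (psi @` (V `&` V2)) (rsubmx w)] ->
  rV_smooth_on [set w : 'rV[R]_(m2 + n2) | (a @` U2) (lsubmx w) /\ (b @` V2) (rsubmx w)]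
    (fun w => H (g (a' (lsubmx w), b' (rsubmx w)))) ->
  rV_smooth_on P (H \o prod_psi).
Proof.
move=> ha hb oP PQ sH.
have oQ := split_open (chart_openI ha) (chart_openI hb).
have oUU : open (U1 `&` U2) by apply: openI; [exact: chart_open hcX|exact: chart_open ha].
have oVV : open (V `&` V2) by apply: openI; [exact: chart_open hcF|exact: chart_open hb].
have UU1 : U1 `&` U2 `<=` U1 by move=> x [].
have VV1 : V `&` V2 `<=` V by move=> x [].
pose th w := row_mx (a (phi' (lsubmx w))) (b (psi' (rsubmx w))) : 'rV[R]_(m2 + n2).
have Hth w : P w -> (H \o prod_psi) w = (fun w => H (g (a' (lsubmx w), b' (rsubmx w)))) (th w).
  move=> /PQ[[x [U1x U2x] xE] [y [Vy V2y] yE]]; rewrite /= /th row_mxKl row_mxKr.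
  rewrite -xE -yE (chartK hcX) // (chartK hcF) // (chartK ha) // (chartK hb) //.
  by rewrite /prod_psi -xE -yE (chartK hcX) // (chartK hcF).
apply: (rV_smooth_ext oP (fun w Pw => esym (Hth w Pw))).
apply: (rV_smooth_comp oP oQ sH (g := th)).
  move=> w /PQ[[x [U1x U2x] xE] [y [Vy V2y] yE]]; rewrite /= /th row_mxKl row_mxKr.
  rewrite -xE -yE (chartK hcX) // (chartK hcF) //.
  by split; [exists x|exists y].
move=> i; case: (split_ordP i) => j ->.
  apply: (@rV_smooth_ext _ _ _ oP (((fun x => a x 0 j) \o phi') \o (fun w : 'rV[R]_(m + n) => lsubmx w))).
    by move=> w _; rewrite /th row_mxEl.
  apply: (rV_smooth_comp oP (chart_image_open hcX oUU UU1)).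
  - apply/(chart_smoothP hcX _ oUU UU1); apply: smooth_onS (chart_coord ha j) => //.
      exact: chart_open ha.
  - by move=> w /PQ[].
  - move=> k; apply: (@rV_smooth_ext _ _ _ oP (fun w : 'rV[R]_(m + n) => w 0 (lshift n k))).
      by move=> w _; rewrite mxE.
    exact: rV_smooth_coord.
apply: (@rV_smooth_ext _ _ _ oP (((fun x => b x 0 j) \o psi') \o (fun w : 'rV[R]_(m + n) => rsubmx w))).
  by move=> w _; rewrite /th row_mxEr.
apply: (rV_smooth_comp oP (chart_image_open hcF oVV VV1)).
- apply/(chart_smoothP hcF _ oVV VV1); apply: smooth_onS (chart_coord hb j) => //.
    exact: chart_open hb.
- by move=> w /PQ[].
- move=> k; apply: (@rV_smooth_ext _ _ _ oP (fun w : 'rV[R]_(m + n) => w 0 (rshift m k))).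
    by move=> w _; rewrite mxE.
  exact: rV_smooth_coord.
Qed.

(** The trivialization describes smooth functions on E in product charts that
    depend on the point; transition_smooth brings them to the given chart. *)
Lemma prod_chart : is_chart prod_dom prod_phi prod_psi.
Proof.
have oI : open (prod_phi @` prod_dom).
  by rewrite prod_image; apply: split_open; [exact: chart_openI hcX|exact: chart_openI hcF].
have cpsi w : (prod_phi @` prod_dom) w -> {for w, continuous prod_psi}.
  rewrite prod_image => -[h1 h2]; have [cl cr] := split_continuous w.
  apply: (@cont_comp _ _ _ (fun w => (phi' (lsubmx w), psi' (rsubmx w))) g).
    apply: cont_pair.
      exact: (@cont_comp _ _ _ (fun w : 'rV[R]_(m + n) => lsubmx w) phi' w cl (chartV_continuous hcX h1)).
    exact: (@cont_comp _ _ _ (fun w : 'rV[R]_(m + n) => rsubmx w) psi' w cr (chartV_continuous hcF h2)).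
  by apply: triv_g_continuous; apply: U1U; have [] := chartV hcX h1.
split=> //.
- by split=> //; exact: prod_dom_open.
- exact: prod_phiK.
- move=> z Dz; exact: (smooth_on_continuous_rV prod_dom_open Dz prod_phi_smooth).
move=> W f oW WD; split=> [fW|fW]; last first.
  have oWI : open (prod_phi @` W).
    rewrite openE => w Ww; rewrite /interior.
    have Iw : (prod_phi @` prod_dom) w by move: Ww => [z /WD Dz <-]; exists z.
    have : \forall w' \near w, (prod_phi @` prod_dom) w' /\ W (prod_psi w').
      apply: filterI; first exact: open_nbhs_nbhs.
      apply: (cpsi w Iw); apply: open_nbhs_nbhs; split=> //.
      by move: Ww => [z Wz <-]; rewrite prod_phiK //; exact: WD.
    apply: filterS => w' [[z Dz <-]]; rewrite prod_phiK // => Wz; by exists z.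
  apply: (@smooth_on_ext _ _ _ ((f \o prod_psi) \o prod_phi)) => //.
    by move=> z /WD Dz; rewrite /= prod_phiK.
  apply: (smooth_on_comp_rV chE oW oWI fW).
    by move=> z Wz; exists z.
  move=> i; apply: smooth_onS (prod_phi_smooth i) => //; exact: prod_dom_open.
move=> vs w Ww; have [z Wz zw] := Ww; have [Uz Vz] := WD z Wz.
have [_ _ _ _ hg] := triv.
have [|U2 [V2 [m2 [n2 [a [a' [b [b' [[ha hb] [U2z V2z] UVW sf]]]]]]]]] := hg W f oW fW (pi z, q z).
  by split=> /=; [exact: U1U|rewrite triv_gK //; exact: U1U].
pose P := [set w | (phi @` (U1 `&` U2)) (lsubmx w) /\ (psi @` (V `&` V2)) (rsubmx w)].
have oP : open P.
  apply: split_open.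
    apply: (chart_image_open hcX); last by move=> x [].
    by apply: openI; [exact: chart_open hcX|exact: chart_open ha].
  apply: (chart_image_open hcF); last by move=> x [].
  by apply: openI; [exact: chart_open hcF|exact: chart_open hb].
apply: (transition_smooth ha hb oP (@subset_refl _ P) sf).
by rewrite -zw /P /= /prod_phi row_mxKl row_mxKr; split; [exists (pi z)|exists (q z)].
Qed.

Lemma prod_star w1 w2 : star_shaped w1 (phi @` U1) -> star_shaped w2 (psi @` V) ->
  star_shaped (row_mx w1 w2) (prod_phi @` prod_dom).
Proof.
move=> s1 s2 w t; rewrite prod_image => -[h1 h2] t01 /=.
have lE : lsubmx (t *: (w - row_mx w1 w2) + row_mx w1 w2) = t *: (lsubmx w - w1) + w1.
  by apply/rowP => i; rewrite !mxE -[lshift n i]/(lshift n i) (unsplitK (inl i)).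
have rE : rsubmx (t *: (w - row_mx w1 w2) + row_mx w1 w2) = t *: (rsubmx w - w2) + w2.
  by apply/rowP => i; rewrite !mxE (unsplitK (inr i)).
by rewrite lE rE; split; [exact: s1|exact: s2].
Qed.

End product_chart.

Section fiber_chart.
Variable (x : X).
Hypothesis Ux : U x.
Let Ex := fiber pi x.
Let iota : Ex -> E := set_val.

Lemma fiber_pi (z : Ex) : pi (iota z) = x.
Proof. exact: (set_mem (valP z)). Qed.

Lemma fiber_pt_subproof y : (pi @^-1` [set x]) (g (x, y)).
Proof. by rewrite /preimage /= triv_pi. Qed.

Definition fiber_pt (y : F) : Ex := SigSub (mem_set (fiber_pt_subproof y)).

Lemma fiber_ptE y : iota (fiber_pt y) = g (x, y). Proof. by []. Qed.

Lemma fiber_ptK y : q (iota (fiber_pt y)) = y.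
Proof. by rewrite fiber_ptE triv_q. Qed.

Lemma fiber_qK (z : Ex) : fiber_pt (q (iota z)) = z.
Proof.
apply: val_inj; rewrite -[LHS]/(g (x, q (iota z))) -{1}(fiber_pi z).
by rewrite triv_gK //; rewrite fiber_pi.
Qed.

Lemma fiber_incl_continuous (z : Ex) : {for z, continuous iota}.
Proof. exact: (@smooth_fun_continuous _ _ _ (fiber_incl pi x) z). Qed.

Lemma fiber_q_continuous (z : Ex) : {for z, continuous (q \o iota)}.
Proof.
apply: cont_comp; first exact: fiber_incl_continuous.
by apply: triv_q_continuous; rewrite fiber_pi.
Qed.

Lemma fiber_pt_continuous y : {for y, continuous fiber_pt}.
Proof.
move=> B; rewrite nbhsE => -[ O [[A oA AO] Oy] OB].
have Ay : A (g (x, y)) by move: Oy; rewrite -AO.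
have := cont_preim (triv_slice_continuous Ux) oA Ay.
apply: filterS => y' Ay'; apply: OB; rewrite -AO; exact: Ay'.
Qed.

Variables (V : set F) (n : nat) (psi : F -> 'rV[R]_n) (psi' : 'rV[R]_n -> F).
Hypothesis (hcF : is_chart V psi psi').

Definition fiber_dom : set Ex := (q \o iota) @^-1` V.

Lemma fiber_dom_open : open fiber_dom.
Proof.
rewrite openE => z Vz; rewrite /interior.
exact: (cont_preim (fiber_q_continuous (z := z)) (chart_open hcF) Vz).
Qed.

Lemma fiber_image : (psi \o q \o iota) @` fiber_dom = psi @` V.
Proof.
apply/seteqP; split=> [w [z Vz <-]|w [y Vy <-]]; first by exists (q (iota z)).
by exists (fiber_pt y); rewrite /fiber_dom /preimage /= fiber_ptK.
Qed.

(** Composition with q extends functions from the fibre to E; conversely the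
    restriction of a smooth function of E is smooth on the slice of a product
    chart. *)
Lemma fiber_chart : is_chart fiber_dom (psi \o q \o iota) (fiber_pt \o psi').
Proof.
have cpsi w : (psi @` V) w -> {for w, continuous (fiber_pt \o psi')}.
  move=> Vw; apply: cont_comp; first exact: (chartV_continuous hcF).
  exact: fiber_pt_continuous.
have phiK z : fiber_dom z -> (fiber_pt \o psi') ((psi \o q \o iota) z) = z.
  by move=> Vz; rewrite /= (chartK hcF) // fiber_qK.
have oI W : open W -> W `<=` fiber_dom -> open ((psi \o q \o iota) @` W).
  move=> oW WD; rewrite openE => w [z Wz zw]; rewrite /interior.
  have Iw : (psi @` V) w by rewrite -fiber_image; exists z => //; exact: WD.
  have : \forall w' \near w, (psi @` V) w' /\ W (fiber_pt (psi' w')).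
    apply: filterI; first exact: open_nbhs_nbhs (conj (chart_openI hcF) Iw).
    apply: (cpsi w Iw); apply: open_nbhs_nbhs; split=> //.
    by rewrite -zw phiK //; exact: WD.
  apply: filterS => w' [[y Vy <-]]; rewrite (chartK hcF) // => Wy.
  by exists (fiber_pt y) => //=; rewrite fiber_ptK.
split.
- by split; [exact: fiber_dom_open|apply: oI => //; exact: fiber_dom_open].
- exact: phiK.
- move=> z Vz; rewrite -compA; apply: cont_comp; first exact: fiber_q_continuous.
  exact: (chart_continuous hcF).
- by move=> w; rewrite fiber_image; exact: cpsi.
move=> W f oW WD; split=> [fW|fW]; last first.
  move=> z Wz; pose P := (pi @^-1` U `&` q @^-1` V) `&` ((psi \o q) @^-1` ((psi \o q \o iota) @` W)).
  have oUV := triv_open oU (@subset_refl _ U) (chart_open hcF).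
  have oP : open P.
    rewrite openE => z' [[Uz' Vz'] Iz']; rewrite /interior; apply: filterI.
      exact: open_nbhs_nbhs (conj oUV (conj Uz' Vz')).
    have c : {for z', continuous (psi \o q)}.
      by apply: cont_comp; [exact: triv_q_continuous|exact: (chart_continuous hcF)].
    by apply: c; apply: open_nbhs_nbhs; split=> //; exact: oI.
  exists P, ((f \o (fiber_pt \o psi')) \o (psi \o q)); split=> //.
  - split; last by exists z.
    by split; [rewrite /preimage /= fiber_pi|exact: WD].
  - apply: (smooth_on_comp_rV chE oP (oI W oW WD) fW).
      by move=> z' [].
    move=> i; have := triv_q_smooth (chart_open hcF) (chart_coord hcF i).
    by apply: smooth_onS => // z' [].
  - by move=> z' Wz' _; rewrite /= -[X in f X = _](phiK z') //; exact: WD.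
move=> vs w [z Wz zw].
have [P [G [oP Pz GP fG]]] := fW z Wz.
have [U0 [m [phi [phi' [hX U0x]]]]] := chX x.
have oU1 : open (U0 `&` U) by apply: openI => //; exact: chart_open hX.
have hX1 : is_chart (U0 `&` U) phi phi' by apply: (chart_restrict hX) => // y [].
have U1U : U0 `&` U `<=` U by move=> y [].
have hE := prod_chart hX1 U1U hcF.
set D := prod_dom _ _ in hE; have oDP := openI (chart_open hE) oP.
have DPD : D `&` P `<=` D by move=> y [].
have GD : smooth_on (D `&` P) G by apply: smooth_onS GP => // y [].
have GE := (chart_smoothP hE G oDP DPD).1 GD.
have oWP : open (W `&` iota @^-1` P).
  apply: openI => //; rewrite openE => z' Pz'; rewrite /interior.
  exact: (cont_preim (fiber_incl_continuous (z := z')) oP Pz').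
have WPD : W `&` iota @^-1` P `<=` fiber_dom by move=> y [/WD].
have oQ := oI _ oWP WPD.
suff h : rV_smooth_on ((psi \o q \o iota) @` (W `&` iota @^-1` P)) (f \o (fiber_pt \o psi')).
  by apply: h; exists z.
have slice z' : W z' -> P (iota z') -> (prod_phi phi psi @` (D `&` P)) (row_mx (phi x) (psi (q (iota z')))).
  move=> Wz' Pz'; exists (iota z'); last by rewrite /prod_phi fiber_pi.
  split=> //; split; last exact: WD.
  by rewrite /preimage /= fiber_pi.
apply: (@rV_smooth_ext _ _ _ oQ ((G \o prod_psi phi' psi') \o (fun w => row_mx (phi x) w))).
  move=> w' [z' [Wz' Pz'] <-]; have Dz' := WD z' Wz'.
  rewrite -[RHS]/(f ((fiber_pt \o psi') ((psi \o q \o iota) z'))) phiK // fG //.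
  rewrite /= /prod_psi row_mxKl row_mxKr (chartK hX1) // (chartK hcF) //; congr G.
  by rewrite -{1}(fiber_pi z') triv_gK // fiber_pi.
apply: (rV_smooth_comp oQ (chart_image_open hE oDP DPD) GE).
  by move=> w' [z' [Wz' Pz'] <-]; exact: slice.
move=> i; case: (split_ordP i) => j ->.
  apply: (@rV_smooth_ext _ _ _ oQ (fun=> phi x 0 j)); last exact: rV_smooth_cst.
  by move=> w' _; rewrite row_mxEl.
apply: (@rV_smooth_ext _ _ _ oQ (fun w : 'rV[R]_n => w 0 j)); last exact: rV_smooth_coord.
by move=> w' _; rewrite row_mxEr.
Qed.

End fiber_chart.

Lemma fiber_charted x : charted F -> U x -> charted (fiber pi x).
Proof.
move=> chF Ux z; have [V [n [psi [psi' [hcF Vz]]]]] := chF (q (set_val z)).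
exists (fiber_dom (x := x) V), n, (psi \o q \o set_val), (fiber_pt Ux \o psi').
exact: (conj (fiber_chart Ux hcF) Vz).
Qed.

Lemma fiber_hausdorff x : hausdorff_space E -> hausdorff_space (fiber pi x).
Proof.
rewrite !open_hausdorff => hE y z yz.
have [|[A B] /= [Ay Bz] [oA oB AB]] := hE (set_val y) (set_val z).
  by apply: contra_neq yz; exact: val_inj.
exists (set_val @^-1` A, set_val @^-1` B) => /=.
  by rewrite !inE in Ay Bz *.
split.
- by exists A.
- by exists B.
- apply/eqP/seteqP; split=> // t [At Bt].
  by move/eqP: AB => /seteqP[h _]; apply: (h (set_val t)).
Qed.

End trivialization.

(** * Closed forms over a trivialization *)

Lemma LD_flat (R : realType) (c : coef) (M : fspace R) (L : local_system (coef_field R c) M)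
    (U : set M) (s : forall x, L x) : open U -> sect U s ->
  LD U ((fun x _ => s x) : pform L 0) 0.
Proof.
move=> oU sU; apply: exact_sum_closed => z Uz.
exists U, 'I_1, (fun _ _ _ => 0), (fun=> s); split=> //.
  by move=> _ k; case: k.
move=> x v _; by rewrite /lsum big_ord1 /elem det_mx00 mulr1 rmorph1 scale1r.
Qed.

Lemma kframe_pull (R : realType) (c : coef) (M N : fspace R) (F : smooth_map M N)
    (L : local_system (coef_field R c) N) U n phi inv :
  @kframe R c N L U n phi inv ->
  @kframe R c M (inverse_system F L) (F @^-1` U) n (fun z => phi (F z)) (fun z => inv (F z)).
Proof.
have FC := @smooth_fun_continuous R M N F.
move=> [oU invP P]; split; first by apply: open_comp => // y _; exact: FC.
  by move=> y; exact: invP.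
move=> W s oW WU; split=> [sW|[k [kW sk]]]; last first.
  suff : @inv_sect _ _ _ F L W s by [].
  move=> y Wy; exists U, (fun z => phi z (k y)); split=> //; first exact: WU.
    by apply/P => //; exists (fun=> k y); split=> // z _; exact: nearW.
  by apply: filterS2 (open_nbhs_nbhs (conj oW Wy)) (kW y Wy) => z Wz kz; rewrite sk // kz.
exists (fun z => inv (F z) (s z)); split; last first.
  by move=> y Wy; have [_ ->] := invP _ (WU _ Wy).
move=> y Wy; have [ O [t [oO Oy tO st]]] : exists O (t : forall y, L y),
    [/\ open O, O (F y), sect O t & \forall z \near y, s z = t (F z)] by exact: (sW y Wy).
have oOU : open (O `&` U) by exact: openI.
have OUU : O `&` U `<=` U by move=> z [].
have tOU : sect (O `&` U) t by apply: sectS tO => // z [].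
have [h [hOU th]] := (P _ t oOU OUU).1 tOU.
have nh : \forall z \near y, (O `&` U) (F z) /\ h (F z) = h (F y).
  have n1 : nbhs (F y) (O `&` U) by apply: open_nbhs_nbhs; split=> //; split=> //; exact: WU.
  apply: filterI; first exact: (FC y _ n1).
  have n2 : \forall w \near F y, h w = h (F y) by apply: hOU; split=> //; exact: WU.
  exact: (FC y _ n2).
have key z : s z = t (F z) -> (O `&` U) (F z) -> inv (F z) (s z) = h (F z).
  by move=> st' Oz; rewrite st' th //; have [-> _] := invP _ Oz.2.
have sty := nbhs_singleton st.
apply: filterS2 st nh => z sz [Oz hz]; rewrite key // hz key //.
by split=> //; exact: WU.
Qed.

Section fiberwise_exactness.
Variables (R : realType) (c : coef) (E X F : fspace R) (pi : smooth_map E X).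
Hypotheses (chE : charted E) (chX : charted X) (chF : charted F).
Hypotheses (hE : hausdorff_space E) (hF : hausdorff_space F) (cbF : countable_base [set: F]).
Let K : fieldType := coef_field R c.
Variable L : local_system K X.
Variables (U : set X) (q : E -> F) (g : X * F -> E).
Hypotheses (oU : open U) (triv : is_trivialization pi U q g).
Variables (U1 : set X) (m : nat) (phi : X -> 'rV[R]_m) (phi' : 'rV[R]_m -> X) (w1 : 'rV[R]_m).
Hypotheses (hcX : is_chart U1 phi phi') (U1U : U1 `<=` U) (st1 : star_shaped w1 (phi @` U1)).
Variables (N : nat) (ph : forall y, {linear 'rV[K]_N -> L y}) (inv : forall y, L y -> 'rV[K]_N).
Hypothesis hk : kframe U1 ph inv.
Variable x : X.
Hypothesis U1x : U1 x.

Let Ex := fiber pi x.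
Let iota := fiber_incl pi x.
Let Ux : U x := U1U U1x.
Let chEx : charted Ex := fiber_charted chE chX oU triv chF Ux.
Let hEx : hausdorff_space Ex := @fiber_hausdorff _ _ _ pi x hE.
Let LE := inverse_system pi L.
Let LEx := inverse_system iota LE.

Let oM0 : open (pi @^-1` U1) := pi_open pi (chart_open hcX).
Let qC z : (pi @^-1` U1) z -> {for z, continuous q}.
Proof. by move=> Uz; apply: (triv_q_continuous triv); exact: U1U. Qed.
Let qS (r : F -> R) : smooth r -> smooth_on (pi @^-1` U1) (r \o q).
Proof.
move=> sr; have := triv_q_smooth triv openT sr; rewrite preimage_setT setIT.
by apply: smooth_onS => //; [exact: pi_open|move=> z; exact: U1U].
Qed.
Let qC' (z : Ex) : [set: Ex] z -> {for z, continuous (q \o iota)}.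
Proof. by move=> _; exact: (fiber_q_continuous triv Ux). Qed.
Let qS' (r : F -> R) : smooth r -> smooth_on [set: Ex] (r \o (q \o iota)).
Proof.
move=> /qS h; have := smooth_fun_comp iota oM0 h.
apply: smooth_onS; [|exact: openT|].
  by apply: open_comp => // z _; exact: smooth_fun_continuous.
by move=> z _; rewrite /preimage /= -/(pi _) (_ : pi _ = x) //; exact: fiber_pi.
Qed.

Let A := form_complex chE hE oM0 qC qS LE.
Let B := form_complex chEx hEx openT qC' qS' LEx.

Let rst n (a : car A n) : car B n := pullback_form iota a.

Let rst_dif n W (a : car A n) a' : open W -> dif A W a a' -> dif B W (rst a) (rst a').
Proof.
move=> oW /(LD_pullback (F := iota)); apply: LDS => z [_ Wz]; split=> //.
by rewrite /preimage /= (_ : pi _ = x) //; exact: fiber_pi.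
Qed.

Let rst_zero n W (a : car A n) : zero_on A W a -> zero_on B W (rst a).
Proof.
rewrite /A /B /= => h z [_ Wz]; apply/funext => v; rewrite /rst /pullback_form h //.
by split=> //; rewrite /preimage /= (_ : pi _ = x) //; exact: fiber_pi.
Qed.

Let rstL n k (a b : car A n) : rst (k *: a + b) = k *: rst a + rst b :> car B n.
Proof. by []. Qed.

Let C := cone rstL rst_zero rst_dif.

(** A star-shaped chart of F gives star-shaped charts of pi^-1(U1) and of the
    fibre, where both complexes satisfy the Poincare lemma; in degree 0 both
    reduce to the same stalk of L. *)
Lemma fiber_cone_locally_exact n W y : open W -> W y ->
  exists V, [/\ open V, V y, V `<=` W & exact_on C n V].
Proof.
move=> oW Wy; have [V [d [psi [psi' [w2 [hcF Vy VW st2]]]]]] := poincare_chart chF oW Wy.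
exists V; split=> //; first exact: chart_open hcF.
have hcE := prod_chart chE oU triv hcX U1U hcF.
have stE := prod_star triv hcX U1U hcF st1 st2.
set D := prod_dom _ _ _ _ in hcE stE.
have DM : D `<=` pi @^-1` U1 by move=> z [].
have hkE := kframeS (chart_open hcE) DM (kframe_pull pi hk).
have hcB := fiber_chart chE chX oU triv Ux hcF.
set DB := fiber_dom _ _ in hcB.
have stB : star_shaped w2 ((psi \o q \o set_val) @` DB) by rewrite (fiber_image triv Ux).
have DBM : DB `<=` iota @^-1` (pi @^-1` U1).
  by move=> z _; rewrite /preimage /= (_ : pi _ = x) //; exact: fiber_pi.
have hkB := kframeS (chart_open hcB) DBM (kframe_pull iota (kframe_pull pi hk)).
have oB p (a : pform LEx p) b : LD (over [set: Ex] (q \o iota) V) a b <-> LD DB a b.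
  by split; apply: LDS => z; [|move=> []].
case: n => [|n].
  move=> a [/= da za].
  have [k kE] := poincare0_kframe chE hE hcE stE hkE da.
  have z0D : D (set_val (fiber_pt triv Ux y)).
    by split; rewrite /preimage /=; [rewrite (fiber_pi (fiber_pt triv Ux y))|rewrite fiber_ptK].
  have k0 : k = 0.
    have : over [set: Ex] (q \o iota) V (fiber_pt triv Ux y).
      by split=> //; rewrite /preimage /= fiber_ptK.
    move=> /za /(congr1 (fun h => h (fun=> 0))).
    rewrite -[LHS]/(0 - a _ _) sub0r kE // => /eqP; rewrite oppr_eq0 => /eqP h.
    have [_ invP _] := hkE; have [h1 _] := invP _ z0D.
    by apply: (can_inj h1); rewrite linear0.
  by move=> z Dz; apply/funext => v; rewrite kE // k0 linear0.
move=> [a b] [/= da]; rewrite subr0 => db.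
have [J [kJ [co hf]]] := kframe_flat hkE.
have [cE dc] := poincare chE hE hcE stE hf da.
have de : LD DB (pullback_form iota cE - b : pform LEx n) 0.
  rewrite -(subrr (rst a)); apply: LDB; last exact/oB.
  have DBD : DB `<=` iota @^-1` D by move=> z Vz; split=> //; exact: DBM.
  have h1 := LD_pullback (F := iota) (L := LE) dc.
  exact: (LDS (L := LEx) DBD h1).
case: n a b da db cE dc de => [|n] a b da db cE dc de.
  have [k kE] := poincare0_kframe chEx hEx hcB stB hkB de.
  pose kf : pform LE 0 := fun z v => ph (pi z) k.
  exists (cE - kf); split=> /=.
    rewrite -[a]subr0; apply: LDB => //.
    exact: (LD_flat (L := LE) (chart_open hcE) (kframe_sect k hkE)).
  move=> z [_ Vz]; apply/funext => v.
  have := kE z v Vz; rewrite -[LHS]/(cE (iota z) _ - b z v) => h.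
  rewrite -[LHS]/(b z v - (cE (iota z) (fun i => tangent_map iota (v i)) - ph (pi (iota z)) k)).
  by rewrite -h subKr subrr.
have [J' [kJ' [co' hf']]] := kframe_flat hkB.
have [e de'] := poincare chEx hEx hcB stB hf' de.
exists (cE, e); split=> //=.
exact/oB.
Qed.

(** Relative to the fibre, the complex of forms over pi^-1(U1) is locally acyclic
    over F, hence acyclic. *)
Theorem fiberwise_exact p (a : pform LE p) : LD (pi @^-1` U1) a 0 ->
  match p return pform LE p -> Prop with
  | 0 => fun a => pullback_form iota a = 0 :> pform LEx 0 -> forall z, U1 (pi z) -> a z = 0
  | m.+1 => fun a => forall b : pform LEx m, LD setT b (pullback_form iota a) ->
      exists b', LD (pi @^-1` U1) b' a
  end a.
Proof.
move=> da.
have ex n : exact_on C n setT.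
  apply: (locally_exact_exact (smooth_normal chF hF cbF) (smooth_shrinkable chF hF cbF)); last exact: openT.
  exact: fiber_cone_locally_exact.
have oE : over (pi @^-1` U1) q setT = pi @^-1` U1 by rewrite /over preimage_setT setIT.
have oB : over [set: Ex] (q \o iota) setT = setT by rewrite /over preimage_setT setIT.
case: p a da => [|p] a da.
  move=> ra z Uz; apply: (ex 0%N a); last by rewrite oE.
  split=> /=; first by rewrite /form_dif oE.
  by move=> z' _; rewrite /rst ra subr0.
move=> b db; have [|c'] := ex p.+1 (a, b).
  split=> /=; first by rewrite /form_dif oE.
  by rewrite subr0 /form_dif oB.
case: p a da b db c' => [|p] a da b db c' [/= dc _].
  by exists c'; move: dc; rewrite /form_dif oE.
by exists c'.1; move: dc; rewrite /form_dif oE.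
Qed.

End fiberwise_exactness.

(** * The Leray-Hirsch morphism of complexes *)

Lemma homogE (K : pzRingType) (V : nat -> lmodType K) q (a : V q) : homog a q = a.
Proof. by rewrite /homog; case: eqP => // e; rewrite eq_axiomK. Qed.

Lemma homog_neq (K : pzRingType) (V : nat -> lmodType K) q p (a : V q) : q <> p -> homog a p = 0.
Proof. by rewrite /homog; case: eqP. Qed.

Definition kLD (R : realType) (c : coef) (M : fspace R) p U (w : kform c M p)
    (w' : kform c M p.+1) := @LD R c M (const_coef c M) p U w w'.

Definition is_exact (R : realType) (c : coef) (M : fspace R) m : kform c M m -> Prop :=
  match m return kform c M m -> Prop with
  | 0 => fun w => w = 0
  | _.+1 => fun w => exists v, kLD setT v w
  end.

Section leray_hirsch.
Variables (R : realType) (c : coef) (E X F : fspace R) (pi : smooth_map E X).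
Hypotheses (chE : charted E) (chX : charted X) (chF : charted F).
Hypotheses (hE : hausdorff_space E) (hX : hausdorff_space X) (hF : hausdorff_space F).
Hypothesis (cbE : countable_base [set: E]).
Hypothesis triv_at : forall x, exists U (q : E -> F) g,
  [/\ open U, U x & is_trivialization pi U q g].
Let K : fieldType := coef_field R c.
Variables (L : local_system (coef_field R c) X) (r : nat) (u : 'I_r -> nat).
Variable eps : forall i : 'I_r, kform c E (u i).
Arguments eps : clear implicits.
Hypothesis eps_closed : forall i, kLD setT (eps i) 0.

Definition rstr x m (w : kform c E m) : kform c (fiber pi x) m := pullback_form (fiber_incl pi x) w.

Arguments rstr : clear implicits.

Definition eps_rstr x m (i : 'I_r) : kform c (fiber pi x) m :=
  rstr x m (homog (V := fun p => kform c E p) (eps i) m).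

Arguments eps_rstr : clear implicits.

Hypothesis free_inj : forall x m (k : 'I_r -> K),
  is_exact (\sum_i k i *: eps_rstr x m i) -> forall i, u i = m -> k i = 0.
Hypothesis free_gen : forall x m (b : kform c (fiber pi x) m),
  kLD setT b 0 ->
  exists k : 'I_r -> K, is_exact (b - \sum_i k i *: eps_rstr x m i).

Let LE := inverse_system pi L.

Let idC (x : X) : [set: X] x -> {for x, continuous (@id X)}.
Proof. by move=> _; exact: cvg_id. Qed.
Let idS (s : X -> R) : smooth s -> smooth_on [set: X] (s \o id).
Proof. by []. Qed.
Let piC (z : E) : [set: E] z -> {for z, continuous pi}.
Proof. by move=> _; exact: smooth_fun_continuous. Qed.
Let piS (s : X -> R) : smooth s -> smooth_on [set: E] (s \o pi).
Proof. exact: smooth_comp. Qed.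

(** Source and target of the morphism are complexes of sheaves on X, the second
    one as a direct image along pi. *)
Definition base_complex := shifted_sum (form_complex chX hX openT idC idS L) u.
Definition total_complex := form_complex chE hE openT piC piS LE.

Definition lh_term n (a : car base_complex n) (i : 'I_r) : pform LE n :=
  match pselect (u i <= n)%N with
  | left h => wedge (subnK h) (pullback_form pi (a (ShiftIndex (subnK h)))) (eps i)
  | right _ => 0
  end.
Arguments lh_term {n} a i _ _.

Definition lh_map n (a : car base_complex n) : car total_complex n :=
  \sum_i lh_term a i.
Arguments lh_map {n} a _ _.

Lemma lh_termE n (a : car base_complex n) i p (H : (p + u i = n)%N) :
  lh_term a i = wedge H (pullback_form pi (a (ShiftIndex H))) (eps i).
Proof.
rewrite /lh_term; case: pselect => [h|nh]; last by case: nh; rewrite -H leq_addl.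
have pE : p = (n - u i)%N by rewrite -H addnK.
by subst p; rewrite (eq_irrelevance H (subnK h)).
Qed.

Lemma lh_term0 n (a : car base_complex n) i : (n < u i)%N -> lh_term a i = 0.
Proof. by move=> ui; rewrite /lh_term; case: pselect => // h; move: ui; rewrite ltnNge h. Qed.

Lemma lh_mapE n (a : car base_complex n) z v : lh_map a z v = \sum_i lh_term a i z v.
Proof. exact: (@pform_sumE R c E LE n _ _ _ z v). Qed.

Lemma lh_mapL n k (a b : car base_complex n) :
  lh_map (k *: a + b) = k *: lh_map a + lh_map b :> car total_complex n.
Proof.
rewrite /lh_map scaler_sumr -big_split; apply: eq_bigr => i _ /=.
rewrite /lh_term; case: pselect => h; last by rewrite scaler0 addr0.
exact: (wedge_linl (L := LE)).
Qed.

Lemma lh_term_zero n W (a : car base_complex n) i z : zero_on base_complex W a -> W (pi z) ->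
  lh_term a i z = 0.
Proof.
move=> h Wz; rewrite /lh_term; case: pselect => // h'; apply: wedge_eq0.
by apply/funext => v; rewrite /pullback_form h.
Qed.

Lemma lh_map_zero n W (a : car base_complex n) : zero_on base_complex W a ->
  zero_on total_complex W (lh_map a).
Proof.
move=> h; rewrite /total_complex /= => z [_ Wz]; apply/funext => v; rewrite lh_mapE big1 // => i _.
by rewrite (lh_term_zero i h Wz).
Qed.

Let eps_exact_sum i U : exact_sum (L := const_coef c E) U (eps i).
Proof.
have h := closed_exact_sum chE hE openT (eps_closed i).
by move=> z _; exact: h.
Qed.

Let totE W : over [set: E] pi W = pi @^-1` W. Proof. by rewrite /over setTI. Qed.
Let baseE W : over [set: X] id W = W. Proof. by rewrite /over setTI. Qed.

Lemma lh_map_dif n W (a : car base_complex n) a' : open W -> dif base_complex W a a' ->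
  dif total_complex W (lh_map a) (lh_map a').
Proof.
move=> oW [h1 h2]; rewrite /= /form_dif totE; apply: LD_sum => i.
have oP : open (pi @^-1` W) by exact: pi_open.
have [ui|ui] := leqP (u i) n.
  have H := subnK ui; have H' : ((n - u i).+1 + u i = n.+1)%N by rewrite addSn H.
  rewrite (lh_termE a H) (lh_termE a' H'); apply: LD_wedge => //.
  have := h1 i _ H H'; rewrite /= /form_dif baseE; exact: LD_pullback.
rewrite lh_term0 //; have := @LD00 R c E LE n (pi @^-1` W); apply: (LD_ext oP) => // z Wz.
have [ui'|ui'] := leqP (u i) n.+1; last by rewrite lh_term0.
have H : (0 + u i = n.+1)%N by apply/eqP; rewrite eqn_leq ui'.
rewrite (lh_termE a' H); apply/esym/wedge_eq0; apply/funext => v.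
by rewrite /pullback_form (h2 i H (pi z)).
Qed.

Definition lh_cone := cone lh_mapL lh_map_zero lh_map_dif.

(** The part of the map coming from flat sections: homog picks the degree of the
    classes that contribute. *)
Lemma lh_map_flat n (a : car base_complex n) W (s : 'I_r -> forall x, L x) :
  (forall i p H x, W x -> (0 < p)%N -> a (@ShiftIndex _ u n i p H) x = 0) ->
  (forall i H x v, W x -> a (@ShiftIndex _ u n i 0 H) x v = s i x) ->
  forall z v, W (pi z) -> lh_map a z v =
    \sum_i (homog (V := fun p => kform c E p) (eps i) n z v : K) *: (s i (pi z) : L (pi z)).
Proof.
move=> a0 as_ z v Wz; rewrite lh_mapE; apply: eq_bigr => i _.
have [ui|ui|ui] := ltngtP (u i) n.
- have H := subnK (ltnW ui); rewrite (lh_termE a H) homog_neq; last first.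
    by move=> e; move: ui; rewrite e ltnn.
  rewrite scale0r; have -> // : (wedge H (pullback_form pi (a (ShiftIndex H))) (eps i) : pform LE n) z = 0.
  apply: wedge_eq0; apply/funext => w; rewrite /pullback_form a0 //.
  by rewrite subn_gt0.
- rewrite lh_term0 // homog_neq ?scale0r //.
  by move=> e; move: ui; rewrite e ltnn.
- have H : (0 + u i = n)%N by rewrite ui.
  rewrite (lh_termE a H); move: {a0} as_ => /(_ i H (pi z)).
  move: v; case: n / H a {ui} => a v as_.
  rewrite homogE (wedge_deg0 (L := LE) _ v (fun=> 0) (@eps_exact_sum i setT)) //.
  by rewrite /pullback_form as_.
Qed.

Section over_chart.
Variables (U : set X) (q : E -> F) (g : X * F -> E).
Hypotheses (oU : open U) (triv : is_trivialization pi U q g).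
Variables (U1 : set X) (m : nat) (phi : X -> 'rV[R]_m) (phi' : 'rV[R]_m -> X) (w1 : 'rV[R]_m).
Hypotheses (hcX : is_chart U1 phi phi') (U1U : U1 `<=` U) (st1 : star_shaped w1 (phi @` U1)).
Variables (N : nat) (ph : forall y, {linear 'rV[K]_N -> L y}) (inv : forall y, L y -> 'rV[K]_N).
Hypothesis hk : kframe U1 ph inv.
Variable x : X.
Hypothesis U1x : U1 x.

Let iota := fiber_incl pi x.
Let LEx := inverse_system iota LE.
Let oU1 : open U1 := chart_open hcX.
Let oP : open (pi @^-1` U1) := pi_open pi oU1.
Let U1f (z : fiber pi x) : U1 (pi (iota z)).
Proof. by rewrite (_ : pi _ = x) //; exact: fiber_pi. Qed.
Let hkE := kframe_pull iota (kframe_pull pi hk).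
Let setTf : iota @^-1` (pi @^-1` U1) = setT.
Proof. by apply/seteqP; split=> // z _; exact: U1f. Qed.

Definition fcoord p (b : pform LE p) l : kform c (fiber pi x) p :=
  fun z v => inv ((pullback_form iota b : pform LEx p) z v) 0 l.
Arguments fcoord {p} b l _ _.

Lemma fcoord_LD p (b : pform LE p) b' l : LD (pi @^-1` U1) b b' ->
  kLD setT (fcoord b l) (fcoord b' l).
Proof.
move=> /(LD_pullback (F := iota)); rewrite setTf => h.
apply: (LD_coef (L := LEx) (L' := const_coef c (fiber pi x)) (U := setT)
   (tau := fun z s => inv s 0 l)) h => //; first exact: openT.
- move=> z a s s' _; rewrite (kframe_inv_lin _ _ _ hk) ?mxE //; exact: U1f.
- move=> P s oP' _ sP; have [_ _ hP] := hkE.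
  have PU : P `<=` iota @^-1` (pi @^-1` U1) by rewrite setTf.
  have [f [fP sf]] := (hP _ s oP' PU).1 sP.
  suff : locally_constant P (fun z => inv (s z) 0 l) by [].
  apply: (locally_constant_ext (f := fun z => f z 0 l)) => //.
    by move=> z Pz; rewrite sf //; have [_ invP _] := hk; have [-> _] := invP _ (U1f z).
  exact: (locally_constant_comp (fun w : 'rV[K]_N => w 0 l) fP).
Qed.

Lemma fcoord0 p l : fcoord (0 : pform LE p) l = 0.
Proof.
apply: functional_extensionality_dep => z; apply/funext => v.
have [_ invP _] := hk; have [h _] := invP _ (U1f z).
by rewrite /fcoord -[pullback_form _ _ _]/(0 : L (pi (iota z))) -(linear0 (ph _)) h mxE.
Qed.

Lemma flift_LD p (b : 'I_N -> kform c (fiber pi x) p) b' :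
  (forall l, kLD setT (b l) (b' l)) ->
  LD (L := LEx) setT ((fun z v => ph (pi (iota z)) (\row_l (b l z v : K))) : pform LEx p)
    ((fun z v => ph (pi (iota z)) (\row_l (b' l z v : K))) : pform LEx p.+1).
Proof.
move=> h.
have key l : LD (L := LEx) setT ((fun z v => ph (pi (iota z)) ((b l z v : K) *: delta_mx 0 l)) : pform LEx p)
    ((fun z v => ph (pi (iota z)) ((b' l z v : K) *: delta_mx 0 l)) : pform LEx p.+1).
  apply: (LD_coef (L := const_coef c (fiber pi x)) (L' := LEx) (U := setT)
    (tau := fun z (s : K) => ph (pi (iota z)) (s *: delta_mx 0 l))) (h l) => //.
  - exact: openT.
  - by move=> z a s s' _; rewrite scalerDl -scalerA linearP.
  - move=> P s oP' _ sP; have [_ _ hP] := hkE.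
    have PU : P `<=` iota @^-1` (pi @^-1` U1) by rewrite setTf.
    apply/(hP _ _ oP' PU); exists (fun z => (s z : K) *: delta_mx 0 l); split=> //.
    exact: (locally_constant_comp (fun k : K => k *: delta_mx 0 l) sP).
apply: LD_ext (LD_sum key) => //; first exact: openT.
- move=> z _; apply/funext => v; rewrite pform_sumE [\row_l _]row_sum_delta linear_sum.
  by apply: eq_bigr => l _; rewrite mxE.
- move=> z _; apply/funext => v; rewrite pform_sumE [\row_l _]row_sum_delta linear_sum.
  by apply: eq_bigr => l _; rewrite mxE.
Qed.

Lemma fcoord_flat n (b : pform LE n) (k : 'I_r -> 'rV[K]_N) l :
  (forall z v, U1 (pi z) -> b z v =
    \sum_i (homog (V := fun p => kform c E p) (eps i) n z v : K) *: ph (pi z) (k i)) ->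
  fcoord b l = \sum_i k i 0 l *: eps_rstr x n i.
Proof.
move=> bE; apply: functional_extensionality_dep => z; apply/funext => v.
rewrite /fcoord /pullback_form bE ?pform_sumE; last exact: U1f.
under eq_bigr do rewrite -linearZ.
rewrite -linear_sum; have [_ invP _] := hk; have [-> _] := invP _ (U1f z).
rewrite summxE; apply: eq_bigr => i _; rewrite mxE mulrC; by [].
Qed.

(** In each coordinate of the frame this is the independence of the classes on the
    fibre. *)
Lemma flat_eq0 n (b : pform LE n) (k : 'I_r -> 'rV[K]_N) :
  (forall z v, U1 (pi z) -> b z v =
    \sum_i (homog (V := fun p => kform c E p) (eps i) n z v : K) *: ph (pi z) (k i)) ->
  (forall l, is_exact (fcoord b l)) -> forall i, u i = n -> k i = 0.
Proof.
move=> bE ex i ui; apply/rowP => l; rewrite [RHS]mxE.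
by have := ex l; rewrite (fcoord_flat l bE) => /free_inj; exact.
Qed.

Let closed_flat n (a : car base_complex n) (i : 'I_r) : dif base_complex U1 a 0 ->
  exists k : 'rV[K]_N, forall (H : (0 + u i = n)%N) y v, U1 y -> a (ShiftIndex H) y v = ph y k.
Proof.
move=> [h _]; have [ui|ui] := eqVneq (u i) n; last first.
  by exists 0 => H; case/eqP: ui.
have H : (0 + u i = n)%N by [].
have H' : (1 + u i = n.+1)%N by rewrite add1n ui.
have := h i 0%N H H'; rewrite /= /form_dif baseE => da.
have [k kE] := poincare0_kframe chX hX hcX st1 hk da.
by exists k => H1; rewrite (eq_irrelevance H1 H).
Qed.

Lemma lh_exact_on0 : exact_on lh_cone 0 U1.
Proof.
move=> a [/= da za].
have /choice[k kE] i := closed_flat i da.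
have aE : forall z v, U1 (pi z) -> lh_map a z v =
    \sum_i (homog (V := fun p => kform c E p) (eps i) 0 z v : K) *: ph (pi z) (k i).
  apply: (@lh_map_flat 0 a U1 (fun i y => ph y (k i))) => //.
  by move=> i [|p] H.
have k0 := flat_eq0 aE.
have {}k0 i : u i = 0%N -> k i = 0.
  apply: k0 => l; rewrite /is_exact /fcoord.
  apply: functional_extensionality_dep => z; apply/funext => v.
  have : lh_map a (iota z) = 0.
    have := za (iota z); rewrite totE => /(_ (U1f z)) h.
    by apply/eqP; rewrite -oppr_eq0 -[- _]sub0r; apply/eqP; exact: h.
  move=> h; rewrite /pullback_form h.
  have [_ invP _] := hk; have [h1 h2] := invP _ (U1f z).
  by rewrite -[LHS]/(inv (0 : L (pi (iota z))) 0 l) -(linear0 (ph _)) h1 mxE.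
move=> [i p H] /= y; rewrite baseE => U1y; apply/funext => v.
have p0 : p = 0%N by move: H => /eqP; rewrite addn_eq0 => /andP[/eqP].
by subst p; rewrite kE // k0 ?linear0.
Qed.

(** The end of the local argument: by fiberwise_exact, b2 is a boundary since its
    restriction to a fibre is one. *)
Lemma lh_cone_solution n (a : car base_complex n.+1) (b b2 : pform LE n)
    (a1 : car base_complex n) (D : 'I_N -> kform c (fiber pi x) n) :
  LD (pi @^-1` U1) b2 0 -> dif base_complex U1 a1 a -> lh_map a1 - b = - b2 ->
  (forall z v, (pullback_form iota b2 : pform LEx n) z v = ph (pi (iota z)) (\row_l (D l z v : K))) ->
  (forall l, is_exact (D l)) -> exists a', cone_dif (n := n) (@lh_map) U1 a' (a, b).
Proof.
move=> db2 da1 a1b b2E exD.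
have cbF : countable_base [set: F] by exact: (triv_countable_base oU triv (U1U U1x) cbE).
have fex := fiberwise_exact chE chX chF hE hF cbF oU triv hcX U1U st1 hk U1x db2.
case: n a b b2 a1 D db2 da1 a1b b2E exD fex => [|n] a b b2 a1 D db2 da1 a1b b2E exD fex.
  exists a1; split=> //.
  rewrite /= (_ : b - lh_map a1 = b2); last by rewrite -opprB a1b opprK.
  move=> z; rewrite totE => U1z; apply: fex => //.
  apply: functional_extensionality_dep => y; apply/funext => v; rewrite b2E.
  rewrite (_ : \row_l _ = 0) ?linear0 //; apply/rowP => l; rewrite !mxE.
  by have := exD l; rewrite /is_exact => ->.
have /choice[vl vlP] l := exD l.
have [|w dw] := fex (fun z v => ph (pi (iota z)) (\row_l (vl l z v : K))).
  apply: LD_ext (flift_LD vlP) => //; first exact: openT.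
  by move=> z _; apply/funext => v; rewrite b2E.
exists (a1, - w); split=> //=.
rewrite a1b /form_dif totE -[- w]sub0r -[- b2]sub0r; apply: LDB => //; exact: LD00.
Qed.

(** Let (a, b) be closed: a is closed and maps to db.  By the Poincare lemma, a is
    dc plus a flat family k, and b - lh_map c restricts on the fibre to a primitive
    of the image of k, so that k = 0.  Hence b - lh_map c is closed; on the fibre
    it is cohomologous to the image of a flat family c', and subtracting the image
    of c' leaves a form to which fiberwise_exact applies. *)
Lemma lh_exact_onS n : exact_on lh_cone n.+1 U1.
Proof.
have [J [kJ [co hf]]] := kframe_flat hk.
move=> [a b] [/= da]; rewrite subr0 /form_dif totE => db.
have /dep_choice[cc ccP] (k : shift_index u n) : exists ck : pform L (shift_p k),
    forall H', LD U1 ck (a (@ShiftIndex _ u n.+1 (shift_i k) (shift_p k).+1 H')).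
  case: k => i p H /=.
  have H' : (p.+1 + u i = n.+1)%N by rewrite addSn H.
  have H'' : (p.+2 + u i = n.+2)%N by rewrite addSn H'.
  have [h _] := da; have := h i _ H' H''; rewrite /= /form_dif baseE => dai.
  have [ck hck] := poincare chX hX hcX st1 hf dai.
  by exists ck => H1; rewrite (eq_irrelevance H1 H').
pose a1 : car base_complex n.+1 := fun k => if shift_p k is 0 then 0 else a k.
(* The components with p = 0 of a are not boundaries: a - a1 is the flat part. *)
have dc : dif base_complex U1 (cc : car base_complex n) a1.
  split=> [i p H H'|i H]; last by [].
  by rewrite /= /form_dif baseE; exact: (ccP (ShiftIndex H)).
have /choice[k kE] i := closed_flat i da.
pose a2 := a - a1.
have a2E : forall z v, U1 (pi z) -> lh_map a2 z v =
    \sum_i (homog (V := fun p => kform c E p) (eps i) n.+1 z v : K) *: ph (pi z) (k i).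
  apply: (@lh_map_flat _ a2 U1 (fun i y => ph y (k i))).
    move=> i [|p] H y U1y // _; rewrite -[LHS]/(a (ShiftIndex H) y - a (ShiftIndex H) y).
    exact: subrr.
  move=> i H y v U1y; rewrite -[LHS]/(a (ShiftIndex H) y v - 0) subr0; exact: kE.
pose b1 := b - lh_map cc.
have lhB p (a' a'' : car base_complex p) : lh_map (a' - a'') = lh_map a' - lh_map a''.
  by rewrite -scaleN1r addrC lh_mapL scaleN1r addrC.
have db1 : LD (pi @^-1` U1) b1 (lh_map a2).
  rewrite lhB; apply: LDB => //.
  by have := lh_map_dif oU1 dc; rewrite /= /form_dif totE.
(* The coordinates of b1 on the fibre are primitives of flat combinations. *)
have k0 i : u i = n.+1 -> k i = 0.
  by apply: (flat_eq0 a2E) => l; exists (fcoord b1 l); exact: fcoord_LD.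
have dca : dif base_complex U1 (cc : car base_complex n) a.
  split=> [i p H H'|i H].
    by rewrite /= /form_dif baseE; exact: (ccP (ShiftIndex H)).
  move=> y; rewrite baseE => U1y; apply/funext => v.
  by rewrite kE // k0 ?linear0.
have {}db1 : LD (pi @^-1` U1) b1 0.
  apply: LD_ext db1 => // z U1z; apply/funext => v; rewrite a2E // big1 // => i _.
  have [ui|ui] := eqVneq (u i) n.+1; first by rewrite k0 // linear0 scaler0.
  by rewrite homog_neq ?scale0r //; exact/eqP.
have db1c l : kLD setT (fcoord b1 l) 0 by rewrite -(fcoord0 _ l); exact: fcoord_LD.
have /choice[kl klP] l := free_gen (db1c l).
(* Subtract the flat family with the coefficients found on the fibre. *)
pose k' i := \row_l kl l i.
pose c' : car base_complex n := fun k => if shift_p k is 0 then fun y _ => ph y (k' (shift_i k)) else 0.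
have dc' : dif base_complex U1 c' 0.
  split=> // i [|p] H H'; rewrite /= /form_dif; last exact: LD00.
  rewrite baseE; exact: (LD_flat oU1 (kframe_sect (k' i) hk)).
have c'E : forall z v, U1 (pi z) -> lh_map c' z v =
    \sum_i (homog (V := fun p => kform c E p) (eps i) n z v : K) *: ph (pi z) (k' i).
  by apply: (@lh_map_flat _ c' U1 (fun i y => ph y (k' i))) => // i [|p].
pose b2 := b1 - lh_map c'.
have db2 : LD (pi @^-1` U1) b2 0.
  rewrite -(subr0 (0 : pform LE n.+1)); apply: LDB => //.
  have := lh_map_dif oU1 dc'; rewrite /= /form_dif totE.
  by rewrite (_ : lh_map 0 = 0) // -(subrr (0 : car base_complex n.+1)) lhB subrr.
have b2E z v : (pullback_form iota b2 : pform LEx n) z v = ph (pi (iota z))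
    (\row_l ((fcoord b1 l - \sum_i kl l i *: eps_rstr x n i : kform c _ n) z v : K)) .
  rewrite -[LHS]/(b1 (iota z) (fun i => tangent_map iota (v i)) - lh_map c' (iota z) (fun i => tangent_map iota (v i))).
  have [_ invP _] := hk; have [h1 h2] := invP _ (U1f z).
  have -> : (\row_l ((fcoord b1 l - \sum_i kl l i *: eps_rstr x n i : kform c _ n) z v : K)) =
     (\row_l (fcoord b1 l z v : K)) - (\row_l (fcoord (lh_map c') l z v : K)).
    apply/rowP => l; rewrite !mxE (fcoord_flat l c'E).
    rewrite -[LHS]/(fcoord b1 l z v - (\sum_i kl l i *: eps_rstr x n i : kform c _ n) z v).
    congr (_ - _); rewrite !pform_sumE; apply: eq_bigr => i _.
    by rewrite mxE.
  rewrite linearB; congr (_ - _).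
    by rewrite -[LHS]h2; congr (ph _ _); apply/rowP => l; rewrite mxE.
  by rewrite -[LHS]h2; congr (ph _ _); apply/rowP => l; rewrite mxE.
have dC : dif base_complex U1 ((cc : car base_complex n) + c') a.
  by rewrite -[a]addr0; exact: difD.
have lhD p (a' a'' : car base_complex p) : lh_map (a' + a'') = lh_map a' + lh_map a''.
  by rewrite -[a']scale1r lh_mapL !scale1r.
have b2b : lh_map ((cc : car base_complex n) + c') - b = - b2.
  by rewrite /b2 /b1 lhD !opprB addrA [lh_map c' + _]addrC.
exact: (lh_cone_solution db2 dC b2b b2E klP).
Qed.

End over_chart.

(** Choose around x a star-shaped chart of X over which E and L are trivial. *)
Lemma lh_locally_exact n W x : open W -> W x ->
  exists U, [/\ open U, U x, U `<=` W & exact_on lh_cone n U].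
Proof.
move=> oW Wx; have [U [q [g [oU Ux triv]]]] := triv_at x.
have [V [N [ph [inv [hk Vx]]]]] := kframe_at L x.
have oV : open V by case: hk.
have oO := openI (openI oW oU) oV.
have [U1 [m [phi [phi' [w1 [hcX U1x U1O st1]]]]]] := poincare_chart chX oO (conj (conj Wx Ux) Vx).
have U1U : U1 `<=` U by move=> y /U1O[[]].
have hk1 : kframe U1 ph inv.
  by apply: kframeS hk; [exact: chart_open hcX|move=> y /U1O[]].
exists U1; split=> //; [exact: chart_open hcX|by move=> y /U1O[[]]|].
case: n => [|n]; first exact: (lh_exact_on0 hcX st1 hk1 U1x).
exact: (lh_exact_onS oU triv hcX U1U st1 hk1 U1x).
Qed.

End leray_hirsch.

(** * Cohomology classes *)

Section subquotient_theory.
Variables (K : pzRingType) (V : lmodType K) (Z B : set V).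
Hypotheses (hZ : is_submod Z) (hB : is_submod B).
Local Notation pi := (\pi_(subquotient hZ hB))%qT.
Local Notation cls := (subq_class hZ hB).

Let Zin v : Z v -> v \in subq_num_pred hZ. Proof. by move=> Zv; apply/asboolP. Qed.

Let clsE v (Zv : Z v) : cls v = pi (Sub v (Zin Zv)).
Proof.
rewrite /subq_class insubT; first by apply/asboolP.
by move=> h; congr (\pi_(subquotient hZ hB))%qT; apply: val_inj.
Qed.

Let pi_eqP (y z : subq_num hZ) : (pi y == pi z) = (y - z \in subq_den_pred hB).
Proof. by rewrite piE. Qed.

Let piZ k (z : subq_num hZ) : k *: pi z = pi (k *: z).
Proof.
apply/eqP; rewrite -[k *: pi z]/(pi (k *: repr (pi z))) pi_eqP -scalerBr; apply: rpredZ.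
by rewrite -pi_eqP reprK.
Qed.

Let piD y z : pi (y + z) = pi y + pi z.
Proof. by have := @Quotient.pi_add _ (subq_den_pred hB) y z. Qed.

Lemma subq_class_lin k v w : Z v -> Z w -> cls (k *: v + w) = k *: cls v + cls w.
Proof.
move=> Zv Zw; have Zk : Z (k *: v + w) by case: hZ => _; exact.
rewrite (clsE Zv) (clsE Zw) (clsE Zk) piZ.
by rewrite -piD; congr (\pi_(subquotient hZ hB))%qT; apply: val_inj.
Qed.

Lemma subq_class_eq v w : Z v -> Z w -> (cls v = cls w) <-> B (v - w).
Proof.
move=> Zv Zw; rewrite (clsE Zv) (clsE Zw); split=> [/eqP|h].
  by rewrite pi_eqP => /asboolP.
by apply/eqP; rewrite pi_eqP; apply/asboolP.
Qed.

Lemma subq_class0 : cls 0 = 0.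
Proof.
have Z0 : Z 0 by case: hZ.
have := subq_class_lin (-1) Z0 Z0; rewrite scaleN1r addNr => ->.
by rewrite scaleN1r addNr.
Qed.

Lemma subq_class_eq0 v : Z v -> (cls v = 0) <-> B v.
Proof.
have Z0 : Z 0 by case: hZ.
by move=> Zv; rewrite -subq_class0 (subq_class_eq Zv Z0) subr0.
Qed.

Lemma subq_reprP (h : subquotient hZ hB) : Z (subq_repr h).
Proof. by apply/asboolP; exact: (valP (repr h)). Qed.

Lemma subq_reprK (h : subquotient hZ hB) : cls (subq_repr h) = h.
Proof.
rewrite (clsE (subq_reprP h)) -[RHS]reprK; congr (\pi_(subquotient hZ hB))%qT; exact: val_inj.
Qed.

End subquotient_theory.

Section cohomology_classes.
Variables (R : realType) (c : coef) (M : fspace R).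
Hypotheses (chM : charted M) (hM : hausdorff_space M).
Let K : fieldType := coef_field R c.
Variables (L : local_system K M) (Phi : supports M).

Lemma cocycleP p (w : pform L p) : cocycle Phi w <-> LD setT w 0 /\ Phi (form_support w).
Proof.
split=> [[[_ Pw] dw]|[dw Pw]]; first by split=> //; exact: (is_d_LD chM hM dw).
split; last exact: LD_is_d.
by split=> //; exact: LD_smooth_form dw.
Qed.

Lemma coboundaryP p (w : pform L p.+1) : coboundary Phi w <->
  exists w', LD setT w' w /\ Phi (form_support w').
Proof.
split=> [[w' [_ Pw'] dw]|[w' [dw Pw']]]; first by exists w'; split=> //; exact: (is_d_LD chM hM dw).
exists w'; last exact: LD_is_d.
by split=> //; exact: LD_smooth_form dw.
Qed.

Lemma coh_class_lin p k (v w : pform L p) : cocycle Phi v -> cocycle Phi w ->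
  coh_class L Phi (k *: v + w) = k *: coh_class L Phi v + coh_class L Phi w.
Proof. exact: subq_class_lin. Qed.

Lemma coh_class0 p : coh_class L Phi (0 : pform L p) = 0.
Proof. exact: subq_class0. Qed.

Lemma coh_class_eq p (v w : pform L p) : cocycle Phi v -> cocycle Phi w ->
  (coh_class L Phi v = coh_class L Phi w) <-> coboundary Phi (v - w).
Proof. exact: subq_class_eq. Qed.

Lemma coh_class_eq0 p (v : pform L p) : cocycle Phi v ->
  (coh_class L Phi v = 0) <-> coboundary Phi v.
Proof. exact: subq_class_eq0. Qed.

Lemma coh_reprP p (h : cohomology L Phi p) : cocycle Phi (coh_repr h).
Proof. exact: subq_reprP. Qed.

Lemma coh_reprK p (h : cohomology L Phi p) : coh_class L Phi (coh_repr h) = h.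
Proof. exact: subq_reprK. Qed.

Lemma cocycle_sum p (I : Type) (s : seq I) (w : I -> pform L p) :
  (forall i, cocycle Phi (w i)) -> cocycle Phi (\sum_(i <- s) w i).
Proof.
move=> h; have [Z0 Zl] := cocycle_submod L Phi p.
elim: s => [|i s IH]; first by rewrite big_nil.
by rewrite big_cons -[w i]scale1r; exact: Zl.
Qed.

Lemma coh_class_sum p (I : Type) (s : seq I) (w : I -> pform L p) (k : I -> K) :
  (forall i, cocycle Phi (w i)) ->
  coh_class L Phi (\sum_(i <- s) k i *: w i) = \sum_(i <- s) k i *: coh_class L Phi (w i).
Proof.
move=> h; have [Z0 Zl] := cocycle_submod L Phi p.
elim: s => [|i s IH]; first by rewrite !big_nil coh_class0.
rewrite !big_cons coh_class_lin ?IH //; apply: cocycle_sum => j.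
by rewrite -[_ *: _]addr0; exact: Zl.
Qed.

Lemma support_sub p (w : pform L p) (P : set M) : closed P ->
  (forall x, ~ P x -> w x = 0) -> form_support w `<=` P.
Proof.
move=> /closure_id {2}-> h; apply: closureS => x /= nz.
by apply: contrapT => /h.
Qed.

Lemma support_notin p (w : pform L p) x : ~ form_support w x -> w x = 0.
Proof. by move=> h; apply: contrapT => nz; apply: h; exact: subset_closure. Qed.

Lemma supports_zero p (w : pform L p) (P : set M) : Phi P ->
  (forall x, ~ P x -> w x = 0) -> Phi (form_support w).
Proof.
move=> PP h; apply: (supports_sub PP); first exact: closed_closure.
by apply: support_sub h; exact: supports_closed PP.
Qed.

End cohomology_classes.

Section de_rham_classes.
Variables (R : realType) (c : coef) (M : fspace R).
Hypotheses (chM : charted M) (hM : hausdorff_space M).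

Definition dR_class p (w : kform c M p) : HdR c M p :=
  coh_class (const_coef c M) (closed_supports M) w.

Lemma kcocycleP p (w : kform c M p) :
  cocycle (L := const_coef c M) (closed_supports M) w <-> kLD setT w 0.
Proof.
by rewrite (cocycleP chM hM); split=> [[]|h] //; split=> //; exact: closed_closure.
Qed.

Lemma kcoboundaryP p (w : kform c M p) :
  coboundary (L := const_coef c M) (closed_supports M) w <-> is_exact w.
Proof.
case: p w => [//|p] w; rewrite (coboundaryP chM hM); split=> [[v [dv _]]|[v dv]]; exists v => //.
by split=> //; exact: closed_closure.
Qed.

End de_rham_classes.

Section fiber_classes.
Variables (R : realType) (c : coef) (E X : fspace R) (pi : smooth_map E X).
Hypotheses (chE : charted E) (hE : hausdorff_space E).
Let K : fieldType := coef_field R c.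
Variables (r : nat) (u : 'I_r -> nat) (e : forall i, HdR c E (u i)).
Variable x : X.
Hypothesis (chx : charted (fiber pi x)).
Let hx : hausdorff_space (fiber pi x) := fiber_hausdorff hE.

Definition class_form i : kform c E (u i) := coh_repr (e i).
Arguments class_form : clear implicits.
Local Notation rs m i := (@eps_rstr R c E X pi r u class_form x m i).

Lemma class_form_closed i : kLD setT (class_form i) 0.
Proof. by apply/(kcocycleP chE hE); exact: coh_reprP. Qed.

Lemma eps_rstr_closed m i : kLD setT (rs m i) 0.
Proof.
rewrite /eps_rstr; have [<-|ui] := eqVneq (u i) m.
  rewrite homogE; have := LD_pullback (F := fiber_incl pi x) (class_form_closed i).
  rewrite preimage_setT => h.
  apply: (LD_coef (L := inverse_system (fiber_incl pi x) (const_coef c E))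
    (L' := const_coef c (fiber pi x)) (U := setT) (tau := fun z (s : K) => s)) h => //.
    exact: openT.
  move=> P s oP _ h' y Py; have [ O' [t [oO Oy tO st]]] := h' y Py.
  have nt : \forall z \near y, t (fiber_incl pi x z) = t (fiber_incl pi x y).
    have nt : \forall z \near fiber_incl pi x y, t z = t (fiber_incl pi x y) by exact: tO.
    exact: (smooth_fun_continuous nt).
  by have sy := nbhs_singleton st; apply: filterS2 st nt => z -> ->; rewrite sy.
rewrite homog_neq; last exact/eqP.
exact: (@LD00 R c _ (const_coef c (fiber pi x)) m setT).
Qed.

Hypothesis hfree : freely_generates (fun i => pullback_dR (fiber_incl pi x) (e i)).

Lemma class_eps_rstr m i : dR_class (rs m i) =
  homog (V := HdR c (fiber pi x)) (pullback_dR (fiber_incl pi x) (e i)) m.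
Proof.
rewrite /eps_rstr; have [ui|/eqP ui] := eqVneq (u i) m.
  by case: m / ui; rewrite !homogE.
rewrite !homog_neq //; exact: (coh_class0 (const_coef c (fiber pi x)) _ m).
Qed.

Let sum_closed m (k : 'I_r -> K) : kLD setT (\sum_i k i *: rs m i) 0.
Proof.
apply/(kcocycleP chx hx); apply: cocycle_sum => i.
have [Z0 Zl] := cocycle_submod (const_coef c (fiber pi x)) (closed_supports _) m.
rewrite -[_ *: _]addr0; apply: Zl => //; apply/(kcocycleP chx hx); exact: eps_rstr_closed.
Qed.

Let class_sum m (k : 'I_r -> K) : dR_class (\sum_i k i *: rs m i) =
  \sum_i k i *: homog (V := HdR c (fiber pi x)) (pullback_dR (fiber_incl pi x) (e i)) m.
Proof.
rewrite /dR_class (coh_class_sum (L := const_coef c (fiber pi x))).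
  by apply: eq_bigr => i _; rewrite -class_eps_rstr.
by move=> i; apply/(kcocycleP chx hx); exact: eps_rstr_closed.
Qed.

(** The hypothesis on the classes concerns all degrees at once; for forms it splits,
    degree by degree, into this independence and the generation below. *)
Lemma fiber_free m (k : 'I_r -> K) : is_exact (\sum_i k i *: rs m i) ->
  forall i, u i = m -> k i = 0.
Proof.
move=> ex i ui; pose a j := if u j == m then k j else 0.
have [a0 [_ a0P]] := hfree (c := fun p => 0) (ex_intro _ 0%N (fun p _ => erefl)).
have E0 : a0 = fun=> 0 by apply: a0P => p; rewrite big1 // => j _; rewrite scale0r.
have Ea : a0 = a.
  apply: a0P => p; have [->|pm] := eqVneq p m.
    have -> : \sum_i a i *: homog (V := HdR c (fiber pi x)) (pullback_dR (fiber_incl pi x) (e i)) m =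
       \sum_i k i *: homog (V := HdR c (fiber pi x)) (pullback_dR (fiber_incl pi x) (e i)) m.
      apply: eq_bigr => j _; rewrite /a; case: eqVneq => // /eqP uj.
      by rewrite homog_neq // !scaler0.
    rewrite -class_sum; apply/esym/(coh_class_eq0 (L := const_coef c (fiber pi x))).
      by apply/(kcocycleP chx hx); exact: sum_closed.
    exact/(kcoboundaryP chx hx).
  rewrite big1 // => j _; rewrite /a; case: eqVneq => [uj|_]; last by rewrite scale0r.
  by rewrite homog_neq ?scaler0 // uj => /esym/eqP; apply/negP.
by have := congr1 (fun h => h i) Ea; rewrite E0 /a ui eqxx.
Qed.

Lemma fiber_generate m (b : kform c (fiber pi x) m) : kLD setT b 0 ->
  exists k : 'I_r -> K, is_exact (b - \sum_i k i *: rs m i).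
Proof.
move=> db; have bc := (kcocycleP chx hx b).2 db.
have [|a [aP _]] := hfree (c := fun p => homog (V := HdR c (fiber pi x)) (dR_class b) p).
  exists m.+1 => p mp; rewrite homog_neq // => e0; move: mp; by rewrite e0 ltnn.
exists a; apply/(kcoboundaryP chx hx).
apply/(coh_class_eq (L := const_coef c (fiber pi x)) bc).
  by apply/(kcocycleP chx hx); exact: sum_closed.
have := aP m; rewrite homogE => h.
by rewrite -[LHS]/(dR_class b) h -class_sum.
Qed.

End fiber_classes.
Arguments class_form {R c E r u} e i _ _ : rename.

Section cup_classes.
Variables (R : realType) (c : coef) (M : fspace R).
Hypotheses (chM : charted M) (hM : hausdorff_space M).
Let K : fieldType := coef_field R c.
Variables (L : local_system K M) (Phi : supports M).

Lemma wedge0l p q n (pqn : (p + q = n)%N) (b : kform c M q) :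
  (wedge pqn (0 : pform L p) b : pform L n) = 0.
Proof. by apply: functional_extensionality_dep => x; exact: wedge_eq0. Qed.

Lemma wedge_cocycle p q n (pqn : (p + q = n)%N) (w : pform L p) (b : kform c M q) :
  cocycle Phi w -> kLD setT b 0 -> cocycle Phi (wedge pqn w b : pform L n).
Proof.
move=> /(cocycleP chM hM)[dw Pw] db; apply/(cocycleP chM hM); split.
  have pqn' : (p.+1 + q = n.+1)%N by rewrite addSn pqn.
  have := LD_wedge pqn pqn' dw (closed_exact_sum chM hM openT db).
  by rewrite wedge0l.
by apply: (supports_zero Pw) => x /support_notin; exact: wedge_eq0.
Qed.

(** Two representatives of a class differ by some dg, and dg /\ b = d (g /\ b)
    for closed b. *)
Lemma cup_class p q n (pqn : (p + q = n)%N) (w : pform L p) (e : HdR c M q) :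
  cocycle Phi w ->
  cup pqn (coh_class L Phi w) e = coh_class L Phi (wedge pqn w (coh_repr e)).
Proof.
move=> cw; have de := (kcocycleP chM hM _).1 (coh_reprP e).
have cv := coh_reprP (coh_class L Phi w).
apply/(coh_class_eq (wedge_cocycle pqn cv de) (wedge_cocycle pqn cw de)).
have := (coh_class_eq cv cw).1 (coh_reprK _).
move: (coh_repr (coh_class L Phi w)) cv => v cv.
have -> : (wedge pqn v (coh_repr e) : pform L n) - wedge pqn w (coh_repr e) =
    wedge pqn (v - w) (coh_repr e).
  by rewrite -scaleN1r addrC [v - w]addrC -scaleN1r (wedge_linl (L := L)).
case: p pqn w v {cw cv} => [|p] pqn w v.
  by move=> /= ->; rewrite wedge0l; have [] := coboundary_submod L Phi n.
move=> /(coboundaryP chM hM)[g [dg Pg]].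
case: n pqn => [//|n] pqn; have pqn0 : (p + q = n)%N by case: pqn.
apply/(coboundaryP chM hM); exists (wedge pqn0 g (coh_repr e)); split.
  exact: LD_wedge dg (closed_exact_sum chM hM openT de).
by apply: (supports_zero Pg) => x /support_notin; exact: wedge_eq0.
Qed.

End cup_classes.

Section pullback_classes.
Variables (R : realType) (c : coef) (M N : fspace R) (F : smooth_map M N).
Hypotheses (chM : charted M) (hM : hausdorff_space M).
Hypotheses (chN : charted N) (hN : hausdorff_space N).
Let K : fieldType := coef_field R c.
Variables (L : local_system K N) (Phi : supports N).
Local Notation LM := (inverse_system F L).
Local Notation PM := (inverse_supports F Phi).

Lemma inverse_support P : Phi P -> PM (F @^-1` P).
Proof.
move=> PP; split; last by exists P.
apply: preimage_closed; last exact: supports_closed PP.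
by move=> x _; exact: smooth_fun_continuous.
Qed.

Lemma pullback_support p (w : pform L p) : Phi (form_support w) ->
  PM (form_support (pullback_form F w : pform LM p)).
Proof.
move=> Pw; apply: (supports_zero (inverse_support Pw)) => x /support_notin h.
by apply/funext => v; rewrite /pullback_form h.
Qed.

Lemma pullback_cocycle p (w : pform L p) : cocycle Phi w ->
  cocycle (L := LM) PM (pullback_form F w).
Proof.
move=> /(cocycleP chN hN)[dw Pw]; apply/(cocycleP chM hM); split.
  by have := LD_pullback (F := F) dw; rewrite preimage_setT.
exact: pullback_support.
Qed.

Lemma pullback_class p (w : pform L p) : cocycle Phi w ->
  pullback F (coh_class L Phi w) = coh_class LM PM (pullback_form F w).
Proof.
move=> cw; have cv := coh_reprP (coh_class L Phi w).
apply/(coh_class_eq (pullback_cocycle cv) (pullback_cocycle cw)).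
have := (coh_class_eq cv cw).1 (coh_reprK _).
move: (coh_repr (coh_class L Phi w)) cv => v cv.
suff : coboundary Phi (v - w) -> coboundary (L := LM) PM (pullback_form F (v - w)) by [].
case: p w v {cw cv} => [|p] w v; first by move=> /= ->.
move=> /(coboundaryP chN hN)[g [dg Pg]]; apply/(coboundaryP chM hM).
exists (pullback_form F g); split; last exact: pullback_support.
by have := LD_pullback (F := F) dg; rewrite preimage_setT.
Qed.

End pullback_classes.

(** * The map in cohomology *)

Section cohomology_map.
Variables (R : realType) (c : coef) (E X : fspace R) (pi : smooth_map E X).
Hypotheses (chE : charted E) (chX : charted X).
Hypotheses (hE : hausdorff_space E) (hX : hausdorff_space X).
Let K : fieldType := coef_field R c.
Variables (L : local_system K X) (Phi : supports X).
Variables (r : nat) (u : 'I_r -> nat) (e : forall i, HdR c E (u i)).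
Local Notation LE := (inverse_system pi L).
Local Notation PE := (inverse_supports pi Phi).
Local Notation base := (base_complex chX hX L u).
Local Notation total := (total_complex pi chE hE L).
Local Notation lh a := (lh_map pi chE hE (class_form e) a : car total _).
Local Notation lrm := (@leray_hirsch_map R c E X pi L Phi r u e _).

Definition base_class n (a : car base n) : dprod (fun i : {i : 'I_r | (u i <= n)%N} =>
    cohomology L Phi (n - u (val i))) :=
  fun i => coh_class L Phi (a (ShiftIndex (subnK (valP i)))).

Let term_cocycle n (a : car base n) i : (forall k, cocycle Phi (a k)) ->
  cocycle (L := LE) PE (lh_term pi (class_form e) a i).
Proof.
move=> ca; have [ui|ui] := leqP (u i) n; last first.
  by rewrite lh_term0 //; have [] := cocycle_submod LE PE n.
rewrite (lh_termE _ _ _ (subnK ui)); apply: wedge_cocycle => //.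
  exact: (pullback_cocycle pi chE hE chX hX (ca (ShiftIndex (subnK ui)))).
exact: class_form_closed.
Qed.

Lemma lh_cocycle n (a : car base n) : (forall k, cocycle Phi (a k)) ->
  cocycle (L := LE) PE (lh a).
Proof. by move=> ca; apply: cocycle_sum => i; exact: term_cocycle. Qed.

(** The terms of lh_map with u i > n are 0, and these indices are absent from the
    sum that defines the map on cohomology. *)
Lemma lh_class n (a : car base n) : (forall k, cocycle Phi (a k)) ->
  lrm (base_class a) = coh_class LE PE (lh a).
Proof.
move=> ca; rewrite /lh_map.
have -> : \sum_i lh_term pi (class_form e) a i =
    \sum_i 1 *: (lh_term pi (class_form e) a i : pform LE n).
  by apply: eq_bigr => i _; rewrite scale1r.
rewrite (coh_class_sum (L := LE)); last by move=> i; exact: term_cocycle.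
rewrite [RHS](bigID (fun i => u i <= n)%N) /= [X in _ + X]big1 ?addr0; last first.
  move=> i; rewrite -ltnNge => ui; rewrite lh_term0 // coh_class0; exact: scaler0.
rewrite [RHS](big_sub [pred i | u i <= n]%N).
apply: eq_bigr => i _; rewrite scale1r /base_class.
have ci : cocycle (p := n - u (val i)) Phi (a (ShiftIndex (subnK (valP i)))) :=
  ca (ShiftIndex (subnK (valP i))).
rewrite (pullback_class pi chE hE chX hX ci) (cup_class chE hE) //; last first.
  exact: (pullback_cocycle pi chE hE chX hX ci).
by rewrite (lh_termE _ _ _ (subnK (valP i))).
Qed.

(** Indices of the complex and of the source of the map differ only by the
    equality p = n - u i, hence the cast. *)
Lemma base_class_surj n (h : dprod (fun i : {i : 'I_r | (u i <= n)%N} =>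
    cohomology L Phi (n - u (val i)))) :
  exists2 a : car base n, (forall k, cocycle Phi (a k)) & base_class a = h.
Proof.
have le (k : shift_index u n) : (u (shift_i k) <= n)%N.
  by case: k => i p /= <-; rewrite leq_addl.
pose a : car base n := fun k =>
  homog (V := fun p => pform L p) (coh_repr (h (exist _ (shift_i k) (le k)))) (shift_p k).
have aE j (H : (n - u j + u j = n)%N) l :
    a (ShiftIndex H) = coh_repr (h (exist _ j l)).
  by rewrite /a /= homogE; congr (coh_repr (h (exist _ j _))); exact: eq_irrelevance.
exists a.
  move=> [i p H]; have pE : p = (n - u i)%N by rewrite -H addnK.
  subst p; rewrite (aE _ _ (le (ShiftIndex H))); exact: coh_reprP.
apply: functional_extensionality_dep => -[j l].
by rewrite /base_class (aE _ _ l) coh_reprK.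
Qed.

Lemma leray_hirsch_linear n : linear (@leray_hirsch_map R c E X pi L Phi r u e n).
Proof.
move=> k h h'; have [a ca <-] := base_class_surj h; have [b cb <-] := base_class_surj h'.
have cab j : cocycle Phi (k *: a j + b j) by have [_] := cocycle_submod L Phi (shift_p j); apply.
have -> : k *: base_class a + base_class b = base_class (k *: a + b).
  apply: functional_extensionality_dep => i.
  by rewrite /base_class [RHS](coh_class_lin k (ca _) (cb _)).
rewrite !lh_class // lh_mapL; apply: coh_class_lin; exact: lh_cocycle.
Qed.

Lemma supports_finite (T : topologicalType) (Psi : supports T) (I : finType) (A : I -> set T) :
  (forall i, Psi (A i)) -> exists2 P, Psi P & forall i, A i `<=` P.
Proof.
move=> PA; suff [P PP h] : exists2 P, Psi P & forall i, i \in enum I -> A i `<=` P.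
  by exists P => // i; apply: h; rewrite mem_enum.
elim: (enum I) => [|i s [P PP h]]; first by exists set0 => //; exact: supports0.
exists (A i `|` P); first exact: supportsU.
move=> j; rewrite in_cons => /orP[/eqP-> x|/h jP x /jP]; [by left|by right].
Qed.

Let kE n (k : shift_index u n) : exists i : {i : 'I_r | (u i <= n)%N},
  k = ShiftIndex (subnK (valP i)).
Proof.
case: k => i p H; have pE : p = (n - u i)%N by rewrite -H addnK.
have ui : (u i <= n)%N by rewrite -H leq_addl.
subst p; exists (exist _ i ui) => /=; congr ShiftIndex; exact: eq_irrelevance.
Qed.

Lemma base_support n (a : car base n) : (forall k, cocycle Phi (a k)) ->
  exists2 P, Phi P & zero_on base (~` P) a.
Proof.
move=> ca; have [|P PP h] := @supports_finite X Phi _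
  (fun i : {i : 'I_r | (u i <= n)%N} => form_support (a (ShiftIndex (subnK (valP i))))).
  by move=> i; have [[_ ?]] := ca (ShiftIndex (subnK (valP i))).
exists P; first by [].
move=> k; have [i ->] := kE k; move=> /= x [_ nP].
apply: support_notin => /h; exact: nP.
Qed.

Let baseE W : over [set: X] id W = W. Proof. by rewrite /over setTI. Qed.
Let totE W : over [set: E] pi W = pi @^-1` W. Proof. by rewrite /over setTI. Qed.

Lemma base_cocycle n (a : car base n) Q : Phi Q -> zero_on base (~` Q) a ->
  dif base setT a 0 -> forall k, cocycle Phi (a k).
Proof.
move=> PQ za [da _] [i p H]; apply/(cocycleP chX hX); split.
  have H' : (p.+1 + u i = n.+1)%N by rewrite addSn H.
  by have := da i p H H'; rewrite /= /form_dif baseE.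
apply: (supports_zero PQ) => x nQ; apply: (za (ShiftIndex H)); by rewrite baseE.
Qed.

Lemma base_coboundary n (a : car base n) (b : car base n.+1) Q : Phi Q ->
  zero_on base (~` Q) a -> dif base setT a b -> forall k, coboundary Phi (b k).
Proof.
move=> PQ za [da b0] [i [|p] H] /=.
  apply: functional_extensionality_dep => x; apply: (b0 i H); by rewrite baseE.
have H0 : (p + u i = n)%N by move: H => [].
apply/(coboundaryP chX hX); exists (a (ShiftIndex H0)); split.
  by have := da i p H0 H; rewrite /= /form_dif baseE.
apply: (supports_zero PQ) => x nQ; apply: (za (ShiftIndex H0)); by rewrite baseE.
Qed.

Lemma total_support n (b : car total n) P : Phi P -> zero_on total (~` P) b ->
  PE (form_support (b : pform LE n)).
Proof.
move=> PP zb; apply: (supports_zero (inverse_support pi PP)) => z nP.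
by apply: zb; rewrite totE.
Qed.

Local Notation C := (lh_cone pi chE chX hE hX L (class_form_closed chE hE e)).

Hypothesis exC : forall n W, open W -> exact_on C n W.
Hypothesis nX : normal_for [set s : X -> R | smooth s].
Hypothesis nbPhi : forall A, Phi A -> exists2 B, Phi B & A `<=` interior B.

Let lh0 n : lh (0 : car base n) = 0.
Proof.
have := lh_mapL pi chE hE (class_form e) (-1) (0 : car base n) 0.
by rewrite !scaleN1r !addNr.
Qed.

(** If the image of a is dg, then (a, g) is a cocycle of the cone; a primitive of
    it with supports in Phi contains a primitive of a. *)
Lemma leray_hirsch_ker n h : @leray_hirsch_map R c E X pi L Phi r u e n h = 0 -> h = 0.
Proof.
have [a ca <-] := base_class_surj h; rewrite lh_class //.
move=> /(coh_class_eq0 (lh_cocycle ca)) ha.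
suff ba k : coboundary Phi (a k).
  apply: functional_extensionality_dep => i.
  exact: ((coh_class_eq0 (ca (ShiftIndex (subnK (valP i))))).2 (ba _)).
have da : dif base setT a 0.
  split=> [i p H H'|i H]; last by [].
  rewrite /= /form_dif baseE; exact: ((cocycleP chX hX _ _).1 (ca (ShiftIndex H))).1.
case: n a ca h ha k da => [|n] a ca h ha k da.
  have : zero_on C (setT : set X) (a : car C 0).
    apply: (exC 0 openT); split=> //=; rewrite ha sub0r => z _.
    exact: oppr0.
  move=> za; have -> : a k = 0.
    by apply: functional_extensionality_dep => x; apply: za; rewrite baseE.
  by have [] := coboundary_submod L Phi (shift_p k).
have [g [dg [_ [B PB gB]]]] := (coboundaryP chE hE PE _).1 ha.
have [P0 PP0 aP0] := base_support ca.
have PP := supportsU PP0 PB; have [Q PQ PQi] := nbPhi PP.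
have [||||y dy yQ] := @exact_supports K R X _ C nX n (P0 `|` B) Q (a, g) exC.
- exact: supports_closed PP.
- exact: PQi.
- by split=> //=; rewrite subr0 /form_dif totE preimage_setT.
- split=> /=.
    by apply: zero_onS aP0 => x nP P0x; apply: nP; left.
  move=> z; rewrite totE => nP; apply: support_notin => /gB Bz; apply: nP; right; exact: Bz.
case: n a ca h ha k da g dg gB aP0 y dy yQ => [|n] a ca h ha k da g dg gB aP0 y [dy _] yQ.
  exact: (base_coboundary PQ yQ dy).
exact: (base_coboundary PQ yQ.1 dy).
Qed.

(** A cocycle b of E gives the cocycle (0, b) of the cone; a primitive (a, w) of
    it consists of a cocycle a and of a form w with dw = lh_map a - b. *)
Lemma leray_hirsch_surj n g : exists h, @leray_hirsch_map R c E X pi L Phi r u e n h = g.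
Proof.
have cb := coh_reprP g; have [db [_ [B PB bB]]] := (cocycleP chE hE _ _).1 cb.
have [Q PQ PQi] := nbPhi PB.
have [||||y dy yQ] := @exact_supports K R X _ C nX n B Q (0, coh_repr g) exC.
- exact: supports_closed PB.
- exact: PQi.
- split; first exact: (@dif00 K R X _ base n.+1 setT).
  by rewrite /= lh0 subr0 /form_dif totE preimage_setT.
- split; first exact: (@zero_on0 K R X _ base n.+1).
  by move=> /= z; rewrite totE => nB; apply: (@support_notin _ _ _ LE) => /bB.
suff [a [da aQ hb]] : exists a : car base n, [/\ dif base setT a 0, zero_on base (~` Q) a &
    coboundary (L := LE) PE (lh a - coh_repr g)].
  have ca := base_cocycle PQ aQ da; exists (base_class a); rewrite lh_class //.
  by rewrite -[RHS]coh_reprK; apply/(coh_class_eq (lh_cocycle ca) cb).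
case: n g cb db bB y dy yQ => [|n] g cb db bB y [/= dy wy] yQ.
  exists y; split=> //=; apply: functional_extensionality_dep => z.
  have := wy z; rewrite totE => /(_ I) h; apply/eqP; rewrite -oppr_eq0; apply/eqP.
  by rewrite -[RHS]h -[LHS]/((- (lh y - coh_repr g)) z) opprB.
exists y.1; split=> //; first exact: yQ.1.
have cbP := @coboundaryP R c E chE hE LE PE n (lh y.1 - coh_repr g : pform LE n.+1).
apply: cbP.2; exists y.2; split; last exact: total_support yQ.2.
by move: wy; rewrite /form_dif totE preimage_setT.
Qed.

Lemma leray_hirsch_bijective n : bijective (@leray_hirsch_map R c E X pi L Phi r u e n).
Proof.
have /choice[inv invK] := @leray_hirsch_surj n.
exists inv => // h; apply/eqP; rewrite -subr_eq0; apply/eqP/leray_hirsch_ker.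
by rewrite addrC -scaleN1r leray_hirsch_linear invK scaleN1r addNr.
Qed.

End cohomology_map.

Theorem theorem5p2 (R : realType) (c : coef) (E X : fspace R)
    (pi : smooth_map E X) (L : local_system (coef_field R c) X)
    (r : nat) (u : 'I_r -> nat) (e : forall i : 'I_r, HdR c E (u i)) :
  smooth_manifold X -> smooth_manifold E -> fiber_bundle pi ->
  (forall x : X, freely_generates
     (fun i => pullback_dR (fiber_incl pi x) (e i))) ->
  forall (Phi : supports X), paracompactifying Phi ->
  forall n : nat,
    linear (@leray_hirsch_map R c E X pi L Phi r u e n) /\
    bijective (@leray_hirsch_map R c E X pi L Phi r u e n).
Proof.
move=> [[pX chX] cX] [[pE chE] cE] [F [[hF _] chF] triv_at] free Phi pPhi n.
have [hX _] := pX; have [hE _] := pE.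
have cbX := connected_countable_base chX pX cX.
have cbE := connected_countable_base chE pE cE.
have chx x : charted (fiber pi x).
  by have [U [q [g [oU Ux triv]]]] := triv_at x; exact: (fiber_charted chE chX oU triv chF Ux).
have loc := lh_locally_exact chE chX chF hE hX hF cbE triv_at L (class_form_closed chE hE e)
  (fun x => fiber_free chE hE (chx x) (free x)) (fun x => fiber_generate chE hE (chx x) (free x)).
have nX := smooth_normal chX hX cbX.
have exC := locally_exact_exact nX (smooth_shrinkable chX hX cbX) loc.
split; first exact: leray_hirsch_linear.
by apply: (leray_hirsch_bijective exC nX) => A /pPhi[].
Qed.
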